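(* Let $P=P(n,m)$ be a uniformly random planar graph on vertex set $[n]$ with $m$ edges, $L$ its largest component and $S=P\setminus L$. Assume $m=\alpha n/2$ with $\alpha=\alpha(n)\to c\in(1,2)$. Let $r$, $r_L$, $r_S$ be uniformly random vertices of $P$, $L$, $S$ respectively. Then, in the local weak sense, (i) $(L,r_L)\to\mathcal S$; (ii) $(S,r_S)\to T(1)$; (iii) $(P,r)\to (c-1)\mathcal S+(2-c)T(1)$.
   Context: Local weak convergence of random rooted graphs $G_n\to G_0$: for every fixed finite rooted graph $(H,r_H)$ and every $\ell\in\mathbb N$, $\Pr[B_\ell(G_n)\cong(H,r_H)]\to\Pr[B_\ell(G_0)\cong(H,r_H)]$, where $B_\ell$ is the ball of radius $\ell$ around the root and $\cong$ is root-preserving isomorphism. $T(c)$ is the Galton–Watson tree with Poisson$(c)$ offspring. The Skeleton tree $\mathcal S$: independent copies $T_1,T_2,\dots$ of $T(1)$ with roots $r_1,r_2,\dots$ joined by edges $r_1r_2,r_2r_3,\dots$, rooted at $r_1$. For random rooted graphs $G_1,G_2$ and $a\in[0,1]$, $aG_1+(1-a)G_2$ denotes the mixture: the random rooted graph $G$ with $\Pr[G=(H,r_H)]=a\Pr[G_1=(H,r_H)]+(1-a)\Pr[G_2=(H,r_H)]$ for every rooted graph $(H,r_H)$. *)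

(* Defs.v *)
From HB Require Import structures.
From mathcomp Require Import all_boot all_order all_algebra.
From mathcomp Require Import all_classical all_reals all_analysis.
Set Implicit Arguments. Unset Strict Implicit. Unset Printing Implicit Defensive.
Import Order.TTheory GRing.Theory Num.Theory.
Import numFieldTopology.Exports numFieldNormedType.Exports.
Local Open Scope ring_scope.

Fixpoint ball (V : Type) (adj : V -> V -> Prop) (r : V) (l : nat) : set V :=
  match l with
  | 0 => [set r]%classic
  | l'.+1 => (ball adj r l' `|` [set y | exists2 x, ball adj r l' x & adj x y])%classic
  end.

Definition ball_iso (V : Type) (adj : V -> V -> Prop) (r : V) (l : nat)
    (k : nat) (E : rel 'I_k) (rH : 'I_k) : Prop :=
  exists f : 'I_k -> V,
    [/\ injective f, f rH = r, (range f)%classic = ball adj r l &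
        forall i j, E i j <-> adj (f i) (f j)].

Definition plane_drawing (R : realType) (T : finType) (g : {set {set T}})
    (p : T -> R * R) (gam : {set T} -> R -> R * R) : Prop :=
  injective p /\
  [/\ (forall e, e \in g -> exists x y,
          [/\ e = [set x; y], x != y, gam e 0 = p x & gam e 1 = p y]),
      (forall e, e \in g -> ({within `[(0:R), 1], continuous (gam e)})%classic),
      (forall e s t, e \in g -> 0 <= s <= 1 -> 0 <= t <= 1 ->
          gam e s = gam e t -> s = t),
      (forall e v s, e \in g -> 0 < s < 1 -> gam e s <> p v) &
      (forall e e' s t, e \in g -> e' \in g -> e != e' ->
          0 < s < 1 -> 0 < t < 1 -> gam e s <> gam e' t)].

Definition planar (R : realType) (T : finType) (g : {set {set T}}) : Prop :=
  exists p gam, @plane_drawing R T g p gam.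

Definition simple_graph (T : finType) (g : {set {set T}}) : bool :=
  [forall e in g, #|e| == 2%N].

Definition graph_adj (T : finType) (g : {set {set T}}) : rel T :=
  fun x y => [set x; y] \in g.

Definition planar_graphs (R : realType) (n m : nat) : {set {set {set 'I_n}}} :=
  [set g | [&& simple_graph g, #|g| == m & `[< planar R g >]]].

Definition comp (T : finType) (a : rel T) (v : T) : {set T} :=
  [set w | connect a v w].

(* the largest component; ties broken by taking the component of the
   first (smallest) vertex whose component has maximum size *)
Definition largest_comp (T : finType) (a : rel T) : {set T} :=
  if [pick v | [forall w, (#|comp a w| <= #|comp a v|)%N]] is Some v
  then comp a v else @finset.set0 T.

(* Pr[B_l(G[A], r_A) ~= (H, rH)] for r_A uniform on A (0 if A is empty) *)
Definition rooted_prob (R : realType) (T : finType) (a : rel T) (A : {set T})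
    (l k : nat) (E : rel 'I_k) (rH : 'I_k) : R :=
  #|[set v in A |
     `[< ball_iso (fun x y => [&& a x y, x \in A & y \in A]) v l E rH >]]|%:R
  / #|A|%:R.

Definition planar_ball_prob (R : realType) (n m : nat)
    (Asel : {set {set 'I_n}} -> {set 'I_n}) (l k : nat) (E : rel 'I_k)
    (rH : 'I_k) : R :=
  (\sum_(g in planar_graphs R n m) rooted_prob R (graph_adj g) (Asel g) l E rH)
  / #|planar_graphs R n m|%:R.

Definition whole_sel (n : nat) (g : {set {set 'I_n}}) : {set 'I_n} := [set: 'I_n].
Definition L_sel (n : nat) (g : {set {set 'I_n}}) : {set 'I_n} :=
  largest_comp (graph_adj g).
Definition S_sel (n : nat) (g : {set {set 'I_n}}) : {set 'I_n} :=
  ~: largest_comp (graph_adj g).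

(* x u = number of children of vertex u; u is in the tree iff every
   step along u is below the offspring count of the prefix *)
Fixpoint in_tree (x : seq nat -> nat) (pre u : seq nat) : bool :=
  match u with
  | [::] => true
  | a :: u' => (a < x pre)%N && in_tree x (rcons pre a) u'
  end.

Definition tree_adj (x : seq nat -> nat) (u v : seq nat) : Prop :=
  [/\ in_tree x [::] u, in_tree x [::] v &
      exists a, v = rcons u a \/ u = rcons v a].

(* Skeleton tree: copies T_i (i = 0,1,2,...) with roots (i, [::]) joined
   along a path; rooted at (0, [::]) *)
Definition skel_adj (xs : nat -> seq nat -> nat) (p q : nat * seq nat) : Prop :=
  (p.1 = q.1 /\ tree_adj (xs p.1) p.2 q.2) \/
  [/\ p.2 = [::], q.2 = [::] & (q.1 = p.1.+1 \/ p.1 = q.1.+1)].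

(* Main.v *)
(** A planar graph with [m] edges is a spanning forest together with [k] further edges. Planar graphs have no K5 minor, and counting K5-minor-free graphs by contracting small connected parts shows that typically [k = o(n)]; so, up to factors [e^(o(n))], a random planar graph is a random forest with about [n - m = (1 - c/2) n] trees, and its [k] extra edges meet the [l]-balls of only [o(n)] vertices. Hence whatever fails with exponentially small probability for forests is negligible for planar graphs.

In such a forest the tree sizes follow the tree series at its singularity [e^-1], where the series of unrooted trees equals 1/2: all but [o(n)] of the vertices of bounded trees number [2 (n - m) = (2 - c) n], and seen from them the forest is a Galton-Watson tree; the other [(c - 1) n] vertices lie in large trees. A large random tree is dominated by a random function, whose cycle structure turns the path to the root into the spine of the skeleton tree; bounded differences give concentration.

The large trees form one component: joining two large components by an edge keeps a planar graph planar, the new edge is a bridge with two large sides, and since most vertices of a large tree have few descendants a graph has [o(n)] such bridges.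

These arguments only bound ball frequencies from below. The matching upper bounds are free: frequencies of pairwise non-isomorphic balls add up to at most 1, while the balls of the limiting trees are finite, so finitely many isomorphism types carry almost all of the limiting mass. *)
Require Import Defs.
From mathcomp Require Import all_boot.
From mathcomp Require Import zify.
Set Implicit Arguments. Unset Strict Implicit. Unset Printing Implicit Defensive.

(** * Forests as functions towards the root *)

(** No asymptotic enumeration of planar graphs enters: everything is compared with the number of
    forests with n - m trees, up to factors e^(o(n)). The decisive comparison is in powers of n. A
    graph without K5 minor and with kap components has a code of n - kap pointers, each worth a
    factor n, plus O(n / beta) further pointers and O(beta^2 n) bits, for a free parameter beta.
    Having s n components more than n - m therefore costs n^(- s n), which no factor e^(O(n))
    repairs once beta is large compared with 1 / s. With fewer surplus components, choosing the
    extra edges costs a factor e^(o(n)) as s tends to 0. This scale forces exponentially small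
    errors on the forest side; hence ball counts are truncated to become Lipschitz, and exponential
    moments of single trees are combined by the exponential formula. It also explains why the giant
    component is treated apart: several large trees in a forest are not exponentially rare, so its
    uniqueness is obtained by comparing graphs with m and m + 1 edges. *)

Section Forest.
Variable T : finType.
Implicit Types (f g h : {ffun T -> T}) (A B : {set T}) (x y u v r : T).

(** A chain of parents has at most [#|T|] distinct vertices, so this many steps end in a fixed point
    unless the chain runs into a longer cycle; [acyc] excludes the latter. *)
Definition froot f x : T := iter #|T| f x.
Definition acyc f : bool := [forall x, f (froot f x) == froot f x].

Lemma iter_fix f x i j : f (iter i f x) = iter i f x -> i <= j ->
  iter j f x = iter i f x.
Proof.
move=> fx /subnK <-; elim: (j - i) => // n IH.
by rewrite addSn iterS IH.
Qed.

Lemma acycP f :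
  reflect (forall x, exists i, f (iter i f x) = iter i f x) (acyc f).
Proof.
apply: (iffP forallP) => [H x|H x]; first by exists #|T|; apply/eqP/H.
have [i Hi] := H x; apply/eqP; rewrite /froot.
pose y := iter i f x.
have yc : fconnect f x y by apply: fconnect_iter.
pose j := findex f x y.
have jE : iter j f x = y by apply: iter_findex.
have jT : j <= #|T|.
  apply: ltnW; apply: leq_trans (findex_max yc) _.
  by apply: max_card.
by rewrite (iter_fix _ jT) jE /y.
Qed.

Lemma froot_fix f x : acyc f -> f (froot f x) = froot f x.
Proof. by move=> /forallP /(_ x) /eqP. Qed.

Lemma frootS f x : acyc f -> froot f (f x) = froot f x.
Proof.
move=> af; have e : froot f x = iter #|T|.+1 f x by rewrite iterS froot_fix.
by rewrite e iterSr.
Qed.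

Lemma froot_iterK f x i : acyc f -> froot f (iter i f x) = froot f x.
Proof. by move=> af; elim: i => //= i IH; rewrite frootS. Qed.

Lemma froot_id f x : f x = x -> froot f x = x.
Proof. by move=> fx; rewrite /froot; elim: #|T| => //= n ->. Qed.

Lemma acyc_ind f (P : T -> Prop) : acyc f ->
  (forall x, f x = x -> P x) -> (forall x, f x != x -> P (f x) -> P x) ->
  forall x, P x.
Proof.
move=> af P0 PS x; have /acycP/(_ x) [i Hi] := af.
elim: i x Hi => [|i IH] x Hi; first exact: P0.
have [/eqP|nx] := boolP (f x == x); first exact: P0.
by apply: (PS _ nx); apply: IH; rewrite -iterSr.
Qed.

Lemma acyc_iter_neq f x i : acyc f -> f x != x -> iter i.+1 f x != x.
Proof.
move=> af nx; apply/eqP => e.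
have per k : iter (k * i.+1) f x = x.
  by elim: k => // k IH; rewrite mulSn iterD IH e.
have rx : froot f x = x.
  have e2 := per #|T|.
  rewrite -{2}e2; symmetry; apply: iter_fix; first exact: froot_fix.
  by rewrite leq_pmulr.
by move: (froot_fix x af); rewrite rx => /eqP; rewrite (negPf nx).
Qed.

Definition stable f A : bool := [forall x, if x \in A then f x \in A else f x == x].
(* Rooted forests on [A]: every vertex points to its parent, roots and vertices outside [A] point to themselves. *)
Definition frs A : {set {ffun T -> T}} := [set f | acyc f && stable f A].
Definition roots f A : {set T} := [set x in A | f x == x].
Definition cell f A r : {set T} := [set x in A | froot f x == r].
Definition restr f B : {ffun T -> T} := [ffun x => if x \in B then f x else x].
Definition upd f x y : {ffun T -> T} := [ffun z => if z == x then y else f z].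

Lemma stable_in f A x : stable f A -> x \in A -> f x \in A.
Proof. by move=> /forallP /(_ x); case: ifP. Qed.
Lemma stable_out f A x : stable f A -> x \notin A -> f x = x.
Proof. by move=> /forallP /(_ x); case: ifP => // _ /eqP. Qed.
Lemma stable_iter f A x i : stable f A -> x \in A -> iter i f x \in A.
Proof. by move=> sf xA; elim: i => //= i; apply: stable_in. Qed.

Lemma frsP f A : reflect (acyc f /\ stable f A) (f \in frs A).
Proof. by rewrite inE; apply: andP. Qed.

Lemma froot_in f A x : f \in frs A -> x \in A -> froot f x \in roots f A.
Proof.
move=> /frsP [af sf] xA; rewrite inE stable_iter //=.
by rewrite -/(froot f x) froot_fix.
Qed.

Lemma rootsP f A x : reflect (x \in A /\ f x = x) (x \in roots f A).
Proof. by rewrite inE; apply: (iffP andP) => -[-> /eqP]. Qed.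

Lemma updE f x y z : upd f x y z = if z == x then y else f z.
Proof. by rewrite ffunE. Qed.

Lemma upd_iter f x y z i : (forall j, j < i -> iter j f z != x) ->
  iter i (upd f x y) z = iter i f z.
Proof.
elim: i => // i IH H; rewrite !iterS IH; last by move=> j ji; apply/H/leqW.
by rewrite updE (negPf (H i _)).
Qed.

Lemma upd_noroot f x y z : acyc f -> f x = x -> froot f z != x ->
  forall i, iter i (upd f x y) z = iter i f z.
Proof.
move=> af fx nz i; apply: upd_iter => j _; apply/eqP => e.
by move/eqP: nz; apply; rewrite -(froot_iterK z j af) e froot_id.
Qed.

Lemma link_acyc f x y : acyc f -> f x = x -> froot f y != x ->
  acyc (upd f x y).
Proof.
move=> af fx ny; apply/acycP => z.
have Hy : exists i, upd f x y (iter i (upd f x y) y) = iter i (upd f x y) y.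
  exists #|T|; rewrite -iterS !upd_noroot // iterS.
  by rewrite -/(froot f y) froot_fix.
case: (eqVneq (froot f z) x) => [e|ne]; last first.
  exists #|T|; rewrite -iterS !upd_noroot // iterS.
  by rewrite -/(froot f z) froot_fix.
have [i ei mi] : exists2 i, iter i f z = x & forall j, j < i -> iter j f z != x.
  have ex : exists i, iter i f z == x by exists #|T|; apply/eqP.
  exists (ex_minn ex); first by case: ex_minnP => m /eqP.
  case: ex_minnP => m _ H j jm; apply/negP => /H; by rewrite leqNgt jm.
have e1 : iter i.+1 (upd f x y) z = y.
  by rewrite iterS upd_iter // ei updE eqxx.
have [k Hk] := Hy; exists (k + i.+1); by rewrite iterD e1.
Qed.

Lemma cut_acyc f x : acyc f -> acyc (upd f x x).
Proof.
move=> af; apply/acycP => z.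
have [i e|ne] := pickP (fun i : 'I_#|T|.+1 => iter i f z == x).
  have ex : exists i, iter i f z == x by exists i.
  exists (ex_minn ex); case: ex_minnP => m /eqP em mm.
  rewrite upd_iter ?em ?updE ?eqxx // => j jm.
  by apply/negP => /mm; rewrite leqNgt jm.
have E k : k <= #|T|.+1 -> iter k (upd f x x) z = iter k f z.
  move=> kT; apply: upd_iter => j jk.
  by have := ne (Ordinal (leq_trans jk kT)) => /= ->.
exists #|T|; rewrite -iterS !E // iterS; exact: froot_fix.
Qed.

Lemma cut_froot f x : acyc f -> f x != x -> froot (upd f x x) (f x) != x.
Proof.
move=> af nx; apply/eqP => e.
have H j : iter j (upd f x x) (f x) = iter j f (f x).
  by apply: upd_iter => i _; rewrite -iterSr; apply: acyc_iter_neq.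
by move: (acyc_iter_neq #|T| af nx); rewrite iterSr -H -/(froot _ _) e eqxx.
Qed.

Lemma link_frs f A x y : f \in frs A -> x \in roots f A -> y \in A ->
  froot f y != x -> upd f x y \in frs A.
Proof.
move=> /frsP [af sf] /rootsP [xA fx] yA ny; apply/frsP; split.
  exact: link_acyc.
apply/forallP => z; rewrite updE; case: eqP => [->|_]; first by rewrite xA.
by have /forallP := sf; apply.
Qed.

Lemma link_roots f A x y : f \in frs A -> x \in roots f A ->
  froot f y != x -> roots (upd f x y) A = roots f A :\ x.
Proof.
move=> /frsP [af sf] /rootsP [xA fx] ny; apply/setP => z.
rewrite !inE updE; case: (eqVneq z x) => [->|] //=.
rewrite andbC; apply/negP => /andP [/eqP e _].
by move: ny; rewrite e froot_id // eqxx.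
Qed.

Lemma cut_frs f A x : f \in frs A -> upd f x x \in frs A.
Proof.
move=> /frsP [af sf]; apply/frsP; split; first exact: cut_acyc.
apply/forallP => z; rewrite updE; case: eqP => [->|_]; first by case: ifP.
by have /forallP := sf; apply.
Qed.

Lemma cut_roots f A x : x \in A -> roots (upd f x x) A = x |: roots f A.
Proof.
move=> xA; apply/setP => z; rewrite !inE updE.
by case: (eqVneq z x) => [->|] //=; rewrite xA eqxx.
Qed.

Definition nforests A k := #|[set f in frs A | #|roots f A| == k]|.

(** Pitman's double counting. Linking a root x to a vertex y of another tree removes one root, and
    cutting a nonroot from its parent is the inverse. For each y exactly k of the k + 1 roots lie in
    other trees. *)
Lemma linking_card A k :
  nforests A k.+1 * (#|A| * k) = nforests A k * (#|A| - k).
Proof.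
pose X := [set p : {ffun T -> T} * (T * T) |
  [&& p.1 \in frs A, #|roots p.1 A| == k.+1, p.2.1 \in roots p.1 A, p.2.2 \in A
    & froot p.1 p.2.2 != p.2.1]].
pose Y := [set p : {ffun T -> T} * T |
  [&& p.1 \in frs A, #|roots p.1 A| == k & p.2 \in A :\: roots p.1 A]].
have cX : #|X| = nforests A k.+1 * (#|A| * k).
  rewrite -sum1_card (eq_bigl (fun p => (p.1 \in [set f in frs A | #|roots f A| == k.+1])
    && ((p.2.1 \in roots p.1 A) && (p.2.2 \in A) && (froot p.1 p.2.2 != p.2.1)))); last first.
    by move=> [f [x y]]; rewrite !inE /= -!andbA.
  rewrite -(pair_big_dep (fun f => f \in [set f in frs A | #|roots f A| == k.+1])
     (fun f (q : T * T) => (q.1 \in roots f A) && (q.2 \in A) && (froot f q.2 != q.1)) (fun _ _ => 1)) /=.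
  rewrite /nforests -sum_nat_const; apply: eq_bigr => f; rewrite inE => /andP [ff /eqP cf].
  rewrite (eq_bigl (fun q => (q.2 \in A) && (q.1 \in roots f A :\ froot f q.2))); last first.
    move=> [x y]; rewrite !inE /= (eq_sym x (froot f y)).
    by case: (x \in A); case: (y \in A); case: (f x == x); case: (_ == x).
  rewrite -(pair_big_dep xpredT (fun x y => (y \in A) && (x \in roots f A :\ froot f y)) (fun _ _ => 1)) /=.
  rewrite (exchange_big_dep (fun y => y \in A)) /=; last by move=> x y _ /andP [].
  rewrite -sum_nat_const; apply: eq_bigr => y yA.
  rewrite (eq_bigl (fun x => x \in roots f A :\ froot f y)); last by move=> x; rewrite yA.
  rewrite sum1_card.
  by have := cardsD1 (froot f y) (roots f A); rewrite cf froot_in // => -[].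
have cY : #|Y| = nforests A k * (#|A| - k).
  rewrite -sum1_card (eq_bigl (fun p => (p.1 \in [set f in frs A | #|roots f A| == k])
    && (p.2 \in A :\: roots p.1 A))); last by move=> [f x]; rewrite !inE /= -!andbA.
  rewrite -(pair_big_dep (fun f => f \in [set f in frs A | #|roots f A| == k])
     (fun f x => x \in A :\: roots f A) (fun _ _ => 1)) /=.
  rewrite /nforests -sum_nat_const; apply: eq_bigr => f; rewrite inE => /andP [ff /eqP cf].
  rewrite sum1_card cardsD -cf; congr (_ - _); congr #|pred_of_set _|.
  by apply/setP => x; rewrite !inE; case: (x \in A).
rewrite -cX -cY.
pose F (p : {ffun T -> T} * (T * T)) := (upd p.1 p.2.1 p.2.2, p.2.1).
pose G (p : {ffun T -> T} * T) := (upd p.1 p.2 p.2, (p.2, p.1 p.2)).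
have FG : {in X, cancel F G}.
  move=> [f [x y]]; rewrite inE /= => /and5P [_ _ /rootsP [_ fx] _ _]; rewrite /F /G /=.
  congr (_, (_, _)); last by rewrite updE eqxx.
  by apply/ffunP => z; rewrite !updE; case: eqP => // ->.
have GF : {in Y, cancel G F}.
  move=> [f x]; rewrite inE /= => _; rewrite /F /G /=.
  by congr (_, _); apply/ffunP => z; rewrite !updE; case: eqP => // ->.
apply/eqP; rewrite eqn_leq; apply/andP; split.
  rewrite -(card_in_imset (can_in_inj FG)); apply/subset_leq_card/subsetP => q.
  case/imsetP => -[f [x y]]; rewrite inE /= => /and5P [ff /eqP cf xr yA ny] ->.
  rewrite inE /= link_frs // link_roots //; apply/and3P; split => //.
    by have := cardsD1 x (roots f A); rewrite xr cf => -[->].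
  by rewrite !inE eqxx /=; case/rootsP: xr => ->.
rewrite -(card_in_imset (can_in_inj GF)); apply/subset_leq_card/subsetP => q.
case/imsetP => -[f x]; rewrite inE /= => /and3P [ff /eqP cf].
rewrite 2!inE => /andP [nx xA] ->; have /frsP [af sf] := ff.
have {}nx : f x != x by move: nx; rewrite xA.
rewrite inE /= cut_frs //= cut_roots //.
rewrite cardsU1 inE xA /= (negPf nx) cf add1n eqxx /=.
by rewrite !inE xA eqxx /= (stable_in sf) // cut_froot.
Qed.

End Forest.

(** * Splitting a forest into one tree and the rest *)

Section Decompose.
Variable T : finType.
Implicit Types (f g h : {ffun T -> T}) (A B C : {set T}) (x y u v r : T).

Lemma restrE f B x : restr f B x = if x \in B then f x else x.
Proof. by rewrite ffunE. Qed.

Lemma agree_iter f g B : {in B, forall x, g x \in B} -> {in B, f =1 g} ->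
  forall x i, x \in B -> iter i f x = iter i g x.
Proof.
move=> cg fg x i xB.
suff [] : iter i f x = iter i g x /\ iter i g x \in B by [].
elim: i => [|i [IH IB]] //=; rewrite IH; split; [exact: fg|exact: cg].
Qed.

Lemma agree_froot f g B : {in B, forall x, g x \in B} -> {in B, f =1 g} ->
  {in B, froot f =1 froot g}.
Proof. by move=> cg fg x xB; apply: agree_iter cg fg _ _ xB. Qed.

Lemma restr_frs f B : acyc f -> {in B, forall x, f x \in B} -> restr f B \in frs B.
Proof.
move=> af cf; apply/frsP; split; last first.
  by apply/forallP => x; rewrite restrE; case: (boolP (x \in B)) => // /cf.
apply/acycP => x; case: (boolP (x \in B)) => xB; last first.
  by exists 0; rewrite /= ffunE (negPf xB).
exists #|T|; rewrite -iterS !(agree_iter (B := B) (g := f)) //.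
- by rewrite iterS -/(froot f x) froot_fix.
- by move=> y yB; rewrite restrE yB.
- by move=> y yB; rewrite restrE yB.
Qed.

Lemma restr_roots f B : roots (restr f B) B = [set x in B | f x == x].
Proof.
by apply/setP => x; rewrite !inE; case: (boolP (x \in B)) => //= xB; rewrite restrE xB.
Qed.

Lemma cellP f A r x : reflect (x \in A /\ froot f x = r) (x \in cell f A r).
Proof. by rewrite inE; apply: (iffP andP) => -[-> /eqP]. Qed.

Lemma cell_sub f A r : cell f A r \subset A.
Proof. by apply/subsetP => x /cellP []. Qed.

Lemma cell_closed f A r : f \in frs A -> {in cell f A r, forall x, f x \in cell f A r}.
Proof.
move=> /frsP [af sf] x /cellP [xA <-]; apply/cellP.
by split; [exact: stable_in|exact: frootS].
Qed.

Lemma co_closed f A r : f \in frs A ->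
  {in A :\: cell f A r, forall x, f x \in A :\: cell f A r}.
Proof.
move=> /frsP [af sf] x /setDP [xA nx]; apply/setDP; split; first exact: stable_in.
apply: contra nx => /cellP [_ e]; apply/cellP; split => //.
by rewrite -e frootS.
Qed.

Lemma cell_root f A r : f \in frs A -> r \in roots f A -> r \in cell f A r.
Proof. by move=> ff /rootsP [rA fr]; apply/cellP; split => //; apply: froot_id. Qed.

Lemma cell_roots f A r : f \in frs A -> r \in roots f A ->
  roots (restr f (cell f A r)) (cell f A r) = [set r].
Proof.
move=> ff rr; rewrite restr_roots; apply/setP => x; rewrite in_set1 inE.
apply/andP/eqP => [[/cellP [_ <-] /eqP fx]|->]; first by rewrite froot_id.
by split; [exact: cell_root|case/rootsP: rr => _ ->].
Qed.

Lemma co_roots f A r : f \in frs A -> r \in roots f A ->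
  roots (restr f (A :\: cell f A r)) (A :\: cell f A r) = roots f A :\ r.
Proof.
move=> ff rr; rewrite restr_roots; apply/setP => x; rewrite !inE.
case: (eqVneq (f x) x) => [fx|]; rewrite ?andbF // !andbT froot_id //.
by case: (x \in A); rewrite ?andbF //= andbT.
Qed.

Definition merge B g h : {ffun T -> T} := [ffun x => if x \in B then g x else h x].

Lemma mergeE B g h x : merge B g h x = if x \in B then g x else h x.
Proof. by rewrite ffunE. Qed.

Section Merge.
Variables (A B : {set T}) (g h : {ffun T -> T}).
Hypotheses (sBA : B \subset A) (gB : g \in frs B) (hB : h \in frs (A :\: B)).

Let ag := proj1 (frsP _ _ gB).
Let sg := proj2 (frsP _ _ gB).
Let ah := proj1 (frsP _ _ hB).
Let sh := proj2 (frsP _ _ hB).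

Lemma merge_frootl : {in B, froot (merge B g h) =1 froot g}.
Proof.
apply: agree_froot => x xB; first exact: stable_in xB.
by rewrite mergeE xB.
Qed.

Lemma h_closed : {in ~: B, forall x, h x \in ~: B}.
Proof.
move=> x; rewrite !inE => xB; case: (boolP (x \in A)) => xA.
  have xD : x \in A :\: B by rewrite inE xB.
  by have := stable_in sh xD; rewrite inE => /andP [].
by rewrite (stable_out sh) // inE (negPf xA) andbF.
Qed.

Lemma merge_frootr : {in ~: B, froot (merge B g h) =1 froot h}.
Proof.
apply: agree_froot; first exact: h_closed.
by move=> x; rewrite inE mergeE => /negPf ->.
Qed.

Lemma merge_frs : merge B g h \in frs A.
Proof.
apply/frsP; split; last first.
  apply/forallP => x; rewrite mergeE; case: ifP => xA; case: ifP => xB.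
  - by apply: (subsetP sBA); apply: stable_in xB.
  - have xD : x \in A :\: B by rewrite inE xB xA.
    by have := stable_in sh xD; rewrite inE => /andP [].
  - by move: (subsetP sBA x xB); rewrite xA.
  - by rewrite (stable_out sh) // inE xA andbF.
apply/acycP => x; exists #|T|; rewrite -/(froot _ x).
case: (boolP (x \in B)) => xB.
  rewrite merge_frootl // mergeE.
  by have /rootsP [-> ->] := froot_in gB xB.
have xC : x \in ~: B by rewrite inE.
rewrite merge_frootr // mergeE froot_fix //.
suff /negPf -> : froot h x \notin B by [].
by rewrite -in_setC /froot; elim: #|T| => //= i; apply: h_closed.
Qed.

Lemma merge_roots : roots (merge B g h) A = roots g B :|: roots h (A :\: B).
Proof.
apply/setP => x; rewrite !inE mergeE; have := subsetP sBA x.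
case: (x \in B) => [->//|_]; by rewrite ?orbF ?andbF.
Qed.

Lemma merge_celll r : r \in roots g B -> cell (merge B g h) A r = cell g B r.
Proof.
move=> rr; apply/setP => x; rewrite !inE.
case: (boolP (x \in B)) => xB /=; first by rewrite merge_frootl // (subsetP sBA).
rewrite merge_frootr ?inE //; apply/negP => /andP [_ /eqP e].
have : froot h x \in ~: B.
  by rewrite /froot; elim: #|T| => //= [|i]; [rewrite inE|apply: h_closed].
by rewrite e inE; case/rootsP: rr => ->.
Qed.

Lemma merge_cellr r : r \in roots h (A :\: B) ->
  cell (merge B g h) A r = cell h (A :\: B) r.
Proof.
move=> /rootsP [rr _]; apply/setP => x; rewrite !inE.
case: (boolP (x \in B)) => xB /=; last by rewrite merge_frootr ?inE.
rewrite merge_frootl //; apply/negP => /andP [_ /eqP e].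
have /rootsP [] := froot_in gB xB; rewrite e => rB _.
by move: rr; rewrite inE rB.
Qed.

Lemma merge_restrl : restr (merge B g h) B = g.
Proof.
apply/ffunP => x; rewrite restrE mergeE; case: (boolP (x \in B)) => // xB.
by rewrite (stable_out sg).
Qed.

Lemma merge_restrr C : C \subset A :\: B -> restr (merge B g h) C = restr h C.
Proof.
move=> /subsetP sC; apply/ffunP => x; rewrite !restrE mergeE.
by case: (boolP (x \in C)) => // /sC; rewrite inE => /andP [/negPf ->].
Qed.

Lemma merge_restrD : restr (merge B g h) (A :\: B) = h.
Proof.
rewrite merge_restrr //; apply/ffunP => x; rewrite restrE; case: (boolP (x \in A :\: B)) => // xD.
by rewrite (stable_out sh).
Qed.

End Merge.

Lemma merge_cut f A r : f \in frs A ->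
  merge (cell f A r) (restr f (cell f A r)) (restr f (A :\: cell f A r)) = f.
Proof.
move=> /frsP [af sf]; apply/ffunP => x; rewrite mergeE !restrE in_setD.
case: (boolP (x \in cell f A r)) => //= nx.
by case: (boolP (x \in A)) => //= xA; rewrite (stable_out sf).
Qed.
End Decompose.

(** * Spanning forests and edge sets *)

Section Graph.
Variable T : finType.
Implicit Types (f g h : {ffun T -> T}) (A B C S : {set T}) (x y u v r : T) (e : rel T).

Definition fadj f : rel T := fun x y => (x != y) && ((f x == y) || (f y == x)).
Definition gr f : {set {set T}} := [set [set x; f x] | x in [set x | f x != x]].

Lemma set2_inj x y u v : [set x; y] = [set u; v] ->
  (x = u /\ y = v) \/ (x = v /\ y = u).
Proof.
move=> E; have : x \in [set u; v] by rewrite -E set21.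
have : y \in [set u; v] by rewrite -E set22.
have : u \in [set x; y] by rewrite E set21.
have : v \in [set x; y] by rewrite E set22.
rewrite !inE => /orP [] /eqP ? /orP [] /eqP ? /orP [] /eqP ? /orP [] /eqP ?; subst; auto.
Qed.

Lemma fadj_sym f : symmetric (fadj f).
Proof. by move=> x y; rewrite /fadj eq_sym orbC. Qed.

Lemma gr_adj f x y : ([set x; y] \in gr f) = fadj f x y.
Proof.
rewrite /fadj; apply/imsetP/andP => [[z]|[ne /orP [] /eqP E]].
- rewrite inE => nz /set2_inj [] [-> ->]; first by rewrite eq_sym nz eqxx.
  by rewrite nz eqxx orbT.
- by exists x; rewrite ?inE E // eq_sym.
- by exists y; rewrite ?inE E // setUC.
Qed.

Lemma card_gr f : acyc f -> #|gr f| = #|[set x | f x != x]|.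
Proof.
move=> af; apply: card_in_imset => x y; rewrite !inE => nx ny /set2_inj [[]//|[E1 E2]].
by have := acyc_iter_neq 1 af nx; rewrite /= E2 -E1 eqxx.
Qed.

(** The roots force the orientation. Going outwards from a root, [g] already agrees with [f] at
    [f x]; if [g] oriented the edge between [x] and [f x] the other way, [f] would have a cycle of
    length two. *)
Lemma gr_inj f g : acyc f -> acyc g -> (forall x, (f x == x) = (g x == x)) ->
  gr f = gr g -> f = g.
Proof.
move=> af ag fix_eq E; apply/ffunP; apply: (acyc_ind af) => x.
  by move=> fx; have /eqP -> : g x == x by rewrite -fix_eq fx.
move=> nx IH; have : fadj g x (f x) by rewrite -gr_adj -E gr_adj /fadj eq_sym nx eqxx.
case/andP => _ /orP [/eqP -> //|/eqP E2].
have fx : f (f x) = x by rewrite IH.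
by have := acyc_iter_neq 1 af nx; rewrite /= fx eqxx.
Qed.

Lemma connect_sym_of_sym e : symmetric e -> connect_sym e.
Proof. exact: sym_connect_sym. Qed.

Lemma fadj_froot f x y : acyc f -> fadj f x y -> froot f x = froot f y.
Proof.
by move=> af /andP [_ /orP [] /eqP <-]; rewrite frootS.
Qed.

Lemma fadj_connect f x : acyc f -> connect (fadj f) x (froot f x).
Proof.
move=> af; apply: (acyc_ind (P := fun x => connect (fadj f) x (froot f x)) af) => {}x; first by move=> /froot_id ->; apply: connect0.
move=> nx IH; rewrite -(frootS _ af); apply: connect_trans IH; apply: connect1.
by rewrite /fadj eq_sym nx eqxx.
Qed.

Lemma connect_inv e (U : eqType) (k : T -> U) x y : (forall x y, e x y -> k x = k y) ->
  connect e x y -> k x = k y.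
Proof.
move=> H /connectP [p]; elim: p x => [|z p IH] x /=; first by move=> _ ->.
by move=> /andP [/H -> pz] E; apply: IH.
Qed.

Lemma connect_froot f x y : acyc f ->
  connect (fadj f) x y = (froot f x == froot f y).
Proof.
move=> af; apply/idP/eqP => [|E].
  by apply: connect_inv => u v; apply: fadj_froot.
apply: connect_trans (fadj_connect x af) _.
by rewrite E (connect_sym_of_sym (fadj_sym f)) fadj_connect.
Qed.

Lemma exit_edge e S x y : connect e x y -> x \notin S -> y \in S ->
  exists u v, [/\ e u v, u \notin S & v \in S].
Proof.
move=> /connectP [p]; elim: p x => [|z p IH] x /=; first by move=> _ -> /negPf ->.
move=> /andP [exz pz] E xS yS; have [zS|zS] := boolP (z \in S); first by exists x, z.
exact: IH E zS yS.
Qed.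

(** The forest grows from the prescribed roots: while some vertex lies outside the grown set, its
    path to [Rt] enters this set along an edge, which becomes the next parent edge. *)
Lemma spanning_forest e (Rt : {set T}) :
  (forall x, exists2 r, r \in Rt & connect e x r) ->
  exists2 f, f \in frs [set: T] & roots f [set: T] = Rt /\
    forall x, f x != x -> e x (f x).
Proof.
move=> HR.
suff H n S f : #|~: S| <= n -> f \in frs S -> Rt \subset S -> roots f S = Rt ->
    (forall x, f x != x -> e x (f x)) ->
    exists2 f, f \in frs [set: T] & roots f [set: T] = Rt /\
    forall x, f x != x -> e x (f x).
  apply: (H #|T| Rt [ffun x => x]) => //.
  - exact: max_card.
  - apply/frsP; split; first by apply/acycP => x; exists 0; rewrite ffunE.
    by apply/forallP => x; rewrite ffunE eqxx; case: ifP.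
  - by apply/setP => x; rewrite inE ffunE eqxx andbT.
  - by move=> x; rewrite ffunE eqxx.
elim: n S f => [|n IH] S f cS ff RS rf ef.
  have ST : S = [set: T] by move: cS; rewrite leqn0 => /eqP/cards0_eq S0; rewrite -[S]setCK S0 setC0.
  by exists f; rewrite -?ST.
have [|[x xS]] := set_0Vmem (~: S); last first.
  have {}xS : x \notin S by rewrite inE in xS.
  have [r rR cr] := HR x.
  have [u [v [euv uS vS]]] := exit_edge cr xS (subsetP RS r rR).
  have /frsP [af sf] := ff; have fu := stable_out sf uS.
  have rv := froot_in ff vS; have nv : froot f v != u.
    by apply: contra uS => /eqP <-; case/rootsP: rv.
  apply: (IH (u |: S) (upd f u v)).
  - by rewrite -ltnS; apply: leq_trans cS; apply: proper_card; rewrite setCU setIC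
      properE subsetIl /=; apply/subsetPn; exists u; rewrite !inE ?uS ?eqxx.
  - apply/frsP; split; first exact: link_acyc.
    apply/forallP => z; rewrite updE !inE; case: (eqVneq z u) => [->|ne] /=.
      by rewrite vS orbT.
    by case: (boolP (z \in S)) => zS; [rewrite (stable_in sf) ?orbT|rewrite (stable_out sf)].
  - exact: subset_trans RS (subsetUr _ _).
  - rewrite -rf; apply/setP => z; rewrite !inE updE; case: (eqVneq z u) => [->|ne] //=.
    by rewrite (negPf uS) /=; apply/negbTE; apply: contra uS => /eqP <-.
  - by move=> z; rewrite updE; case: (eqVneq z u) => [->|_ /ef].
move=> S0; have ST : S = [set: T] by rewrite -[S]setCK S0 setC0.
by exists f; rewrite -ST.
Qed.

Definition trees B r := [set g in frs B | roots g B == [set r]].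

Lemma treesP B r g : reflect [/\ acyc g, stable g B & roots g B = [set r]] (g \in trees B r).
Proof.
rewrite inE; apply: (iffP andP) => [[/frsP [ag sg] /eqP]|[ag sg /eqP rg]] //.
by split=> //; apply/frsP.
Qed.

Lemma trees_fix B r g x : g \in trees B r -> (g x == x) = (x \in r |: ~: B).
Proof.
move=> /treesP [ag sg rg]; rewrite !inE; have [xB|xB] := boolP (x \in B); last first.
  by rewrite (stable_out sg xB) eqxx orbT.
by have := in_set1 x r; rewrite -rg inE xB orbF.
Qed.

Lemma gr_trees_inj B r : {in trees B r &, injective gr}.
Proof.
move=> g h tg th; have /treesP [ag _ _] := tg; have /treesP [ah _ _] := th.
by apply: gr_inj => // x; rewrite (trees_fix x tg) (trees_fix x th).
Qed.

(** The tree is regrown from r' as a spanning forest of itself, with the vertices outside B as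
    isolated roots. No new edge appears and the numbers of edges agree, so the edge sets
    coincide. *)
Lemma reroot B r r' f : f \in trees B r -> r' \in B ->
  exists2 g, g \in trees B r' & gr g = gr f.
Proof.
move=> tf r'B; have /treesP [af sf rf] := tf.
have rB : r \in B by have := set11 r; rewrite -rf; case/rootsP.
have ff : f \in frs B by apply/frsP.
have rt x : x \in B -> froot f x = r.
  by move=> xB; have := froot_in ff xB; rewrite rf inE => /eqP.
have [x|g gT [rg eg]] := @spanning_forest (fadj f) (r' |: ~: B).
  have [xB|xB] := boolP (x \in B); last by exists x; rewrite ?connect0 // !inE xB orbT.
  by exists r'; rewrite ?setU11 // connect_froot // !rt.
have fixg x : (g x == x) = (x \in r' |: ~: B) by rewrite -rg !inE.
have /frsP [ag _] := gT.
have tg : g \in trees B r'.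
  apply/treesP; split=> //.
    apply/forallP => x; case: ifPn => xB; last by rewrite fixg !inE xB orbT.
    have [/eqP -> //|/eg] := boolP (g x == x).
    move=> /andP [ne /orP [/eqP <-|/eqP E]]; first exact: stable_in sf xB.
    apply: contraT => gB; move: ne.
    by rewrite (stable_out sf gB) in E; rewrite E eqxx.
  apply/setP => x; rewrite !inE fixg !inE; case: (eqVneq x r') => [->|_] /=.
    by rewrite r'B.
  by case: (x \in B).
exists g => //; apply/eqP; rewrite eqEcard; apply/andP; split.
  by apply/subsetP => _ /imsetP [z nz ->]; rewrite gr_adj; apply: eg; rewrite inE in nz.
rewrite !card_gr // -(leq_add2l #|[set x | g x == x]|).
have c h : #|[set x | h x == x]| + #|[set x | h x != x]| = #|T|.
  rewrite -(cardsC [set x | h x == x]); congr (_ + #|pred_of_set _|).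
  by apply/setP => x; rewrite !inE.
rewrite c -(c f); rewrite leq_add2r; apply/eq_leq.
rewrite (eq_card (B := r' |: ~: B)); last by move=> x; rewrite inE fixg.
rewrite [RHS](eq_card (B := r |: ~: B)); last by move=> x; rewrite inE (trees_fix x tf).
by rewrite !cardsU1 !inE rB r'B.
Qed.

Lemma reroot_le B r r' (P : pred {set {set T}}) : r' \in B ->
  #|[set g in trees B r | P (gr g)]| <= #|[set g in trees B r' | P (gr g)]|.
Proof.
move=> r'B; rewrite -(card_in_imset (f := gr)); last first.
  by move=> g h /setIdP [tg _] /setIdP [th _]; apply: (@gr_trees_inj B r).
rewrite -[in X in _ <= X](card_in_imset (f := gr)); last first.
  by move=> g h /setIdP [tg _] /setIdP [th _]; apply: (@gr_trees_inj B r').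
apply/subset_leq_card/subsetP => _ /imsetP [g /setIdP [tg Pg] ->].
have [h th E] := reroot tg r'B; apply/imsetP; exists h => //.
by rewrite in_set th E.
Qed.

Lemma reroot_card B r r' (P : pred {set {set T}}) : r \in B -> r' \in B ->
  #|[set g in trees B r | P (gr g)]| = #|[set g in trees B r' | P (gr g)]|.
Proof. by move=> rB r'B; apply/eqP; rewrite eqn_leq !reroot_le. Qed.

Lemma nforests1 B : nforests B 1 = \sum_(r in B) #|trees B r|.
Proof.
rewrite /nforests -sum1_card.
rewrite (eq_bigr (fun r => \sum_(g in [set f in frs B | #|roots f B| == 1]) (g \in trees B r))).
  rewrite exchange_big /=; apply: eq_bigr => g; rewrite inE => /andP [gB /cards1P [r rE]].
  have rB : r \in B by have := set11 r; rewrite -rE; case/rootsP.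
  rewrite (bigD1 r) //= inE gB rE eqxx big1 // => r' /andP [_ ne].
  by rewrite inE gB rE /= (inj_eq set1_inj) eq_sym (negPf ne).
move=> r _; rewrite -sum1_card big_mkcond [RHS]big_mkcond; apply: eq_bigr => g _.
have -> : (g \in trees B r) = (g \in frs B) && (roots g B == [set r]) by rewrite in_set.
have -> : (g \in [set f in frs B | #|roots f B| == 1]) = (g \in frs B) && (#|roots g B| == 1) by rewrite in_set.
case: (g \in frs B) => //=; case: eqP => [->|]; first by rewrite cards1 eqxx.
by case: ifP.
Qed.

Lemma card_trees B r : r \in B -> #|trees B r| * #|B| = nforests B 1.
Proof.
move=> rB; rewrite nforests1 mulnC -sum_nat_const; apply: eq_bigr => r' r'B.
have := @reroot_card B r r' predT rB r'B.
by congr (_ = _); apply: eq_card => g; rewrite in_set andbT.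
Qed.

(** An unrooted tree is counted once by demanding that its root be the vertex that [pick] selects in
    its vertex set; [least_rooted] asks this of every tree of a forest. *)
Definition crep B g := [forall r in roots g B, [pick x in B] == Some r].
Definition least_rooted f A :=
  [forall r in roots f A, [pick x in cell f A r] == Some r].

Lemma crep_trees B : (if [pick x in B] is Some r then trees B r else set0) =
  [set g in frs B | (#|roots g B| == 1) && crep B g].
Proof.
apply/setP => g; rewrite in_set /crep; case E : [pick x in B] => [r|]; rewrite in_set.
  apply: andb_id2l => gB; apply/eqP/andP => [->|[/cards1P [r' ->] /forall_inP H]].
    by rewrite cards1; split=> //; apply/forall_inP => x; rewrite in_set1 => /eqP ->.
  by have /eqP [->] := H r' (set11 _).
apply/esym/and3P => -[gB /cards1P [r' rE] _].
have : r' \in B by have := set11 r'; rewrite -rE; case/rootsP.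
by move: E; case: pickP => // /(_ r') /= ->.
Qed.

Lemma canonical_spanning e : symmetric e ->
  exists2 f, f \in frs [set: T] & [/\ least_rooted f [set: T],
    forall x, f x != x -> e x (f x) & forall x y, connect e x y = (froot f x == froot f y)].
Proof.
move=> se; pose Rt := [set r | [pick x | connect e r x] == Some r].
have cs := connect_sym_of_sym se.
have pickE x y : connect e x y -> [pick z | connect e x z] = [pick z | connect e y z].
  move=> cxy; apply: eq_pick => z; exact: (same_connect cs).
have [x|f ff [rf ef]] := @spanning_forest e Rt.
  case E : [pick z | connect e x z] => [r|]; last first.
    by move: E; case: pickP => // /(_ x); rewrite connect0.
  have cr : connect e x r by move: E; case: pickP => // z + [<-].
  by exists r => //; rewrite inE -(pickE x) // E.
have /frsP [af sf] := ff.
have cxr x : connect e x (froot f x).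
  apply: (acyc_ind (P := fun x => connect e x (froot f x)) af) => {}x.
    by move=> /froot_id ->; apply: connect0.
  move=> /ef /connect1 H IH; apply: connect_trans H _.
  by move: IH; rewrite frootS.
have conn x y : connect e x y = (froot f x == froot f y).
  apply/idP/eqP => [cxy|E]; last by apply: connect_trans (cxr x) _; rewrite E cs.
  have rin z : froot f z \in Rt by rewrite -rf; apply: froot_in; rewrite ?in_setT.
  have c2 : connect e (froot f x) (froot f y).
    by apply: connect_trans (cxr y); apply: connect_trans cxy; rewrite cs.
  have := rin x; have := rin y; rewrite !inE (pickE _ _ c2) => /eqP -> /eqP.
  by case.
exists f => //; split=> //.
apply/forall_inP => r; rewrite rf inE => /eqP E; apply/eqP; rewrite -E.
apply: eq_pick => x; rewrite !inE cs conn /= [froot f r]froot_id //.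
by have /rootsP [] : r \in roots f [set: T] by rewrite rf inE E.
Qed.

End Graph.

(** * Balls and rooted isomorphism *)

Lemma card_bigcup_le (I T : finType) (P : pred I) (F : I -> {set T}) :
  #|\bigcup_(i | P i) F i| <= \sum_(i | P i) #|F i|.
Proof.
elim/big_rec2 : _ => [|y n S yW]; first by rewrite cards0.
by move=> H; apply: leq_trans (leq_card_setU _ _).1 _; rewrite leq_add2l.
Qed.

Section FiniteBall.
Variable T : finType.
Implicit Types (a : rel T) (v x y : T) (X Y : {set T}).

Fixpoint fball a v l : {set T} :=
  if l is l'.+1 then fball a v l' :|: [set y | [exists x in fball a v l', a x y]]
  else [set v].

Lemma fball0 a v : fball a v 0 = [set v]. Proof. by []. Qed.
Lemma fballE a v l :
  fball a v l.+1 = fball a v l :|: [set y | [exists x in fball a v l, a x y]].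
Proof. by []. Qed.
Arguments fball : simpl never.

Lemma fballSP a v l y :
  reflect (y \in fball a v l \/ exists2 x, x \in fball a v l & a x y) (y \in fball a v l.+1).
Proof.
rewrite fballE !inE; apply: (iffP orP) => [[->|/exists_inP [x xB axy]]|[->|[x xB axy]]].
- by left.
- by right; exists x.
- by left.
- by right; apply/exists_inP; exists x.
Qed.

Lemma fball_center a v l : v \in fball a v l.
Proof. by elim: l => [|l IH]; rewrite ?fballE ?set11 // inE IH. Qed.

Lemma fballS a v l : fball a v l \subset fball a v l.+1.
Proof. exact: subsetUl. Qed.

Lemma fball_homo a v l l' : l <= l' -> fball a v l \subset fball a v l'.
Proof.
move=> /subnK <-; elim: (l' - l) => // n IH.
by apply: subset_trans IH _; rewrite addSn fballS.
Qed.

Lemma fball_first a v l y :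
  reflect (y = v \/ exists2 x, a v x & y \in fball a x l) (y \in fball a v l.+1).
Proof.
elim: l y => [|l IH] y.
  apply: (iffP (fballSP _ _ _ _)); rewrite !inE => -[].
  - by move/eqP; left.
  - by move=> [x]; rewrite inE => /eqP -> avy; right; exists y; rewrite ?inE.
  - by move=> ->; left.
  - by move=> [x avx]; rewrite inE => /eqP ->; right; exists v; rewrite ?inE.
apply: (iffP (fballSP _ _ _ _)) => [[/IH [->|[x ax yx]]|[z /IH [->|[x ax zx]] azy]]|[->|[x ax /fballSP [yx|[z zx azy]]]]].
- by left.
- by right; exists x => //; apply: (subsetP (fballS _ _ _)).
- by right; exists y => //; apply: fball_center.
- by right; exists x => //; apply/fballSP; right; exists z.
- by left; apply: fball_center.
- by left; apply/IH; right; exists x.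
- by right; exists z => //; apply/IH; right; exists x.
Qed.

Lemma fball_step a v x l : a v x -> fball a x l \subset fball a v l.+1.
Proof. by move=> ax; apply/subsetP => y yx; apply/fball_first; right; exists x. Qed.

(** Without a degree bound one vertex may lie in the balls of very many centres; bounding the next
    larger ball repairs this. By induction on l: a centre v other than x has a neighbour y that is a
    centre for radius one less, and y has at most K neighbours because its own ball is small. *)
Lemma card_ball_centers a x K l : symmetric a ->
  #|[set v | (x \in fball a v l) && (#|fball a v l.+1| <= K)]| <= K.+1 ^ l.
Proof.
move=> sa; elim: l => [|l IH].
  rewrite expn0 -(cards1 x); apply/subset_leq_card/subsetP => v.
  by rewrite !inE eq_sym => /andP [].
set W := [set v | _] in IH.
have -> : K.+1 ^ l.+1 = K.+1 ^ l + K.+1 ^ l * K by rewrite expnSr mulnSr addnC.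
apply: (@leq_trans #|x |: \bigcup_(y in W) fball a y l.+1|).
  apply/subset_leq_card/subsetP => v; rewrite in_set => /andP [/fball_first [->|[y avy xy]] cK].
    by rewrite setU11.
  rewrite inE; apply/orP; right; apply/bigcupP; exists y.
    rewrite in_set xy; apply: leq_trans cK; apply: subset_leq_card.
    exact: fball_step.
  apply: (subsetP (fball_homo a y (isT : 1 <= l.+1))).
  by apply/fballSP; right; exists y; rewrite ?inE // sa.
rewrite cardsU1; apply: leq_add; first by case: (_ \notin _); rewrite // expn_gt0.
apply: leq_trans (leq_mul IH (leqnn K)).
rewrite -sum_nat_const; apply: leq_trans (card_bigcup_le _ _) _; apply: leq_sum => y.
by rewrite inE => /andP [].
Qed.

(** The adjacencies agree as soon as the first vertex is outside X. So a ball of radius l that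
    avoids X determines even the ball of radius l + 1. *)
Lemma fball_local a a' v l X : (forall x y, x \notin X -> a x y = a' x y) ->
  [disjoint fball a v l & X] -> forall j, j <= l.+1 -> fball a v j = fball a' v j.
Proof.
move=> aa' dX; elim=> // j IH jl; rewrite !fballE -IH; last exact: ltnW.
congr (_ :|: _); apply/setP => y; rewrite !inE; apply: eq_existsb => x.
apply: andb_id2l => xj; apply: aa'; rewrite (disjointFr dX) //.
by move: xj; apply/subsetP/fball_homo; rewrite -ltnS.
Qed.

Section Iso.
Variables (k : nat) (E : rel 'I_k) (rH : 'I_k).
Definition isom a v l (phi : {ffun 'I_k -> T}) :=
  [&& injectiveb phi, phi rH == v, phi @: setT == fball a v l &
      [forall i, forall j, E i j == a (phi i) (phi j)]].
Definition fiso a v l := [exists phi, isom a v l phi].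

Lemma isomP a v l (phi : {ffun 'I_k -> T}) : reflect [/\ injective phi, phi rH = v, phi @: setT = fball a v l &
  forall i j, E i j = a (phi i) (phi j)] (isom a v l phi).
Proof.
apply: (iffP and4P) => [[/injectiveP ? /eqP ? /eqP ? H]|[? -> -> H]]; split => //.
- by move=> i j; apply/eqP; move/forallP: H => /(_ i)/forallP.
- exact/injectiveP.
- by apply/forallP => i; apply/forallP => j; rewrite H.
Qed.

Lemma isom_local a a' v l X phi : (forall x y, x \notin X -> a x y = a' x y) ->
  [disjoint fball a v l & X] -> isom a v l phi -> isom a' v l phi.
Proof.
move=> aa' dX /isomP [ip pr im ae]; apply/isomP; split => //.
  by rewrite im; apply: fball_local aa' dX _ _.
move=> i j; rewrite ae aa' // (disjointFr dX) // -im; exact: imset_f.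
Qed.

(** The bound on the ball of radius l + 1 makes this count Lipschitz under changes of the graph at
    few vertices, by [card_ball_centers]; the plain number of isomorphic balls is not. *)
Definition Mset a l K Y := [set v in Y | fiso a v l && (#|fball a v l.+1| <= K)].

Lemma Mset_lip a a' l K X Y : symmetric a ->
  (forall x y, x \notin X -> a x y = a' x y) ->
  #|Mset a l K Y| <= #|Mset a' l K Y| + #|X| * K.+1 ^ l.
Proof.
move=> sa aa'.
pose W x := [set v | (x \in fball a v l) && (#|fball a v l.+1| <= K)].
apply: (@leq_trans (#|Mset a' l K Y| + #|\bigcup_(x in X) W x|)).
  apply: leq_trans (leq_card_setU _ _).1; apply/subset_leq_card/subsetP => v.
  rewrite inE => /and3P [vY /existsP [phi ip] cK].
  rewrite inE; have [d|] := boolP [disjoint fball a v l & X].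
    apply/orP; left; rewrite inE vY /= -(fball_local aa' d (leqnn _)) cK andbT.
    by apply/existsP; exists phi; apply: isom_local aa' d ip.
  rewrite -setI_eq0 => /set0Pn [x /setIP [xb xX]]; apply/orP; right.
  by apply/bigcupP; exists x => //; rewrite inE xb cK.
rewrite leq_add2l -sum_nat_const.
apply: leq_trans (card_bigcup_le _ _) _; apply: leq_sum => x _; exact: card_ball_centers.
Qed.

Definition Aut := #|[set s : {ffun 'I_k -> 'I_k} |
  [&& injectiveb s, s rH == rH & [forall i, forall j, E (s i) (s j) == E i j]]]|.

(** Two isomorphisms onto the same ball differ by a rooted automorphism. *)
Lemma card_isom a v l : #|[set phi | isom a v l phi]| <= Aut * fiso a v l.
Proof.
case: (boolP (fiso a v l)) => [/existsP [p0 ip0]|/existsPn H]; last first.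
  by rewrite muln0 leqn0 cards_eq0 -subset0; apply/subsetP => p; rewrite inE (negPf (H p)).
rewrite muln1; have /isomP [i0 r0 m0 e0] := ip0.
pose inv x := odflt rH [pick i | p0 i == x].
have invE i : inv (p0 i) = i.
  by rewrite /inv; case: pickP => [j /eqP /i0 -> //|/(_ i)]; rewrite eqxx.
have invK x : x \in fball a v l -> p0 (inv x) = x.
  by rewrite -m0 => /imsetP [i _ ->]; rewrite invE.
pose F (p : {ffun 'I_k -> T}) : {ffun 'I_k -> 'I_k} := [ffun i => inv (p i)].
rewrite -(card_in_imset (f := F)).
  apply/subset_leq_card/subsetP => _ /imsetP [p /[!inE] /isomP [ip rp mp ep] ->].
  have pK i : p0 (inv (p i)) = p i by apply: invK; rewrite -mp imset_f.
  apply/and3P; split; first by apply/injectiveP => i j; rewrite !ffunE => /(congr1 p0); rewrite !pK => /ip.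
    by rewrite ffunE rp -r0 invE.
  by apply/forallP => i; apply/forallP => j; rewrite !ffunE e0 !pK ep.
move=> p q /[!inE] /isomP [ip rp mp ep] /isomP [iq rq mq eq] /ffunP FE.
apply/ffunP => i; have := FE i; rewrite !ffunE => /(congr1 p0).
have pb : p i \in fball a v l by rewrite -mp imset_f.
have qb : q i \in fball a v l by rewrite -mq imset_f.
by rewrite (invK _ pb) (invK _ qb).
Qed.
End Iso.
End FiniteBall.
Arguments fball : simpl never.

Section TreeData.
Variables (k : nat) (E : rel 'I_k) (rH : 'I_k) (l : nat) (par : 'I_k -> 'I_k) (D : 'I_k -> nat).

(* [par] and [D] (parent and depth) exhibit the rooted graph [(E, rH)] as a tree of height at most [l]. *)
Definition tdata := [/\ D rH = 0, par rH = rH, forall i, i != rH -> D i = (D (par i)).+1,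
  forall i, D i <= l &
  forall i j, E i j = ((i != rH) && (par i == j)) || ((j != rH) && (par j == i))].

Hypothesis td : tdata.
Let D0 : D rH = 0. Proof. by case: td. Qed.
Let parr : par rH = rH. Proof. by case: td. Qed.
Let DS i : i != rH -> D i = (D (par i)).+1. Proof. by case: td => _ _ H _ _; apply: H. Qed.
Let Dl i : D i <= l. Proof. by case: td. Qed.
Let EE i j : E i j = ((i != rH) && (par i == j)) || ((j != rH) && (par j == i)).
Proof. by case: td. Qed.

Lemma td_root i : D i = 0 -> i = rH.
Proof. by move=> Di; apply/eqP/contraT => /DS; rewrite Di. Qed.

Lemma td_iter y t : t <= D y -> D (iter t par y) = D y - t.
Proof.
elim: t => [|t IH] ty; first by rewrite subn0.
have := IH (ltnW ty) => e /=; have := @DS (iter t par y).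
case: (eqVneq (iter t par y) rH) => [e2|_ /(_ isT)]; last by rewrite e; lia.
by move: e; rewrite e2 D0; lia.
Qed.

Lemma td_edge i j : E i j -> D j <= (D i).+1.
Proof.
rewrite EE => /orP [] /andP [n /eqP <-]; first by rewrite (DS n); lia.
by rewrite (DS n).
Qed.

Definition depthset : {set 'I_k} := [set i | D i == l].

Section Embed.
Variables (T : finType) (a : rel T) (phi : {ffun 'I_k -> T}).
Hypotheses (iphi : injective phi) (aE : forall i j, E i j = a (phi i) (phi j)).
Hypothesis nbr : forall i w, D i < l -> a (phi i) w -> w \in phi @: setT.

Lemma embed_ball s : s <= l -> fball a (phi rH) s = phi @: [set i | D i <= s].
Proof.
elim: s => [|s IH] sl.
  rewrite fball0; apply/setP => y; rewrite inE; apply/eqP/imsetP => [->|[i]].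
    by exists rH; rewrite ?inE ?D0.
  by rewrite inE leqn0 => /eqP /td_root -> ->.
apply/setP => y; apply/fballSP/imsetP; rewrite (IH (ltnW sl)).
  move=> [/imsetP [i]|[x /imsetP [i]]]; rewrite inE => Di.
    by move=> ->; exists i => //; rewrite inE (leq_trans Di).
  move=> -> ay; have Dil : D i < l by apply: leq_ltn_trans Di sl.
  have /imsetP [j _ yj] := nbr Dil ay; exists j => //.
  by rewrite inE; apply: leq_trans (td_edge (_ : E i j)) _; rewrite ?aE -?yj.
move=> [j]; rewrite inE => Dj ->; have [Ds|Ds] := leqP (D j) s.
  by left; apply: imset_f; rewrite inE.
have nj : j != rH by apply: contraTneq Ds => ->; rewrite D0.
right; exists (phi (par j)); first by apply: imset_f; rewrite inE; have := DS nj; lia.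
by rewrite -aE EE nj eqxx orbT.
Qed.

Lemma embed_isom : isom E rH a (phi rH) l phi.
Proof.
apply/isomP; split => //; rewrite embed_ball //.
by apply/setP => y; apply/imsetP/imsetP => -[i _ ->]; exists i; rewrite ?inE.
Qed.
End Embed.

(** For y at depth l, [iter (l - D i) par y] is the ancestor of y at the depth of i. The map [next]
    orients the tree towards y instead of [rH]: up along the path to y, and to the parent elsewhere.
    This is the shape of a ball in a functional graph when the forward orbit of its centre leaves it
    through y. The value [next y y] is junk. *)
Definition onpath y i := iter (l - D i) par y == i.
Definition next y i := if onpath y i then iter (l - D i).-1 par y else par i.

Lemma next_edge y i j : D y = l ->
  E i j = ((i != y) && (next y i == j)) || ((j != y) && (next y j == i)).
Proof.
move=> Dy.
have half u v : v != rH -> par v = u -> ((u != y) && (next y u == v)) || ((v != y) && (next y v == u)).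
  move=> nv pv; have Dv := DS nv; rewrite pv in Dv; have Dvl := Dl v.
  case: (boolP (onpath y v)) => [/eqP ov|ov].
    have e : (l - D u) = (l - D v).+1 by lia.
    have ou : onpath y u by rewrite /onpath e iterS ov pv.
    have uy : u != y by apply: contraTneq Dvl => e2; rewrite Dv e2 Dy ltnn.
    by rewrite uy /next ou e /= ov eqxx.
  have vy : v != y.
    by apply: contraNneq ov => ->; rewrite /onpath Dy subnn.
  by rewrite vy /next (negPf ov) pv eqxx orbT.
have half2 u v : u != y -> next y u = v -> E u v.
  move=> uy; rewrite /next; case: ifP => [/eqP ou|/negbT ou] <-; last first.
    rewrite EE eqxx andbT; case: eqVneq => //= e; move: ou; rewrite e /onpath D0 subn0.
    by move/eqP; case; apply: td_root; rewrite td_iter Dy ?subnn.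
  have Du : D u < l.
    rewrite ltn_neqAle Dl andbT; apply: contraNneq uy => e.
    by rewrite -ou e subnn.
  have e : l - D u = (l - D u).-1.+1 by lia.
  have pe : par (iter (l - D u).-1 par y) = u by rewrite -iterS -e ou.
  rewrite EE; apply/orP; right; rewrite pe eqxx andbT.
  apply: contraTneq Du => e2; have := @td_iter y (l - D u).-1; rewrite e2 D0 Dy; lia.
apply/idP/orP => [|[/andP [iy /eqP]|/andP [jy /eqP]]].
- rewrite EE => /orP [/andP [ni /eqP /(half _ _ ni)]|/andP [nj /eqP /(half _ _ nj)]].
    by move/orP => []; auto.
  by move/orP.
- exact: half2.
- by move=> /(half2 _ _ jy); rewrite !EE orbC.
Qed.

Lemma td_noloop i : E i i = false.
Proof.
rewrite EE orbb; apply/negP => /andP [/DS e /eqP p]; move: e; rewrite p; lia.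
Qed.
End TreeData.

(** * Random functions *)

Lemma card_family_set (T S : finType) (F : T -> {set S}) :
  #|[set f : {ffun T -> S} | [forall x, f x \in F x]]| = \prod_x #|F x|.
Proof.
transitivity #|family (fun x => mem (F x))|.
  by apply: eq_card => f; rewrite inE; apply/forallP/familyP.
by rewrite card_family foldrE big_map big_enum.
Qed.

Section RandomFunction.
Variable T : finType.
Implicit Types (B : {set T}) (f : {ffun T -> T}) (v w x : T).

Definition Fam B : {set {ffun T -> T}} := [set f | stable f B].

Lemma Fam_family B : Fam B =
  [set f : {ffun T -> T} | [forall x, f x \in if x \in B then B else [set x]]].
Proof.
apply/setP => f; rewrite !in_set /stable; apply: eq_forallb => x.
by case: ifP; rewrite ?inE.
Qed.

Lemma card_Fam B : #|Fam B| = #|B| ^ #|B|.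
Proof.
rewrite Fam_family card_family_set (bigID (fun x => x \in B)) /=.
rewrite [X in _ * X]big1; last by move=> x /negPf ->; rewrite cards1.
by rewrite muln1 (eq_bigr (fun=> #|B|)) ?prod_nat_const // => x ->.
Qed.

Variables (k : nat) (E : rel 'I_k) (rH : 'I_k) (l : nat) (par : 'I_k -> 'I_k) (D : 'I_k -> nat).
Hypothesis td : tdata E rH l par D.
Variable B : {set T}.

Let Z := #|depthset l D|.
Let I := #|[set i | D i < l]|.

Section OnePhi.
Variable phi : {ffun 'I_k -> T}.
Hypotheses (iphi : injective phi) (phiB : forall i, phi i \in B).
Variable y : 'I_k.
Hypothesis Dy : D y = l.

Let PH := phi @: setT.
Let PI := phi @: [set i | D i < l].
Notation nx := (next l par D y).

(** The admissible values at x of a function whose ball around [phi rH] is the image of [phi] with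
    exit y: image points follow [next], the exit leaves the image, and a point off the image may hit
    vertices at depth l but no inner vertex. As a product of such sets the event has an explicit
    cardinality. *)
Definition Gset (x : T) : {set T} := if x \notin B then [set x] else
  if [pick i | phi i == x] is Some i then (if i == y then B :\: PH else [set phi (nx i)])
  else B :\: PI.

Definition Ev : {set {ffun T -> T}} := [set f : {ffun T -> T} | [forall x, f x \in Gset x]].
(** Number of arcs from outside into the vertices at depth l. Besides the forward image of the exit,
    their sources are the only vertices at distance l + 1. *)
Definition ind f := \sum_(z in depthset l D) #|[set w in B :\: PH | f w == phi z]|.

Lemma Gset_phi i : Gset (phi i) = if i == y then B :\: PH else [set phi (nx i)].
Proof.
rewrite /Gset phiB /=; case: pickP => [j /eqP /iphi -> //|/(_ i)].
by rewrite eqxx.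
Qed.

Lemma Gset_out x : x \in B :\: PH -> Gset x = B :\: PI.
Proof.
rewrite inE => /andP [xP xB]; rewrite /Gset xB /=; case: pickP => [i /eqP e|//].
by move: xP; rewrite -e imset_f.
Qed.

Lemma EvP f x : f \in Ev -> f x \in Gset x.
Proof. by rewrite inE => /forallP. Qed.

Lemma Ev_phi f i : f \in Ev -> i != y -> f (phi i) = phi (nx i).
Proof. by move=> fE /negPf e; have := EvP (phi i) fE; rewrite Gset_phi e inE => /eqP. Qed.

Lemma Ev_y f : f \in Ev -> f (phi y) \in B :\: PH.
Proof. by move=> fE; have := EvP (phi y) fE; rewrite Gset_phi eqxx. Qed.

Lemma Ev_outB f x : f \in Ev -> x \notin B -> f x = x.
Proof. by move=> fE xB; have := EvP x fE; rewrite /Gset xB inE => /eqP. Qed.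

Lemma PH_B : PH \subset B.
Proof. by apply/subsetP => _ /imsetP [i _ ->]. Qed.

Lemma Ev_Fam f : f \in Ev -> f \in Fam B.
Proof.
move=> fE; rewrite in_set; apply/forallP => x; case: ifPn => xB; last by rewrite (Ev_outB fE).
have := EvP x fE; rewrite /Gset xB /=; case: pickP => [i _|_]; last by rewrite inE => /andP [].
by case: eqP => _; rewrite inE; [case/andP|move/eqP->].
Qed.

Lemma nbr_cases f i w : f \in Ev -> fadj f (phi i) w -> w \notin PH ->
  D i = l /\ ((i = y /\ w = f (phi y)) \/ (w \in B :\: PH /\ f w = phi i)).
Proof.
move=> fE /andP [ne /orP [/eqP fw|/eqP fw]] wP.
  case: (eqVneq i y) => [e|iy]; first by rewrite -fw e; split=> //; left.
  by move: wP; rewrite -fw (Ev_phi fE iy) imset_f.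
have wB : w \in B.
  by apply: contraT => wB; move: ne; rewrite -fw (Ev_outB fE wB) eqxx.
have wD : w \in B :\: PH by rewrite inE wP.
split; last by right.
have := EvP w fE; rewrite (Gset_out wD) fw inE phiB andbT => nP.
have [_ _ _ Dl _] := td; apply/eqP; rewrite eqn_leq Dl leqNgt.
by apply: contra nP => Di; apply: imset_f; rewrite inE.
Qed.

Lemma Ev_isom f : f \in Ev -> isom E rH (fadj f) (phi rH) l phi.
Proof.
move=> fE; apply: (embed_isom td) => //.
  move=> i j; rewrite (next_edge td i j Dy) /fadj (inj_eq iphi).
  have H (u v : 'I_k) : (f (phi u) == phi v) = (u != y) && (nx u == v).
    case: (eqVneq u y) => [->|uy] /=; last by rewrite (Ev_phi fE uy) (inj_eq iphi).
    have := Ev_y fE; rewrite inE => /andP [nP _]; apply: contraNF nP => /eqP ->.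
    exact: imset_f.
  rewrite !H; case: (eqVneq i j) => //= ->.
  by have := td_noloop td j; rewrite (next_edge td j j Dy) => ->.
move=> i w Di aw; apply: contraT => wP.
by have [e _] := nbr_cases fE aw wP; move: Di; rewrite e ltnn.
Qed.

Lemma Ev_ballsize f : f \in Ev -> #|fball (fadj f) (phi rH) l.+1| <= k + 1 + ind f.
Proof.
move=> fE; have /isomP [_ _ im _] := Ev_isom fE.
pose U := \bigcup_(z in depthset l D) [set w in B :\: PH | f w == phi z].
apply: (@leq_trans #|PH :|: (f (phi y) |: U)|).
  apply/subset_leq_card/subsetP => w wb; rewrite in_setU.
  case: (boolP (w \in PH)) => //= wP.
  move/fballSP: wb => [|[x]]; rewrite -im; first by rewrite (negPf wP).
  move=> /imsetP [i _ ->] /(nbr_cases fE) /(_ wP) [Di [[_ ->]|[wD fw]]]; first by rewrite setU11.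
  rewrite inE; apply/orP; right; apply/bigcupP; exists i; first by rewrite inE Di.
  by rewrite in_set wD fw eqxx.
apply: leq_trans (leq_card_setU _ _).1 _; rewrite -addnA leq_add //.
  by rewrite card_imset // cardsT card_ord.
by rewrite cardsU1 leq_add ?leq_b1 // card_bigcup_le.
Qed.

Lemma card_PH : #|PH| = k. Proof. by rewrite card_imset // cardsT card_ord. Qed.
Lemma card_PI : #|PI| = I. Proof. by rewrite card_imset. Qed.
Lemma PI_PH : PI \subset PH. Proof. exact: imsetS (subsetT _). Qed.
Lemma card_BPI : #|B :\: PI| = #|B| - I.
Proof. by rewrite cardsDS ?card_PI // (subset_trans PI_PH PH_B). Qed.
Lemma card_BPH : #|B :\: PH| = #|B| - k.
Proof. by rewrite cardsDS ?card_PH // PH_B. Qed.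

Lemma card_Ev : #|Ev| = (#|B| - k) * (#|B| - I) ^ (#|B| - k).
Proof.
rewrite /Ev card_family_set (bigID (fun x => x \in B :\: PH)) /= mulnC; congr (_ * _).
  rewrite (bigD1 (phi y)) /=; last by rewrite inE imset_f.
  rewrite Gset_phi eqxx card_BPH big1 ?muln1 // => x; rewrite inE negb_and negbK.
  move=> /andP [/orP [/imsetP [i _ ->]|xB] ne]; last by rewrite /Gset xB cards1.
  rewrite Gset_phi; case: eqP => [e|_]; first by rewrite e eqxx in ne.
  exact: cards1.
rewrite -card_BPH -card_BPI -prod_nat_const; apply: eq_bigr => x xD.
by rewrite Gset_out.
Qed.

Lemma card_Ev_w w z : w \in B :\: PH ->
  #|[set f in Ev | f w == phi z]| * (#|B| - I) <= #|Ev|.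
Proof.
move=> wD; rewrite -card_BPI -(Gset_out wD).
rewrite [leqRHS]card_family_set (bigD1 w) //= mulnC leq_mul2l; apply/orP; right.
apply: (@leq_trans #|[set f : {ffun T -> T} | [forall x, f x \in if x == w then [set phi z] else Gset x]]|).
  apply/subset_leq_card/subsetP => f; rewrite in_set => /andP [fE /eqP fw].
  rewrite inE; apply/forallP => x; case: eqP => [->|_]; first by rewrite inE fw.
  exact: EvP.
rewrite card_family_set (bigD1 w) //= eqxx cards1 mul1n.
by apply: eq_leq; apply: eq_bigr => x /negPf ->.
Qed.

(** Each of the b - k points off the image chooses freely among b - I values, so each vertex at
    depth l receives at most one arc on average. *)
Lemma sum_ind : \sum_(f in Ev) ind f <= Z * #|Ev|.
Proof.
rewrite /ind exchange_big /= -sum_nat_const; apply: leq_sum => z _.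
case: (posnP (#|B| - I)) => [e0|p0].
  have e1 : #|B| - k = 0.
    by apply/eqP; rewrite -leqn0 -e0 leq_sub2l // /I -[k in _ <= k]card_ord max_card.
  rewrite (eq_bigr (fun=> 0)) ?big1_eq // => f _.
  have /cards0_eq e2 : #|B :\: PH| = 0 by rewrite card_BPH.
  by rewrite e2; apply/eqP; rewrite cards_eq0 -subset0; apply/subsetP => w; rewrite !inE.
rewrite -(leq_pmul2r p0).
have -> : \sum_(f in Ev) #|[set w in B :\: PH | f w == phi z]| =
   \sum_(w in B :\: PH) #|[set f in Ev | f w == phi z]|.
  rewrite (eq_bigr (fun f => \sum_(w in B :\: PH) (f w == phi z : nat))); last first.
    move=> f _; rewrite -sum1_card big_mkcond [RHS]big_mkcond; apply: eq_bigr => w _.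
    by rewrite in_set; case: (w \in _) => //=; case: eqP.
  rewrite exchange_big /=; apply: eq_bigr => w _.
  rewrite -sum1_card big_mkcond [RHS]big_mkcond; apply: eq_bigr => f _.
  by rewrite in_set; case: (f \in _) => //=; case: eqP.
rewrite big_distrl /=.
apply: (@leq_trans (\sum_(w in B :\: PH) #|Ev|)).
  by apply: leq_sum => w wD; apply: card_Ev_w.
rewrite sum_nat_const card_BPH mulnC leq_mul2l; apply/orP; right.
by apply: leq_sub2l; rewrite /I -[k in _ <= k]card_ord max_card.
Qed.

(** Markov's inequality: under the event, [ind] exceeds K2 with probability at most Z / (K2 + 1). *)
Lemma card_Ev_small K2 : (K2.+1 - Z) * #|Ev| <= K2.+1 * #|[set f in Ev | ind f <= K2]|.
Proof.
have H : K2.+1 * #|[set f in Ev | K2 < ind f]| <= Z * #|Ev|.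
  apply: leq_trans sum_ind; rewrite mulnC -sum_nat_const.
  rewrite [leqRHS](bigID (fun f => K2 < ind f)) /=; apply: leq_trans (leq_addr _ _).
  rewrite (eq_bigl (fun f => (f \in Ev) && (K2 < ind f))); last by move=> f; rewrite in_set.
  by apply: leq_sum => f /andP [].
have e : #|Ev| = #|[set f in Ev | ind f <= K2]| + #|[set f in Ev | K2 < ind f]|.
  rewrite -(cardsID [set f | ind f <= K2] Ev); congr (_ + _); apply: eq_card => f; rewrite !in_set //.
  by rewrite -ltnNge andbC.
rewrite mulnBl leq_subLR {1}e mulnDr addnC.
by rewrite leq_add2r.
Qed.
End OnePhi.

Lemma Ev_disj (phi : {ffun 'I_k -> T}) (y y' : 'I_k) f : injective phi -> (forall i, phi i \in B) ->
  f \in Ev phi y -> f \in Ev phi y' -> y = y'.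
Proof.
move=> ip pB f1 f2; apply/eqP/contraT => ne.
have := Ev_y ip pB f1; rewrite (Ev_phi ip pB f2 ne) inE => /andP [/negP []].
exact: imset_f.
Qed.

(** Sum over all embeddings and all Z exits: events with distinct exits are disjoint, and a centre
    belongs to at most [Aut] embeddings. For large b this says that a vertex of a random function
    has the given ball with probability at least about Z e^(-I) / Aut, up to the Markov loss Z / (K2
    + 1). *)
Lemma function_stat_mean K2 :
  #|B| ^_ k * (Z * ((K2.+1 - Z) * ((#|B| - k) * (#|B| - I) ^ (#|B| - k)))) <=
  K2.+1 * (Aut E rH * \sum_(f in Fam B) #|Mset E rH (fadj f) l (k + 1 + K2) B|).
Proof.
pose Phi := [set phi : {ffun 'I_k -> T} in ffun_on (mem B) | injectiveb phi].
have cP : #|Phi| = #|B| ^_ k by rewrite /Phi card_inj_ffuns_on card_ord.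
have PhiP phi : phi \in Phi -> injective phi /\ forall i, phi i \in B.
  by rewrite in_set => /andP [/ffun_onP H /injectiveP].
rewrite -cP -sum_nat_const.
apply: (@leq_trans (\sum_(phi in Phi) \sum_(y in depthset l D)
   K2.+1 * #|[set f in Ev phi y | ind phi f <= K2]|)).
  apply: leq_sum => phi /PhiP [ip pB]; rewrite -sum_nat_const; apply: leq_sum => y.
  rewrite inE => _.
  by rewrite -(card_Ev ip pB y); apply: card_Ev_small.
rewrite (eq_bigr (fun phi => K2.+1 * \sum_(y in depthset l D) #|[set f in Ev phi y | ind phi f <= K2]|));
  last by move=> phi _; rewrite big_distrr.
rewrite -big_distrr leq_mul2l; apply/orP; right; rewrite big_distrr /=.
apply: (@leq_trans (\sum_(phi in Phi) \sum_(f in Fam B)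
   (isom E rH (fadj f) (phi rH) l phi && (#|fball (fadj f) (phi rH) l.+1| <= k + 1 + K2)))).
  apply: leq_sum => phi /PhiP [ip pB].
  rewrite (eq_bigr (fun y => \sum_(f in Fam B) ((f \in Ev phi y) && (ind phi f <= K2) : nat))); last first.
    move=> y; rewrite inE => /eqP Dy; rewrite -sum1_card big_mkcond [RHS]big_mkcond; apply: eq_bigr => f _.
    rewrite in_set; case: (boolP (f \in Ev phi y)) => /= [fE|_]; last by case: ifP.
    have -> : f \in Fam B by apply: Ev_Fam fE.
    by case: ifP.
  rewrite exchange_big /=; apply: leq_sum => f fF.
  have [y /andP [yD /andP [fE fi]]|H] := pickP (fun y => (y \in depthset l D) && ((f \in Ev phi y) && (ind phi f <= K2))).
    have Dy : D y = l by move: yD; rewrite inE => /eqP.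
    rewrite (bigD1 y) //= fE fi big1 ?addn0 /=; last first.
      move=> y' /andP [_ ne]; case: (boolP (f \in Ev phi y')) => //= fE'.
      by move: ne; rewrite (Ev_disj ip pB fE fE') eqxx.
    rewrite (Ev_isom ip pB Dy fE) (_ : (_ <= k + 1 + K2)%N = true) //.
    by apply: leq_trans (Ev_ballsize ip pB Dy fE) _; rewrite leq_add2l.
  rewrite big1 // => y yD; have := H y; rewrite /= yD /= => ->.
  by [].
rewrite exchange_big /=; apply: leq_sum => f _.
rewrite mulnC -sum_nat_const.
apply: (@leq_trans (\sum_(v in Mset E rH (fadj f) l (k + 1 + K2) B)
    #|[set phi | isom E rH (fadj f) v l phi]|)); last first.
  apply: leq_sum => v; rewrite inE => /and3P [_ iv _].
  by apply: leq_trans (card_isom _ _ _ _ _) _; rewrite iv muln1.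
rewrite (eq_bigr (fun v => \sum_(phi : {ffun 'I_k -> T}) (isom E rH (fadj f) v l phi : nat))); last first.
  by move=> v _; rewrite -sum1_card big_mkcond; apply: eq_bigr => phi _; rewrite inE; case: ifP.
rewrite exchange_big /= [leqRHS](bigID (fun phi => phi \in Phi)) /=.
apply: leq_trans (leq_addr _ _); apply: leq_sum => phi /PhiP [ip pB].
case: (boolP (_ && _)) => // /andP [ism cK].
rewrite (bigD1 (phi rH)) /= ?ism // inE pB cK andbT.
by apply/existsP; exists phi.
Qed.
End RandomFunction.

(** * Complete minors as disjoint connected sets that touch pairwise *)

Section Minors.
Variables (T : finType) (a : rel T).
Implicit Types (X Y Z U : {set T}).
Definition rin X : rel T := fun x y => [&& a x y, x \in X & y \in X].
Definition conn X := (X != set0) && [forall x in X, forall y in X, connect (rin X) x y].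
Definition touch X Y := [exists x in X, exists y in Y, a x y].
Definition Kminor t := exists s : seq {set T},
  [/\ size s = t, all conn s & pairwise (fun X Y => [disjoint X & Y] && touch X Y) s].

Lemma connP X : reflect ((exists x, x \in X) /\ {in X &, forall x y, connect (rin X) x y}) (conn X).
Proof.
apply: (iffP andP) => -[h1 h2]; split.
- by apply/set0Pn.
- by move=> x y xX yX; move/forall_inP: h2 => /(_ x xX) /forall_inP; apply.
- by apply/set0Pn.
- by apply/forall_inP => x xX; apply/forall_inP => y yX; apply: h2.
Qed.

Lemma touchP X Y : reflect (exists x y, [/\ x \in X, y \in Y & a x y]) (touch X Y).
Proof.
apply: (iffP exists_inP) => [[x xX /exists_inP [y yY axy]]|[x [y [xX yY axy]]]].
  by exists x, y.
by exists x => //; apply/exists_inP; exists y.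
Qed.

Lemma rin_sub X Y : X \subset Y -> subrel (connect (rin X)) (connect (rin Y)).
Proof.
move=> XY; apply: connect_sub => x y /and3P [axy xX yX]; apply: connect1.
by rewrite /rin axy !(subsetP XY).
Qed.

Hypothesis sa : symmetric a.

Lemma touch_sym X Y : touch X Y = touch Y X.
Proof. by apply/touchP/touchP => -[x [y [h1 h2 h3]]]; exists y, x; rewrite sa. Qed.

Lemma rin_sym X : symmetric (rin X).
Proof. by move=> x y; rewrite /rin sa; case: (a y x) => //=; rewrite andbC. Qed.

Lemma connU X Y : conn X -> conn Y -> touch X Y -> conn (X :|: Y).
Proof.
move=> /connP [[x0 x0X] cX] /connP [_ cY] /touchP [u [v [uX vY auv]]].
have sU := connect_sym_of_sym (rin_sym (X :|: Y)).
have toX x : x \in X :|: Y -> connect (rin (X :|: Y)) x u.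
  rewrite in_setU => /orP [xX|xY].
    by apply: (rin_sub (subsetUl X Y)); apply: cX.
  apply: (@connect_trans _ _ v); first by apply: (rin_sub (subsetUr X Y)); apply: cY.
  by apply: connect1; rewrite /rin sa auv !inE vY uX orbT.
apply/connP; split; first by exists x0; rewrite inE x0X.
move=> x y xU yU; apply: connect_trans (toX x xU) _.
by rewrite sU; apply: toX.
Qed.
End Minors.

(** * Graphs without a complete minor *)

Section Mader.
Variables (T : finType) (a : rel T).
Hypothesis sa : symmetric a.
Implicit Types (X Y Z W : {set T}) (P Q : {set {set T}}).

(** A family P of disjoint connected sets stands for the minor obtained by contracting each of them;
    [#|nbs P X|] is a degree in it and [arcs P] is twice its number of edges. *)
Definition nbs P X := [set Y in P | (Y != X) && touch a X Y].
Definition arcs P := \sum_(X in P) #|nbs P X|.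
Definition blocks P := trivIset P && [forall X in P, conn a X].

Lemma blocksP P : reflect ({in P &, forall X Y, X != Y -> [disjoint X & Y]} /\ {in P, forall X, conn a X}) (blocks P).
Proof.
apply: (iffP andP) => -[h1 h2]; split.
- by move=> X Y XP YP; apply: (trivIsetP h1).
- by move=> X XP; apply: (forall_inP h2).
- by apply/trivIsetP => X Y XP YP; apply: h1.
- by apply/forall_inP.
Qed.

Lemma blocks_sub P Q : Q \subset P -> blocks P -> blocks Q.
Proof.
move=> /subsetP QP /blocksP [h1 h2]; apply/blocksP; split.
  by move=> X Y /QP XP /QP YP; apply: h1.
by move=> X /QP; apply: h2.
Qed.

Lemma in_nbs P X Y : (Y \in nbs P X) = [&& Y \in P, Y != X & touch a X Y].
Proof. by rewrite in_set. Qed.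

Lemma nbs_setU1 P X Y : X \notin P -> Y \in P ->
  #|nbs (X |: P) Y| = #|nbs P Y| + touch a X Y.
Proof.
move=> XP YP; have XY : X != Y by apply: contraNneq XP => ->.
rewrite (cardsD1 X) addnC; congr (_ + _).
  apply: eq_card => Z; rewrite in_setD1 !in_nbs in_setU1; case: (eqVneq Z X) => //= ->.
  by rewrite (negPf XP).
by rewrite in_nbs in_setU1 eqxx XY /= touch_sym.
Qed.

Lemma arcs_setU1 P X : X \notin P -> arcs (X |: P) = arcs P + 2 * #|[set Y in P | touch a X Y]|.
Proof.
move=> XP; rewrite /arcs big_setU1 //= [X in _ + X](eq_bigr (fun Y => #|nbs P Y| + touch a X Y)); last first.
  by move=> Y YP; apply: nbs_setU1.
rewrite big_split /= addnCA mul2n -addnn; congr (_ + (_ + _)).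
  by apply: eq_card => Z; rewrite in_nbs in_setU1 [RHS]in_set; case: (eqVneq Z X) => //= ->; rewrite (negPf XP).
by rewrite -sum1_card -big_mkcondr /=; apply: eq_bigl => Z; rewrite in_set.
Qed.

Lemma touchUl X Y Z : touch a (X :|: Y) Z = touch a X Z || touch a Y Z.
Proof.
apply/touchP/orP => [[x [z [xX zZ xz]]]|[/touchP|/touchP] [x [z [xX zZ xz]]]].
- by case/setUP: xX => xX; [left|right]; apply/touchP; exists x, z.
- by exists x, z; rewrite inE xX.
- by exists x, z; rewrite inE xX orbT.
Qed.

(** Every branch set contains a member of P. So if P is the neighbourhood of a block X, then X
    touches all branch sets and extends the clique. *)
Definition clique_in P (s : seq {set T}) :=
  [/\ all (conn a) s, pairwise (fun X Y => [disjoint X & Y] && touch a X Y) s &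
    forall Z, Z \in s -> Z \subset cover P /\ exists2 X, X \in P & X \subset Z].

Lemma touch_subr X Y Z : touch a X Y -> Y \subset Z -> touch a X Z.
Proof. by move=> /touchP [x [y [xX yY xy]]] /subsetP YZ; apply/touchP; exists x, y; rewrite YZ. Qed.

(* Contract an edge lying in few triangles, or else recurse into a neighbourhood. *)
Lemma mader t P : blocks P -> P != set0 -> 2 ^ t * #|P| <= arcs P ->
  exists2 s, size s = t.+1 & clique_in P s.
Proof.
elim: t P => [|t IHt] P.
  move=> /blocksP [_ cP] /set0Pn [X XP] _; exists [:: X] => //; split=> //=; first by rewrite cP.
  by move=> Z; rewrite mem_seq1 => /eqP ->; split; [apply: bigcup_sup|exists X].
have [n] := ubnP #|P|; elim: n P => // n IHn P; rewrite ltnS => Pn bP P0 dens.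
have [cP dP] := (proj2 (blocksP _ bP), proj1 (blocksP _ bP)).
have [/existsP [X /andP [XP /existsP [Y /andP [YX cmn]]]]|/existsPn noX] :=
  boolP [exists X, (X \in P) && [exists Y, (Y \in nbs P X) && (#|nbs P X :&: nbs P Y| < 2 ^ t)]].
  move: (YX); rewrite in_set => /and3P [YP neYX tXY].
  pose Q := P :\ X :\ Y; pose W := X :|: Y.
  have XQ : X \notin Y |: Q by rewrite in_setU1 negb_or eq_sym neYX /= /Q !in_setD1 eqxx andbF.
  have YQ : Y \notin Q by rewrite /Q in_setD1 eqxx.
  have PE : P = X |: (Y |: Q).
    by apply/setP => Z; rewrite !in_setU1 /Q !in_setD1; case: (eqVneq Z X) => [->|_] //; case: (eqVneq Z Y) => [->|_].
  have QP : Q \subset P by rewrite PE; apply/subsetP => Z ZQ; rewrite !in_setU1 ZQ !orbT.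
  have disjW Z : Z \in Q -> [disjoint W & Z].
    rewrite /Q !in_setD1 => /and3P [ZY ZX ZP]; rewrite -setI_eq0 setIUl setU_eq0 !setI_eq0.
    by rewrite !dP // eq_sym.
  have cW : conn a W by apply: connU => //; apply: cP.
  have WQ : W \notin Q.
    apply/negP => /disjW; rewrite -setI_eq0 setIid => /eqP W0.
    by have /connP [[x]] := cW; rewrite W0 inE.
  have [||||s ss [cs ps hs]] := IHn (W |: Q).
  - rewrite cardsU1 WQ; apply: leq_trans Pn.
    by rewrite [in leqRHS]PE cardsU1 XQ cardsU1 YQ !add1n.
  - apply/blocksP; split=> [Z Z'|Z].
      rewrite !in_setU1 => /orP [/eqP ->|ZQ] /orP [/eqP ->|ZQ'] ne.
      + by rewrite eqxx in ne.
      + exact: disjW.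
      + by rewrite disjoint_sym; apply: disjW.
      + by apply: dP; rewrite ?(subsetP QP).
    by rewrite in_setU1 => /orP [/eqP ->//|ZQ]; apply: cP; apply: (subsetP QP).
  - by apply/set0Pn; exists W; rewrite in_setU1 eqxx.
  (* Contraction removes one block, the two arcs between X and Y, and two arcs for each of the fewer
     than 2^t common neighbours: at most 2^(t+1) arcs, so the density bound survives. *)
  - move: dens; rewrite PE arcs_setU1 // arcs_setU1 // arcs_setU1 // !cardsU1 XQ YQ WQ.
    have -> : #|[set Z in Y |: Q | touch a X Z]| = #|[set Z in Q | touch a X Z]|.+1.
      rewrite (cardsD1 Y) in_set in_setU1 eqxx tXY /= add1n; congr _.+1; apply: eq_card => Z.
      by rewrite [RHS]in_set in_setD1 [X in _ && X]in_set in_setU1; case: (eqVneq Z Y) => //= ->; rewrite (negPf YQ).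
    have -> : #|[set Z in Q | touch a W Z]| =
        #|[set Z in Q | touch a X Z] :|: [set Z in Q | touch a Y Z]|.
      by apply: eq_card => Z; rewrite in_setU !in_set touchUl andb_orr.
    have : #|[set Z in Q | touch a X Z] :&: [set Z in Q | touch a Y Z]| < 2 ^ t.
      apply: leq_ltn_trans cmn; apply: subset_leq_card; apply/subsetP => Z; rewrite !in_setI !in_set.
      rewrite !in_set1; by move=> /andP [/andP [/and3P [-> -> ->] ->] /andP [_ ->]].
    rewrite cardsU.
    have := subset_leq_card (subsetIl [set Z in Q | touch a X Z] [set Z in Q | touch a Y Z]).
    rewrite expnS; move: (2 ^ t) #|_ :&: _| #|[set Z in Q | touch a X Z]| #|[set Z in Q | touch a Y Z]| (arcs Q) #|Q|.
    move=> A B C D F G; rewrite !add1n !mulnS; move: (2 * A * G) => N; clear -A B C D F G N; lia.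
  exists s => //; split=> // Z /hs [Zc [V VP VZ]]; split.
    apply: subset_trans Zc _; apply/bigcupsP => V'; rewrite in_setU1 => /orP [/eqP ->|V'Q].
      by rewrite subUset !bigcup_sup.
    by apply: bigcup_sup; apply: (subsetP QP).
  move: VP; rewrite in_setU1 => /orP [/eqP VW|VQ]; last by exists V => //; apply: (subsetP QP).
  by exists X => //; apply: subset_trans VZ; rewrite VW subsetUl.
have [X XP nX] : exists2 X, X \in P & nbs P X != set0.
  apply/exists_inP; apply: contraTT dens => /exists_inPn H; rewrite -ltnNge /arcs big1.
    by rewrite muln_gt0 expn_gt0 /= card_gt0.
  by move=> X XP; apply/eqP; rewrite cards_eq0 -[_ == _]negbK; apply: H.
have sub1 : nbs P X \subset P by apply/subsetP => Y; rewrite in_set => /andP [].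
have [|s ss [cs ps hs]] := IHt (nbs P X) (blocks_sub sub1 bP) nX.
  rewrite mulnC -sum_nat_const; apply: leq_sum => Y YN; have := noX X; rewrite XP /= => /existsPn /(_ Y).
  rewrite YN /= -leqNgt => /leq_trans; apply; apply: subset_leq_card; apply/subsetP => Z.
  by rewrite in_setI !in_set => /andP [/and3P [-> -> ->] /and3P [_ -> ->]].
exists (X :: s); first by rewrite /= ss.
have hX Z : Z \in s -> [disjoint X & Z] && touch a X Z.
  move=> /hs [Zc [Y]]; rewrite in_set => /and3P [YP YX tXY] YZ; apply/andP; split.
    apply: disjointWr Zc _; apply/bigcup_disjointP => V; rewrite in_set => /and3P [VP VX _].
    by rewrite dP // eq_sym.
  exact: touch_subr tXY YZ.
split=> /=.
- by rewrite cP.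
- by rewrite ps andbT; apply/allP.
- move=> Z; rewrite in_cons => /orP [/eqP ->|/hs [Zc [Y YN YZ]]].
    by split; [apply: bigcup_sup|exists X].
  split; last by exists Y => //; apply: (subsetP sub1).
  apply: subset_trans Zc _; apply/bigcupsP => V VN; apply: bigcup_sup; exact: (subsetP sub1).
Qed.

Hypothesis nK : ~ Kminor a 5.

(** [mader] at t = 4 yields five branch sets, whence the constant 16 = 2^4. *)
Lemma arcs_lt P : blocks P -> P != set0 -> arcs P < 16 * #|P|.
Proof.
move=> bP P0; rewrite ltnNge; apply/negP => h; apply: nK.
by have [s ss [cs ps _]] := @mader 4 P bP P0 h; exists s.
Qed.

Lemma arcs_le P : blocks P -> arcs P <= 16 * #|P|.
Proof.
move=> bP; have [->|P0] := eqVneq P set0; first by rewrite /arcs big_set0.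
exact: ltnW (arcs_lt bP P0).
Qed.
End Mader.

(** Vertices of small degree are removed one after the other, and [out x] records the neighbours
    that remain when x is removed. The vertex of a clique that is removed first sees all the
    others. *)
Lemma degenerate_out (I : finType) (h : rel I) D (Z0 : {set I}) :
  (forall Z : {set I}, Z \subset Z0 -> Z != set0 -> exists2 x, x \in Z & #|[set y in Z | (y != x) && h x y]| <= D) ->
  exists2 out : I -> {set I}, (forall x, #|out x| <= D /\ out x \subset Z0) &
    forall C : {set I}, C \subset Z0 -> C != set0 -> {in C &, forall x y, x != y -> h x y} ->
      exists2 x, x \in C & C \subset x |: out x.
Proof.
have [n] := ubnP #|Z0|; elim: n Z0 => // n IH Z0; rewrite ltnS => Zn H.
have [Z00|Z0n] := eqVneq Z0 set0.
  exists (fun=> set0) => [x|C]; first by rewrite cards0 sub0set.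
  by rewrite Z00 subset0 => ->.
have [x xZ dx] := H Z0 (subxx _) Z0n.
have [||out ho hc] := IH (Z0 :\ x).
- by apply: leq_trans Zn; rewrite [in leqRHS](cardsD1 x) xZ.
- by move=> Z ZZ; apply: H; apply: subset_trans ZZ (subD1set _ _).
exists (fun y => if y == x then [set y in Z0 | (y != x) && h x y] else out y) => [y|C CZ C0 cl].
  case: eqP => _; first by split=> //; apply/subsetP => z; rewrite inE => /andP [].
  by have [h1 h2] := ho y; split=> //; apply: subset_trans h2 (subD1set _ _).
have [xC|xC] := boolP (x \in C).
  exists x => //; rewrite eqxx; apply/subsetP => y yC; rewrite in_setU1 in_set (subsetP CZ) //.
  by case: (eqVneq y x) => //= yx; apply: cl => //; rewrite eq_sym.
have [|y yC hy] := hc C _ C0 cl; first by rewrite subsetD1 CZ.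
by exists y => //; rewrite ifN //; apply: contraNneq xC => <-.
Qed.

Lemma card_small_sets (S : finType) q : #|[set A : {set S} | #|A| <= q]| <= #|S|.+1 ^ q.
Proof.
pose im (h : {ffun 'I_q -> option S}) : {set S} := [set x | [exists i, h i == Some x]].
have sub : [set A : {set S} | #|A| <= q] \subset im @: [set: {ffun 'I_q -> option S}].
  apply/subsetP => A; rewrite inE => Aq; apply/imsetP.
  exists [ffun i : 'I_q => nth None [seq Some x | x <- enum A] i]; first by rewrite inE.
  apply/setP => x; rewrite inE; apply/idP/existsP => [xA|[i]].
    have ix : index x (enum A) < q by apply: leq_trans Aq; rewrite cardE index_mem mem_enum.
    exists (Ordinal ix); rewrite ffunE /= (nth_map x) ?nth_index ?mem_enum //.
    by rewrite index_mem mem_enum.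
  rewrite ffunE; case: (ltnP i (size (enum A))) => hi; last by rewrite nth_default ?size_map.
  by rewrite (nth_map x) // => /eqP [<-]; rewrite -mem_enum mem_nth.
apply: leq_trans (subset_leq_card sub) _; apply: leq_trans (leq_imset_card _ _) _.
by rewrite cardsT card_ffun card_option card_ord.
Qed.

Lemma card_few_moved (T : finType) q : 0 < #|T| -> #|[set f : {ffun T -> T} | #|[set x | f x != x]| <= q]| <= 2 ^ #|T| * #|T| ^ q.
Proof.
move=> Tn; apply: (@leq_trans (\sum_(A : {set T} | #|A| <= q) #|T| ^ #|A|)).
  apply: (@leq_trans #|\bigcup_(A : {set T} | #|A| <= q) [set f : {ffun T -> T} | [forall x, f x \in if x \in A then [set: T] else [set x]]]|).
    apply: subset_leq_card; apply/subsetP => f; rewrite inE => fq; apply/bigcupP.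
    exists [set x | f x != x] => //; rewrite inE; apply/forallP => x; rewrite inE.
    by case: eqP => //= ->; rewrite inE.
  apply: leq_trans (card_bigcup_le _ _) _; apply: leq_sum => A _.
  pose F x := if x \in A then [set: T] else [set x].
  apply: (@leq_trans #|family (fun x => mem (F x))|).
    by apply: subset_leq_card; apply/subsetP => f; rewrite inE => /forallP h; apply/familyP.
  rewrite card_family foldrE big_map big_enum /= (bigID (mem A)) /= (eq_bigr (fun=> #|T|)); last first.
    by move=> x xA; rewrite /F xA cardsT.
  rewrite [X in _ * X]big1 ?muln1 ?prod_nat_const // => x xA.
  by rewrite /F (negPf xA) cards1.
apply: (@leq_trans (\sum_(A : {set T} | #|A| <= q) #|T| ^ q)).
  by apply: leq_sum => A Aq; rewrite leq_pexp2l.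
rewrite sum_nat_const leq_mul2r; apply/orP; right.
apply: leq_trans (max_card _) _; by rewrite -cardsT -powersetT card_powerset cardsT.
Qed.

(** * Minimal partitions into small connected blocks *)

Section Partition.
Variables (T : finType) (a : rel T).
Hypothesis sa : symmetric a.
Hypothesis nK : ~ Kminor a 5.
Variable beta : nat.
Hypothesis beta0 : 0 < beta.
Implicit Types (X Y Z W v x y z : {set T}) (P Q : {set {set T}}).

Definition goodpart Q := [&& partition Q [set: T], [forall X in Q, conn a X] & [forall X in Q, #|X| <= 2 * beta]].

Lemma singletons_good : goodpart [set [set x] | x : T].
Proof.
apply/and3P; split.
- apply/and3P; split.
  + apply/eqP/setP => x; rewrite inE; apply/bigcupP; exists [set x]; rewrite ?inE ?imset_f //.
  + apply/trivIsetP => _ _ /imsetP [x _ ->] /imsetP [y _ ->] xy.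
    by rewrite disjoints1 inE; apply: contraNneq xy => ->.
  + apply/imsetP => -[x _ /setP /(_ x)]; by rewrite !inE eqxx.
- apply/forall_inP => _ /imsetP [x _ ->]; apply/connP; split; first by exists x; rewrite inE.
  by move=> y z; rewrite !inE => /eqP -> /eqP ->.
- by apply/forall_inP => _ /imsetP [x _ ->]; rewrite cards1; lia.
Qed.

Section Minimal.
Variable Q : {set {set T}}.
Hypothesis gQ : goodpart Q.
Hypothesis minQ : forall Q', goodpart Q' -> #|Q| <= #|Q'|.

Let pQ : partition Q [set: T]. Proof. by case/and3P: gQ. Qed.
Let cQ : {in Q, forall X, conn a X}. Proof. by case/and3P: gQ => _ /forall_inP. Qed.
Let sQ : {in Q, forall X, #|X| <= 2 * beta}. Proof. by case/and3P: gQ => _ _ /forall_inP. Qed.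
Let tQ : trivIset Q. Proof. by case/and3P: pQ. Qed.
Let dQ : {in Q &, forall X Y, X != Y -> [disjoint X & Y]}.
Proof. by move=> X Y XQ YQ; apply: (trivIsetP tQ). Qed.

Lemma touch_large X Y : X \in Q -> Y \in Q -> X != Y -> touch a X Y -> 2 * beta < #|X| + #|Y|.
Proof.
move=> XQ YQ XY tXY; rewrite ltnNge; apply/negP => small.
pose Q' := (X :|: Y) |: (Q :\ X :\ Y).
have dW Z : Z \in Q :\ X :\ Y -> [disjoint X :|: Y & Z].
  rewrite !in_setD1 => /and3P [ZY ZX ZQ]; rewrite -setI_eq0 setIUl setU_eq0 !setI_eq0.
  by rewrite !dQ // eq_sym.
have sub Z : Z \in Q :\ X :\ Y -> Z \in Q by rewrite !in_setD1 => /and3P [].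
have cW : conn a (X :|: Y) by apply: connU => //; apply: cQ.
have : goodpart Q'.
  apply/and3P; split.
  - apply/and3P; split.
    + apply/eqP/setP => x; rewrite inE; have : x \in cover Q by case/and3P: pQ => /eqP ->.
      case/bigcupP => Z ZQ xZ; apply/bigcupP.
      have [/orP [] /eqP ZE|/norP [ZX ZY]] := boolP ((Z == X) || (Z == Y)).
      * by exists (X :|: Y); rewrite ?in_setU1 ?eqxx // in_setU -ZE xZ.
      * by exists (X :|: Y); rewrite ?in_setU1 ?eqxx // in_setU -ZE xZ orbT.
      * by exists Z => //; rewrite in_setU1 !in_setD1 ZX ZY ZQ orbT.
    + apply/trivIsetP => Z Z'; rewrite !in_setU1 => /orP [/eqP ->|ZQ] /orP [/eqP ->|ZQ'].
      * by rewrite eqxx.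
      * by move=> _; apply: dW.
      * by move=> _; rewrite disjoint_sym; apply: dW.
      * by apply: dQ; apply: sub.
    + rewrite in_setU1 negb_or; apply/andP; split; last by apply/negP => /sub; case/and3P: pQ => _ _ /negPf ->.
      by rewrite eq_sym; case/connP: cW => -[x xW] _; apply/set0Pn; exists x.
  - by apply/forall_inP => Z; rewrite in_setU1 => /orP [/eqP ->//|/sub /cQ].
  - apply/forall_inP => Z; rewrite in_setU1 => /orP [/eqP ->|/sub /sQ //].
    by apply: leq_trans small; rewrite leq_card_setU.
move/minQ; rewrite leqNgt => /negP; apply.
have YX : Y \in Q :\ X by rewrite in_setD1 eq_sym XY.
rewrite (cardsD1 X Q) XQ (cardsD1 Y (Q :\ X)) YX !add1n ltnS.
by apply: leq_trans (leq_card_setU _ _) _; rewrite cards1 add1n.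
Qed.

(** By minimality two touching blocks have more than 2 beta vertices together. Hence there are at
    most n / beta big blocks, the small blocks with neighbours ([Oth]) touch big blocks only, and a
    small block without neighbours is a whole component. *)
Definition Big := [set X in Q | beta < #|X|].
Definition Oth := [set X in Q | (#|X| <= beta) && (nbs a Q X != set0)].

Lemma BigQ : Big \subset Q. Proof. by apply/subsetP => X; rewrite in_set => /andP []. Qed.
Lemma OthQ : Oth \subset Q. Proof. by apply/subsetP => X; rewrite in_set => /andP []. Qed.

Lemma card_Big : beta * #|Big| <= #|T|.
Proof.
rewrite mulnC -sum_nat_const -cardsT.
have -> : #|[set: T]| = \sum_(X in Q) #|X| by rewrite (card_partition pQ).
rewrite [leqRHS](bigID (mem Big)) /= -[leqLHS]addn0; apply: leq_add => //.
rewrite [leqRHS](eq_bigl (mem Big)); last first.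
  by move=> X /=; case: (boolP (X \in Big)) => XB; rewrite ?andbF // andbT; apply: (subsetP BigQ).
by apply: leq_sum => X; rewrite in_set => /andP [_ /ltnW].
Qed.

Lemma Oth_nbs X : X \in Oth -> nbs a Q X \subset Big.
Proof.
rewrite in_set => /and3P [XQ Xb _]; apply/subsetP => Y; rewrite in_nbs => /and3P [YQ YX tXY].
rewrite in_set YQ /=; have := touch_large XQ YQ _ tXY; rewrite eq_sym => /(_ YX); lia.
Qed.

(** Every component contains a block outside [Oth], since a block of [Oth] has a big neighbour. The
    code will spend pointers only on nonleading vertices and on leaders of [Oth], so this bound is
    the source of the exponent n - kap. *)
Lemma card_indep (Rt : {set T}) : {in Rt &, forall u w, connect a u w -> u = w} -> #|Rt| <= #|Q :\: Oth|.
Proof.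
move=> ind; pose B u := pblock Q u.
have cov u : u \in cover Q by case/and3P: pQ => /eqP -> _ _; rewrite inE.
have BQ u : B u \in Q by apply: pblock_mem.
have uB u : u \in B u by rewrite mem_pblock.
pose F u := if B u \in Oth then odflt set0 [pick Y in nbs a Q (B u)] else B u.
have HF u : [/\ F u \in Q, F u \notin Oth & forall w, w \in F u -> connect a u w].
  have inB w : w \in B u -> connect a u w.
    move=> wB; have /connP [_ h] := cQ (BQ u).
    by apply: connect_sub (h _ _ (uB u) wB) => y z /and3P [yz _ _]; apply: connect1.
  rewrite /F; case: ifP => uO; last by rewrite uO; split.
  case: pickP => [Y YN|H]; last first.
    by move: uO; rewrite in_set => /and3P [_ _ /set0Pn [Y YN]]; have := H Y; rewrite YN.
  have YB := subsetP (Oth_nbs uO) Y YN; move: YN; rewrite in_nbs => /and3P [YQ YX /touchP [y [z [yB zY yz]]]].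
  split=> //=.
    by move: YB; rewrite !in_set YQ /= ltnNge => /negPf ->.
  move=> w wY; apply: connect_trans (inB y yB) _; apply: connect_trans (connect1 yz) _.
  have /connP [_ h] := cQ YQ.
  by apply: connect_sub (h _ _ zY wY) => y' z' /and3P [yz' _ _]; apply: connect1.
have iF : {in Rt &, injective F}.
  move=> u w uR wR E; apply: ind => //; have [FQ _ h] := HF u; have [_ _ h'] := HF w.
  have /connP [[z zF] _] := cQ FQ; apply: connect_trans (h z zF) _.
  by rewrite (connect_sym_of_sym sa); apply: h'; rewrite -E.
rewrite -(card_in_imset iF); apply: subset_leq_card; apply/subsetP => _ /imsetP [u _ ->].
by have [h1 h2 _] := HF u; rewrite in_setD h2.
Qed.

Definition hM (M : {ffun {set T} -> {set T}}) : rel {set T} := fun x y => touch a (M x) (M y).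
Definition eM M := \sum_(x in Big) #|[set y in Big | (y != x) && hM M x y]|.
(** Blocks of [Oth] are absorbed into a big neighbour as long as this makes two enlarged big blocks
    adjacent for the first time. J is the set of absorbed blocks and M the enlarged ones. Each
    absorption pays with a new arc of a K5-minor-free graph on [Big], which bounds [#|J|]. *)
Definition sinv (J : {set {set T}}) (M : {ffun {set T} -> {set T}}) :=
  [&& J \subset Oth, #|J| <= eM M, [forall x in Big, (x \subset M x) && conn a (M x)],
    [forall x in Big, forall y in Big, (x != y) ==> [disjoint M x & M y]] &
    [forall x in Big, forall v in Oth :\: J, [disjoint M x & v]]].

Lemma eM_lt J M (Z : {set {set T}}) : sinv J M -> Z \subset Big -> Z != set0 ->
  \sum_(x in Z) #|[set y in Z | (y != x) && hM M x y]| < 16 * #|Z|.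
Proof.
case/and5P => _ _ /forall_inP i3 /forall_inP i4 _ ZB Z0.
have iM : {in Z &, injective M}.
  move=> x y xZ yZ E; apply/eqP; apply/negPn/negP => xy.
  have xB := subsetP ZB x xZ; have yB := subsetP ZB y yZ.
  have := i4 x xB => /forall_inP /(_ y yB); rewrite xy /= E -setI_eq0 setIid => /eqP M0.
  by have /andP [_ /connP [[z]]] := i3 y yB; rewrite M0 inE.
have bM : blocks a (M @: Z).
  apply/blocksP; split.
    move=> _ _ /imsetP [x xZ ->] /imsetP [y yZ ->] ne.
    have := i4 x (subsetP ZB x xZ) => /forall_inP /(_ y (subsetP ZB y yZ)) /implyP; apply.
    by apply: contraNneq ne => ->.
  by move=> _ /imsetP [x xZ ->]; have /andP [] := i3 x (subsetP ZB x xZ).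
have := arcs_lt sa nK bM; rewrite /arcs big_imset //= card_in_imset //.
have M0 : M @: Z != set0 by rewrite -card_gt0 card_in_imset // card_gt0.
move=> /(_ M0); apply: leq_ltn_trans; apply: leq_sum => x xZ.
have <- : M @: [set y in Z | (y != x) && hM M x y] = nbs a (M @: Z) (M x).
  apply/setP => W; apply/imsetP/idP => [[y]|].
    rewrite in_set => /and3P [yZ yx h] ->; rewrite in_nbs imset_f //= [touch _ _ _]h andbT.
    by apply: contraNneq yx => /(iM _ _ yZ xZ) ->.
  rewrite in_nbs => /and3P [/imsetP [y yZ ->] ne h]; exists y => //.
  by rewrite in_set yZ [hM _ _ _]h andbT; apply: contraNneq ne => ->.
by rewrite card_in_imset // => y z; rewrite !in_set => /andP [yZ _] /andP [zZ _]; apply: iM.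
Qed.

Lemma eM_le J M : sinv J M -> eM M <= 16 * #|Big|.
Proof.
move=> i; have [B0|B0] := eqVneq Big set0; first by rewrite /eM B0 big_set0.
exact: ltnW (eM_lt i (subxx _) B0).
Qed.

Lemma sinv0 : sinv set0 [ffun x => x].
Proof.
apply/and5P; split.
- exact: sub0set.
- by rewrite cards0.
- by apply/forall_inP => x xB; rewrite ffunE subxx cQ // (subsetP BigQ).
- apply/forall_inP => x xB; apply/forall_inP => y yB; apply/implyP => xy.
  by rewrite !ffunE dQ // (subsetP BigQ).
- apply/forall_inP => x xB; apply/forall_inP => v; rewrite setD0 => vO; rewrite ffunE dQ ?(subsetP BigQ x xB) ?(subsetP OthQ v vO) //.
  by apply: contraTneq xB => ->; move: vO; rewrite !in_set => /and3P [-> h _]; rewrite -leqNgt.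
Qed.

Lemma sinv_step J M v y z : sinv J M -> v \in Oth -> v \notin J -> y \in nbs a Q v -> z \in nbs a Q v ->
  y != z -> ~~ hM M y z -> sinv (v |: J) [ffun x => if x == y then M y :|: v else M x].
Proof.
move=> /and5P [i1 i2 /forall_inP i3 /forall_inP i4 /forall_inP i5] vO vJ yN zN yz nh.
have yB := subsetP (Oth_nbs vO) y yN; have zB := subsetP (Oth_nbs vO) z zN.
set M' := [ffun x => _]; have M'E x : M' x = if x == y then M y :|: v else M x by rewrite ffunE.
have MM' x : M x \subset M' x by rewrite M'E; case: eqP => [->|_]; rewrite ?subsetUl.
have vOJ : v \in Oth :\: J by rewrite in_setD vJ.
have tv x : x \in Big -> x \in nbs a Q v -> touch a v (M x).
  move=> xB; rewrite in_nbs => /and3P [_ _ t]; have /andP [xM _] := i3 x xB; exact: touch_subr t xM.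
apply/and5P; split.
- by rewrite subUset sub1set vO.
- rewrite cardsU1 vJ add1n; apply: leq_ltn_trans i2 _.
  rewrite /eM (bigD1 y) //= [in ltnRHS](bigD1 y) //= -addSn; apply: leq_add.
    apply: (@proper_card _ _ _); apply/properP; split.
      apply/subsetP => x; rewrite !in_set => /and3P [-> -> h] /=; apply: touch_subr (MM' x).
      by rewrite touch_sym //; apply: touch_subr (MM' y); rewrite touch_sym.
    exists z; last by rewrite in_set zB eq_sym yz /= (negPf nh).
    rewrite in_set zB eq_sym yz /= /hM !M'E eqxx eq_sym (negPf yz) touchUl.
    by rewrite tv ?orbT.
  apply: leq_sum => x _; apply: subset_leq_card; apply/subsetP => w; rewrite !in_set => /and3P [-> -> h] /=.
  by apply: touch_subr (MM' w); rewrite touch_sym //; apply: touch_subr (MM' x); rewrite touch_sym.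
- apply/forall_inP => x xB; have /andP [h1 h2] := i3 x xB; rewrite (subset_trans h1 (MM' x)) /=.
  rewrite M'E; case: eqP => [xy|//]; subst x; apply: connU => //; first by apply: cQ; apply: (subsetP OthQ).
  by rewrite touch_sym // tv.
- have dj x : x \in Big -> x != y -> [disjoint M y :|: v & M x].
    move=> xB xy; rewrite -setI_eq0 setIUl setU_eq0 !setI_eq0.
    have := i4 y yB => /forall_inP /(_ x xB); rewrite eq_sym xy /= => -> /=.
    by rewrite disjoint_sym; have /forall_inP := i5 x xB; apply.
  apply/forall_inP => x xB; apply/forall_inP => w wB; apply/implyP => xw; rewrite !M'E.
  case: (eqVneq x y) => [xy|xy]; case: (eqVneq w y) => [wy|wy].
  + by rewrite xy wy eqxx in xw.
  + exact: dj.
  + by rewrite disjoint_sym; apply: dj.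
  + by have /forall_inP /(_ w wB) /implyP := i4 x xB; apply.
- apply/forall_inP => x xB; apply/forall_inP => w; rewrite in_setD in_setU1 negb_or => /andP [/andP [wv wJ] wO].
  have wOJ : w \in Oth :\: J by rewrite in_setD wJ.
  have h t : t \in Big -> [disjoint M t & w] by move=> tB; have /forall_inP := i5 t tB; apply.
  rewrite M'E; case: eqP => _; last exact: h.
  rewrite -setI_eq0 setIUl setU_eq0 !setI_eq0 h //= dQ ?(subsetP OthQ) // eq_sym //.
Qed.

Lemma saturated : exists J : {set {set T}}, exists M, sinv J M /\ forall v, v \in Oth -> v \notin J ->
  {in nbs a Q v &, forall y z, y != z -> hM M y z}.
Proof.
have [[J M] /= i mx] := @arg_maxnP ({set {set T}} * {ffun {set T} -> {set T}})%type (set0, [ffun x => x])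
   (fun JM => sinv JM.1 JM.2) (fun JM => #|JM.1|) sinv0.
exists J, M; split=> // v vO vJ y z yN zN yz; case: (boolP (hM M y z)) => // nh.
have := mx (v |: J, [ffun x => if x == y then M y :|: v else M x]) (sinv_step i vO vJ yN zN yz nh).
by rewrite /= cardsU1 vJ add1n ltnn.
Qed.

(** When no absorption is possible, the neighbourhood of every remaining block of [Oth] is a clique
    in a 15-degenerate graph. One pointer to its first vertex x confines it to x and the at most 15
    members of [out x]. *)
Lemma structure : exists J : {set {set T}}, exists out : {set T} -> {set {set T}},
  [/\ J \subset Oth, #|J| <= 16 * #|Big|, forall x, #|out x| <= 15 /\ out x \subset Big &
    forall v, v \in Oth -> v \notin J -> exists2 x, x \in nbs a Q v & nbs a Q v \subset x |: out x].
Proof.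
have [J [M [i sat]]] := saturated.
have [|out ho hc] := @degenerate_out {set T} (hM M) 15 Big.
  move=> Z ZB Z0; apply/exists_inP; apply: contraTT (eM_lt i ZB Z0) => /exists_inPn H; rewrite -leqNgt.
  by rewrite mulnC -sum_nat_const; apply: leq_sum => x /H; rewrite -ltnNge.
exists J, out; split=> //; first by case/and5P: i.
  by apply: leq_trans (eM_le i); case/and5P: i.
move=> v vO vJ; apply: hc; first exact: Oth_nbs.
  by move: vO; rewrite in_set => /and3P [].
exact: sat.
Qed.
End Minimal.
End Partition.

Lemma cardU_le (T : finType) (A B : {set T}) : #|A :|: B| <= #|A| + #|B|.
Proof. by rewrite leq_card_setU. Qed.

(** * Codes for K5-minor-free graphs *)

Section Encoding.
Variable T : finType.
Implicit Types (Ls : {set T}) (f : {ffun T -> T}) (Q : {set T * T}) (g : {set {set T}}).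

(** [Ls] holds one leader per block. The map f sends a nonleader to its leader, and the leader of an
    unabsorbed block of [Oth] to the leader of its first big neighbour. [Q1] lists the adjacencies
    among big and absorbed blocks, [Q2] the sets [out]. The decoded relation is only a superset of
    the edges, but of linear size, so the graph is then chosen among its subsets. *)
Definition ldr Ls f x := if x \in Ls then x else f x.
Definition linked f Q1 Q2 (p q : T) := [|| p == q, (p, q) \in Q1, f p == q, f q == p,
  (f p, q) \in Q2 | (f q, p) \in Q2].
Definition decode Ls f Q1 Q2 : {set T * T} :=
  [set xy | linked f Q1 Q2 (ldr Ls f xy.1) (ldr Ls f xy.2)].

Lemma card_decode Ls f Q1 Q2 b q1 d : (forall p, #|[set x | ldr Ls f x == p]| <= b) ->
  #|Q1| <= q1 -> (forall u, #|[set q | (u, q) \in Q2]| <= d) ->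
  #|decode Ls f Q1 Q2| <= (3 * #|T| + q1 + 2 * (#|T| * d)) * b ^ 2.
Proof.
move=> hb h1 hd; pose W := [set pq : T * T | linked f Q1 Q2 pq.1 pq.2].
have hW : #|W| <= 3 * #|T| + q1 + 2 * (#|T| * d).
  pose A1 := [set (p, p) | p : T]; pose A3 := [set (p, f p) | p : T]; pose A4 := [set (f p, p) | p : T].
  pose A5 := \bigcup_(p : T) [set (p, q) | q in [set q | (f p, q) \in Q2]].
  pose A6 := \bigcup_(p : T) [set (q, p) | q in [set q | (f p, q) \in Q2]].
  have sub : W \subset A1 :|: Q1 :|: A3 :|: A4 :|: A5 :|: A6.
    apply/subsetP => -[p q]; rewrite !in_setU [_ \in W]in_set /=.
    case/or4P => [/eqP ->|h|/eqP <-|/or3P [/eqP <-|h|h]].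
    - by rewrite imset_f.
    - by rewrite h orbT.
    - suff -> : (p, f p) \in A3 by rewrite !orbT.
      exact: (imset_f (fun p => (p, f p))).
    - suff -> : (f q, q) \in A4 by rewrite !orbT.
      exact: (imset_f (fun p => (f p, p))).
    - suff -> : (p, q) \in A5 by rewrite !orbT.
      by apply/bigcupP; exists p => //; rewrite imset_f // in_set.
    - suff -> : (p, q) \in A6 by rewrite !orbT.
      by apply/bigcupP; exists q => //; apply/imsetP; exists p; rewrite ?in_set.
  have c1 : #|A1| <= #|T| by rewrite leq_imset_card.
  have c3 : #|A3| <= #|T| by rewrite leq_imset_card.
  have c4 : #|A4| <= #|T| by rewrite leq_imset_card.
  have c5 : #|A5| <= #|T| * d.
    apply: leq_trans (card_bigcup_le _ _) _; rewrite -sum_nat_const; apply: leq_sum => p _.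
    exact: leq_trans (leq_imset_card _ _) (hd _).
  have c6 : #|A6| <= #|T| * d.
    apply: leq_trans (card_bigcup_le _ _) _; rewrite -sum_nat_const; apply: leq_sum => p _.
    exact: leq_trans (leq_imset_card _ _) (hd _).
  apply: leq_trans (subset_leq_card sub) _.
  have -> : 3 * #|T| + q1 + 2 * (#|T| * d) = #|T| + q1 + #|T| + #|T| + #|T| * d + #|T| * d by lia.
  by do 5 (apply: leq_trans (cardU_le _ _) _; apply: leq_add => //).
apply: leq_trans (leq_mul hW (leqnn _)); rewrite -sum_nat_const.
rewrite -sum1_card (partition_big (fun xy => (ldr Ls f xy.1, ldr Ls f xy.2)) (mem W)) /=; last first.
  by move=> [x y]; rewrite !in_set.
apply: leq_sum => -[p q] _; rewrite sum1_card expnS expn1.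
apply: leq_trans (leq_mul (hb p) (hb q)); rewrite -cardsX; apply: subset_leq_card.
apply/subsetP => -[x y]; rewrite unfold_in /= => /andP [_]; rewrite xpair_eqE => /andP [h h'].
by rewrite !inE /= h h'.
Qed.

(** Constants: big and absorbed blocks number at most 17 n / beta, so [Q1] has at most 16 * 17 = 272
    times n / beta members; 15 is the degeneracy; and 1220 = 4 (3 + 272 + 2 * 15), where 4 beta^2
    bounds the vertex pairs of two blocks. *)
Lemma encode (a : rel T) beta (Rt : {set T}) : symmetric a -> ~ Kminor a 5 -> 0 < beta ->
  {in Rt &, forall u w, connect a u w -> u = w} ->
  exists Ls, exists f, exists Q1, exists Q2,
  [/\ #|[set x | f x != x]| <= #|T| - #|Rt|, #|Q1| <= 272 * (#|T| %/ beta), #|Q2| <= 15 * (#|T| %/ beta),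
   forall x y, a x y -> (x, y) \in decode Ls f Q1 Q2 &
   #|decode Ls f Q1 Q2| <= 1220 * beta ^ 2 * #|T|].
Proof.
move=> sa nK b0 ind.
have [Q gQ mQ] := arg_minnP (fun Q : {set {set T}} => #|Q|) (singletons_good a b0).
have [J [out [JO Jc ho hn]]] := structure sa nK b0 gQ mQ.
pose B := Big beta Q; pose O := Oth a beta Q.
have /and3P [pQ _ /forall_inP szQ] := gQ; have /and3P [/eqP covQ tQ nQ] := pQ.
have BQ : B \subset Q := BigQ beta Q; have OQ : O \subset Q := OthQ a beta Q.
pose bl x := pblock Q x.
have blQ x : bl x \in Q by apply: pblock_mem; rewrite covQ inE.
have xbl x : x \in bl x by rewrite mem_pblock covQ inE.
pose ld (X : {set T}) (x0 : T) := odflt x0 [pick x in X].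
have ldX (X : {set T}) (x0 x : T) : x \in X -> ld X x0 \in X /\ forall x1, ld X x1 = ld X x0.
  by move=> xX; rewrite /ld; case: pickP => [//|/(_ x)]; rewrite xX.
pose r x := ld (bl x) x.
have rbl x : r x \in bl x by have [] := ldX (bl x) x x (xbl x).
have blr x : bl (r x) = bl x by rewrite /bl; apply: def_pblock => //; exact: rbl.
have rr x : r (r x) = r x by rewrite /r blr; have [_ ->] := ldX (bl x) x x (xbl x).
have rE x y : bl x = bl y -> r x = r y.
  by move=> e; rewrite /r e; have [_ ->] := ldX (bl y) y y (xbl y).
pose Ls := [set x | r x == x].
pose xv v := odflt set0 [pick x in nbs a Q v | nbs a Q v \subset x |: out x].
have hxv v : v \in O -> v \notin J -> xv v \in nbs a Q v /\ nbs a Q v \subset xv v |: out (xv v).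
  move=> vO vJ; rewrite /xv; case: pickP => [x /andP [] //|H].
  by have [x x1 x2] := hn v vO vJ; have := H x; rewrite x1 x2.
pose f := [ffun x => if r x != x then r x else if (bl x \in O) && (bl x \notin J) then ld (xv (bl x)) x else x].
have ldrE x : ldr Ls f x = r x.
  by rewrite /ldr in_set; case: eqP => [->//|/eqP ne]; rewrite ffunE ne.
pose Q1 := [set pq : T * T | [&& r pq.1 == pq.1, r pq.2 == pq.2, bl pq.1 \in B :|: J & bl pq.2 \in nbs a (B :|: J) (bl pq.1)]].
pose Q2 := [set pq : T * T | [&& r pq.1 == pq.1, r pq.2 == pq.2, bl pq.1 \in B & bl pq.2 \in out (bl pq.1)]].
have blinj : {in Ls &, injective bl}.
  by move=> x y; rewrite !in_set => /eqP <- /eqP <-; rewrite !blr => /rE.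
have cB : #|B| <= #|T| %/ beta by rewrite leq_divRL // mulnC (card_Big gQ).
have deg (Z : {set {set T}}) : #|[set q | (r q == q) && (bl q \in Z)]| <= #|Z|.
  rewrite -(@card_in_imset _ _ bl); last first.
    by move=> x y; rewrite !in_set => /andP [hx _] /andP [hy _]; apply: blinj; rewrite in_set.
  by apply: subset_leq_card; apply/subsetP => _ /imsetP [q + ->]; rewrite in_set => /andP [].
have pairs (Z : {set {set T}}) (N : {set T} -> {set {set T}}) :
  #|[set pq : T * T | [&& r pq.1 == pq.1, r pq.2 == pq.2, bl pq.1 \in Z & bl pq.2 \in N (bl pq.1)]]| <=
  \sum_(X in Z) #|N X|.
  pose Z' := [set p | (r p == p) && (bl p \in Z)].
  apply: (@leq_trans (\sum_(p in Z') #|N (bl p)|)).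
    apply: (@leq_trans #|\bigcup_(p in Z') [set (p, q) | q in [set q | (r q == q) && (bl q \in N (bl p))]]|).
      apply: subset_leq_card; apply/subsetP => -[p q]; rewrite in_set /= => /and4P [h1 h2 h3 h4].
      by apply/bigcupP; exists p; rewrite ?in_set ?h1 // imset_f // in_set h2.
    apply: leq_trans (card_bigcup_le _ _) _; apply: leq_sum => p _.
    exact: leq_trans (leq_imset_card _ _) (deg _).
  rewrite -(@big_imset _ _ _ _ _ bl (mem Z') (fun X => #|N X|)) /=; last first.
    by move=> x y; rewrite !in_set => /andP [hx _] /andP [hy _]; apply: blinj; rewrite in_set.
  rewrite [leqRHS](bigID (mem (bl @: Z'))) /= -[leqLHS]addn0 leq_add //.
  rewrite [leqRHS](eq_bigl (mem (bl @: Z'))) // => X /=; case: (boolP (X \in bl @: Z')); rewrite ?andbF //.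
  by case/imsetP => p; rewrite in_set => /andP [_ h] ->; rewrite h.
have bBJ : blocks a (B :|: J).
  apply: (@blocks_sub _ _ Q); first by rewrite subUset BQ (subset_trans JO OQ).
  by rewrite /blocks tQ; case/and3P: gQ.
exists Ls, f, Q1, Q2; split.
- have cR := card_indep sa b0 gQ mQ ind; rewrite -/O in cR.
  have leL (Z : {set {set T}}) : Z \subset Q -> #|Z| <= #|[set x | (r x == x) && (bl x \in Z)]|.
    move=> ZQ; apply: leq_trans (leq_imset_card bl _); apply: subset_leq_card; apply/subsetP => X XZ.
    have [x xX] : exists x, x \in X.
      by apply/set0Pn; apply: contraNneq nQ => <-; apply: (subsetP ZQ).
    have bx : bl x = X by apply: def_pblock => //; apply: (subsetP ZQ).
    by apply/imsetP; exists (r x); rewrite ?in_set ?rr ?eqxx blr bx.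
  have := leq_trans cR (leL _ (subsetDl _ _)); set F := [set x | _ && _] => RF.
  have : #|[set x | f x != x]| + #|F| <= #|T|.
    rewrite -cardsUI (_ : _ :&: _ = set0) ?cards0 ?addn0 ?max_card //.
    apply/setP => x; rewrite in_set0; apply/negbTE/negP => /setIP []; rewrite in_set => fx.
    move=> /setIdP [/eqP rx /setDP [_ nO]]; move: fx.
    by rewrite ffunE rx eqxx /= (negPf nO) /= eqxx.
  move: RF; clear; lia.
- apply: leq_trans (pairs _ _) _; apply: leq_trans (arcs_le sa nK bBJ) _.
  have := cardU_le B J; move: Jc cB; rewrite -/B; clear; lia.
- apply: leq_trans (pairs _ _) _; apply: (@leq_trans (\sum_(X in B) 15)).
    by apply: leq_sum => X _; have [] := ho X.
  by rewrite sum_nat_const mulnC leq_mul2l cB orbT.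
- move=> x y axy; rewrite in_set /= !ldrE /linked.
  have [e|ne] := eqVneq (bl x) (bl y); first by rewrite (rE _ _ e) eqxx.
  have txy : touch a (bl x) (bl y) by apply/touchP; exists x, y.
  have := touch_large sa gQ mQ (blQ x) (blQ y) ne txy => sum2.
  have [h|h] := boolP ((bl x \in B :|: J) && (bl y \in B :|: J)).
    apply/orP; right; apply/orP; left; rewrite in_set /= !rr !eqxx !blr; case/andP: h => -> yB.
    by rewrite in_nbs yB eq_sym ne.
  have key u v : bl u != bl v -> touch a (bl u) (bl v) -> bl v \in B -> bl u \notin B :|: J ->
    [|| f (r u) == r v | (f (r u), r v) \in Q2].
    move=> nuv tuv vB; rewrite in_setU negb_or => /andP [uB uJ].
    have vN : bl v \in nbs a Q (bl u) by rewrite in_nbs (subsetP BQ) // eq_sym nuv.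
    have uO : bl u \in O.
      rewrite in_set blQ /=; apply/andP; split; last by apply/set0Pn; exists (bl v).
      by move: uB; rewrite in_set blQ /= -leqNgt.
    have [h1 h2] := hxv _ uO uJ.
    have xB : xv (bl u) \in B := subsetP (Oth_nbs sa b0 gQ mQ uO) _ h1.
    have xQ := subsetP BQ _ xB.
    have [z zx] : exists z, z \in xv (bl u) by apply/set0Pn; apply: contraNneq nQ => <-.
    have bz : bl z = xv (bl u) by apply: def_pblock.
    have fu : f (r u) = r z.
      rewrite ffunE rr eqxx blr uO uJ /= /r bz.
      by have [_ ->] := ldX (xv (bl u)) z z zx.
    have := subsetP h2 _ vN; rewrite in_setU1 => /orP [/eqP e|o].
      by rewrite fu (rE v z) ?eqxx // bz.
    by apply/orP; right; rewrite in_set /= fu !rr !eqxx !blr bz xB.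
  have [xB|xB] := boolP (bl x \in B).
    have yBJ : bl y \notin B :|: J by move: h; rewrite in_setU xB.
    have tyx : touch a (bl y) (bl x) by rewrite touch_sym.
    have nyx : bl y != bl x by rewrite eq_sym.
    by have /orP [->|->] := key y x nyx tyx xB yBJ; rewrite !orbT.
  have yB : bl y \in B.
    move: xB; rewrite !in_set !blQ /= -leqNgt; move: sum2; clear; lia.
  have xBJ : bl x \notin B :|: J by move: h; rewrite [bl y \in _]in_setU yB andbT.
  by have /orP [->|->] := key x y ne txy yB xBJ; rewrite !orbT.
- have := @card_decode Ls f Q1 Q2 (2 * beta) (272 * #|T|) 15.
  have e : (3 * #|T| + 272 * #|T| + 2 * (#|T| * 15)) * (2 * beta) ^ 2 = 1220 * beta ^ 2 * #|T|.
    by rewrite expnMn; move: (beta ^ 2); clear; lia.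
  rewrite e; apply.
  + move=> p; apply: (@leq_trans #|bl p|).
      apply: subset_leq_card; apply/subsetP => x; rewrite in_set ldrE => /eqP <-.
      by rewrite blr.
    exact: szQ.
  + apply: leq_trans (pairs _ _) _; apply: leq_trans (arcs_le sa nK bBJ) _.
    have := cardU_le B J; have : #|B| <= #|T| by apply: leq_trans cB (leq_div _ _).
    move: Jc; rewrite -/B; clear; lia.
  + move=> u; have [ub|ub] := boolP (bl u \in B); last first.
      rewrite (_ : [set q | _] = set0) ?cards0 //; apply/setP => q; rewrite in_set0 in_set.
      by apply/negbTE/negP => /setIdP [_ /and3P [_ h _]]; rewrite h in ub.
    apply: leq_trans (_ : #|out (bl u)| <= 15); last by have [] := ho (bl u).
    apply: leq_trans (deg (out (bl u))); apply: subset_leq_card; apply/subsetP => q.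
    by rewrite !in_set /= => /and4P [_ -> _ ->].
Qed.

(** The factors count, in this order: [Ls] and the set of vertices moved by f, the values of f on
    that set, the pair [Q1], [Q2] (272 + 15 = 287), and the subset of the decoded relation. *)
Theorem count_noK5 (S : {set {set {set T}}}) beta kap : 0 < beta -> 0 < #|T| ->
  (forall g, g \in S -> [/\ forall e, e \in g -> exists x y, e = [set x; y],
     ~ Kminor (fun x y => [set x; y] \in g) 5 &
     exists2 Rt : {set T}, #|Rt| = kap & {in Rt &, forall u w, connect (fun x y => [set x; y] \in g) u w -> u = w}]) ->
  #|S| <= 2 ^ (2 * #|T|) * #|T| ^ (#|T| - kap) * (#|T| ^ 2).+1 ^ (287 * (#|T| %/ beta)) * 2 ^ (1220 * beta ^ 2 * #|T|).
Proof.
move=> b0 T0 HS; set n := #|T|; pose q1 := 272 * (n %/ beta); pose q2 := 15 * (n %/ beta).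
pose CU := 1220 * beta ^ 2 * n.
pose codes := setX (setX (powerset [set: T]) [set f : {ffun T -> T} | #|[set x | f x != x]| <= n - kap])
  (setX [set A : {set T * T} | #|A| <= q1] [set A : {set T * T} | #|A| <= q2]).
pose dec (c : {set T} * {ffun T -> T} * ({set T * T} * {set T * T})) := decode c.1.1 c.1.2 c.2.1 c.2.2.
pose img (U : {set T * T}) : {set {set T}} := [set [set xy.1; xy.2] | xy in U].
pose codes' := [set c in codes | #|dec c| <= CU].
have sub : S \subset \bigcup_(c in codes') powerset (img (dec c)).
  apply/subsetP => g gS; have [hg nK [Rt cR ind]] := HS g gS.
  have sg : symmetric (fun x y => [set x; y] \in g) by move=> x y; rewrite setUC.
  have [Ls [f [Q1 [Q2 [h1 h2 h3 h4 h5]]]]] := encode sg nK b0 ind.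
  apply/bigcupP; exists ((Ls, f), (Q1, Q2)).
    rewrite in_set h5 andbT !in_setX /= powersetE subsetT !in_set.
    by rewrite -cR h1 h2 h3.
  rewrite powersetE; apply/subsetP => e eg; have [x [y ee]] := hg e eg.
  by apply/imsetP; exists (x, y) => //; apply: h4; rewrite -ee.
apply: leq_trans (subset_leq_card sub) _; apply: leq_trans (card_bigcup_le _ _) _.
apply: (@leq_trans (\sum_(c in codes') 2 ^ CU)).
  apply: leq_sum => c; rewrite in_set => /andP [_ hc]; rewrite card_powerset leq_exp2l //.
  exact: leq_trans (leq_imset_card _ _) hc.
rewrite sum_nat_const leq_mul2r; apply/orP; right.
apply: (@leq_trans #|codes|); first by apply: subset_leq_card; apply/subsetP => c; rewrite in_set => /andP [].
rewrite !cardsX card_powerset cardsT -/n.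
have s1 := card_small_sets (T * T)%type q1; have s2 := card_small_sets (T * T)%type q2.
have s3 := @card_few_moved T (n - kap) T0.
apply: leq_trans (leq_mul (leq_mul (leqnn _) s3) (leq_mul s1 s2)) _.
rewrite card_prod -/n -expnD -mulnDl (_ : 272 + 15 = 287) // mulnn mul2n -addnn expnD !mulnA.
by [].
Qed.
End Encoding.

From mathcomp Require Import all_order all_algebra.
From mathcomp Require Import ring lra.
Import Order.TTheory GRing.Theory Num.Theory.

(** * Cayley's formula for forests *)

Section ForestCount.
Variable T : finType.
Implicit Types (f g h : {ffun T -> T}) (A B : {set T}) (x y u v r : T).

Lemma nforests_all A : nforests A #|A| = 1%N.
Proof.
rewrite /nforests; suff -> : [set f in frs A | #|roots f A| == #|A|] = [set [ffun x => x]].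
  by rewrite cards1.
apply/setP => f; rewrite in_set1; apply/idP/eqP => [|->].
  rewrite inE => /andP [/frsP [af sf] /eqP cr].
  have e : roots f A = A.
    by apply/eqP; rewrite eqEcard cr leqnn andbT; apply/subsetP => x /rootsP [].
  apply/ffunP => x; rewrite ffunE.
  case: (boolP (x \in A)) => [|/(stable_out sf) //].
  by rewrite -{1}e => /rootsP [].
rewrite inE; apply/andP; split.
  apply/frsP; split; first by apply/acycP => x; exists 0%N; rewrite ffunE.
  by apply/forallP => x; rewrite ffunE eqxx; case: ifP.
apply/eqP; congr #|pred_of_set _|; apply/setP => x.
by rewrite inE ffunE eqxx andbT.
Qed.

(** Induction from the edgeless forest, removing one root at a time with [linking_card]. The factor
    [#|A|] avoids a division. *)
Lemma nforestsE A j : (j < #|A|)%N ->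
  (#|A| * nforests A (#|A| - j) = 'C(#|A|, #|A| - j) * (#|A| - j) * #|A| ^ j)%N.
Proof.
set a := #|A|; elim: j => [|j IH] lt.
  by rewrite subn0 expn0 nforests_all binn mul1n.
have {IH} := IH (ltnW lt).
have H := linking_card A (a - j.+1); rewrite -/a in H.
have -> : (a - j = (a - j.+1).+1)%N by lia.
have e : (a - (a - j.+1) = j.+1)%N by lia.
rewrite e in H; set k := (a - j.+1)%N in H *.
have ba : ('C(a, k.+1) * k.+1 = 'C(a, k) * j.+1)%N.
  by have := mul_bin_left a k; rewrite e; lia.
move=> E; apply/eqP; rewrite -(eqn_pmul2r (ltn0Sn j)); apply/eqP.
transitivity ((a * nforests A k.+1) * (a * k))%N.
  by rewrite -mulnA -H; lia.
by rewrite E ba expnS; lia.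
Qed.

Lemma card_rooted_trees A : (0 < #|A|)%N -> nforests A 1 = (#|A| ^ #|A|.-1)%N.
Proof.
move=> a0; have := @nforestsE A #|A|.-1; rewrite ltn_predL => /(_ a0).
have -> : (#|A| - #|A|.-1 = 1)%N by lia.
by rewrite bin1 muln1 => /eqP; rewrite eqn_pmul2l // => /eqP.
Qed.

Lemma card_two_forests A : (1 < #|A|)%N ->
  nforests A 2 = (#|A|.-1 * #|A| ^ (#|A| - 2))%N.
Proof.
move=> a1; have lt : (#|A| - 2 < #|A|)%N by rewrite ltn_subrL (ltnW a1).
have e2 : (#|A| - (#|A| - 2) = 2)%N by rewrite subKn.
have e3 := bin_ffact #|A| 2; rewrite [2`!]/= in e3.
have := nforestsE lt; rewrite e2 e3.
rewrite ffactnS ffactn1 -mulnA => /eqP.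
by rewrite eqn_pmul2l ?(ltnW a1) // => /eqP.
Qed.

End ForestCount.

(** * Descendants in a random function *)

Section Descendants.
Variable T : finType.
Implicit Types (B C : {set T}) (f g : {ffun T -> T}) (u v w x s : T).

Definition dsc f u : {set T} := [set x | fconnect f x u].
Definition smalldsc f K B := [set u in B | #|dsc f u| <= K].

Lemma fconnectP f x u : reflect (exists i, u = iter i f x) (fconnect f x u).
Proof.
apply: (iffP idP) => [/iter_findex <-|[i ->]]; last exact: fconnect_iter.
by exists (findex f x u).
Qed.

(** A vertex u that gains descendants lies on the forward orbit of s. The vertices before it on this
    orbit are descendants of u already under f, so u is among the first K points of the orbit. *)
Lemma smalldsc_lip f x s K B :
  #|smalldsc f K B| <= #|smalldsc (upd f x s) K B| + K.
Proof.
set f' := upd f x s.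
apply: (@leq_trans (#|smalldsc f' K B| + #|[set iter (i : 'I_K) f s | i in setT]|)); last first.
  by rewrite leq_add2l -[K in _ <= K]card_ord -cardsT leq_imset_card.
apply: leq_trans (leq_card_setU _ _).1; apply/subset_leq_card/subsetP => u.
rewrite in_set => /andP [uB cu]; rewrite in_setU in_set uB /=.
have [//|cu'] := boolP (#|dsc f' u| <= K).
have fE : upd f' x (f x) = f by apply/ffunP => z; rewrite !updE; case: eqP => // ->.
have agree z i : (forall j, j < i -> iter j f' z != x) -> iter i f z = iter i f' z.
  by move=> H; rewrite -{1}fE upd_iter.
have [z zu' zu] : exists2 z, z \in dsc f' u & z \notin dsc f u.
  apply/subsetPn; apply: contra cu' => /subset_leq_card h; exact: leq_trans h cu.
have su' : fconnect f' s u.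
  move: zu' zu; rewrite !in_set => /fconnectP [i ui] zu.
  have [j jx|H] := pickP (fun j : 'I_i => iter j f' z == x).
    apply/fconnectP; exists (i - j.+1); rewrite ui.
    have e : i = (i - j.+1) + j.+1 by rewrite subnK.
    by rewrite {1}e iterD iterS (eqP jx) /f' updE eqxx.
  case/negP: zu; apply/fconnectP; exists i; rewrite ui agree // => j ji.
  by have := H (Ordinal ji); rewrite /= => ->.
set i := findex f' s u; have io : i < order f' s by apply: findex_max.
have ui : iter i f' s = u by apply: iter_findex.
have ag j : j <= i -> iter j f s = iter j f' s.
  move=> ji; apply: agree => a aj; apply/eqP => ax.
  have e : i = (i - a.+1) + a.+1 by rewrite subnK // (leq_trans aj).
  have e2 : iter (i - a.+1) f' s = u.
    by rewrite -ui {2}e iterD iterS ax /f' updE eqxx.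
  have lt : i - a.+1 < i by rewrite ltn_subrL /= (leq_ltn_trans _ (leq_trans aj ji)).
  by have := findex_iter (ltn_trans lt io); rewrite e2 -/i => e3; rewrite -e3 ltnn in lt.
have iK : i < K.
  apply: leq_trans cu; rewrite -[i.+1]card_ord -(card_imset (f := fun j : 'I_i.+1 => iter j f s)).
    apply/subset_leq_card/subsetP => _ /imsetP [j _ ->]; rewrite in_set; apply/fconnectP.
    have ji : j <= i by rewrite -ltnS.
    by exists (i - j); rewrite -iterD subnK // ag.
  move=> a b /=; have ai : a <= i by rewrite -ltnS. 
  have bi : b <= i by rewrite -ltnS.
  rewrite !ag // => e; apply/val_inj => /=.
  by rewrite -(findex_iter (leq_ltn_trans ai io)) e findex_iter // (leq_ltn_trans bi io).
by apply/imsetP; exists (Ordinal iK); rewrite //= ag.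
Qed.

Variable B : {set T}.

(** The product event that the descendants of the root of g are exactly C, arranged as the tree g:
    its root leaves C, and no point outside maps into C. *)
Definition Gd C g x : {set T} :=
  if x \in C then (if g x == x then B :\: C else [set g x])
  else if x \in B then B :\: C else [set x].
Definition Evd C g : {set {ffun T -> T}} := [set f : {ffun T -> T} | [forall x, f x \in Gd C g x]].

Section OneTree.
Variables (C : {set T}) (g : {ffun T -> T}) (r : T).
Hypotheses (CB : C \subset B) (gC : g \in frs C) (rg : roots g C = [set r]).
Let ag : acyc g. Proof. by case/frsP: gC. Qed.
Let sg : stable g C. Proof. by case/frsP: gC. Qed.
Let rC : r \in C. Proof. by have := set11 r; rewrite -rg => /rootsP []. Qed.
Let fixC x : x \in C -> (g x == x) = (x == r).
Proof. by move=> xC; have := in_set1 x r; rewrite -rg inE xC. Qed.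

Lemma EvdP f x : f \in Evd C g -> f x \in Gd C g x.
Proof. by rewrite in_set => /forallP. Qed.

Lemma Evd_in f x : f \in Evd C g -> x \in C -> x != r -> f x = g x.
Proof. by move=> fE xC nr; have := EvdP x fE; rewrite /Gd xC fixC // (negPf nr) inE => /eqP. Qed.

Lemma Evd_out f x : f \in Evd C g -> x \notin C -> f x \notin C.
Proof.
move=> fE xC; have := EvdP x fE; rewrite /Gd (negPf xC).
by case: ifP => _; rewrite !inE; [case/andP|move/eqP->].
Qed.

Lemma Evd_Fam f : f \in Evd C g -> f \in Fam B.
Proof.
move=> fE; rewrite in_set; apply/forallP => x; have := EvdP x fE; rewrite /Gd.
case: (boolP (x \in C)) => xC.
  rewrite (subsetP CB x xC); case: ifP => _; rewrite !inE; first by case/andP.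
  by move/eqP->; apply: (subsetP CB); apply: stable_in xC.
by case: ifP => _; rewrite !inE; first by case/andP.
Qed.

Lemma Evd_dsc f : f \in Evd C g -> dsc f r = C.
Proof.
move=> fE; apply/setP => x; rewrite in_set; apply/idP/idP => [/fconnectP [i ri]|].
  apply: contraLR rC => xC; rewrite ri; elim: (i) => //= n; exact: Evd_out.
move: x; apply: (acyc_ind (P := fun x => x \in C -> fconnect f x r) ag) => x.
  by move=> /eqP gx xC; move: gx; rewrite fixC // => /eqP ->; apply: connect0.
move=> nx IH xC; have nr : x != r by rewrite -fixC.
have := IH (stable_in sg xC); rewrite -(Evd_in fE xC nr).
by apply: connect_trans; apply: fconnect1.
Qed.

Lemma card_Evd : #|Evd C g| = (#|B| - #|C|) * (#|B| - #|C|) ^ (#|B| - #|C|).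
Proof.
have cD : #|B :\: C| = #|B| - #|C| by rewrite cardsDS.
rewrite card_family_set (bigID (fun x => x \in B :\: C)) /= mulnC; congr (_ * _).
  rewrite (bigD1 r) /=; last by rewrite inE rC.
  rewrite {1}/Gd rC fixC // eqxx cD big1 ?muln1 // => x; rewrite inE negb_and negbK.
  move=> /andP [H nr]; rewrite /Gd; case: (boolP (x \in C)) H => xC /= H.
    by rewrite fixC // (negPf nr) cards1.
  by rewrite (negPf H) cards1.
rewrite -cD -prod_nat_const; apply: eq_bigr => x; rewrite inE => /andP [xC xB].
by rewrite /Gd (negPf xC) xB.
Qed.
End OneTree.

(** Given f, the pair of C and g is determined by the root r of g, since C is the descendant set of
    r and g is f on C apart from r. So the events on the left count distinct vertices r with at most
    K descendants. *)
Lemma smalldsc_mean K :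
  \sum_(j < #|B|.+1 | 0 < j <= K) 'C(#|B|, j) * (j ^ j.-1 * (#|B| - j) ^ (#|B| - j).+1) <=
  \sum_(f in Fam B) #|smalldsc f K B|.
Proof.
pose P (p : {set T} * {ffun T -> T}) := [&& p.1 \subset B, 0 < #|p.1| <= K & p.2 \in [set g in frs p.1 | #|roots g p.1| == 1]].
apply: (@leq_trans (\sum_(p | P p) #|Evd p.1 p.2|)).
  rewrite (eq_bigl (fun p : {set T} * {ffun T -> T} => ((p.1 \subset B) && (0 < #|p.1| <= K)) &&
     (p.2 \in [set g in frs p.1 | #|roots g p.1| == 1]))); last by move=> p; rewrite /P andbA.
  rewrite -(pair_big_dep (fun C : {set T} => (C \subset B) && (0 < #|C| <= K))
    (fun C g => g \in [set g in frs C | #|roots g C| == 1]) (fun C g => #|Evd C g|)) /=.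
  rewrite (eq_bigr (fun C : {set T} => (fun j => j ^ j.-1 * (#|B| - j) ^ (#|B| - j).+1) #|C|)); last first.
    move=> C /andP [CB /andP [C0 _]]; rewrite -card_rooted_trees // /nforests -sum_nat_const.
    apply: eq_bigr => g; rewrite in_set => /andP [gC /cards1P [r rg]].
    by rewrite (card_Evd CB rg) expnS.
  rewrite (partition_big (fun C : {set T} => inord #|C| : 'I_#|B|.+1) (fun j => 0 < j <= K)) /=; last first.
    by move=> C /andP [CB]; rewrite inordK // ltnS subset_leq_card.
  apply: leq_sum => j jK; rewrite -cards_draws -sum_nat_const.
  rewrite [leqRHS](eq_bigr (fun=> j ^ j.-1 * (#|B| - j) ^ (#|B| - j).+1)); last first.
    by move=> C /andP [/andP [CB _] /eqP <-]; rewrite inordK // ltnS subset_leq_card.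
  rewrite big_mkcond [leqRHS]big_mkcond; apply: leq_sum => C _.
  rewrite in_set; case: (boolP (C \subset B)) => //= CB; case: eqP => // e.
  have jE : inord #|C| = j by apply: val_inj; rewrite /= inordK ?ltnS ?subset_leq_card.
  have cK : 0 < #|C| <= K by move: jK; rewrite -e.
  by rewrite jE eqxx andbT ifT.
rewrite (eq_bigr (fun p => \sum_(f in Fam B) (f \in Evd p.1 p.2 : nat))); last first.
  move=> [C g] /and3P [/= CB _]; rewrite in_set => /andP [gC /cards1P [r rg]].
  rewrite -sum1_card big_mkcond [RHS]big_mkcond; apply: eq_bigr => f _.
  case: (boolP (f \in Evd C g)) => [fE|_]; last by case: ifP.
  by rewrite (Evd_Fam CB gC fE).
rewrite exchange_big /=; apply: leq_sum => f fF.
pose Q := [set p | P p && (f \in Evd p.1 p.2)].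
have -> : \sum_(i | P i) (f \in Evd i.1 i.2 : nat) = #|Q|.
  rewrite -sum1_card big_mkcond [RHS]big_mkcond; apply: eq_bigr => p _.
  have -> : (p \in Q) = P p && (f \in Evd p.1 p.2) by rewrite in_set.
  by case: (P p) => //=; case: (f \in Evd p.1 p.2).
case: (set_0Vmem B) => [B0|[b0 b0B]].
  rewrite (_ : Q = set0) ?cards0 //; apply/setP => -[C g]; rewrite !inE /P /= B0.
  by case: (boolP (C \subset set0)) => //=; rewrite subset0 => /eqP ->; rewrite cards0.
pose rt (p : {set T} * {ffun T -> T}) := odflt b0 [pick r in roots p.2 p.1].
have QP p : p \in Q -> [/\ p.1 \subset B, 0 < #|p.1| <= K, p.2 \in frs p.1, roots p.2 p.1 = [set rt p] & f \in Evd p.1 p.2].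
  rewrite in_set /P => /andP [/and3P [CB cK]]; rewrite in_set => /andP [gC /cards1P [r rg]] fE.
  split=> //; rewrite rg /rt; case: pickP => [x|/(_ r)]; rewrite /= rg inE ?eqxx //.
  by move=> /eqP ->.
rewrite -(card_in_imset (f := rt)).
  apply/subset_leq_card/subsetP => _ /imsetP [p /QP [CB /andP [_ cK] gC rg fE] ->].
  rewrite in_set (Evd_dsc gC rg fE) cK andbT; apply: (subsetP CB).
  by have := set11 (rt p); rewrite -rg => /rootsP [].
move=> [C g] [C' g'] /QP [/= CB _ gC rg fE] /QP [/= CB' _ gC' rg' fE'] e.
have eC : C = C' by rewrite -(Evd_dsc gC rg fE) -(Evd_dsc gC' rg' fE') e.
rewrite -eC in gC' rg' fE' e *; congr (_, _); apply/ffunP => x.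
have [_ sg] := frsP _ _ gC; have [_ sg'] := frsP _ _ gC'.
have [xC|xC] := boolP (x \in C); last by rewrite (stable_out sg) // (stable_out sg').
have [xr|nr] := eqVneq x (rt (C, g)); last first.
  by rewrite -(Evd_in rg fE xC nr) -(Evd_in rg' fE' xC) // -e.
have : x \in roots g C by rewrite rg xr set11.
have : x \in roots g' C by rewrite rg' xr e set11.
by move=> /rootsP [_ ->] /rootsP [_ ->].
Qed.
End Descendants.

(** * Restriction of balls and descendants to one tree *)

Section Locality.
Variable T : finType.
Implicit Types (f : {ffun T -> T}) (a : rel T) (C : {set T}).

Lemma fball_closed a C v l : {in C, forall x y, a x y -> y \in C} -> v \in C ->
  fball a v l \subset C.
Proof.
move=> cl vC; elim: l => [|l IH]; first by rewrite fball0 sub1set.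
apply/subsetP => y /fballSP [/(subsetP IH) //|[x /(subsetP IH) xC]]; exact: cl.
Qed.

Definition cc f v := cell f [set: T] (froot f v).

Lemma in_cc f v x : (x \in cc f v) = (froot f x == froot f v).
Proof. by rewrite /cc /cell in_set in_setT. Qed.

Lemma cc_closed f v : acyc f -> {in cc f v, forall x y, fadj f x y -> y \in cc f v}.
Proof. by move=> af x; rewrite in_cc => /eqP xv y /(fadj_froot af) e; rewrite in_cc -e xv. Qed.

Lemma fadj_restr f C : acyc f -> {in C, forall x, f x \in C} ->
  (forall x, f x \in C -> x \in C) -> forall x y, x \in C ->
  fadj (restr f C) x y = fadj f x y.
Proof.
move=> af c1 c2 x y xC; rewrite /fadj !restrE xC; case: (boolP (y \in C)) => // yC.
case: (eqVneq x y) => //= xy; rewrite orbF; case: (f x == y) => //=.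
by apply/esym/negbTE; apply: contraNN yC => /eqP e; apply: c2; rewrite e.
Qed.

Lemma cell_restr_adj f r x y : acyc f -> x \in cell f [set: T] r ->
  fadj (restr f (cell f [set: T] r)) x y = fadj f x y.
Proof.
move=> af; apply: fadj_restr => // z; rewrite !in_set.
  by rewrite frootS.
by rewrite frootS.
Qed.

Variables (k : nat) (E : rel 'I_k) (rH : 'I_k) (l : nat).

Lemma closed_fball a a' C v : {in C, forall x y, a x y -> y \in C} ->
  (forall x y, x \in C -> a x y = a' x y) -> v \in C ->
  fiso E rH a v l = fiso E rH a' v l /\ fball a v l.+1 = fball a' v l.+1.
Proof.
move=> cl aa' vC; have cl' : {in C, forall x y, a' x y -> y \in C}.
  by move=> x xC y; rewrite -aa' //; apply: cl.
have dj (b : rel T) s : {in C, forall x y, b x y -> y \in C} -> [disjoint fball b v s & ~: C].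
  by move=> cb; rewrite disjoints_subset setCK fball_closed.
split.
  apply/idP/idP => /existsP [phi H]; apply/existsP; exists phi; apply: (isom_local (X := ~: C) _ _ H).
  - by move=> x y; rewrite inE negbK; apply: aa'.
  - exact: dj.
  - by move=> x y; rewrite inE negbK => xC; rewrite aa'.
  - exact: dj.
elim: l.+1 => [//|s IH]; apply/setP => y.
apply/fballSP/fballSP; rewrite -IH => -[|[x xB]]; try by left.
  by rewrite aa' => [|]; [right; exists x|apply: (subsetP (fball_closed _ cl vC)) xB].
by rewrite -aa' => [|]; [right; exists x|apply: (subsetP (fball_closed _ cl vC)) xB].
Qed.

Lemma cell_ball f r v : acyc f -> v \in cell f [set: T] r ->
  fiso E rH (fadj (restr f (cell f [set: T] r))) v l = fiso E rH (fadj f) v l /\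
  fball (fadj (restr f (cell f [set: T] r))) v l.+1 = fball (fadj f) v l.+1.
Proof.
move=> af vC; apply: closed_fball vC => [x xC y|x y xC]; last by rewrite cell_restr_adj.
by rewrite cell_restr_adj // => /(fadj_froot af) e; move: xC; rewrite !in_set e.
Qed.

Lemma dsc_restr f C u : u \in C -> {in C, forall x, f x \in C} ->
  (forall x, f x \in C -> x \in C) -> dsc (restr f C) u = dsc f u.
Proof.
move=> uC c1 c2; apply/setP => x; rewrite !in_set; case: (boolP (x \in C)) => xC.
  apply/fconnectP/fconnectP => -[i ->]; exists i.
    by apply: (agree_iter (B := C)) => // z zC; rewrite restrE zC.
  by apply/esym; apply: (agree_iter (B := C)) => // z zC; rewrite restrE zC.
apply/fconnectP/fconnectP => -[i ui].
  suff e j : iter j (restr f C) x = x by move: uC; rewrite ui e (negPf xC).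
  by elim: j => //= j ->; rewrite restrE (negPf xC).
case/negP: xC; move: uC; rewrite {}ui; elim: i => //= i IH /c2; exact: IH.
Qed.

Definition smallv f K : {set T} := [set v | #|cc f v| <= K].

Lemma sum_cells f (P : {set T} -> bool) (Q : T -> bool) : acyc f ->
  #|[set v | P (cc f v) && Q v]| =
  \sum_(r in roots f [set: T] | P (cell f [set: T] r)) #|[set v in cell f [set: T] r | Q v]|.
Proof.
move=> af; rewrite -sum1_card (partition_big (fun v => froot f v)
  (fun r => (r \in roots f [set: T]) && P (cell f [set: T] r))) /=.
  apply: eq_bigr => r /andP [rr Pr]; rewrite -sum1_card; apply: eq_bigl => v.
  rewrite [v \in [set v0 | _]]in_set [RHS]in_set [v \in cell _ _ _]in_set in_setT /= /cc.
  by case: eqP => [->|]; rewrite ?andbF // Pr andbT.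
move=> v; rewrite in_set => /andP [Pv _]; rewrite Pv andbT in_set in_setT /=.
by rewrite froot_fix.
Qed.
End Locality.

From mathcomp Require Import perm.

(** * Forests with a prescribed root set *)

Section SpecifiedRoots.
Variable T : finType.
Implicit Types (A B L : {set T}) (f g h : {ffun T -> T}) (x y r v : T).

Definition rooted_at A L := [set h in frs A | roots h A == L].

Definition conj2 x y f : {ffun T -> T} := [ffun z => tperm x y (f (tperm x y z))].

Lemma conj2_iter x y f i z : iter i (conj2 x y f) z = tperm x y (iter i f (tperm x y z)).
Proof. by elim: i => [|i IH] /=; rewrite ?tpermK // IH ffunE tpermK. Qed.

Lemma conj2K x y : involutive (conj2 x y).
Proof. by move=> f; apply/ffunP => z; rewrite !ffunE !tpermK. Qed.

Lemma rooted_at_swap A L x y : x \in L -> L \subset A -> y \in A -> y \notin L ->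
  #|rooted_at A L| <= #|rooted_at A (y |: L :\ x)|.
Proof.
move=> xL LA yA yL; rewrite -(card_imset _ (inv_inj (conj2K x y))).
have xA := subsetP LA x xL.
have tA z : (tperm x y z \in A) = (z \in A).
  by case: tpermP => // ->; rewrite xA yA.
apply/subset_leq_card/subsetP => _ /imsetP [f /setIdP [/frsP [af sf] /eqP rf] ->].
apply/setIdP; split.
  apply/frsP; split.
    apply/acycP => z; have /acycP/(_ (tperm x y z)) [i Hi] := af.
    by exists i; rewrite -iterS !conj2_iter iterS Hi.
  apply/forallP => z; rewrite ffunE; case: ifPn => zA.
    by rewrite tA; apply: stable_in sf _; rewrite tA.
  by rewrite (stable_out sf) ?tA // tpermK.
apply/eqP/setP => z; rewrite inE ffunE.
have -> : (tperm x y (f (tperm x y z)) == z) = (f (tperm x y z) == tperm x y z).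
  by rewrite -{2}[z](tpermK x y) (inj_eq perm_inj).
have := in_set1 z z; have -> : (z \in A) && (f (tperm x y z) == tperm x y z) = (tperm x y z \in L).
  by rewrite -rf inE tA.
rewrite !inE; case: tpermP => [->|->|/eqP/negPf -> /eqP/negPf ->] // _.
  rewrite (negPf yL) eqxx /= orbF; case: eqVneq => // e.
  by move: yL; rewrite -e xL.
by rewrite xL eqxx.
Qed.

(** Conjugation by a transposition exchanges one root for another vertex, so the number of forests
    depends on the root set through its size only. *)
Lemma rooted_at_le A L L' : L \subset A -> L' \subset A -> #|L| = #|L'| ->
  #|rooted_at A L| <= #|rooted_at A L'|.
Proof.
have [n] := ubnP #|L :\: L'|; elim: n L => // n IH L cL LA LA' eL.
have [e|[x]] := set_0Vmem (L :\: L').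
  have s : L \subset L' by rewrite -setD_eq0 e.
  by have /eqP -> : L == L' by rewrite eqEcard s eL /=.
rewrite inE => /andP [xL' xL].
have [e|[y]] := set_0Vmem (L' :\: L).
  have s : L' \subset L by rewrite -setD_eq0 e.
  have /eqP E : L' == L by rewrite eqEcard s eL /=.
  by move: xL'; rewrite E xL.
rewrite inE => /andP [yL yL'].
apply: leq_trans (rooted_at_swap xL LA (subsetP LA' y yL') yL) _; apply: IH.
- have lt : #|(y |: L :\ x) :\: L'| < #|L :\: L'|.
    apply: proper_card; apply/properP; split.
      apply/subsetP => z; rewrite !inE => /andP [zL' /orP [/eqP e|/andP [_ ->]]]; rewrite zL' //.
      by move: zL'; rewrite e yL'.
    exists x; first by rewrite inE xL' xL.
    rewrite !inE eqxx /= orbF xL' /=; by apply: contraNneq xL' => ->.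
  exact: leq_trans lt _.
- apply/subsetP => z; rewrite !inE => /orP [/eqP ->|/andP [_ zL]].
    exact: (subsetP LA').
  exact: (subsetP LA).
- exact: LA'.
- by rewrite cardsU1 !inE (negPf yL) andbF -eL (cardsD1 x L) xL.
Qed.

Lemma card_rooted_at A L : L \subset A ->
  'C(#|A|, #|L|) * #|rooted_at A L| = nforests A #|L|.
Proof.
move=> LA; rewrite -cards_draws -sum_nat_const.
have -> : nforests A #|L| = \sum_(L' in [set L' : {set T} | L' \subset A & #|L'| == #|L|]) #|rooted_at A L'|.
  rewrite /nforests -sum1_card (partition_big (fun f => roots f A)
    (fun L' => L' \in [set L' : {set T} | L' \subset A & #|L'| == #|L|])) /=; last first.
    move=> f /setIdP [_ cf]; rewrite inE cf andbT; apply/subsetP => x; by case/rootsP.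
  apply: eq_bigr => L' /setIdP [_ cL']; rewrite sum1_card; apply: eq_card => f.
  rewrite unfold_in; apply/idP/idP => H; move: H;
  [by case/andP => /setIdP [ff _] e; apply/setIdP|case/setIdP => ff e].
  by apply/andP; split => //; apply/setIdP; rewrite ff (eqP e).
apply: eq_bigr => L' /setIdP [L'A /eqP cL']; apply/eqP.
by rewrite eqn_leq !rooted_at_le.
Qed.
End SpecifiedRoots.

(** * Trees with a prescribed ball around the root *)

Section EmbedTree.
Variable T : finType.
Implicit Types (A B L : {set T}) (f g h : {ffun T -> T}) (x y r v : T).
Variables (k : nat) (E : rel 'I_k) (rH : 'I_k) (l : nat) (par : 'I_k -> 'I_k) (D : 'I_k -> nat).
Hypothesis td : tdata E rH l par D.
Variable B : {set T}.
Let I := #|[set i | D i < l]|.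

Lemma card_depthset : #|depthset l D| + I = k.
Proof.
rewrite -[RHS]card_ord -(cardsC [set i | D i < l]) addnC; congr (_ + #|pred_of_set _|).
apply/setP => i; rewrite !inE -leqNgt; have [_ _ _ Dl _] := td.
by rewrite eqn_leq Dl.
Qed.

Section OnePhi.
Variable phi : {ffun 'I_k -> T}.
Hypotheses (iphi : injective phi) (phiB : forall i, phi i \in B).
Let PI := phi @: [set i | D i < l].
Let PL := phi @: depthset l D.

(** A tree whose ball around its root is the image of [phi] is this image together with a forest h
    hung below it: h lives on B without the inner vertices and has the images of the vertices at
    depth l as its roots. *)
Definition attach h : {ffun T -> T} :=
  [ffun x => if [pick i | phi i == x] is Some i then phi (par i) else h x].

Lemma attach_phi h i : attach h (phi i) = phi (par i).
Proof.
rewrite ffunE; case: pickP => [j /eqP /iphi ->|/(_ i)] //; by rewrite eqxx.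
Qed.

Lemma attach_out h x : x \notin phi @: setT -> attach h x = h x.
Proof.
move=> xP; rewrite ffunE; case: pickP => // i /eqP e.
by move: xP; rewrite -e imset_f.
Qed.

Lemma PIL x : x \in phi @: setT -> (x \in PL) = (x \notin PI).
Proof.
case/imsetP => i _ ->; rewrite !mem_imset // !inE -leqNgt.
by have [_ _ _ Dl _] := td; rewrite eqn_leq Dl.
Qed.

Section OneH.
Variable h : {ffun T -> T}.
Hypothesis hR : h \in rooted_at (B :\: PI) PL.
Let ah : acyc h. Proof. by case/setIdP: hR => /frsP []. Qed.
Let sh : stable h (B :\: PI). Proof. by case/setIdP: hR => /frsP []. Qed.
Let rh : roots h (B :\: PI) = PL. Proof. by case/setIdP: hR => _ /eqP. Qed.
Notation F := (attach h).

Lemma attach_iter_phi i t : iter t F (phi i) = phi (iter t par i).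
Proof. by elim: t => //= t ->; rewrite attach_phi. Qed.

Lemma attach_to_root i : iter (D i) F (phi i) = phi rH.
Proof.
rewrite attach_iter_phi; congr (phi _); apply: (td_root td).
by rewrite (td_iter td) // subnn.
Qed.

Lemma attach_froot x : x \in B -> exists t, iter t F x = phi rH.
Proof.
move: x; apply: (acyc_ind (P := fun x => x \in B -> exists t, iter t F x = phi rH) ah) => x.
  move=> hx xB; case: (boolP (x \in phi @: setT)) => [/imsetP [i _ ->]|xP].
    by exists (D i); apply: attach_to_root.
  have xD : x \in B :\: PI.
    rewrite inE xB andbT; apply: contra xP => /imsetP [i _ ->]; exact: imset_f.
  have : x \in PL by rewrite -rh inE xD hx eqxx.
  by case/imsetP => i _ e; move: xP; rewrite e imset_f.
move=> nx IH xB; case: (boolP (x \in phi @: setT)) => [/imsetP [i _ ->]|xP].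
  by exists (D i); apply: attach_to_root.
have xD : x \in B :\: PI.
  rewrite inE xB andbT; apply: contra xP => /imsetP [i _ ->]; exact: imset_f.
have := stable_in sh xD; rewrite inE => /andP [_ /IH [t Ht]].
by exists t.+1; rewrite iterSr attach_out.
Qed.

Lemma attach_rroot : F (phi rH) = phi rH.
Proof. by rewrite attach_phi; case: td => _ ->. Qed.

Lemma attach_outB x : x \notin B -> F x = x.
Proof.
move=> xB; rewrite attach_out; last by apply: contra xB => /imsetP [i _ ->].
by apply: (stable_out sh); rewrite inE (negPf xB) andbF.
Qed.

Lemma attach_tree : F \in trees B (phi rH).
Proof.
have sF : stable F B.
  apply/forallP => x; case: ifPn => xB; last by rewrite attach_outB.
  case: (boolP (x \in phi @: setT)) => [/imsetP [i _ ->]|xP]; first by rewrite attach_phi.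
  rewrite attach_out //; have xD : x \in B :\: PI.
    rewrite inE xB andbT; apply: contra xP => /imsetP [i _ ->]; exact: imset_f.
  by have := stable_in sh xD; rewrite inE => /andP [].
apply/treesP; split => //.
  apply/acycP => x; case: (boolP (x \in B)) => xB; last by exists 0; rewrite /= attach_outB.
  by have [t e] := attach_froot xB; exists t; rewrite e attach_rroot.
apply/setP => x; rewrite !inE; apply/andP/eqP => [[xB /eqP fx]|->]; last by rewrite phiB attach_rroot.
by have [t <-] := attach_froot xB; elim: t => //= t <-.
Qed.

Lemma attach_isom : isom E rH (fadj F) (phi rH) l phi.
Proof.
apply: (embed_isom td) => //.
  move=> i j; have [_ pr DS _ EE] := td; rewrite EE /fadj (inj_eq iphi) !attach_phi !(inj_eq iphi).
  have ne (u v : 'I_k) : u != rH -> par u == v -> u != v.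
    by move=> nu /eqP <-; apply: contraTneq (leqnn (D u)) => e; rewrite {2}e DS // -e ltnn.
  apply/orP/andP => [[/andP [ni pi]|/andP [nj pj]]|[nij /orP [] p]].
  - by rewrite pi (ne _ _ ni pi).
  - by rewrite pj orbT eq_sym (ne _ _ nj pj).
  - left; rewrite p andbT; apply: contra nij => /eqP e; by move: p; rewrite e pr.
  - right; rewrite p andbT; apply: contra nij => /eqP e; by move: p; rewrite e pr eq_sym.
move=> i w Di /andP [ne /orP [/eqP <-|/eqP fw]]; first by rewrite attach_phi imset_f.
apply: contraT => wP; have wB : w \in B.
  by apply: contraT => wB; move: ne; rewrite -fw attach_outB // eqxx.
have wD : w \in B :\: PI.
  rewrite inE wB andbT; apply: contra wP => /imsetP [j _ ->]; exact: imset_f.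
have := stable_in sh wD; rewrite -(attach_out h wP) fw inE => /andP [/negP []].
by apply: imset_f; rewrite inE.
Qed.
End OneH.

Lemma attach_inj : {in rooted_at (B :\: PI) PL &, injective attach}.
Proof.
move=> h h' /setIdP [/frsP [_ sh] /eqP rh] /setIdP [/frsP [_ sh'] /eqP rh'] /ffunP e.
apply/ffunP => x; have := e x; case: (boolP (x \in phi @: setT)) => xP; last by rewrite !attach_out.
case: (boolP (x \in PI)) => xI _.
  by rewrite (stable_out sh) ?(stable_out sh') // inE xI.
have xL : x \in PL by rewrite PIL.
have : x \in roots h (B :\: PI) by rewrite rh.
have : x \in roots h' (B :\: PI) by rewrite rh'.
by move=> /rootsP [_ ->] /rootsP [_ ->].
Qed.

Lemma card_attach : #|rooted_at (B :\: PI) PL| <=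
  #|[set g in trees B (phi rH) | isom E rH (fadj g) (phi rH) l phi]|.
Proof.
rewrite -(card_in_imset attach_inj); apply/subset_leq_card/subsetP => _ /imsetP [h hR ->].
by rewrite in_set (attach_tree hR) (attach_isom hR).
Qed.

Lemma card_rooted_phi : 'C(#|B| - I, #|depthset l D|) * #|rooted_at (B :\: PI) PL| =
  nforests (B :\: PI) #|depthset l D|.
Proof.
have cL : #|PL| = #|depthset l D| by rewrite card_imset.
have cI : #|B :\: PI| = #|B| - I.
  rewrite cardsDS ?card_imset //; apply/subsetP => _ /imsetP [i _ ->] //.
rewrite -cL -cI card_rooted_at //; apply/subsetP => _ /imsetP [i iL ->].
rewrite inE phiB andbT mem_imset // inE; move: iL; rewrite inE => /eqP ->.
by rewrite ltnn.
Qed.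
End OnePhi.

Lemma fiso_ext (a a' : rel T) v : a =2 a' -> fiso E rH a v l = fiso E rH a' v l.
Proof.
move=> aa; have H (b b' : rel T) : b =2 b' -> fiso E rH b v l -> fiso E rH b' v l.
  move=> bb /existsP [p ip]; apply/existsP; exists p; apply: (@isom_local _ _ _ _ b b' _ _ set0) ip.
    by move=> x y _; apply: bb.
  by rewrite disjoint_sym; apply/pred0P => x; rewrite /= inE.
by apply/idP/idP; apply: H.
Qed.

(** Balls depend on the edge set alone, so each tree may be re-rooted at the centre of the ball,
    where the ball consists of the first l generations. *)
Lemma sum_tree_balls r0 : r0 \in B ->
  \sum_(g in trees B r0) #|[set v in B | fiso E rH (fadj g) v l]| =
  \sum_(v in B) #|[set g in trees B v | fiso E rH (fadj g) v l]|.
Proof.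
move=> r0B.
pose P v (G : {set {set T}}) := fiso E rH (fun x y => [set x; y] \in G) v l.
have PE v g : fiso E rH (fadj g) v l = P v (gr g).
  by apply: fiso_ext => x y; rewrite gr_adj.
rewrite (eq_bigr (fun g => \sum_(v in B) (P v (gr g) : nat))); last first.
  move=> g _; rewrite -sum1_card big_mkcond [RHS]big_mkcond; apply: eq_bigr => v _.
  by rewrite in_set PE; case: (v \in B) => //=; case: (P _ _).
rewrite exchange_big /=; apply: eq_bigr => v vB.
have := @reroot_card T B r0 v (P v) r0B vB => H.
transitivity #|[set g in trees B r0 | P v (gr g)]|.
  rewrite -sum1_card big_mkcond [RHS]big_mkcond; apply: eq_bigr => g _.
  have -> : (g \in [set g in trees B r0 | P v (gr g)]) = (g \in trees B r0) && P v (gr g) by rewrite in_set.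
  by case: (g \in trees B r0) => //=; case: (P _ _).
rewrite H; apply: eq_card => g; rewrite !in_set -PE; by [].
Qed.

Lemma tree_balls_lb r0 N : r0 \in B ->
  (forall A : {set T}, #|A| = #|B| - I -> nforests A #|depthset l D| = N) ->
  #|B| ^_ k * N <= 'C(#|B| - I, #|depthset l D|) *
    (Aut E rH * \sum_(g in trees B r0) #|[set v in B | fiso E rH (fadj g) v l]|).
Proof.
move=> r0B HN; rewrite sum_tree_balls //.
pose Phi := [set phi : {ffun 'I_k -> T} in ffun_on (mem B) | injectiveb phi].
have cP : #|Phi| = #|B| ^_ k by rewrite /Phi card_inj_ffuns_on card_ord.
have PhiP phi : phi \in Phi -> injective phi /\ forall i, phi i \in B.
  by rewrite in_set => /andP [/ffun_onP H /injectiveP].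
rewrite -cP -sum_nat_const.
apply: (@leq_trans (\sum_(phi in Phi) 'C(#|B| - I, #|depthset l D|) *
   #|[set g in trees B (phi rH) | isom E rH (fadj g) (phi rH) l phi]|)).
  apply: leq_sum => phi /PhiP [ip pB].
  rewrite -(HN (B :\: phi @: [set i | D i < l])).
    by rewrite -card_rooted_phi // leq_mul2l card_attach // orbT.
  rewrite cardsDS ?card_imset //; by apply/subsetP => _ /imsetP [i _ ->].
rewrite -big_distrr leq_mul2l; apply/orP; right; rewrite big_distrr /=.
apply: (@leq_trans (\sum_(v in B) \sum_(phi | (phi \in Phi) && (phi rH == v))
    #|[set g in trees B v | isom E rH (fadj g) v l phi]|)).
  rewrite (partition_big (fun phi : {ffun 'I_k -> T} => phi rH) (fun v => v \in B)) /=; last by move=> phi /PhiP [].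
  by apply: leq_sum => v vB; apply: leq_sum => phi /andP [_ /eqP ->].
apply: leq_sum => v vB.
apply: (@leq_trans (\sum_(phi : {ffun 'I_k -> T}) #|[set g in trees B v | isom E rH (fadj g) v l phi]|)).
  by rewrite [leqRHS](bigID (fun phi => (phi \in Phi) && (phi rH == v))) /= leq_addr.
rewrite (eq_bigr (fun phi => \sum_(g in trees B v) (isom E rH (fadj g) v l phi : nat))); last first.
  move=> phi _; rewrite -sum1_card big_mkcond [RHS]big_mkcond; apply: eq_bigr => g _.
  have -> : (g \in [set g in trees B v | isom E rH (fadj g) v l phi]) = (g \in trees B v) && isom E rH (fadj g) v l phi by rewrite in_set.
  by case: (g \in trees B v) => //=; case: (isom _ _ _ _ _ _).
rewrite exchange_big /= mulnC -sum_nat_const.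
apply: (@leq_trans (\sum_(g in trees B v) Aut E rH * fiso E rH (fadj g) v l)).
  apply: leq_sum => g _; apply: leq_trans (card_isom _ _ _ _ _).
  by rewrite -sum1_card big_mkcond [leqRHS]big_mkcond; apply: leq_sum => phi _; rewrite inE; case: ifP.
rewrite big_mkcond [leqRHS]big_mkcond; apply: leq_sum => g _.
have -> : (g \in [set g in trees B v | fiso E rH (fadj g) v l]) = (g \in trees B v) && fiso E rH (fadj g) v l by rewrite in_set.
by case: (g \in trees B v) => //=; case: (fiso _ _ _ _ _); rewrite ?muln1 ?muln0.
Qed.
End EmbedTree.

Local Open Scope ring_scope.

(** * The exponential formula *)

Section ExponentialFormula.
Variables (T : finType) (R : comNzRingType) (om : {set T} -> {ffun T -> T} -> R).
Implicit Types (f g h : {ffun T -> T}) (A B C : {set T}) (x y u v r : T).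

Definition fweight f A : R :=
  \prod_(r in roots f A) om (cell f A r) (restr f (cell f A r)).
Definition fsum A k : R := \sum_(f in frs A | #|roots f A| == k) fweight f A.
Definition tsum B : R := \sum_(g in frs B | #|roots g B| == 1%N) om B g.

Lemma fweight_merge A B g h : B \subset A -> g \in frs B -> h \in frs (A :\: B) ->
  #|roots g B| == 1%N -> fweight (merge B g h) A = om B g * fweight h (A :\: B).
Proof.
move=> sB gB hB /cards1P [r rE].
have rr : r \in roots g B by rewrite rE set11.
rewrite /fweight merge_roots // rE (bigD1 r) /=; last by rewrite !inE eqxx.
have cB : cell g B r = B.
  apply/setP => x; rewrite inE; case: (boolP (x \in B)) => //= xB.
  by have := froot_in gB xB; rewrite rE inE.
rewrite merge_celll // cB merge_restrl //; congr (_ * _).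
have rB : r \in B by case/rootsP: rr.
apply: eq_big => [x|x].
  rewrite !inE; case: (eqVneq x r) => [->|] /=; last by rewrite andbT.
  by rewrite rB.
rewrite inE => /andP [xr nx].
have xh : x \in roots h (A :\: B) by move: xr; rewrite !inE (negPf nx).
by rewrite merge_cellr // (merge_restrr (A := A)) // cell_sub.
Qed.

Lemma fweight_cut f A r : f \in frs A -> r \in roots f A ->
  fweight f A = om (cell f A r) (restr f (cell f A r)) *
     fweight (restr f (A :\: cell f A r)) (A :\: cell f A r).
Proof.
move=> ff rr; have /frsP [af sf] := ff.
rewrite -{1}(merge_cut r ff) fweight_merge ?cell_sub //.
- by apply: restr_frs => //; apply: cell_closed.
- by apply: restr_frs => //; apply: co_closed.
- by rewrite cell_roots // cards1.
Qed.

(** Both sides weigh forests with k + 1 trees and one marked tree; the right side cuts the marked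
    tree out. *)
Lemma exponential_formula A k :
  k.+1%:R * fsum A k.+1 = \sum_(B : {set T} | B \subset A) tsum B * fsum (A :\: B) k.
Proof.
pose P (p : {ffun T -> T} * T) :=
  [&& p.1 \in frs A, #|roots p.1 A| == k.+1 & p.2 \in roots p.1 A].
pose Q (q : {set T} * ({ffun T -> T} * ({ffun T -> T} * T))) :=
  [&& q.1 \subset A, q.2.1 \in frs q.1, #|roots q.2.1 q.1| == 1%N,
    q.2.2.1 \in frs (A :\: q.1), #|roots q.2.2.1 (A :\: q.1)| == k &
    q.2.2.2 \in roots q.2.1 q.1].
transitivity (\sum_(p | P p) fweight p.1 A).
  rewrite /fsum mulr_sumr /P.
  rewrite [RHS](eq_bigl (fun p => ((p.1 \in frs A) && (#|roots p.1 A| == k.+1))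
     && (p.2 \in roots p.1 A))); last by move=> p; rewrite andbA.
  rewrite -(pair_big_dep (fun f => (f \in frs A) && (#|roots f A| == k.+1))
     (fun f r => r \in roots f A) (fun f _ => fweight f A)) /=.
  apply: eq_bigr => f /andP [_ /eqP cf].
  by rewrite sumr_const cf mulr_natl.
transitivity (\sum_(q | Q q) om q.1 q.2.1 * fweight q.2.2.1 (A :\: q.1)); last first.
  rewrite [LHS](eq_bigl (fun q : {set T} * ({ffun T -> T} * ({ffun T -> T} * T)) => (q.1 \subset A) &&
    [&& q.2.1 \in frs q.1, #|roots q.2.1 q.1| == 1%N,
    q.2.2.1 \in frs (A :\: q.1), #|roots q.2.2.1 (A :\: q.1)| == k &
    q.2.2.2 \in roots q.2.1 q.1])) //.
  rewrite -(pair_big_dep (fun B => B \subset A) (fun B (q : {ffun T -> T} * ({ffun T -> T} * T)) =>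
    [&& q.1 \in frs B, #|roots q.1 B| == 1%N,
    q.2.1 \in frs (A :\: B), #|roots q.2.1 (A :\: B)| == k &
    q.2.2 \in roots q.1 B]) (fun B q => om B q.1 * fweight q.2.1 (A :\: B))) /=.
  apply: eq_bigr => B sB; rewrite /tsum mulr_suml.
  rewrite (eq_bigl (fun q : {ffun T -> T} * ({ffun T -> T} * T) =>
    ((q.1 \in frs B) && (#|roots q.1 B| == 1%N)) &&
    [&& q.2.1 \in frs (A :\: B), #|roots q.2.1 (A :\: B)| == k &
    q.2.2 \in roots q.1 B])); last by move=> q; rewrite !andbA.
  rewrite -(pair_big_dep (fun g => (g \in frs B) && (#|roots g B| == 1%N))
    (fun g (q : {ffun T -> T} * T) => [&& q.1 \in frs (A :\: B),
    #|roots q.1 (A :\: B)| == k & q.2 \in roots g B])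
    (fun g q => om B g * fweight q.1 (A :\: B))) /=.
  apply: eq_bigr => g /andP [_ /cards1P [r rE]]; rewrite /fsum mulr_sumr.
  rewrite (eq_bigl (fun q : {ffun T -> T} * T =>
    ((q.1 \in frs (A :\: B)) && (#|roots q.1 (A :\: B)| == k)) && (q.2 \in roots g B)));
    last by move=> q; rewrite !andbA.
  rewrite -(pair_big_dep (fun h => (h \in frs (A :\: B)) && (#|roots h (A :\: B)| == k))
    (fun h r => r \in roots g B) (fun h _ => om B g * fweight h (A :\: B))) /=.
  by apply: eq_bigr => h _; rewrite rE big_set1.
pose F (q : {set T} * ({ffun T -> T} * ({ffun T -> T} * T))) :=
  (merge q.1 q.2.1 q.2.2.1, q.2.2.2).
pose G (p : {ffun T -> T} * T) := let B := cell p.1 A p.2 in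
  (B, (restr p.1 B, (restr p.1 (A :\: B), p.2))).
have FG p : P p -> F (G p) = p.
  by case: p => f r /and3P [/= ff _ rr]; rewrite /F /G /= merge_cut.
rewrite (reindex_onto F G FG).
apply: eq_big => [[B [g [h r]]]|[B [g [h r]]] /andP [/and3P [/= ff cf rr] /eqP]].
  rewrite /P /F /G /=; apply/andP/idP => [[]|].
    move: (merge B g h) => f /and3P [ff cf rr] /eqP [<- <- <-].
    have /frsP [af sf] := ff; rewrite /Q /= cell_sub restr_frs //=; last exact: cell_closed.
    rewrite cell_roots // cards1 eqxx restr_frs //=; last exact: co_closed.
    rewrite co_roots // set11 andbT.
    by have := cardsD1 r (roots f A); rewrite rr (eqP cf) add1n => -[->].
  rewrite /Q /= => /and5P [sB gB cg hB /andP [ch rr]].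
  have /cards1P [r' rE] := cg.
  have {r' rE} rE : roots g B = [set r] by move: rr; rewrite rE inE => /eqP ->.
  have rB : r \in B by case/rootsP: rr.
  have cB : cell g B r = B.
    apply/setP => x; rewrite inE; case: (boolP (x \in B)) => //= xB.
    by have := froot_in gB xB; rewrite rE inE.
  split.
    rewrite merge_frs // merge_roots // rE !inE eqxx /= cardsU1 (eqP ch).
    by rewrite !inE rB /= add1n eqxx.
  by rewrite merge_celll // cB merge_restrl // merge_restrD.
by rewrite /G /F /=; move: (merge B g h) ff rr => f ff rr [<- <- <-]; rewrite (fweight_cut ff rr).
Qed.

End ExponentialFormula.

Lemma sum_subsets (T : finType) (V : nmodType) (A : {set T}) (F : nat -> V) :
  \sum_(B : {set T} | B \subset A) F #|B| = \sum_(b < #|A|.+1) F b *+ 'C(#|A|, b).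
Proof.
rewrite (partition_big (fun B : {set T} => inord #|B| : 'I_#|A|.+1) xpredT) //=.
apply: eq_bigr => b _; rewrite -cards_draws.
rewrite -sumr_const; apply: eq_big => [B|B /andP [sB /eqP <-]]; last first.
  by rewrite inordK // ltnS subset_leq_card.
rewrite inE; apply: andb_id2l => sB.
by rewrite -val_eqE /= inordK // ltnS subset_leq_card.
Qed.

Lemma coef_exp_ge0 (R : numDomainType) (p : {poly R}) k i :
  (forall i, 0 <= p`_i) -> 0 <= (p ^+ k)`_i.
Proof.
move=> p0; elim: k i => [|k IH] i; first by rewrite expr0 coef1 ler0n.
by rewrite exprS coefM sumr_ge0 // => j _; rewrite mulr_ge0.
Qed.

Section ExpPoly.
Variables (T : finType) (R : realFieldType) (om : {set T} -> {ffun T -> T} -> R).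
Implicit Types (f g h : {ffun T -> T}) (A B C : {set T}).
Variable (N : nat) (Om : nat -> R).

(** Truncated to a polynomial. Only coefficients below N are ever compared, and these do not see the
    truncation. *)
Definition egf : {poly R} := \poly_(b < N) (Om b / b`!%:R).

Lemma fsum0 A : fsum om A 0 = (#|A| == 0%N)%:R.
Proof.
rewrite /fsum; have [/eqP/cards0_eq ->|nA] := boolP (#|A| == 0%N).
  rewrite (eq_bigl (pred1 [ffun x => x])).
    rewrite big_pred1_eq /fweight (_ : roots _ _ = set0) ?big_set0 //.
    by apply/setP => x; rewrite !inE.
  move=> f; rewrite /=; apply/andP/eqP => [[/frsP [_ sf] _]|->].
    by apply/ffunP => x; rewrite ffunE (stable_out sf) ?inE.
  split; last by apply/eqP/eq_card0 => x; rewrite !inE.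
  apply/frsP; split; first by apply/acycP => x; exists 0%N; rewrite ffunE.
  by apply/forallP => x; rewrite inE ffunE.
rewrite big1 // => f /andP [ff /eqP/cards0_eq r0].
have /set0Pn [x xA] : A != set0 by apply: contra nA => /eqP ->; rewrite cards0.
by have := froot_in ff xA; rewrite r0 inE.
Qed.

Hypothesis Om0 : forall b, 0 <= Om b.

Let step A k : (#|A| < N)%N ->
  \sum_(B : {set T} | B \subset A) Om #|B| *
     ((#|A :\: B|)`!%:R * ((egf ^+ k)`_#|A :\: B| / k`!%:R)) =
  (k.+1)%:R * (#|A|`!%:R * ((egf ^+ k.+1)`_#|A| / (k.+1)`!%:R)).
Proof.
move=> lt; rewrite (eq_bigr (fun B : {set T} => (fun b => Om b *
   ((#|A| - b)`!%:R * ((egf ^+ k)`_(#|A| - b) / k`!%:R))) #|B|)); last first.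
  by move=> B sB; rewrite cardsDS.
rewrite (@sum_subsets T R A (fun b => Om b * ((#|A| - b)`!%:R * ((egf ^+ k)`_(#|A| - b) / k`!%:R)))).
rewrite exprS coefM mulr_suml 2!mulr_sumr factS natrM.
apply: eq_bigr => b _; have bA : (b <= #|A|)%N by rewrite -ltnS.
rewrite coef_poly (leq_ltn_trans bA lt).
have := bin_fact bA => /(congr1 (fun n => n%:R : R)); rewrite !natrM => <-.
rewrite -mulr_natr.
have n0 m : (m`!)%:R != 0 :> R by rewrite pnatr_eq0 -lt0n fact_gt0.
have k0 : k.+1%:R != 0 :> R by rewrite pnatr_eq0.
have := n0 b; have := n0 k; move: (Om b) ((egf ^+ k)`_(#|A| - b)) => o c.
move: (b`!%:R : R) ((#|A| - b)`!%:R : R) (k`!%:R : R) => x y z z0 x0.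
by rewrite -mulr_natl -natr1; field; rewrite x0 z0 natr1 k0.
Qed.

Lemma fsum_le_egf A k : (#|A| < N)%N ->
  (forall B, B \subset A -> tsum om B <= Om #|B|) ->
  (forall B, B \subset A -> 0 <= tsum om B) ->
  fsum om A k <= #|A|`!%:R * ((egf ^+ k)`_#|A| / k`!%:R).
Proof.
move=> lt tO t0; elim: k => [|k IH] in A lt tO t0 *.
  rewrite fsum0 expr0 coef1 fact0 divr1.
  by case: eqP => [->|]; rewrite ?fact0 ?mulr1 ?mulr0.
rewrite -(ler_pM2l (_ : 0 < k.+1%:R)) ?ltr0Sn // exponential_formula -step //.
apply: ler_sum => B sB; apply: le_trans (_ : tsum om B * _ <= _).
  apply: ler_wpM2l; first exact: t0.
  have sD : A :\: B \subset A by apply: subsetDl.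
  apply: IH => [|C sC|C sC].
  - exact: leq_ltn_trans (subset_leq_card sD) lt.
  - by apply/tO/(subset_trans sC).
  - by apply/t0/(subset_trans sC).
apply: ler_wpM2r; last exact: tO.
rewrite mulr_ge0 ?ler0n // divr_ge0 ?ler0n //.
by apply: coef_exp_ge0 => i; rewrite coef_poly; case: ifP => // _; rewrite divr_ge0 ?ler0n.
Qed.

Lemma fsum_egf A k : (#|A| < N)%N ->
  (forall B, B \subset A -> tsum om B = Om #|B|) ->
  fsum om A k = #|A|`!%:R * ((egf ^+ k)`_#|A| / k`!%:R).
Proof.
move=> lt tO; elim: k => [|k IH] in A lt tO *.
  rewrite fsum0 expr0 coef1 fact0 divr1.
  by case: eqP => [->|]; rewrite ?fact0 ?mulr1 ?mulr0.
apply: (mulfI (_ : k.+1%:R != 0)); first by rewrite pnatr_eq0.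
rewrite exponential_formula -step //.
apply: eq_bigr => B sB; rewrite tO //; congr (_ * _).
have sD : A :\: B \subset A by apply: subsetDl.
apply: IH => [|C sC]; first exact: leq_ltn_trans (subset_leq_card sD) lt.
by apply/tO/(subset_trans sC).
Qed.

End ExpPoly.

(** Numbers of rooted and unrooted labelled trees on b vertices. The value at 0 is set apart because
    the powers would give 0^0 = 1. *)
Definition tnum b : nat := if b == 0%N then 0 else (b ^ b.-1)%N.
Definition cnum b : nat := if b == 0%N then 0 else (b ^ (b - 2))%N.

Lemma tnum_cnum b : tnum b = (b * cnum b)%N.
Proof.
rewrite /tnum /cnum; case: b => [|[|b]] //=.
by rewrite -expnS; congr (_ ^ _)%N; lia.
Qed.

Lemma tsum1 (T : finType) (R : realFieldType) (B : {set T}) :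
  tsum (fun _ _ => 1 : R) B = (tnum #|B|)%:R.
Proof.
rewrite /tsum sumr_const; have -> : #|fun g => (g \in frs B) && (#|roots g B| == 1%N)| = nforests B 1.
  by apply: eq_card => g; rewrite [RHS]inE.
rewrite /tnum; case: eqP => [/cards0_eq ->|/eqP n0]; last by rewrite card_rooted_trees ?lt0n.
rewrite /nforests (_ : [set _ in _ | _] = set0) ?cards0 //.
apply/setP => g; rewrite !inE; apply/negbTE/nandP; right.
rewrite (_ : roots g set0 = set0) ?cards0 //.
by apply/setP => x; rewrite !inE.
Qed.

Lemma fsum1 (T : finType) (R : realFieldType) (A : {set T}) k :
  fsum (fun _ _ => 1 : R) A k = (nforests A k)%:R.
Proof.
rewrite /fsum (eq_bigr (fun _ => 1)); last by move=> f _; rewrite /fweight big1.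
rewrite sumr_const; by congr (_%:R); apply: eq_card => g; rewrite [RHS]inE.
Qed.

Section TreeEgf.
Variable R : realFieldType.

Definition tegf N : {poly R} := egf N (fun b => (tnum b)%:R).

Lemma nforests_egf (T : finType) (A : {set T}) N k : (#|A| < N)%N ->
  (nforests A k)%:R = #|A|`!%:R * ((tegf N ^+ k)`_#|A| / k`!%:R) :> R.
Proof.
move=> lt; rewrite -fsum1 (@fsum_egf T R _ N (fun b => (tnum b)%:R)) //.
by move=> B _; rewrite tsum1.
Qed.

Lemma nforests_binE (T : finType) (A : {set T}) k : (0 < k <= #|A|)%N ->
  nforests A k = ('C(#|A|.-1, k.-1) * #|A| ^ (#|A| - k))%N.
Proof.
case: k => // k /andP [_ kA]; have lt : (#|A| - k.+1 < #|A|)%N by lia.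
have := nforestsE lt; rewrite subKn // => E.
apply/eqP; rewrite -(eqn_pmul2l (_ : 0 < #|A|)%N); last by lia.
apply/eqP; rewrite E mulnA; congr (_ * _)%N.
by case: (#|A|) kA => // a _; rewrite mulnC -mul_bin_diag.
Qed.

(** Coefficient form of T = x exp(T): deleting the root of a tree leaves a rooted forest. With the
    explicit forest numbers it becomes a case of the binomial theorem. *)
Lemma tnumS_forests a N : (a < N)%N ->
  (tnum a.+1)%:R / a.+1`!%:R =
  \sum_(k < a.+1) (tegf N ^+ k)`_a / k`!%:R :> R.
Proof.
move=> aN; have a1 : a.+1%:R != 0 :> R by rewrite pnatr_eq0.
have af : a`!%:R != 0 :> R by rewrite pnatr_eq0 -lt0n fact_gt0.
case: a => [|a] in aN a1 af *.
  by rewrite big_ord1 expr0 coef1 /= fact0 !divr1.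
apply: (mulfI af); rewrite (factS a.+1) natrM mulr_sumr.
rewrite (eq_bigr (fun k : 'I_a.+2 => (nforests [set: 'I_a.+1] k)%:R)); last first.
  by move=> k _; rewrite (@nforests_egf _ _ N) ?cardsT ?card_ord.
rewrite /tnum /=.
have -> : a.+1`!%:R * ((a.+2 ^ a.+1)%:R / (a.+2%:R * a.+1`!%:R)) = (a.+2 ^ a)%:R :> R.
  by rewrite expnS natrM; field; rewrite af -natrD add2n.
rewrite -natr_sum; congr (_%:R).
rewrite big_ord_recl {1}/nforests (_ : [set _ in _ | _] = set0); last first.
  apply/setP => f; rewrite !inE; apply/negbTE/negP => /andP [ff /eqP/cards0_eq r0].
  have fs : f \in frs [set: 'I_a.+1] by rewrite inE.
  by have := froot_in fs (in_setT ord0); rewrite r0 inE.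
rewrite cards0 add0n (eq_bigr (fun k : 'I_a.+1 => 'C(a, k) * (a.+1 ^ (a - k) * 1 ^ k))%N); last first.
  move=> k _; rewrite lift0 nforests_binE cardsT card_ord //=.
  by rewrite exp1n muln1 subSS.
by rewrite -expnDn addn1.
Qed.

(** Deleting an edge of an unrooted tree leaves two rooted trees, in two orders. As series, U = T -
    T^2 / 2. *)
Lemma two_forests_egf b N : (b < N)%N ->
  2 * (b%:R - 1) * ((cnum b)%:R / b`!%:R) = (tegf N ^+ 2)`_b :> R.
Proof.
move=> bN; have bf : b`!%:R != 0 :> R by rewrite pnatr_eq0 -lt0n fact_gt0.
have := @nforests_egf _ [set: 'I_b] N 2; rewrite cardsT card_ord => /(_ bN) E.
have -> : (tegf N ^+ 2)`_b = 2 * (nforests [set: 'I_b] 2)%:R / b`!%:R.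
  by rewrite E (_ : 2`! = 2%N) //; field; exact: bf.
case: b => [|[|b]] in bN bf E *.
- rewrite (_ : nforests _ _ = 0%N) ?mulr0n ?mulr0 ?mul0r ?mulr0 //.
  apply/eqP; rewrite cards_eq0 -subset0; apply/subsetP => f; rewrite inE => /andP [_ /eqP H].
  by have := max_card (roots f [set: 'I_0]); rewrite H card_ord.
- rewrite subrr mulr0 mul0r (_ : nforests _ _ = 0%N) ?mulr0 ?mul0r //.
  apply/eqP; rewrite cards_eq0 -subset0; apply/subsetP => f; rewrite inE => /andP [_ /eqP H].
  by have := max_card (roots f [set: 'I_1]); rewrite H card_ord.
by rewrite card_two_forests cardsT card_ord // /cnum /= natrM -(natr1 b.+1) addrK !mulrA.
Qed.

End TreeEgf.

From mathcomp Require Import all_classical all_reals all_analysis.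
(* Imported again so that set comprehensions denote finite sets by default. *)
From mathcomp Require Import ssrfun ssrbool eqtype ssrnat seq fintype finfun bigop finset.
From mathcomp Require Import all_order all_algebra.
Import Order.TTheory GRing.Theory Num.Theory.
Import numFieldTopology.Exports numFieldNormedType.Exports.
Local Open Scope ring_scope.

(** * Tree generating functions at their singularity *)

Section SingularValues.
Local Open Scope classical_set_scope.
Local Open Scope ring_scope.
Section TreeSeries.
Variable R : realType.
Implicit Types (p q : {poly R}) (x z : R).

Lemma trunc_horner_le q x N : 0 <= x -> (forall i, 0 <= q`_i) ->
  \sum_(a < N) q`_a * x ^+ a <= q.[x].
Proof.
move=> x0 q0; rewrite (@horner_coef_wide _ (maxn N (size q))) ?leq_maxr //.
rewrite (big_ord_widen (maxn N (size q)) (fun a => q`_a * x ^+ a)) ?leq_maxl //.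
rewrite [leRHS](bigID (fun i : 'I__ => (i < N)%N)) /= lerDl sumr_ge0 // => i _.
by rewrite mulr_ge0 // exprn_ge0.
Qed.

Lemma exp_partial_le z M : 0 <= z -> \sum_(k < M) z ^+ k / k`!%:R <= expR z.
Proof.
move=> z0; have := nondecreasing_cvgn_le _ (is_cvg_series_exp_coeff z) M.
rewrite /series /= big_mkord; apply.
apply: nondecreasing_series => i _ _; rewrite /exp_coeff /=.
by rewrite divr_ge0 ?exprn_ge0.
Qed.

Lemma exp_partial_lim z c : (forall M, \sum_(k < M) z ^+ k / k`!%:R <= c) -> expR z <= c.
Proof.
move=> H; apply: limr_le; first exact: is_cvg_series_exp_coeff.
by apply: nearW => M; rewrite /series /= big_mkord; apply: H.
Qed.

(** The tree series have radius of convergence e^-1. [ytree] and [utree] are partial sums there of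
    the series T and U of rooted and unrooted trees; their limits turn out to be 1 and 1/2. *)
Definition ex : R := expR (-1).
Definition ytree N : R := (tegf R N).[ex].
Definition utree N : R := \sum_(b < N) (cnum b)%:R / b`!%:R * ex ^+ b.

Lemma ex_gt0 : 0 < ex. Proof. exact: expR_gt0. Qed.
Let ex0 : 0 <= ex := ltW ex_gt0.

Lemma ytreeE N : ytree N = \sum_(b < N) (tnum b)%:R / b`!%:R * ex ^+ b.
Proof. by rewrite /ytree /tegf /egf horner_poly. Qed.

Lemma tegf_coef_ge0 N i : 0 <= (tegf R N)`_i.
Proof. by rewrite coef_poly; case: ifP => // _; rewrite divr_ge0. Qed.

Lemma ytree_ge0 N : 0 <= ytree N.
Proof. by rewrite ytreeE sumr_ge0 // => b _; rewrite mulr_ge0 ?divr_ge0 ?exprn_ge0. Qed.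

Lemma ytree_homo N M : (N <= M)%N -> ytree N <= ytree M.
Proof.
move=> NM; rewrite !ytreeE (big_ord_widen M (fun b => (tnum b)%:R / b`!%:R * ex ^+ b)) //.
rewrite [leRHS](bigID (fun i : 'I__ => (i < N)%N)) /= lerDl sumr_ge0 // => i _.
by rewrite mulr_ge0 ?divr_ge0 ?exprn_ge0.
Qed.

Lemma tegf_exp_small N k a : (a < k)%N -> (tegf R N ^+ k)`_a = 0.
Proof.
elim: k a => // k IH a ak; rewrite exprS coefM big1 // => -[[|j] jlt] _ /=.
  by rewrite coef_poly /tnum /=; case: ifP => _; rewrite ?mul0r.
by rewrite IH ?mulr0 //; lia.
Qed.

Lemma ytreeS N : ytree N.+1 =
  ex * \sum_(k < N.+1) (\sum_(a < N) (tegf R N ^+ k)`_a * ex ^+ a) / k`!%:R.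
Proof.
rewrite ytreeE big_ord_recl /= !mul0r add0r.
transitivity (\sum_(a < N) \sum_(k < N.+1) ex * ((tegf R N ^+ k)`_a * ex ^+ a / k`!%:R)).
  apply: eq_bigr => a _; rewrite (_ : bump 0 a = a.+1) // (@tnumS_forests R a N) ?ltn_ord // exprS.
  rewrite (big_ord_widen N.+1 (fun k => (tegf R N ^+ k)`_a / k`!%:R)) ?ltnS 1?ltnW ?ltn_ord //.
  rewrite big_mkcond mulr_suml; apply: eq_bigr => k _.
  case: ifP => [_|/negbT ak]; first by ring.
  by rewrite tegf_exp_small ?mul0r ?mulr0 ?mul0r //; lia.
rewrite exchange_big /= mulr_sumr; apply: eq_bigr => k _.
by rewrite mulr_suml mulr_sumr.
Qed.

(** T = x exp(T) gives y_(N+1) <= e^(y_N - 1) for the partial sums, and this map keeps them below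
    its fixed point 1. *)
Lemma ytree_le1 N : ytree N <= 1.
Proof.
elim: N => [|N IH]; first by rewrite ytreeE big_ord0.
rewrite ytreeS; apply: le_trans (_ : ex * expR (ytree N) <= _).
  rewrite ler_wpM2l //; apply: le_trans (exp_partial_le N.+1 (ytree_ge0 N)).
  apply: ler_sum => k _; rewrite ler_wpM2r //.
  rewrite /ytree -horner_exp; apply: trunc_horner_le => // i.
  by apply: coef_exp_ge0 => j; apply: tegf_coef_ge0.
by rewrite /ex -expRD expR_le1; lra.
Qed.

Lemma coef_exp_le p q k i : (forall i, 0 <= p`_i) -> (forall i, p`_i <= q`_i) ->
  (p ^+ k)`_i <= (q ^+ k)`_i.
Proof.
move=> p0 pq; elim: k i => [|k IH] i; first by rewrite !expr0.
rewrite !exprS !coefM; apply: ler_sum => j _; apply: ler_pM => //.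
exact: coef_exp_ge0.
Qed.

Lemma tegf_coef_le N M i : (N <= M)%N -> (tegf R N)`_i <= (tegf R M)`_i.
Proof.
move=> NM; rewrite !coef_poly; case: ifP => iN.
  by rewrite (leq_trans iN NM).
by case: ifP => // _; rewrite divr_ge0.
Qed.

Lemma full_horner N M L k : (k < M)%N -> (N * M + M < L)%N ->
  ytree N ^+ k <= \sum_(a < L) (tegf R L ^+ k)`_a * ex ^+ a.
Proof.
move=> kM LL; rewrite /ytree -horner_exp (@horner_coef_wide _ L); last first.
  apply: leq_trans (size_poly_exp_leq _ _) _.
  have sN : (size (tegf R N) <= N)%N by apply: size_poly.
  have : ((size (tegf R N)).-1 * k <= N * M)%N.
    by apply: leq_mul; [apply: leq_trans sN; exact: leq_pred|exact: ltnW].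
  by move=> h; apply: leq_ltn_trans h _; lia.
apply: ler_sum => a _; rewrite ler_wpM2r ?exprn_ge0 //; apply: coef_exp_le => i.
  exact: tegf_coef_ge0.
by apply: tegf_coef_le; nia.
Qed.

(** Reverse of the recursion behind [ytree_le1]: powers of a truncated series have higher degree, so
    a longer partial sum is needed to dominate them. *)
Lemma ytree_ge_exp N M : exists L, ex * \sum_(k < M) ytree N ^+ k / k`!%:R <= ytree L.
Proof.
pose L := (N * M + M).+1; exists L.+1; rewrite ytreeS ler_wpM2l //.
rewrite (big_ord_widen L.+1 (fun k => ytree N ^+ k / k`!%:R)); last by rewrite /L; lia.
rewrite big_mkcond; apply: ler_sum => k _; case: ifP => kM.
  by rewrite ler_wpM2r // (@full_horner N M).
rewrite divr_ge0 // sumr_ge0 // => a _; rewrite mulr_ge0 ?exprn_ge0 //.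
by apply: coef_exp_ge0 => j; apply: tegf_coef_ge0.
Qed.

(** The limit s is at most 1 and satisfies e^(s-1) <= s. As e^t > 1 + t for t different from 0, only
    s = 1 is left. *)
Lemma ytree_cvg1 : ytree @ \oo --> (1 : R).
Proof.
have nd : nondecreasing_seq ytree by move=> n m /ytree_homo.
have cv : cvgn ytree.
  apply: nondecreasing_is_cvgn => //; exists 1 => _ [n _ <-]; exact: ytree_le1.
set s := limn ytree.
have le_s n : ytree n <= s by apply: nondecreasing_cvgn_le.
have s1 : s <= 1 by apply: limr_le => //; apply: nearW; exact: ytree_le1.
have H N : expR (ytree N - 1) <= s.
  rewrite addrC expRD -/ex mulrC -ler_pdivlMr ?ex_gt0 //; apply: exp_partial_lim => M.
  rewrite ler_pdivlMr ?ex_gt0 // mulrC.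
  by have [L HL] := ytree_ge_exp N M; apply: le_trans HL _.
have cs : (fun N => expR (ytree N - 1)) @ \oo --> expR (s - 1).
  apply: continuous_cvg; first exact: continuous_expR.
  by apply: cvgB => //; apply: cvg_cst.
have Es : expR (s - 1) <= s.
  rewrite -(cvg_lim _ cs) //; apply: limr_le; first by apply/cvg_ex; exists (expR (s - 1)).
  by apply: nearW.
have -> : (1 : R) = s; last by [].
apply/eqP/contraT => ns; have : 1 + (s - 1) < expR (s - 1).
  by apply: expR_gt1Dx; rewrite subr_eq0 eq_sym.
by rewrite addrC subrK ltNge Es.
Qed.

Lemma ytree_lb e : 0 < e -> exists N0, forall N, (N0 <= N)%N -> 1 - e <= ytree N.
Proof.
move=> e0; have lt : 1 - e < 1 by lra.
have [N0 _ H] := cvgr_ge _ ytree_cvg1 _ lt; exists N0 => N NN.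
by apply: H.
Qed.

Lemma sum_cnum N : \sum_(b < N) 2 * (b%:R - 1) * ((cnum b)%:R / b`!%:R) * ex ^+ b =
  2 * (ytree N - utree N).
Proof.
rewrite ytreeE /utree -sumrB mulr_sumr; apply: eq_bigr => b _.
by rewrite tnum_cnum natrM; ring.
Qed.

(** From U = T - T^2 / 2, where the partial sums of T^2 stay below 1. *)
Lemma utree_lb N : ytree N - 1 / 2 <= utree N.
Proof.
have : 2 * (ytree N - utree N) <= 1.
  rewrite -sum_cnum.
  rewrite (eq_bigr (fun b : 'I_N => (tegf R N ^+ 2)`_b * ex ^+ b)); last first.
    by move=> b _; rewrite (@two_forests_egf R b N) ?ltn_ord.
  apply: le_trans (trunc_horner_le _ _ _) _ => // [i|].
    by apply: coef_exp_ge0 => j; apply: tegf_coef_ge0.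
  rewrite horner_exp -/(ytree N) expr2.
  by have := ytree_le1 N; have := ytree_ge0 N; nra.
lra.
Qed.

Lemma utree_homo N M : (N <= M)%N -> utree N <= utree M.
Proof.
move=> NM; rewrite /utree (big_ord_widen M (fun b => (cnum b)%:R / b`!%:R * ex ^+ b)) //.
rewrite [leRHS](bigID (fun i : 'I__ => (i < N)%N)) /= lerDl sumr_ge0 // => i _.
by rewrite mulr_ge0 ?divr_ge0 ?exprn_ge0.
Qed.

Lemma utree_le N : utree N <= 1 / 2.
Proof.
rewrite leNgt; apply/negP => lt.
pose e := (utree N - 1 / 2) / 2; have e0 : 0 < e by rewrite /e; lra.
have [N0 H0] := ytree_lb e0.
pose L := (N + N0 * 3 + 3).+1.
have : 2 * (ytree L - utree L) >= 1 - 2 * e.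
  rewrite -sum_cnum.
  rewrite (eq_bigr (fun b : 'I_L => (tegf R L ^+ 2)`_b * ex ^+ b)); last first.
    by move=> b _; rewrite (@two_forests_egf R b L) ?ltn_ord.
  apply: le_trans (@full_horner N0 3 L 2 _ _) => //; last by rewrite /L; lia.
  have := H0 N0 (leqnn _); rewrite expr2; nra.
have := ytree_le1 L; have : utree N <= utree L by apply: utree_homo; rewrite /L; lia.
rewrite /e; lra.
Qed.

Lemma utree_lb' e : 0 < e -> exists N0, forall N, (N0 <= N)%N -> 1 / 2 - e <= utree N.
Proof.
move=> /ytree_lb [N0 H]; exists N0 => N /H; have := utree_lb N; lra.
Qed.

End TreeSeries.
End SingularValues.

(** * Concentration *)

Section McDiarmid.
Variable R : realType.

Lemma expR_le_quad (t : R) : t <= 1 / 2 -> expR t <= 1 + t + 2 * t ^+ 2.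
Proof.
move=> t2; have e1 : 1 - t <= expR (- t) by have := expR_ge1Dx (- t).
have p : 0 < 1 - t by lra.
have : (expR (- t))^-1 <= (1 - t)^-1 by rewrite lef_pV2 ?posrE ?expR_gt0.
rewrite expRN invrK => /le_trans; apply.
rewrite -[(1 - t)^-1]mul1r ler_pdivrMr // expr2; nra.
Qed.

Variables (T S : finType) (g : {ffun T -> S} -> R) (c : R).
Implicit Types (F : T -> {set S}) (f : {ffun T -> S}).

Definition prodset F : {set {ffun T -> S}} := [set f : {ffun T -> S} | [forall x, f x \in F x]].
Definition setat (f : {ffun T -> S}) x s : {ffun T -> S} := [ffun z => if z == x then s else f z].
Definition pin F x s : T -> {set S} := fun z => if z == x then [set s] else F z.

Lemma pinE F x s : s \in F x -> prodset (pin F x s) = [set f in prodset F | f x == s].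
Proof.
move=> sF; apply/setP => f; rewrite !in_set; apply/forallP/andP => [H|[/forallP H /eqP fx] z].
  have fx : f x = s by have := H x; rewrite /pin eqxx inE => /eqP.
  split; last by rewrite fx.
  by apply/forallP => z; have := H z; rewrite /pin; case: eqP => [->|//]; rewrite fx.
by rewrite /pin; case: eqP => [->|//]; rewrite fx inE.
Qed.

Lemma sum_prodset F x (h : {ffun T -> S} -> R) :
  \sum_(f in prodset F) h f = \sum_(s in F x) \sum_(f in prodset (pin F x s)) h f.
Proof.
rewrite (partition_big (fun f => f x) (fun s => s \in F x)) /=; last first.
  by move=> f; rewrite in_set => /forallP.
apply: eq_bigr => s sF; apply: eq_bigl => f; by rewrite pinE // [RHS]in_set.
Qed.

Lemma sum_pin F x s s' (h : {ffun T -> S} -> R) : s \in F x -> s' \in F x ->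
  \sum_(f in prodset (pin F x s')) h f = \sum_(f in prodset (pin F x s)) h (setat f x s').
Proof.
move=> sF sF'; rewrite (reindex_onto (fun f => setat f x s') (fun f => setat f x s)) /=.
  apply: eq_bigl => f; rewrite !in_set; apply/andP/forallP => [[/forallP H /eqP E] z|H].
    have := H z; have /ffunP/(_ z) := E; rewrite /setat /pin !ffunE.
    by case: eqP => [_ <- _|//]; rewrite inE.
  split.
    apply/forallP => z; have := H z; rewrite /pin /setat !ffunE; case: eqP => // _ _.
    by rewrite inE.
  apply/eqP/ffunP => z; rewrite !ffunE; case: eqP => // ->.
  by have := H x; rewrite /pin eqxx inE => /eqP.
move=> f; rewrite in_set => /forallP H; apply/ffunP => z; rewrite !ffunE; case: eqP => // ->.
by have := H x; rewrite /pin eqxx inE => /eqP.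
Qed.

Lemma card_pin F x s s' : s \in F x -> s' \in F x ->
  #|prodset (pin F x s')| = #|prodset (pin F x s)|.
Proof.
move=> sF sF'; have := sum_pin (fun=> 1) sF sF'.
by rewrite !sumr_const => /eqP; rewrite eqr_nat => /eqP.
Qed.

Hypothesis c0 : 0 <= c.

(** Bounded differences on a product of finite sets; coordinates outside A are already fixed.
    Pinning one coordinate x to s changes the conditional mean m s by at most c, so [expR_le_quad]
    applies to m s - mu, whose average over s vanishes: each coordinate costs 2 (la c)^2 in the
    exponent. *)
Lemma mcdiarmid (A : {set T}) F (la : R) : (forall x, (0 < #|F x|)%N) ->
  (forall x, x \notin A -> #|F x| = 1%N) ->
  (forall f x s, f \in prodset F -> x \in A -> s \in F x -> `|g f - g (setat f x s)| <= c) ->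
  0 <= la -> la * c <= 1 / 2 ->
  \sum_(f in prodset F) expR (- la * g f) <=
  #|prodset F|%:R * expR (- la * ((\sum_(f in prodset F) g f) / #|prodset F|%:R)
     + 2 * (la * c) ^+ 2 * #|A|%:R).
Proof.
move=> + + + la0 lac.
have [n] := ubnP #|A|; elim: n A F => // n IH A F cA F0 FA lip.
have lc0 : 0 <= la * c by rewrite mulr_ge0.
have [A0|[x xA]] := set_0Vmem A.
  have : #|prodset F| = 1%N by rewrite card_family_set big1 // => x _; rewrite FA // A0 inE.
  move=> /eqP/cards1P [f0 ->]; rewrite cards1 !big_set1 A0 cards0 mulr0 addr0 divr1 mul1r.
  by [].
have /card_gt0P [s0 s0F] := F0 x.
pose M := #|prodset (pin F x s0)|; pose q := #|F x|.
have sub s : s \in F x -> prodset (pin F x s) \subset prodset F.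
  by move=> sF; rewrite pinE //; apply/subsetP => f; rewrite in_set => /andP [].
have cM s : s \in F x -> #|prodset (pin F x s)| = M by move=> sF; apply: card_pin.
have M0 : (0 < M)%N.
  rewrite /M card_family_set; apply: prodn_gt0 => z; rewrite /pin; case: eqP => // _.
  by rewrite cards1.
have q0 : (0 < q)%N by apply/card_gt0P; exists s0.
have M0' : 0 < M%:R :> R by rewrite ltr0n.
have q0' : 0 < q%:R :> R by rewrite ltr0n.
pose m s : R := (\sum_(f in prodset (pin F x s)) g f) / M%:R.
have NE : #|prodset F| = (q * M)%N.
  rewrite -sum_nat_const -sum1_card; apply/eqP; rewrite -(eqr_nat R) !natr_sum.
  rewrite (sum_prodset F x (fun=> 1)); apply/eqP/eq_bigr => s sF.
  by rewrite sumr_const cM.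
pose mu : R := (\sum_(s in F x) m s) / q%:R.
have muE : (\sum_(f in prodset F) g f) / #|prodset F|%:R = mu.
  rewrite (sum_prodset F x) NE natrM /mu /m -mulr_suml; field.
  by rewrite !gt_eqF.
have msm s s' : s \in F x -> s' \in F x -> `|m s - m s'| <= c.
  move=> sF sF'; rewrite /m (sum_pin g sF sF') -mulrBl -sumrB normrM [`|_^-1|]ger0_norm ?invr_ge0 //.
  rewrite ler_pdivrMr // (le_trans (ler_norm_sum _ _ _)) // -(cM s sF) mulr_natr -sumr_const.
  apply: ler_sum => f fs; apply: lip => //; exact: (subsetP (sub s sF)).
have msmu s : s \in F x -> `|m s - mu| <= c.
  move=> sF; have -> : m s - mu = (\sum_(s' in F x) (m s - m s')) / q%:R.
    rewrite sumrB sumr_const -mulr_natr -/q /mu; field; by rewrite gt_eqF.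
  rewrite normrM [`|_^-1|]ger0_norm ?invr_ge0 // ler_pdivrMr //.
  rewrite (le_trans (ler_norm_sum _ _ _)) // mulr_natr -sumr_const.
  by apply: ler_sum => s' sF'; apply: msm.
rewrite muE (sum_prodset F x).
have cA' : #|A| = #|A :\ x|.+1 by rewrite (cardsD1 x) xA.
apply: (@le_trans _ _ (\sum_(s in F x) M%:R *
    expR (- la * m s + 2 * (la * c) ^+ 2 * #|A :\ x|%:R))).
  apply: ler_sum => s sF; rewrite -(cM s sF) /m -(cM s sF); apply: IH.
  - by rewrite -ltnS -cA'.
  - by move=> z; rewrite /pin; case: eqP => // _; rewrite cards1.
  - move=> z zA; rewrite /pin; case: eqP => [_|ne]; first by rewrite cards1.
    by apply: FA; apply: contra zA => zA; rewrite !inE zA andbT; apply/eqP.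
  - move=> f z s' fF; rewrite in_setD1 => /andP [/negPf nz zA]; rewrite /pin nz => s'F.
    by apply: lip => //; apply: (subsetP (sub s sF)).
rewrite -mulr_sumr NE natrM [q%:R * _]mulrC -(mulrA M%:R q%:R) ler_wpM2l //.
rewrite (eq_bigr (fun s => expR (- la * (m s - mu)) * expR (- la * mu + 2 * (la * c) ^+ 2 * #|A :\ x|%:R))); last first.
  by move=> s _; rewrite -expRD; congr expR; ring.
rewrite -mulr_suml.
have -> : - la * mu + 2 * (la * c) ^+ 2 * #|A|%:R =
   2 * (la * c) ^+ 2 + (- la * mu + 2 * (la * c) ^+ 2 * #|A :\ x|%:R).
  by rewrite cA' -natr1; ring.
rewrite (expRD (2 * (la * c) ^+ 2)) mulrA ler_wpM2r ?expR_ge0 //.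
apply: (@le_trans _ _ (\sum_(s in F x) (1 - la * (m s - mu) + 2 * (la * c) ^+ 2))).
  apply: ler_sum => s sF; have H := msmu s sF.
  have H1 : `|- la * (m s - mu)| <= la * c.
    by rewrite normrM normrN (ger0_norm la0) ler_wpM2l.
  have H2 : (- la * (m s - mu)) ^+ 2 <= (la * c) ^+ 2.
    by rewrite -[leLHS]real_normK ?num_real // ler_sqr ?nnegrE.
  have := @expR_le_quad (- la * (m s - mu)).
  have : - la * (m s - mu) <= 1 / 2 by apply: le_trans (ler_norm _) (le_trans H1 lac).
  move=> h /(_ h) h2; apply: le_trans h2 _; lra.
rewrite big_split /= sumr_const -[_ *+ #|_|]mulr_natr -/q.
have -> : \sum_(s in F x) (1 - la * (m s - mu)) = q%:R.
  rewrite sumrB sumr_const -mulr_sumr sumrB sumr_const -/q -[mu *+ _]mulr_natr /mu.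
  have qn : q%:R != 0 :> R by rewrite gt_eqF.
  by rewrite divfK // subrr mulr0 subr0.
rewrite -{1}[q%:R]mulr1 mulrC -mulrDl mulrC ler_wpM2l //.
exact: expR_ge1Dx.
Qed.
End McDiarmid.

(** * Mean values and exponential moments of random functions *)

Section Bounds.
Variable R : realType.

Lemma cube_le_expR (x : R) : 0 <= x -> x ^+ 3 / 6 <= expR x.
Proof.
by move=> x0; have := expR_ge1Dxn 2 x0; rewrite (_ : (3`! = 6)%N) //; lra.
Qed.

Lemma sqr_expN_le1 (d : R) (b : nat) : 0 < d -> 6 / d ^+ 3 <= b%:R ->
  b%:R ^+ 2 * expR (- (d * b%:R)) <= 1.
Proof.
move=> d0; rewrite ler_pdivrMr ?exprn_gt0 // => H.
rewrite expRN ler_pdivrMr ?expR_gt0 // mul1r; apply: le_trans (cube_le_expR _); last first.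
  by rewrite mulr_ge0 // ltW.
rewrite ler_pdivlMr // exprMn; have -> : (b%:R : R) ^+ 3 = b%:R ^+ 2 * b%:R by rewrite exprSr.
have := @exprn_ge0 R 2 b%:R (ler0n _ _); move: (b%:R ^+ 2) => c c0.
by have := ler_wpM2l c0 H; lra.
Qed.

Lemma pow_lb (j b : nat) : (0 < b)%N -> (2 * j <= b)%N ->
  expR (- j%:R) * (1 - 2 * j%:R ^+ 2 / b%:R) <= (1 - j%:R / b%:R) ^+ b :> R.
Proof.
move=> b0 jb; have b0' : 0 < b%:R :> R by rewrite ltr0n.
have jb' : 2 * j%:R <= b%:R :> R by rewrite -natrM ler_nat.
have j0 : 0 <= j%:R :> R by [].
have p : 0 < b%:R - j%:R :> R by lra.
have e1 : expR (- (j%:R / (b%:R - j%:R))) <= 1 - j%:R / b%:R :> R.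
  have r0 : 0 < 1 - j%:R / b%:R :> R by rewrite subr_gt0 ltr_pdivrMr // mul1r; lra.
  rewrite expRN -[leRHS]invrK lef_pV2 ?posrE ?expR_gt0 ?invr_gt0 //.
  have -> : (1 - j%:R / b%:R)^-1 = 1 + j%:R / (b%:R - j%:R) :> R.
    by field; rewrite !gt_eqF.
  exact: expR_ge1Dx.
apply: le_trans (lerXn2r b _ _ e1); rewrite ?nnegrE ?expR_ge0 //; last first.
  by rewrite subr_ge0 ler_pdivrMr // mul1r; lra.
rewrite -expRM_natl.
have -> : b%:R * - (j%:R / (b%:R - j%:R)) = - j%:R + - (j%:R ^+ 2 / (b%:R - j%:R)) :> R.
  by field; rewrite gt_eqF.
rewrite expRD ler_wpM2l ?expR_ge0 //; apply: le_trans (expR_ge1Dx _).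
rewrite lerD2l lerN2 ler_pdivrMr // mulrAC ler_pdivlMr //.
have := exprn_ge0 2 j0; nra.
Qed.

Lemma bernoulli_sub (x : R) n : 0 <= x <= 1 -> 1 - n%:R * x <= (1 - x) ^+ n.
Proof.
move=> /andP [x0 x1]; elim: n => [|n IH]; first by rewrite expr0; lra.
rewrite exprS -natr1; have n0 : 0 <= n%:R :> R by [].
have : (1 - x) * (1 - n%:R * x) <= (1 - x) * (1 - x) ^+ n by rewrite ler_wpM2l //; lra.
have nx : 0 <= n%:R * (x * x) by rewrite !mulr_ge0.
by move=> h; apply: le_trans h; lra.
Qed.

Lemma ffact_lb b k : ((b - k) ^ k <= b ^_ k)%N.
Proof.
elim: k b => [|k IH] b; first by rewrite expn0 ffactn0.
case: b => [|b]; first by rewrite sub0n exp0n.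
rewrite ffactSS expnS subSS; apply: leq_mul; last exact: IH.
by apply: leq_trans (leq_subr _ _) _.
Qed.

Lemma cnum_ratio b : (0 < b)%N -> (b ^ b)%:R = b%:R ^+ 2 * (cnum b)%:R :> R.
Proof.
case: b => [|[|b]] // _; rewrite /cnum /= -natrX -natrM; first by rewrite !exp1n.
by rewrite -expnD; congr (_ ^ _)%:R; lia.
Qed.

(** The bound over all functions carries the factor b^b = b^2 [cnum b]. Half of the deviation eps
    yields a term e^(- la eps b / 4) that swallows b^2 for large b. The result is at most [cnum b],
    so the weight of a large tree may replace 1 in the generating function at no cost. *)
Lemma tree_chernoff (T : finType) (B : {set T}) (g : {ffun T -> T} -> nat) (c mu eps la : R) :
  0 < eps -> 0 < la -> 0 <= c -> la * c <= 1 / 2 -> 8 * la * c ^+ 2 <= eps ->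
  (forall f x s, f \in Fam B -> x \in B -> s \in B ->
     `|(g f)%:R - (g (upd f x s))%:R| <= c) ->
  (mu - eps / 2) * #|B|%:R * (#|B| ^ #|B|)%:R <= (\sum_(f in Fam B) g f)%:R ->
  6 / (la * eps / 4) ^+ 3 <= #|B|%:R -> (0 < #|B|)%N ->
  \sum_(f in Fam B) expR (- la * ((g f)%:R - (mu - eps) * #|B|%:R)) <= (cnum #|B|)%:R.
Proof.
move=> e0 l0 c0 lc lc2 lip mean big b0.
pose F x := if x \in B then B else [set x].
have FE : Fam B = prodset F by rewrite Fam_family.
have := @mcdiarmid R T T (fun f => (g f)%:R) c c0 B F la.
have H1 x : (0 < #|F x|)%N by rewrite /F; case: ifP; rewrite ?cards1.
have H2 x : x \notin B -> #|F x| = 1%N by rewrite /F => /negPf ->; rewrite cards1.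
move=> /(_ H1 H2); rewrite -!FE card_Fam => H.
have {}H := H _ (ltW l0) lc.
have {H} : \sum_(f in Fam B) expR (- la * (g f)%:R) <=
   (#|B| ^ #|B|)%:R * expR (- la * ((\sum_(f in Fam B) (g f)%:R) / (#|B| ^ #|B|)%:R) + 2 * (la * c) ^+ 2 * #|B|%:R).
  apply: H => f x s fF xB; rewrite /F xB => sB.
  have -> : setat f x s = upd f x s by apply/ffunP => z; rewrite !ffunE.
  exact: lip.
have b0' : 0 < #|B|%:R :> R by rewrite ltr0n.
have N0 : 0 < (#|B| ^ #|B|)%:R :> R by rewrite ltr0n expn_gt0 b0.
rewrite natr_sum in mean; have mean' : (mu - eps / 2) * #|B|%:R <= (\sum_(f in Fam B) (g f)%:R) / (#|B| ^ #|B|)%:R.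
  by rewrite ler_pdivlMr.
move: (_ / _) mean' => m mean' H.
rewrite (eq_bigr (fun f => expR (la * ((mu - eps) * #|B|%:R)) * expR (- la * (g f)%:R))); last first.
  by move=> f _; rewrite -expRD; congr expR; ring.
rewrite -mulr_sumr; apply: le_trans (ler_wpM2l (expR_ge0 _) H) _.
rewrite mulrCA -expRD (cnum_ratio b0) mulrAC -[leRHS]mul1r ler_wpM2r //.
apply: le_trans (sqr_expN_le1 (_ : 0 < la * eps / 4) big); last by rewrite !mulr_gt0 ?invr_gt0.
rewrite ler_wpM2l ?exprn_ge0 // ler_expR.
have := ler_wpM2l (ltW l0) mean'.
have : la * (8 * la * c ^+ 2 * #|B|%:R) <= la * (eps * #|B|%:R).
  by rewrite ler_wpM2l ?(ltW l0) // ler_wpM2r // ltW.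
have -> : (la * c) ^+ 2 = la * (la * c ^+ 2) by rewrite exprMn expr2 mulrA.
lra.
Qed.

Lemma falling_ratio (k I b : nat) : (I <= k)%N -> (0 < k)%N -> (2 * k <= b)%N ->
  expR (- I%:R) * (1 - 4 * k%:R ^+ 2 / b%:R) * b%:R * (b ^ b)%N%:R <=
    (b ^_ k)%:R * ((b - k)%N%:R * ((b - I) ^ (b - k))%N%:R) :> R.
Proof.
move=> Ik k1 kb2; have b_gt0 : (0 < b)%N by lia.
have bk0 : (k <= b)%N by lia.
have bI0 : (I <= b)%N by lia.
have I2b : (2 * I <= b)%N by lia.
have p1 := @pow_lb I b b_gt0 I2b.
have bR : 0 < b%:R :> R by rewrite ltr0n.
have h1 : (b - k)%N%:R ^+ k <= (b ^_ k)%:R :> R by rewrite -natrX ler_nat ffact_lb.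
have bk : (b - k)%N%:R = b%:R - k%:R :> R by rewrite natrB.
have bI : (b - I)%N%:R = b%:R - I%:R :> R by rewrite natrB.
have kb : 2 * k%:R <= b%:R :> R by rewrite -natrM ler_nat.
have kR : 1 <= k%:R :> R by rewrite ler1n.
have Ib : I%:R <= k%:R :> R by rewrite ler_nat.
have I0 : 0 <= I%:R :> R by [].
pose v : R := b%:R^-1; have v0 : 0 <= v by rewrite invr_ge0 ltW.
pose X : R := (b ^ b)%:R; rewrite -/X.
have X0 : 0 < X by rewrite ltr0n expn_gt0 b_gt0.
have kv1 : k%:R / b%:R <= 1 :> R by rewrite ler_pdivrMr // mul1r; lra.
have Iv1 : I%:R / b%:R <= 1 :> R by rewrite ler_pdivrMr // mul1r; lra.
have kv0 : 0 <= k%:R / b%:R :> R by rewrite mulr_ge0.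
have Iv0 : 0 <= I%:R / b%:R :> R by rewrite mulr_ge0.
have kv2 : 0 <= k%:R ^+ 2 * v by rewrite mulr_ge0 ?exprn_ge0.
have Iv : I%:R ^+ 2 * v <= k%:R ^+ 2 * v.
  by rewrite ler_wpM2r // ler_sqr ?nnegrE.
have p2 : 1 - k.+1%:R * (k%:R / b%:R) <= (1 - k%:R / b%:R) ^+ k.+1 :> R.
  by apply: bernoulli_sub; rewrite kv0.
have p0 : 0 <= (1 - k%:R / b%:R) ^+ k.+1 :> R by rewrite exprn_ge0 // subr_ge0.
apply: (@le_trans _ _ ((1 - k%:R / b%:R) ^+ k.+1 * (1 - I%:R / b%:R) ^+ b * b%:R * X)).
  rewrite ler_wpM2r ?(ltW X0) // ler_wpM2r ?(ltW bR) //.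
  apply: le_trans (ler_wpM2l p0 p1); rewrite [leRHS]mulrCA ler_wpM2l ?expR_ge0 //.
  have [n1|n2] := leP (1 - 2 * I%:R ^+ 2 / b%:R : R) 0.
    have r1 : (1 - k%:R / b%:R) ^+ k.+1 <= 1 :> R.
      by apply: exprn_ile1; rewrite ?subr_ge0 // gerBl.
    have : 1 * (1 - 2 * I%:R ^+ 2 / b%:R) <= (1 - k%:R / b%:R) ^+ k.+1 * (1 - 2 * I%:R ^+ 2 / b%:R) :> R.
      by rewrite ler_wnM2r.
    apply: le_trans; rewrite mul1r -!mulrA -/v; lra.
  apply: le_trans (ler_wpM2r (ltW n2) p2).
  have e3 : k%:R * v <= k%:R ^+ 2 * v by rewrite ler_wpM2r // expr2 ler_peMr.
  have e2 : 0 <= I%:R ^+ 2 * v by rewrite mulr_ge0 ?exprn_ge0.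
  have e1 : 0 <= k%:R * v by rewrite mulr_ge0.
  have -> : k.+1%:R * (k%:R / b%:R) = k%:R ^+ 2 * v + k%:R * v :> R by rewrite -natr1 /v; ring.
  rewrite -!(mulrA _ (_ ^+ 2)) -/v.
  move: (k%:R * v) (k%:R ^+ 2 * v) (I%:R ^+ 2 * v) e1 e2 e3 Iv => a1 a2 a3 e1 e2 e3 Iv.
  have e4 : 0 <= (a2 + a1) * a3 by rewrite mulr_ge0 // addr_ge0 // (le_trans e1).
  lra.
rewrite natrX bk bI.
have bb1 : b%:R - k%:R = (1 - k%:R / b%:R) * b%:R :> R by rewrite mulrBl mul1r divfK // gt_eqF.
have bb2 : b%:R - I%:R = (1 - I%:R / b%:R) * b%:R :> R by rewrite mulrBl mul1r divfK // gt_eqF.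
have r0 : 0 <= 1 - I%:R / b%:R :> R by rewrite subr_ge0.
have r1 : 1 - I%:R / b%:R <= 1 :> R by rewrite gerBl.
apply: (@le_trans _ _ ((b%:R - k%:R) ^+ k * ((b%:R - k%:R) * (b%:R - I%:R) ^+ (b - k)))); last first.
  have d1 : 0 <= b%:R - k%:R :> R by lra.
  have d2 : 0 <= b%:R - I%:R :> R by lra.
  by rewrite ler_wpM2r -?bk // mulr_ge0 ?exprn_ge0 // bk.
rewrite mulrA -exprSr bb1 bb2 !exprMn.
have -> : X = b%:R ^+ k * b%:R ^+ (b - k) by rewrite /X natrX -exprD subnKC.
have : (1 - I%:R / b%:R) ^+ b <= (1 - I%:R / b%:R) ^+ (b - k) :> R.
  by apply: ler_wiXn2l => //; apply: leq_subr.
move=> le; rewrite [leRHS](_ : _ = (1 - k%:R / b%:R) ^+ k.+1 * (1 - I%:R / b%:R) ^+ (b - k) * (b%:R * (b%:R ^+ k * b%:R ^+ (b - k)))); last by rewrite [b%:R ^+ k.+1]exprS; ring.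
by rewrite -mulrA ler_wpM2r ?mulr_ge0 ?exprn_ge0 ?(ltW bR) // ler_wpM2l.
Qed.

Section Hdata.
Variables (k : nat) (E : rel 'I_k) (rH : 'I_k) (l : nat) (par : 'I_k -> 'I_k) (D : 'I_k -> nat).
Hypothesis td : tdata E rH l par D.
(* [qT] and [qS] will turn out to bound the probabilities that the [l]-ball of T(1), resp. of the skeleton tree, is the tree [(E, rH)]. *)
Definition qT : R := expR (- (#|[set i | (D i < l)%N]|)%:R) / (Aut E rH)%:R.
Definition qS : R := #|depthset l D|%:R * qT.

Lemma Aut_gt0 : (0 < Aut E rH)%N.
Proof.
apply/card_gt0P; exists [ffun i => i]; rewrite inE; apply/and3P; split.
- by apply/injectiveP => i j; rewrite !ffunE.
- by rewrite ffunE.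
- by apply/forallP => i; apply/forallP => j; rewrite !ffunE.
Qed.

Lemma qT_ge0 : 0 <= qT. Proof. by rewrite /qT divr_ge0 ?expR_ge0. Qed.
Lemma qS_ge0 : 0 <= qS. Proof. by rewrite /qS mulr_ge0 ?qT_ge0. Qed.

Lemma big_tree_mean eps : 0 < eps -> exists K2, exists b0, forall (T : finType) (B : {set T}),
  (b0 <= #|B|)%N ->
  (qS - eps) * #|B|%:R * (#|B| ^ #|B|)%:R <=
    (\sum_(f in Fam B) #|Mset E rH (fadj f) l (k + 1 + K2) B|)%:R.
Proof.
move=> e0; pose Z : R := #|depthset l D|%:R.
(* K2 makes the Markov loss qS Z / (K2 + 1) at most eps / 2; b0 does the same for the finite size
   correction 4 k^2 qS / b of [falling_ratio]. *)
pose K2 := Num.trunc (2 * qS * Z / eps); exists K2.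
pose b0 := (2 * k + 1 + Num.trunc (8 * k%:R ^+ 2 * qS / eps))%N; exists b0.+1 => T B bb.
have [qe|qe] := leP qS eps.
  apply: (@le_trans _ _ 0); last by [].
  by rewrite -mulrA mulr_le0_ge0 ?mulr_ge0 // subr_le0.
have Ik : (#|[set i | (D i < l)%N]| <= k)%N by rewrite -[k in (_ <= k)%N]card_ord max_card.
have k1 : (0 < k)%N by apply: leq_trans (ltn_ord rH).
have kb2 : (2 * k <= #|B|)%N by rewrite /b0 in bb; lia.
have tbn : ((Num.trunc (8 * k%:R ^+ 2 * qS / eps)).+1 <= #|B|)%N by rewrite /b0 in bb; lia.
have nZ : (K2.+1 - #|depthset l D| + #|depthset l D| >= K2.+1)%N by lia.
have := falling_ratio Ik k1 kb2.
have := function_stat_mean td B K2; rewrite -(ler_nat R) !natrM.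
have bR : 0 < #|B|%:R :> R by rewrite ltr0n; apply: leq_trans kb2; rewrite muln_gt0.
move: #|B| bR tbn => b bR tbn.
have qE : Z * expR (- (#|[set i | (D i < l)%N]|)%:R) = qS * (Aut E rH)%:R.
  by rewrite /qS /qT -/Z mulrA divfK // pnatr_eq0 -lt0n Aut_gt0.
move: #|[set i | (D i < l)%N]| qE => I qE.
move: (\sum_(f in _) _)%N => S H main.
set F := (b ^_ k)%:R * ((b - k)%N%:R * ((b - I) ^ (b - k))%N%:R) in main.
have A0 : 0 < (Aut E rH)%:R :> R by rewrite ltr0n Aut_gt0.
have K0 : 0 < K2.+1%:R :> R by rewrite ltr0n.
have Z0 : 0 <= Z by rewrite /Z.
have F0 : 0 <= F by rewrite /F !mulr_ge0.
have KZ : K2.+1%:R - Z <= (K2.+1 - #|depthset l D|)%N%:R :> R.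
  by rewrite lerBlDr -natrD ler_nat.
have tb : 8 * k%:R ^+ 2 * qS <= eps * b%:R.
  rewrite [leRHS]mulrC -ler_pdivrMr //; apply: le_trans (ltW (truncnS_gt _)) _.
  by rewrite ler_nat.
have tK : 2 * qS * Z <= eps * K2.+1%:R.
  by rewrite [leRHS]mulrC -ler_pdivrMr //; apply: ltW (truncnS_gt _).
have q0 : 0 < qS by apply: lt_trans qe.
have pos : 0 <= K2.+1%:R - Z.
  have : qS * Z <= qS * K2.+1%:R.
    apply: le_trans (_ : eps * K2.+1%:R <= _); last by rewrite ler_wpM2r ?(ltW K0) // ltW.
    by apply: le_trans tK; rewrite -mulrA ler_peMl ?mulr_ge0 ?(ltW q0) // ler1n.
  by rewrite ler_pM2l // subr_ge0.
rewrite -(ler_pM2l K0) -(ler_pM2l A0) [leRHS]mulrCA.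
apply: le_trans H.
apply: (@le_trans _ _ ((K2.+1%:R - Z) * (Z * F))); last first.
  rewrite [leRHS](_ : _ = (K2.+1 - #|depthset l D|)%N%:R * (Z * F)); last by rewrite -/Z /F; ring.
  by rewrite ler_wpM2r ?mulr_ge0.
apply: le_trans (ler_wpM2l pos (ler_wpM2l Z0 main)).
have X0 : 0 <= (b ^ b)%N%:R :> R by [].
move: (b ^ b)%N%:R X0 => X X0.
rewrite [leLHS](_ : _ = (K2.+1%:R * (qS - eps)) * ((Aut E rH)%:R * b%:R * X)); last by ring.
rewrite [leRHS](_ : _ = ((K2.+1%:R - Z) * (qS * (1 - 4 * k%:R ^+ 2 / b%:R))) * ((Aut E rH)%:R * b%:R * X)); last first.
  rewrite [LHS](_ : _ = (K2.+1%:R - Z) * (1 - 4 * k%:R ^+ 2 / b%:R) * (Z * expR (- I%:R)) * (b%:R * X)); last by ring.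
  by rewrite qE; ring.
rewrite ler_wpM2r ?mulr_ge0 ?(ltW A0) ?(ltW bR) //.
have tb' : 2 * (qS * (4 * k%:R ^+ 2 / b%:R)) <= eps.
  by rewrite [leLHS](_ : _ = (8 * k%:R ^+ 2 * qS) / b%:R) ?ler_pdivrMr //; ring.
have t4 : 0 <= 4 * k%:R ^+ 2 / b%:R :> R by rewrite !mulr_ge0 ?exprn_ge0 ?invr_ge0 ?(ltW bR).
move: (4 * k%:R ^+ 2 / b%:R) tb' t4 => t tb' t4.
have h1 : 0 <= (Z * qS) * t by rewrite !mulr_ge0 ?(ltW q0).
have h2 := ler_wpM2l (ltW K0) tb'.
move: tK h2; move: (K2.+1%:R : R) => KK tK h2.
lra.
Qed.
End Hdata.

(** A vertex of a random function has exactly j descendants, forming a tree below it, with limiting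
    probability j^(j-1) e^(-j) / j!, the Borel distribution. Its total mass is T(e^-1) = 1, so a
    finite K1 catches almost everything. *)
Lemma desc_mean eps : 0 < eps -> exists K1, exists b0, forall (T : finType) (B : {set T}),
  (b0 <= #|B|)%N ->
  (1 - eps) * #|B|%:R * (#|B| ^ #|B|)%:R <= (\sum_(f in Fam B) #|smalldsc f K1 B|)%:R :> R.
Proof.
move=> e0; have e2 : 0 < eps / 2 by rewrite divr_gt0.
have [e1|e1] := leP 1 eps.
  exists 0%N, 0%N => T B _; apply: (@le_trans _ _ 0); last by [].
  by rewrite -mulrA mulr_le0_ge0 ?mulr_ge0 // subr_le0.
have [N0 HN] := ytree_lb e2; pose K := N0.+1; exists K.
pose b0 := (2 * K + Num.trunc (8 * K%:R ^+ 2 / eps))%N; exists b0.+1 => T B bb.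
have bK : (2 * K <= #|B|)%N by rewrite /b0 in bb; lia.
have tbn : ((Num.trunc (8 * K%:R ^+ 2 / eps)).+1 <= #|B|)%N by rewrite /b0 in bb; lia.
have B0 : (0 < #|B|)%N by apply: leq_trans bK; rewrite muln_gt0.
apply: le_trans (_ : (\sum_(j < #|B|.+1 | (0 < j <= K)%N)
   'C(#|B|, j) * (j ^ j.-1 * (#|B| - j) ^ (#|B| - j).+1))%N%:R <= _); last first.
  by rewrite ler_nat; apply: smalldsc_mean.
move: #|B| bK tbn B0 => b bK tbn b0'.
have bR : 0 < b%:R :> R by rewrite ltr0n.
have tb : 8 * K%:R ^+ 2 <= eps * b%:R.
  rewrite [leRHS]mulrC -ler_pdivrMr //; apply: le_trans (ltW (truncnS_gt _)) _.
  by rewrite ler_nat.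
have K1 : 1 <= K%:R :> R by rewrite ler1n.
have term (j : nat) : (0 < j <= K)%N -> (tnum j)%:R / j`!%:R * ex R ^+ j * (1 - 4 * K%:R ^+ 2 / b%:R) * (b%:R * (b ^ b)%N%:R) <=
   ('C(b, j) * (j ^ j.-1 * (b - j) ^ (b - j).+1))%N%:R.
  move=> /andP [j0 jK]; have jb : (j <= b)%N by apply: leq_trans jK (leq_trans _ bK); rewrite leq_pmull.
  have j2b : (2 * j <= b)%N by apply: leq_trans bK; rewrite leq_mul2l jK orbT.
  have f0 : 0 < j`!%:R :> R by rewrite ltr0n fact_gt0.
  have eb : ('C(b, j))%:R = (b ^_ j)%:R / j`!%:R :> R.
    by rewrite -bin_ffact natrM mulfK // gt_eqF.
  have -> : tnum j = (j ^ j.-1)%N by rewrite /tnum gtn_eqF.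
  rewrite !natrM eb.
  rewrite [leLHS](_ : _ = ((j ^ j.-1)%N%:R / j`!%:R) * (ex R ^+ j * (1 - 4 * K%:R ^+ 2 / b%:R) * (b%:R * (b ^ b)%N%:R))); last by ring.
  rewrite [leRHS](_ : _ = ((j ^ j.-1)%N%:R / j`!%:R) * ((b ^_ j)%:R * ((b - j) ^ (b - j).+1)%N%:R)); last by ring.
  rewrite ler_wpM2l ?divr_ge0 //.
  apply: le_trans (_ : ((b - j) ^ b.+1)%N%:R <= _); last first.
    rewrite -natrM ler_nat; apply: leq_trans (leq_mul (ffact_lb b j) (leqnn _)).
    by rewrite -expnD addnS subnKC.
  rewrite (natrX _ (b - j)) natrB //.
  have bb2 : b%:R - j%:R = (1 - j%:R / b%:R) * b%:R :> R by rewrite mulrBl mul1r divfK // gt_eqF.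
  rewrite bb2 exprMn (natrX _ b b) -[b%:R * _]exprS ler_wpM2r ?exprn_ge0 ?(ltW bR) //.
  have jK' : j%:R <= K%:R :> R by rewrite ler_nat.
  have jb' : 2 * j%:R <= b%:R :> R by rewrite -natrM ler_nat.
  have p1 := pow_lb b0' j2b.
  have r0 : 0 <= 1 - j%:R / b%:R :> R by rewrite subr_ge0 ler_pdivrMr // mul1r; have : 0 <= j%:R :> R by []; lra.
  rewrite [leRHS]exprS; apply: le_trans (ler_wpM2l r0 p1).
  have -> : ex R ^+ j = expR (- j%:R) by rewrite /ex -expRM_natl mulrN1.
  rewrite [leRHS]mulrCA ler_wpM2l ?expR_ge0 //.
  pose v : R := b%:R^-1; have v0 : 0 <= v by rewrite invr_ge0 ltW.
  rewrite -!(mulrA _ (_ ^+ 2)) -/v.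
  have j0' : 0 <= j%:R :> R by [].
  have a1 : j%:R ^+ 2 * v <= K%:R ^+ 2 * v by rewrite ler_wpM2r // ler_sqr ?nnegrE.
  have a2 : j%:R * v <= K%:R ^+ 2 * v.
    by rewrite ler_wpM2r //; apply: le_trans jK' _; rewrite expr2 ler_peMr.
  have a3 : 0 <= (j%:R * v) * (j%:R ^+ 2 * v) by rewrite !mulr_ge0 ?exprn_ge0.
  have a4 : 0 <= j%:R ^+ 2 * v by rewrite mulr_ge0 ?exprn_ge0.
  move: (j%:R * v) (K%:R ^+ 2 * v) (j%:R ^+ 2 * v) a1 a2 a3 a4 => x1 x2 x3 a1 a2 a3 a4.
  lra.
have H := HN K.+1 (leqW (leqnSn _)).
have tt : 2 * (4 * K%:R ^+ 2 / b%:R) <= eps.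
  by rewrite [leLHS](_ : _ = (8 * K%:R ^+ 2) / b%:R) ?ler_pdivrMr //; ring.
have t0 : 0 <= 4 * K%:R ^+ 2 / b%:R :> R by rewrite !mulr_ge0 ?exprn_ge0 ?invr_ge0 ?(ltW bR).
have W0 : 0 <= b%:R * (b ^ b)%N%:R :> R by rewrite mulr_ge0.
apply: le_trans (_ : ytree R K.+1 * (1 - 4 * K%:R ^+ 2 / b%:R) * (b%:R * (b ^ b)%N%:R) <= _).
  rewrite -mulrA ler_wpM2r //.
  have : 0 <= (ytree R K.+1 - (1 - eps / 2)) * (1 - 4 * K%:R ^+ 2 / b%:R) by rewrite mulr_ge0; lra.
  move: (4 * K%:R ^+ 2 / b%:R) tt t0 => t tt t0; nra.
rewrite natr_sum ytreeE !mulr_suml.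
rewrite (big_ord_widen b.+1 (fun j => (tnum j)%:R / j`!%:R * ex R ^+ j * (1 - 4 * K%:R ^+ 2 / b%:R) * (b%:R * (b ^ b)%N%:R))); last first.
  by rewrite ltnS; apply: leq_trans bK; rewrite leq_pmull.
rewrite big_mkcond [leRHS]big_mkcond; apply: ler_sum => -[[|j] jlt] _ /=; first by rewrite !mul0r.
by rewrite ltnS; case: ifP => // jK; apply: term.
Qed.
End Bounds.

Lemma tegf_exp_indep (R : realFieldType) N N' z a : (a < N)%N -> (a < N')%N ->
  (tegf R N ^+ z)`_a = (tegf R N' ^+ z)`_a.
Proof.
move=> aN aN'; have f0 m : m`!%:R != 0 :> R by rewrite pnatr_eq0 -lt0n fact_gt0.
have := @nforests_egf R _ [set: 'I_a] N z; have := @nforests_egf R _ [set: 'I_a] N' z.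
rewrite cardsT card_ord => /(_ aN') -> /(_ aN) /(mulfI (f0 a)) /(mulIf _) -> //.
Qed.

(** * Balls in trees of bounded size *)

Section SmallTrees.
Variable R : realType.
Variables (k : nat) (E : rel 'I_k) (rH : 'I_k) (l : nat) (par : 'I_k -> 'I_k) (D : 'I_k -> nat).
Hypothesis td : tdata E rH l par D.
Let Z := #|depthset l D|.
Let I := #|[set i | (D i < l)%N]|.
Let ZI : (Z + I = k)%N := card_depthset td.

(** Pairs of a tree on b vertices and a centre with the given ball: [b ^_ k] embeddings, then (b -
    k)! [x^(b-I)] T^Z forests on the b - I remaining vertices with the Z prescribed roots, divided
    by the automorphisms. *)
Definition sT b : R := if (k <= b)%N then
  (b ^_ k)%:R * ((b - k)`!%:R * (tegf R b.+1 ^+ Z)`_(b - I)) / (Aut E rH)%:R else 0.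

Lemma sT_ge0 b : 0 <= sT b.
Proof.
rewrite /sT; case: ifP => // _; rewrite divr_ge0 // !mulr_ge0 // coef_exp_ge0 // => j.
exact: tegf_coef_ge0.
Qed.

Lemma small_tree_lb (T : finType) (B : {set T}) r0 : r0 \in B ->
  sT #|B| <= (\sum_(g in trees B r0) #|[set v in B | fiso E rH (fadj g) v l]|)%:R.
Proof.
move=> r0B; rewrite /sT; case: ifP => // kb.
have aE : (#|B| - I - Z = #|B| - k)%N by lia.
have Za : (Z <= #|B| - I)%N by lia.
have ab : (#|B| - I < #|B|.+1)%N by rewrite ltnS leq_subr.
have f0 m : m`!%:R != 0 :> R by rewrite pnatr_eq0 -lt0n fact_gt0.
have H := @tree_balls_lb T k E rH l par D td B r0 (nforests [set: 'I_(#|B| - I)] Z) r0B.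
have {}H := H _; move: H; set S := (\sum_(g in _) _)%N => H.
have {H} : (#|B| ^_ k * nforests [set: 'I_(#|B| - I)] Z <= 'C(#|B| - I, Z) * (Aut E rH * S))%N.
  apply: H => A cA; apply/eqP; rewrite -(eqr_nat R) (@nforests_egf R _ A #|B|.+1) ?cA //.
  by rewrite (@nforests_egf R _ [set: 'I_(#|B| - I)] #|B|.+1) ?cardsT ?card_ord.
rewrite -(ler_nat R) !natrM (@nforests_egf R _ [set: 'I_(#|B| - I)] #|B|.+1) cardsT card_ord //.
have := bin_fact Za; rewrite aE => /(congr1 (fun n => n%:R : R)); rewrite !natrM => <-.
have C0 : 0 < 'C(#|B| - I, Z)%:R :> R by rewrite ltr0n bin_gt0.
have A0 : 0 < (Aut E rH)%:R :> R by rewrite ltr0n Aut_gt0.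
move: (tegf _ _ ^+ _)`_ _ => c.
have -> : (#|B| ^_ k)%:R * ('C(#|B| - I, Z)%:R * (Z`!%:R * (#|B| - k)`!%:R) * (c / Z`!%:R)) =
   'C(#|B| - I, Z)%:R * ((#|B| ^_ k)%:R * ((#|B| - k)`!%:R * c)) :> R.
  by field.
rewrite ler_pM2l // => H.
by rewrite ler_pdivrMr // [leRHS]mulrC.
Qed.

Lemma sT_term b L : (I <= b)%N -> (b - I < L)%N ->
  sT b * ex R ^+ b / b`!%:R = qT R E rH l D * ((tegf R L ^+ Z)`_(b - I) * ex R ^+ (b - I)).
Proof.
move=> Ib bL; have A0 : (Aut E rH)%:R != 0 :> R by rewrite pnatr_eq0 -lt0n Aut_gt0.
have f0 m : m`!%:R != 0 :> R by rewrite pnatr_eq0 -lt0n fact_gt0.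
have qE : qT R E rH l D = ex R ^+ I / (Aut E rH)%:R.
  by rewrite /qT -/I /ex -expRM_natl mulrN1.
have eE : ex R ^+ b = ex R ^+ I * ex R ^+ (b - I) by rewrite -exprD subnKC.
rewrite qE eE /sT; case: (leqP k b) => kb; last first.
  by rewrite tegf_exp_small ?mul0r ?mulr0 //; lia.
rewrite (@tegf_exp_indep R b.+1 L) ?ltnS ?leq_subr //.
have := ffact_fact kb => /(congr1 (fun n => n%:R : R)); rewrite !natrM => eb.
rewrite -eb; have : (b ^_ k)%:R != 0 :> R by rewrite pnatr_eq0 -lt0n ffact_gt0.
by move: (f0 (b - k)%N) A0 => h1 h2 h3; field; rewrite h1 h2 h3.
Qed.

(** By [sT_term] the series is qT times T(e^-1)^Z, and T(e^-1) = 1. *)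
Lemma sT_sum eps : 0 < eps -> exists K0, forall K, (K0 <= K)%N ->
  qT R E rH l D - eps <= \sum_(b < K) sT b * ex R ^+ b / b`!%:R.
Proof.
move=> e0; set q := qT R E rH l D; have q0 : 0 <= q := qT_ge0 _ _ _ _ _.
pose e' := eps / ((q + 1) * (Z%:R + 1) + eps).
have Z0 : 0 <= Z%:R :> R by [].
have d0 : 0 < (q + 1) * (Z%:R + 1) + eps by rewrite addr_gt0 // mulr_gt0 // ltr_pwDr.
have e'0 : 0 < e' by rewrite divr_gt0.
have e'1 : e' <= 1 by rewrite ler_pdivrMr // mul1r lerDr mulr_ge0 // addr_ge0.
have qe' : q * (Z%:R * e') <= eps.
  rewrite /e' mulrA mulrA ler_pdivrMr //.
  have : 0 <= q * eps by rewrite mulr_ge0 // ltW.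
  have : 0 <= Z%:R * eps by rewrite mulr_ge0 // ltW.
  have : 0 <= eps * eps by rewrite mulr_ge0 // ltW.
  lra.
have [N0 HN] := ytree_lb e'0.
exists (N0 * Z.+1 + Z.+1 + I).+1 => K KK.
pose L := (K - I)%N; have LK : (L + I = K)%N by rewrite /L; lia.
apply: (@le_trans _ _ (q * \sum_(a < L) (tegf R L ^+ Z)`_a * ex R ^+ a)).
  have full := @full_horner R N0 Z.+1 L Z (ltnSn Z).
  apply: le_trans (ler_wpM2l q0 (full _)); last by rewrite /L; lia.
  have : (1 - e') ^+ Z <= ytree R N0 ^+ Z.
    by apply: lerXn2r; rewrite ?nnegrE ?subr_ge0 ?ytree_ge0 // HN.
  have := @bernoulli_sub R e' Z; rewrite e'1 ltW // => /(_ isT) h1 h2.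
  have := ler_wpM2l q0 (le_trans h1 h2); rewrite mulrBr mulr1; lra.
rewrite -LK addnC big_split_ord /= -[leLHS]add0r lerD //.
  by rewrite sumr_ge0 // => b _; rewrite divr_ge0 ?mulr_ge0 ?sT_ge0 ?exprn_ge0 ?ltW ?ex_gt0.
rewrite mulr_sumr; apply: ler_sum => a _.
by rewrite (@sT_term _ L) ?leq_addr ?addKn ?ltn_ord //.
Qed.
End SmallTrees.

(** * Counting canonical forests *)

Section CanonicalForests.
Variable R : realType.
Variable T : finType.
Implicit Types (A B : {set T}) (f g : {ffun T -> T}).

Definition CF kap : {set {ffun T -> T}} :=
  [set f in frs [set: T] | (#|roots f [set: T]| == kap) && least_rooted f [set: T]].

(* First-order count of unrooted forests on [n] vertices with [kap] trees: the series of unrooted trees equals 1/2 at its singularity [ex R] = e^-1. *)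
Definition Xn (n kap : nat) : R := n`!%:R / (ex R ^+ n * 2 ^+ kap * kap`!%:R).

Lemma Xn_ge0 n kap : 0 <= Xn n kap.
Proof. by rewrite divr_ge0 // !mulr_ge0 ?exprn_ge0 // ltW // ex_gt0. Qed.

Lemma CF_fsum (w : {set T} -> {ffun T -> T} -> R) kap :
  \sum_(f in CF kap) \prod_(r in roots f [set: T]) w (cell f [set: T] r) (restr f (cell f [set: T] r)) =
  fsum (fun B g => (crep B g)%:R * w B g) [set: T] kap.
Proof.
rewrite /fsum big_mkcond [RHS]big_mkcond /=; apply: eq_bigr => f _.
rewrite in_set; case: (boolP (f \in frs [set: T])) => //= ff; case: eqP => //= _.
case: (boolP (least_rooted f _)) => [/forall_inP cf|/forall_inPn [r rr cr]].
  apply: eq_bigr => r rr; rewrite (_ : crep _ _ = true) ?mul1r //.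
  by apply/forall_inP => r'; rewrite cell_roots // inE => /eqP ->; apply: cf.
rewrite /fweight (bigD1 r) //= (_ : crep _ _ = false) ?mul0r //.
apply/negbTE/forall_inPn; exists r => //.
by rewrite cell_roots // set11.
Qed.

Lemma tsum_crep (w : {set T} -> {ffun T -> T} -> R) B :
  tsum (fun B g => (crep B g)%:R * w B g) B =
  if [pick x in B] is Some r then \sum_(g in trees B r) w B g else 0.
Proof.
have H := crep_trees B; rewrite /tsum.
transitivity (\sum_(g in [set g in frs B | (#|roots g B| == 1%N) && crep B g]) w B g).
  rewrite big_mkcond [RHS]big_mkcond; apply: eq_bigr => g _; rewrite in_set.
  by case: (g \in frs B) => //=; case: eqP => //= _; case: (crep B g); rewrite ?mul1r ?mul0r.
by rewrite -H; case: pickP => // _; rewrite big_set0.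
Qed.

Lemma card_trees_cnum B r : r \in B -> #|trees B r| = cnum #|B|.
Proof.
move=> rB; have b0 : (0 < #|B|)%N by apply/card_gt0P; exists r.
have := card_trees rB; rewrite card_rooted_trees // => e.
apply/eqP; rewrite -(eqn_pmul2r b0) e mulnC -tnum_cnum /tnum.
by rewrite (gtn_eqF b0).
Qed.

Definition cegf N : {poly R} := egf N (fun b => (cnum b)%:R).

Lemma card_CF kap N : (#|T| < N)%N ->
  #|CF kap|%:R = (#|T|)`!%:R * ((cegf N ^+ kap)`_#|T| / kap`!%:R) :> R.
Proof.
move=> TN; have := CF_fsum (fun _ _ => 1) kap.
rewrite (eq_bigr (fun=> 1)); last by move=> f _; rewrite big1.
rewrite sumr_const => ->.
have := @fsum_egf T R (fun B g => (crep B g)%:R * 1) N (fun b => (cnum b)%:R) [set: T] kap.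
rewrite cardsT => -> // B _; rewrite (tsum_crep (fun _ _ => 1)).
case: pickP => [r rB|B0]; first by rewrite sumr_const card_trees_cnum.
by rewrite (_ : B = set0) ?cards0 //; apply/setP => x; rewrite inE; have := B0 x.
Qed.

Lemma coef_le_horner (q : {poly R}) (x : R) a : 0 <= x -> (forall i, 0 <= q`_i) ->
  q`_a * x ^+ a <= q.[x].
Proof.
move=> x0 q0; apply: le_trans (trunc_horner_le a.+1 x0 q0).
by rewrite big_ord_recr /= lerDr sumr_ge0 // => i _; rewrite mulr_ge0 // exprn_ge0.
Qed.

(** Saddle point bound: a power series with nonnegative coefficients has n-th coefficient at most
    its value at e^-1 divided by e^(-n). *)
Lemma CF_weight_bound (w : {set T} -> {ffun T -> T} -> R) (Om : nat -> R) kap :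
  (forall b, 0 <= Om b) -> (forall B g, 0 <= w B g) ->
  (forall B r, r \in B -> \sum_(g in trees B r) w B g <= Om #|B|) ->
  \sum_(f in CF kap) \prod_(r in roots f [set: T]) w (cell f [set: T] r) (restr f (cell f [set: T] r))
  <= (#|T|)`!%:R / (ex R ^+ #|T| * kap`!%:R) * (\sum_(b < #|T|.+1) Om b * ex R ^+ b / b`!%:R) ^+ kap.
Proof.
move=> Om0 w0 H; rewrite CF_fsum.
have x0 : 0 < ex R ^+ #|T| by rewrite exprn_gt0 // ex_gt0.
have f0 m : 0 < m`!%:R :> R by rewrite ltr0n fact_gt0.
have := @fsum_le_egf T R (fun B g => (crep B g)%:R * w B g) #|T|.+1 Om Om0 [set: T] kap.
rewrite cardsT ltnSn => /(_ isT) H1; apply: le_trans (H1 _ _) _ => [B _|B _|].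
- by rewrite tsum_crep; case: pickP => [r rB|_]; [apply: H|].
- by rewrite tsum_crep; case: pickP => [r rB|_] //; apply: sumr_ge0.
set p := egf _ _; have p0 i : 0 <= p`_i.
  by rewrite coef_poly; case: ifP => // _; rewrite divr_ge0.
have -> : \sum_(b < #|T|.+1) Om b * ex R ^+ b / b`!%:R = p.[ex R].
  by rewrite horner_poly; apply: eq_bigr => b _; rewrite mulrAC.
rewrite -horner_exp; have := @coef_le_horner (p ^+ kap) (ex R) #|T| (ltW (ex_gt0 R)).
move=> /(_ (fun i => coef_exp_ge0 kap i p0)).
move: (p ^+ kap)`_ _ (p ^+ kap).[_] => c h ch.
have -> : (#|T|)`!%:R * (c / kap`!%:R) = (#|T|)`!%:R / (ex R ^+ #|T| * kap`!%:R) * (c * ex R ^+ #|T|).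
  by field; rewrite !gt_eqF.
by rewrite ler_wpM2l // divr_ge0 // mulr_ge0 // ltW.
Qed.

(** If a weight raises the value 1/2 of the series of unrooted trees to at most (1 + t) / 2, each of
    the kap trees contributes at most a factor e^t compared with [Xn]. *)
Lemma CF_weight_exp (w : {set T} -> {ffun T -> T} -> R) (Om : nat -> R) kap (t : R) :
  (forall b, 0 <= Om b) -> (forall B g, 0 <= w B g) ->
  (forall B r, r \in B -> \sum_(g in trees B r) w B g <= Om #|B|) ->
  \sum_(b < #|T|.+1) Om b * ex R ^+ b / b`!%:R <= 1 / 2 * (1 + t) ->
  \sum_(f in CF kap) \prod_(r in roots f [set: T]) w (cell f [set: T] r) (restr f (cell f [set: T] r))
  <= Xn #|T| kap * expR (t * kap%:R).
Proof.
move=> Om0 w0 H Ht; apply: le_trans (CF_weight_bound kap Om0 w0 H) _.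
have x0 : 0 < ex R ^+ #|T| by rewrite exprn_gt0 // ex_gt0.
have f0 m : 0 < m`!%:R :> R by rewrite ltr0n fact_gt0.
rewrite [Xn _ _](_ : _ = (#|T|)`!%:R / (ex R ^+ #|T| * kap`!%:R) * (1 / 2) ^+ kap); last first.
  have t0 : 2 ^+ kap != 0 :> R by rewrite expf_neq0 // pnatr_eq0.
  by rewrite /Xn expr_div_n expr1n; field; rewrite !gt_eqF.
rewrite -[leRHS]mulrA ler_wpM2l ?divr_ge0 ?mulr_ge0 ?(ltW x0) //.
rewrite expRM_natr -exprMn lerXn2r ?nnegrE ?mulr_ge0 ?expR_ge0 ?divr_ge0 //.
  by rewrite sumr_ge0 // => b _; rewrite divr_ge0 // mulr_ge0 // exprn_ge0 // ltW // ex_gt0.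
by apply: le_trans Ht _; rewrite ler_wpM2l // ?divr_ge0 // expR_ge1Dx.
Qed.

Lemma CF_markov (Bad : {set {ffun T -> T}}) (w : {set T} -> {ffun T -> T} -> R) (M : R) kap (a : R) :
  0 < a -> (forall B g, 0 <= w B g) ->
  (forall f, f \in Bad -> f \in CF kap /\
    a <= \prod_(r in roots f [set: T]) w (cell f [set: T] r) (restr f (cell f [set: T] r))) ->
  \sum_(f in CF kap) \prod_(r in roots f [set: T]) w (cell f [set: T] r) (restr f (cell f [set: T] r)) <= M ->
  #|Bad|%:R <= M / a.
Proof.
move=> a0 w0 HB HM; rewrite ler_pdivlMr //; apply: le_trans HM.
rewrite mulr_natl -sumr_const big_mkcond [leRHS]big_mkcond; apply: ler_sum => f _.
case: (boolP (f \in Bad)) => [/HB [-> //]|_]; case: ifP => // _.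
by apply: prodr_ge0.
Qed.

End CanonicalForests.

(** * Large deviations in forests *)

Section ForestDeviations.
Variable R : realType.

Lemma sum_cnum_le n : \sum_(b < n) (cnum b)%:R * ex R ^+ b / b`!%:R <= 1 / 2.
Proof.
rewrite (eq_bigr (fun b : 'I_n => (cnum b)%:R / b`!%:R * ex R ^+ b)) ?utree_le // => b _.
by rewrite mulrAC.
Qed.

Lemma sum_tnum_le n : \sum_(b < n) b%:R * (cnum b)%:R * ex R ^+ b / b`!%:R <= 1.
Proof.
rewrite (eq_bigr (fun b : 'I_n => (tnum b)%:R / b`!%:R * ex R ^+ b)) -?ytreeE ?ytree_le1 // => b _.
by rewrite mulrAC tnum_cnum natrM.
Qed.

Lemma card_smallv (T : finType) (f : {ffun T -> T}) K : acyc f ->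
  #|smallv f K| = (\sum_(r in roots f [set: T] | #|cell f [set: T] r| <= K) #|cell f [set: T] r|)%N.
Proof.
move=> af; have := @sum_cells T f (fun C => #|C| <= K)%N xpredT af.
rewrite (_ : [set v | _ && _] = smallv f K); last by apply/setP => v; rewrite !in_set andbT.
by move=> ->; apply: eq_bigr => r _; apply: eq_card => v; rewrite in_set andbT.
Qed.

Lemma card_bigv (T : finType) (f : {ffun T -> T}) K : acyc f ->
  #|~: smallv f K| = (\sum_(r in roots f [set: T] | K < #|cell f [set: T] r|) #|cell f [set: T] r|)%N.
Proof.
move=> af; have := @sum_cells T f (fun C => K < #|C|)%N xpredT af.
rewrite (_ : [set v | _ && _] = ~: smallv f K); last by apply/setP => v; rewrite !in_set andbT ltnNge.
by move=> ->; apply: eq_bigr => r _; apply: eq_card => v; rewrite in_set andbT.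
Qed.

Lemma prod_expR (I : finType) (P Q : pred I) (F : I -> R) :
  \prod_(i | P i) (if Q i then expR (F i) else 1) = expR (\sum_(i | P i && Q i) F i).
Proof. by rewrite -big_mkcondr expR_sum. Qed.

Lemma CF_acyc (T : finType) (f : {ffun T -> T}) kap : f \in CF T kap -> acyc f.
Proof. by rewrite in_set => /andP [/frsP []]. Qed.

(** A small tree of size b gets weight e^(la b). To first order the series U grows by la T, and T /
    U = 2 at e^-1: small trees hold on average at most two vertices per tree. *)
Lemma small_mass (eps : R) K : 0 < eps -> (0 < K)%N -> exists2 d, 0 < d &
  forall (T : finType) kap,
  #|[set f in CF T kap | (2 + eps) * kap%:R < #|smallv f K|%:R]|%:R
    <= Xn R #|T| kap * expR (- d * kap%:R).
Proof.
move=> e0 K0; have K0' : 0 < K%:R :> R by rewrite ltr0n.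
(* The second order term 4 la^2 K has to stay below half the gain la eps, and la K <= 1/2 is the
   range of [expR_le_quad]. *)
pose la := Num.min (eps / (8 * K%:R)) (1 / (2 * K%:R)).
have la0 : 0 < la by rewrite lt_min !divr_gt0 // mulr_gt0.
have la1 : la * K%:R <= 1 / 2.
  by rewrite -ler_pdivlMr // (le_trans (_ : la <= 1 / (2 * K%:R))) ?ge_min ?lexx ?orbT // invfM mulrA.
have la2 : 8 * la * K%:R <= eps.
  have : la <= eps / (8 * K%:R) by rewrite ge_min lexx.
  by rewrite ler_pdivlMr ?mulr_gt0 //; lra.
exists (la * eps / 2); first by rewrite !mulr_gt0 // invr_gt0.
move=> T kap; pose w (B : {set T}) (g : {ffun T -> T}) : R :=
  if (#|B| <= K)%N then expR (la * #|B|%:R) else 1.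
pose Om b : R := (cnum b)%:R * (if (b <= K)%N then expR (la * b%:R) else 1).
have Om0 b : 0 <= Om b by rewrite /Om mulr_ge0 //; case: ifP; rewrite ?expR_ge0.
have w0 B g : 0 <= w B g by rewrite /w; case: ifP; rewrite ?expR_ge0.
have H1 (B : {set T}) r : r \in B -> \sum_(g in trees B r) w B g <= Om #|B|.
  by move=> rB; rewrite sumr_const (card_trees_cnum rB) /Om /w mulr_natl.
pose t := 2 * la + 4 * la ^+ 2 * K%:R.
have H2 : \sum_(b < #|T|.+1) Om b * ex R ^+ b / b`!%:R <= 1 / 2 * (1 + t).
  pose u b : R := ex R ^+ b / b`!%:R; have u0 b : 0 <= u b.
    by rewrite divr_ge0 ?exprn_ge0 // ltW // ex_gt0.
  apply: (@le_trans _ _ (\sum_(b < #|T|.+1) ((cnum b)%:R * ex R ^+ b / b`!%:R +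
      (la + 2 * la ^+ 2 * K%:R) * (b%:R * (cnum b)%:R * ex R ^+ b / b`!%:R)))).
    apply: ler_sum => b _; have uE (x : R) : x * ex R ^+ b / b`!%:R = x * u b by rewrite /u mulrA.
    rewrite !uE [leRHS](_ : _ = (cnum b)%:R * u b * (1 + (la + 2 * la ^+ 2 * K%:R) * b%:R)); last by ring.
    rewrite /Om mulrAC; apply: ler_wpM2l; first by apply: mulr_ge0.
    case: (leqP b K) => bK; last first.
      by rewrite lerDl mulr_ge0 // addr_ge0 ?mulr_ge0 // ?exprn_ge0 // ltW.
    have bK' : b%:R <= K%:R :> R by rewrite ler_nat.
    have lab : la * b%:R <= la * K%:R by rewrite ler_wpM2l // ltW.
    apply: le_trans (expR_le_quad (le_trans lab la1)) _.
    have : (la * b%:R) * (la * b%:R) <= (la * b%:R) * (la * K%:R).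
      by rewrite ler_wpM2l // mulr_ge0 // ltW.
    by rewrite !expr2; lra.
  rewrite big_split /= -mulr_sumr.
  have h0 : 0 <= la + 2 * la ^+ 2 * K%:R by rewrite addr_ge0 ?mulr_ge0 ?exprn_ge0 // ltW.
  have := lerD (sum_cnum_le #|T|.+1) (ler_wpM2l h0 (sum_tnum_le #|T|.+1)).
  by rewrite /t; lra.
set Bad := [set f in _ | _].
have := CF_weight_exp kap Om0 w0 H1 H2.
move/(@CF_markov R T Bad w _ kap (expR (la * ((2 + eps) * kap%:R))) (expR_gt0 _) w0) => H.
apply: le_trans (H _) _ => [f|].
  rewrite in_set => /andP [fC bad]; split=> //; rewrite prod_expR ler_expR.
  rewrite -mulr_sumr ler_wpM2l ?(ltW la0) //.
  by apply: ltW; apply: lt_le_trans bad _; rewrite (card_smallv _ (CF_acyc fC)) natr_sum.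
rewrite -mulrA ler_wpM2l ?Xn_ge0 // -expRN -expRD ler_expR.
have k0 : 0 <= kap%:R :> R by [].
have : (4 * la ^+ 2 * K%:R) * kap%:R <= (la * eps / 2) * kap%:R.
  by rewrite ler_wpM2r // expr2; have := ler_wpM2l (ltW la0) la2; lra.
by rewrite /t; lra.
Qed.

Section Small.
Variables (k : nat) (E : rel 'I_k) (rH : 'I_k) (l : nat) (par : 'I_k -> 'I_k) (D : 'I_k -> nat).
Hypothesis td : tdata E rH l par D.
Notation q := (qT R E rH l D).

Lemma sT_le b : sT R E rH l D b <= b%:R * (cnum b)%:R.
Proof.
case: b => [|b].
  by rewrite /sT; case: k E rH par D td => // [_ []|] //= *; rewrite mul0r.
have := @small_tree_lb R k E rH l par D td 'I_b.+1 [set: 'I_b.+1] ord0 (in_setT _).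
rewrite cardsT card_ord => /le_trans -> //; rewrite -natrM ler_nat.
rewrite -[X in (_ <= _ * X)%N](_ : #|trees [set: 'I_b.+1] ord0| = _); last first.
  by rewrite (card_trees_cnum (in_setT _)) cardsT card_ord.
rewrite mulnC -sum_nat_const; apply: leq_sum => g _; rewrite -[leqRHS](card_ord b.+1) -cardsT.
by rewrite subset_leq_card // subsetT.
Qed.

(** Weight e^(- la N) for a small tree with N suitable centres. The first order change of U is - la
    qT by [sT_sum], and U = 1/2, so the mean number of such centres is 2 qT per tree. The sizes up
    to K all occur in the sum because K < [#|T|]. *)
Lemma small_balls (eps : R) : 0 < eps -> exists K0, forall K, (K0 <= K)%N -> exists2 d, 0 < d &
  forall (T : finType) kap, (K < #|T|)%N ->
  #|[set f in CF T kap | #|[set v in smallv f K | fiso E rH (fadj f) v l]|%:R < (2 * q - eps) * kap%:R]|%:R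
    <= Xn R #|T| kap * expR (- d * kap%:R).
Proof.
move=> e0; have [|K0 HK0] := @sT_sum R k E rH l par D td (eps / 8); first by lra.
exists K0.+1 => K KK; have K0' : 1 <= K%:R :> R by rewrite ler1n; apply: leq_trans KK.
have Kp : 0 < K%:R :> R by lra.
pose la := Num.min (eps / (8 * K%:R ^+ 2)) (1 / (2 * K%:R)).
have la0 : 0 < la by rewrite lt_min !divr_gt0 // mulr_gt0 // exprn_gt0.
have la1 : la * K%:R <= 1 / 2.
  by rewrite -ler_pdivlMr // (le_trans (_ : la <= 1 / (2 * K%:R))) ?ge_min ?lexx ?orbT // invfM mulrA.
have la2 : 8 * la * K%:R ^+ 2 <= eps.
  have : la <= eps / (8 * K%:R ^+ 2) by rewrite ge_min lexx.
  by rewrite ler_pdivlMr ?mulr_gt0 ?exprn_gt0 //; lra.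
exists (la * eps / 4); first by rewrite !mulr_gt0 // invr_gt0.
move=> T kap Kn; pose N (B : {set T}) (g : {ffun T -> T}) := #|[set v in B | fiso E rH (fadj g) v l]|.
pose w (B : {set T}) (g : {ffun T -> T}) : R :=
  if (#|B| <= K)%N then expR (- la * (N B g)%:R) else 1.
pose s := sT R E rH l D.
pose Om b : R := if (b <= K)%N then (cnum b)%:R * (1 + 2 * (la * K%:R) ^+ 2) - la * s b else (cnum b)%:R.
have Om0 b : 0 <= Om b.
  rewrite /Om; case: ifP => // bK; have := ler_wpM2l (ltW la0) (sT_le b); rewrite -/s.
  have : la * b%:R <= 1 / 2 by apply: le_trans la1; rewrite ler_wpM2l ?ler_nat // ltW.
  have c0 : 0 <= (cnum b)%:R :> R by [].
  move=> /(ler_wpM2r c0); have : 0 <= (cnum b)%:R * (la * K%:R) ^+ 2 by rewrite mulr_ge0 // exprn_ge0 // mulr_ge0 // ltW.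
  by lra.
have w0 B g : 0 <= w B g by rewrite /w; case: ifP; rewrite ?expR_ge0.
have H1 (B : {set T}) r : r \in B -> \sum_(g in trees B r) w B g <= Om #|B|.
  move=> rB; rewrite /w /Om; case: ifP => BK; last by rewrite sumr_const (card_trees_cnum rB).
  have NB g : (N B g)%:R <= K%:R :> R.
    by rewrite ler_nat (leq_trans _ BK) // subset_leq_card //; apply/subsetP => v; rewrite in_set => /andP [].
  apply: (@le_trans _ _ (\sum_(g in trees B r) (1 - la * (N B g)%:R + 2 * (la * K%:R) ^+ 2))).
    apply: ler_sum => g _; have N0 : 0 <= la * (N B g)%:R by rewrite mulr_ge0 // ltW.
    apply: le_trans (expR_le_quad _) _; first by rewrite mulNr; lra.
    have : (la * (N B g)%:R) ^+ 2 <= (la * K%:R) ^+ 2.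
      by rewrite lerXn2r ?nnegrE ?mulr_ge0 // ?ler_wpM2l // ltW.
    by rewrite mulNr sqrrN; lra.
  rewrite big_split /= sumr_const big_split /= sumr_const sumrN -mulr_sumr (card_trees_cnum rB).
  have := small_tree_lb R td rB; rewrite natr_sum -/(s _) => /(ler_wpM2l (ltW la0)).
  rewrite -[_ *+ cnum _]mulr_natl -[(2 * _) *+ cnum _]mulr_natl /N; lra.
pose t := 2 * (la * K%:R) ^+ 2 - 2 * la * (q - eps / 8).
have H2 : \sum_(b < #|T|.+1) Om b * ex R ^+ b / b`!%:R <= 1 / 2 * (1 + t).
  have u0 (b : nat) : 0 <= ex R ^+ b / b`!%:R by rewrite divr_ge0 ?exprn_ge0 // ltW // ex_gt0.
  apply: (@le_trans _ _ ((1 + 2 * (la * K%:R) ^+ 2) * (\sum_(b < #|T|.+1) (cnum b)%:R * ex R ^+ b / b`!%:R)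
      - la * \sum_(b < #|T|.+1) (if (b < K.+1)%N then s b * ex R ^+ b / b`!%:R else 0))).
    rewrite !mulr_sumr -sumrB; apply: ler_sum => b _.
    have uE (x : R) : x * ex R ^+ b / b`!%:R = x * (ex R ^+ b / b`!%:R) by rewrite mulrA.
    have h0 : 0 <= 2 * (la * K%:R) ^+ 2 * ((cnum b)%:R * (ex R ^+ b / b`!%:R)).
      by rewrite mulr_ge0 //; [rewrite mulr_ge0 ?sqr_ge0|rewrite mulr_ge0].
    by rewrite /Om ltnS; case: ifP => bK; rewrite !uE; move: h0; move: (ex R ^+ b / b`!%:R) => u; lra.
  rewrite -big_mkcond /= -(@big_ord_widen _ _ _ K.+1 #|T|.+1 (fun b => s b * ex R ^+ b / b`!%:R)) ?ltnS 1?ltnW //.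
  have h0 : 0 <= 1 + 2 * (la * K%:R) ^+ 2 by rewrite addr_ge0 // mulr_ge0 // exprn_ge0 // mulr_ge0 // ltW.
  have := ler_wpM2l h0 (sum_cnum_le #|T|.+1).
  have := ler_wpM2l (ltW la0) (HK0 K.+1 (leqW (ltnW KK))); rewrite -/s /t; lra.
set Bad := [set f in _ | _].
have := CF_weight_exp kap Om0 w0 H1 H2.
move/(@CF_markov R T Bad w _ kap (expR (- la * ((2 * q - eps) * kap%:R))) (expR_gt0 _) w0) => H.
apply: le_trans (H _) _ => [f|].
  rewrite in_set => /andP [fC bad]; split=> //; rewrite prod_expR ler_expR.
  rewrite -mulr_sumr ler_wnM2l ?oppr_le0 ?(ltW la0) //.
  apply: ltW; apply: le_lt_trans bad; have af := CF_acyc fC.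
  rewrite (_ : [set v in smallv f K | _] = [set v | (#|cc f v| <= K)%N && fiso E rH (fadj f) v l]); last first.
    by apply/setP => v; rewrite !in_set.
  rewrite (sum_cells (fun C => #|C| <= K)%N _ af) natr_sum.
  apply: ler_sum => r _; rewrite ler_nat; apply: subset_leq_card; apply/subsetP => v.
  rewrite !in_set /= => /andP [vC fi]; rewrite vC /=; move: fi.
  have vC' : v \in cell f [set: T] r by rewrite in_set in_setT.
  by have [-> _] := @cell_ball T k E rH l f r v af vC'.
rewrite -mulrA ler_wpM2l ?Xn_ge0 // -expRN -expRD ler_expR.
have k0 : 0 <= kap%:R :> R by [].
have : 2 * (la * K%:R) ^+ 2 * kap%:R <= (la * eps / 4) * kap%:R.
  by rewrite ler_wpM2r // !expr2; have := ler_wpM2l (ltW la0) la2; rewrite !expr2; lra.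
have : 0 <= la * eps * kap%:R by rewrite !mulr_ge0 // ltW.
by rewrite /t; lra.
Qed.
End Small.

(* Big cells: random trees are dominated by random functions, for which bounded differences apply. *)
Lemma big_stat (g : forall T : finType, {set T} -> {ffun T -> T} -> nat) (mu eps c : R) b0 :
  0 < eps -> 0 <= c ->
  (forall (T : finType) (B : {set T}) f x s, f \in Fam B -> x \in B -> s \in B ->
     `|(g T B f)%:R - (g T B (upd f x s))%:R| <= c) ->
  (forall (T : finType) (B : {set T}), (b0 <= #|B|)%N ->
     (mu - eps / 2) * #|B|%:R * (#|B| ^ #|B|)%:R <= (\sum_(f in Fam B) g T B f)%:R) ->
  exists K0, forall K, (K0 <= K)%N -> exists2 d, 0 < d & forall (T : finType) kap,
    #|[set f in CF T kap |
      (\sum_(r in roots f [set: T] | (K < #|cell f [set: T] r|)%N)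
          g T (cell f [set: T] r) (restr f (cell f [set: T] r)))%:R
        < (mu - eps) * #|~: smallv f K|%:R - eps * #|T|%:R]|%:R
    <= Xn R #|T| kap * expR (- d * #|T|%:R).
Proof.
move=> e0 c0 lip mean; have c1 : 0 < c + 1 by lra.
pose la := Num.min (eps / (8 * (c + 1) ^+ 2)) (1 / (2 * (c + 1))).
have la0 : 0 < la by rewrite lt_min !divr_gt0 // mulr_gt0 // exprn_gt0.
have la1 : la * c <= 1 / 2.
  have : la * (c + 1) <= 1 / 2.
    by rewrite -ler_pdivlMr // (le_trans (_ : la <= 1 / (2 * (c + 1)))) ?ge_min ?lexx ?orbT // invfM mulrA.
  by lra.
have la2 : 8 * la * c ^+ 2 <= eps.
  have : la <= eps / (8 * (c + 1) ^+ 2) by rewrite ge_min lexx.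
  rewrite ler_pdivlMr ?mulr_gt0 ?exprn_gt0 //; apply: le_trans.
  have : la * c ^+ 2 <= la * (c + 1) ^+ 2.
    by rewrite ler_wpM2l ?(ltW la0) // lerXn2r ?nnegrE //; lra.
  by lra.
have [K1 HK1] : exists K1 : nat, 6 / (la * eps / 4) ^+ 3 <= K1%:R.
  have d0 : 0 <= 6 / (la * eps / 4) ^+ 3 by rewrite divr_ge0 // exprn_ge0 // divr_ge0 // mulr_ge0 // ltW.
  by exists (Num.bound (6 / (la * eps / 4) ^+ 3)); apply/ltW/archi_boundP.
exists (b0 + K1)%N => K KK; exists (la * eps); first by rewrite mulr_gt0.
move=> T kap; pose w (B : {set T}) (h : {ffun T -> T}) : R :=
  if (K < #|B|)%N then expR (- la * ((g T B h)%:R - (mu - eps) * #|B|%:R)) else 1.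
have w0 B h : 0 <= w B h by rewrite /w; case: ifP; rewrite ?expR_ge0.
have H1 (B : {set T}) r : r \in B -> \sum_(h in trees B r) w B h <= (cnum #|B|)%:R.
  move=> rB; rewrite /w; case: (ltnP K #|B|) => BK; last by rewrite sumr_const (card_trees_cnum rB).
  apply: (@le_trans _ _ (\sum_(h in Fam B) expR (- la * ((g T B h)%:R - (mu - eps) * #|B|%:R)))).
    rewrite big_mkcond [leRHS]big_mkcond; apply: ler_sum => h _.
    case: (boolP (h \in trees B r)) => [/treesP [_ sh _]|_]; last by case: ifP => // _; rewrite expR_ge0.
    by rewrite [h \in Fam B]in_set sh.
  apply: (@tree_chernoff R T B (g T B) c mu eps la) => //.
  - by move=> f x s; apply: lip.
  - by apply: mean; apply: leq_trans (ltnW BK); apply: leq_trans KK; apply: leq_addr.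
  - apply: le_trans HK1 _; rewrite ler_nat; apply: leq_trans (ltnW BK); apply: leq_trans KK; apply: leq_addl.
  - by apply: leq_ltn_trans BK.
have H2 : \sum_(b < #|T|.+1) (cnum b)%:R * ex R ^+ b / b`!%:R <= 1 / 2 * (1 + 0).
  by rewrite addr0 mulr1 sum_cnum_le.
set Bad := [set f in _ | _].
have := CF_weight_exp kap (fun b => ler0n R (cnum b)) w0 H1 H2.
move/(@CF_markov R T Bad w _ kap (expR (la * (eps * #|T|%:R))) (expR_gt0 _) w0) => H.
apply: le_trans (H _) _ => [f|].
  rewrite in_set => /andP [fC bad]; split=> //; rewrite prod_expR ler_expR.
  rewrite -mulr_sumr sumrB -mulr_sumr -!natr_sum -(card_bigv _ (CF_acyc fC)).
  by rewrite mulNr -mulrN ler_wpM2l ?(ltW la0) //; move: bad; lra.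
by rewrite -mulrA ler_wpM2l ?Xn_ge0 // -expRN -expRD ler_expR; lra.
Qed.

Lemma fadj_upd (T : finType) (f : {ffun T -> T}) x s y z : y \notin [set x; f x; s] ->
  fadj f y z = fadj (upd f x s) y z.
Proof.
rewrite !in_setU !in_set1 !negb_or -andbA => /and3P [yx yfx ys]; rewrite /fadj !updE (negPf yx).
by case: (eqVneq z x) => // ->; rewrite [f x == y]eq_sym (negPf yfx) [s == y]eq_sym (negPf ys).
Qed.

Lemma upd_upd (T : finType) (f : {ffun T -> T}) x s : upd (upd f x s) x (f x) = f.
Proof. by apply/ffunP => z; rewrite !updE; case: eqP => [->|]. Qed.

Lemma absn_le (a b c : nat) : (a <= b + c)%N -> (b <= a + c)%N -> `|a%:R - b%:R| <= c%:R :> R.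
Proof. by rewrite -!(ler_nat R) !natrD => h1 h2; rewrite ler_norml; lra. Qed.

Lemma big_desc (eps : R) : 0 < eps -> exists K1, exists K0, forall K, (K0 <= K)%N ->
  exists2 d, 0 < d & forall (T : finType) kap,
    #|[set f in CF T kap | #|smalldsc f K1 (~: smallv f K)|%:R
        < (1 - eps) * #|~: smallv f K|%:R - eps * #|T|%:R]|%:R
    <= Xn R #|T| kap * expR (- d * #|T|%:R).
Proof.
move=> e0; have [|K1 [b0 mean]] := @desc_mean R (eps / 2); first by lra.
have [//||||K0 HK0] := @big_stat (fun T B f => #|smalldsc f K1 B|) 1 eps K1%:R b0.
- by [].
- move=> T B f x s _ _ _; apply: absn_le; first exact: smalldsc_lip.
  by rewrite -{2}(upd_upd f x s); apply: smalldsc_lip.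
- by move=> T B bB; apply: mean.
exists K1, K0 => K KK; have [d d0 Hd] := HK0 K KK; exists d => // T kap.
apply: le_trans (Hd T kap); rewrite ler_nat; apply: subset_leq_card; apply/subsetP => f.
rewrite !in_set => /andP [fC bad]; rewrite fC /=; apply: le_lt_trans bad; rewrite ler_nat.
have af : acyc f by move: fC => /andP [/andP []].
rewrite -[in leqRHS](_ : [set v | (K < #|cc f v|)%N && (#|dsc f v| <= K1)%N] = smalldsc f K1 (~: smallv f K)); last first.
  by apply/setP => v; rewrite !in_set ltnNge.
rewrite (sum_cells (fun C => K < #|C|)%N _ af); apply: leq_sum => r _.
apply: subset_leq_card; apply/subsetP => v; rewrite !in_set /= => /andP [vC]; rewrite vC /= dsc_restr //.
- by rewrite in_set in_setT.
- by move=> z; rewrite !in_set frootS.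
- by move=> z; rewrite !in_set frootS.
Qed.

Section Big.
Variables (k : nat) (E : rel 'I_k) (rH : 'I_k) (l : nat) (par : 'I_k -> 'I_k) (D : 'I_k -> nat).
Hypothesis td : tdata E rH l par D.
Notation q := (qS R E rH l D).

Lemma big_balls (eps : R) : 0 < eps -> exists K', exists K0, forall K, (K0 <= K)%N ->
  exists2 d, 0 < d & forall (T : finType) kap,
    #|[set f in CF T kap | #|Mset E rH (fadj f) l K' (~: smallv f K)|%:R
        < (q - eps) * #|~: smallv f K|%:R - eps * #|T|%:R]|%:R
    <= Xn R #|T| kap * expR (- d * #|T|%:R).
Proof.
move=> e0; have [|K2 [b0 mean]] := @big_tree_mean R k E rH l par D td (eps / 2); first by lra.
pose K' := (k + 1 + K2)%N.
have [//||||K0 HK0] := @big_stat (fun T B f => #|Mset E rH (fadj f) l K' B|) q eps (3 * K'.+1 ^ l)%:R b0.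
- by [].
- move=> T B f x s _ _ _.
  (* Redirecting x from [f x] to s leaves adjacency unchanged at every vertex other than these
     three. *)
  have c3 : (#|[set x; f x; s]| <= 3)%N.
    rewrite (leq_trans (leq_card_setU _ _)) // cards1 addn1 ltnS (leq_trans (leq_card_setU _ _)) //.
    by rewrite !cards1.
  have lip := @Mset_lip T k E rH (fadj f) (fadj (upd f x s)) l K' [set x; f x; s] B (@fadj_sym _ f).
  have lip' := @Mset_lip T k E rH (fadj (upd f x s)) (fadj f) l K' [set x; f x; s] B (@fadj_sym _ _).
  apply: absn_le; [apply: leq_trans (lip _) _|apply: leq_trans (lip' _) _];
    try (by move=> y z yX; rewrite (fadj_upd z yX)); by rewrite leq_add2l leq_mul2r c3 orbT.
- by move=> T B bB; apply: mean.
exists K', K0 => K KK; have [d d0 Hd] := HK0 K KK; exists d => // T kap.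
apply: le_trans (Hd T kap); rewrite ler_nat; apply: subset_leq_card; apply/subsetP => f.
rewrite !in_set => /andP [fC bad]; rewrite fC /=; apply: le_lt_trans bad; rewrite ler_nat.
have af : acyc f by move: fC => /andP [/andP []].
rewrite -[in leqRHS](_ : [set v | (K < #|cc f v|)%N && (fiso E rH (fadj f) v l && (#|fball (fadj f) v l.+1| <= K')%N)]
   = Mset E rH (fadj f) l K' (~: smallv f K)); last first.
  by apply/setP => v; rewrite !in_set ltnNge.
rewrite (sum_cells (fun C => K < #|C|)%N _ af); apply: leq_sum => r _.
apply: subset_leq_card; apply/subsetP => v; rewrite !in_set /= => /andP [vC]; rewrite vC /=.
have vC' : v \in cell f [set: T] r by rewrite in_set in_setT.
by have [-> ->] := @cell_ball T k E rH l f r v af vC'.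
Qed.
End Big.
End ForestDeviations.

(** * A lower bound for the number of forests *)

Section ForestLowerBound.
Variable R : realType.

Lemma fact_le_pow b : (0 < b)%N -> b`!%:R * ex R <= b%:R * (b%:R ^+ b * ex R ^+ b) :> R.
Proof.
case: b => // b _; elim: b => [|b IH]; first by rewrite (_ : 1`! = 1)%N // !expr1 !mul1r.
have b1 : 0 < b.+1%:R :> R by rewrite ltr0n.
have b2 : 0 < b.+2%:R :> R by rewrite ltr0n.
have key : b.+1%:R ^+ b.+2 <= b.+2%:R ^+ b.+2 * ex R.
  have : (1 - b.+2%:R^-1) ^+ b.+2 <= expR (- b.+2%:R^-1) ^+ b.+2 :> R.
    rewrite lerXn2r ?nnegrE ?expR_ge0 //; last by apply: expR_ge1Dx.
    by rewrite subr_ge0 invf_le1 // ler1n.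
  rewrite -expRM_natl mulrN divff ?gt_eqF // -/(ex R).
  have -> : 1 - b.+2%:R^-1 = b.+1%:R / b.+2%:R :> R.
    apply: (mulIf (lt0r_neq0 b2)); rewrite mulrBl divfK ?mulVf ?gt_eqF // mul1r.
    by rewrite -(natr1 b.+1) addrK.
  by rewrite expr_div_n ler_pdivrMr ?exprn_gt0 // mulrC.
have x0 : 0 <= ex R ^+ b.+1 by rewrite exprn_ge0 // ltW // ex_gt0.
have := ler_wpM2l (ltW b2) IH; rewrite [leLHS]mulrA -natrM -factS => /le_trans; apply.
rewrite ler_wpM2l ?(ltW b2) // mulrA -exprS [ex R ^+ b.+2]exprS mulrA.
by rewrite ler_wpM2r.
Qed.

Lemma cnum_lb b : (0 < b)%N -> ex R / b%:R ^+ 3 <= (cnum b)%:R / b`!%:R * ex R ^+ b.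
Proof.
move=> b0; have b1 : 0 < b%:R :> R by rewrite ltr0n.
have f0 : 0 < b`!%:R :> R by rewrite ltr0n fact_gt0.
have := fact_le_pow b0; rewrite -natrX (cnum_ratio R b0) => H.
rewrite mulrAC ler_pdivlMr // mulrAC ler_pdivrMr ?exprn_gt0 // mulrC.
by apply: le_trans H _; rewrite le_eqVlt; apply/orP; left; apply/eqP; ring.
Qed.

(** Chernoff bound for the tail: a term with exponent at least n grows by a factor e^(la n) or more
    when x becomes x e^la. *)
Lemma horner_tail (q : {poly R}) (x la : R) n : 0 <= x -> 0 <= la -> (forall i, 0 <= q`_i) ->
  q.[x] - expR (- la * n%:R) * q.[x * expR la] <= \sum_(a < n) q`_a * x ^+ a.
Proof.
move=> x0 l0 q0; rewrite lerBlDr.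
have sq : (size q <= n + size q)%N by apply: leq_addl.
rewrite !(horner_coef_wide _ sq) [leLHS]big_split_ord /= lerD2l.
rewrite [X in _ <= _ * X]big_split_ord /= mulrDr -[leLHS]add0r lerD //.
  rewrite mulr_ge0 ?expR_ge0 // sumr_ge0 // => i _; rewrite mulr_ge0 // exprn_ge0 // mulr_ge0 ?expR_ge0 //.
rewrite mulr_sumr; apply: ler_sum => i _; rewrite exprMn mulrCA ler_wpM2l // mulrCA mulrC -{1}[x ^+ _]mul1r ler_wpM2r ?exprn_ge0 // -expRM_natr -expRD.
by rewrite -[leLHS](expR0 R) ler_expR mulNr addrC subr_ge0 ler_wpM2l // ler_nat leq_addr.
Qed.

Lemma sum3_le a b c n : ((a + b + c).+1 <= n -> [/\ a <= n, b <= n & c <= n])%N.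
Proof. by move=> h; split; lia. Qed.

(** A critical forest of kap trees has about 2 kap vertices, fewer than n by hypothesis. One tree
    takes up the surplus, at the polynomial cost n^-3 of [cnum_lb]; the other kap - 1 trees come
    from the truncated series, where sizes are bounded. *)
Lemma CF_lb (e1 e2 c1 : R) : 0 < e1 -> 0 < e2 -> 0 < c1 -> exists n0, forall (T : finType) kap,
  (n0 <= #|T|)%N -> c1 * #|T|%:R <= kap%:R -> (2 + e1) * kap%:R <= #|T|%:R ->
  Xn R #|T| kap * expR (- e2 * #|T|%:R) <= #|CF T kap|%:R.
Proof.
move=> e10 e20 c10.
(* With u the truncated value of U, the first bound makes (2 u)^kap no smaller than e^(- e2 n / 2);
   the second keeps the mean tree size, at most 1 / u, below 2 + e1 / 4, so that the total is below
   n with room to spare. *)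
pose e3 := Num.min ((1 - expR (- (e2 / 2))) / 2) (e1 / (4 * (4 + e1))).
have E1 : expR (- (e2 / 2)) < 1 by rewrite -(expR0 R) ltr_expR oppr_lt0 divr_gt0.
have e30 : 0 < e3 by rewrite lt_min !divr_gt0 ?subr_gt0 // mulr_gt0 // addr_gt0.
have [N0 HN] := utree_lb' e30.
pose K := N0.+1; pose u := utree R K; have u1 : 1 / 2 - e3 <= u by apply: HN.
have uhalf : expR (- (e2 / 2)) <= 2 * u.
  have : e3 <= (1 - expR (- (e2 / 2))) / 2 by rewrite ge_min lexx.
  by lra.
have u0 : 0 < u by have := expR_gt0 (- (e2 / 2)); lra.
have uinv : 1 <= u * (2 + e1 / 4).
  have : e3 <= e1 / (4 * (4 + e1)) by rewrite ge_min lexx orbT.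
  rewrite ler_pdivlMr ?mulr_gt0 ?addr_gt0 // => h.
  have : (1 / 2 - e3) * (2 + e1 / 4) <= u * (2 + e1 / 4) by rewrite ler_wpM2r //; lra.
  have : 0 <= e3 * e1 by rewrite mulr_ge0 // ltW.
  by lra.
pose la := Num.min (1 / (2 * K%:R)) (e1 / (24 * (2 + e1) * K%:R)).
have K0 : 0 < K%:R :> R by rewrite ltr0n.
have la0 : 0 < la by rewrite lt_min !divr_gt0 // ?mulr_gt0 // addr_gt0.
have la1 : la * K%:R <= 1 / 2.
  by rewrite -ler_pdivlMr // (le_trans (_ : la <= 1 / (2 * K%:R))) ?ge_min ?lexx // invfM mulrA.
have la2 : 24 * (2 + e1) * (la * K%:R) <= e1.
  have : la <= e1 / (24 * (2 + e1) * K%:R) by rewrite ge_min lexx orbT.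
  by rewrite ler_pdivlMr ?mulr_gt0 ?addr_gt0 //; lra.
pose dd := la * e1 / 4 * c1; have dd0 : 0 < dd by rewrite !mulr_gt0 // invr_gt0.
pose n1 := Num.bound (1 / dd); pose n2 := Num.bound (6 / (e2 / 4) ^+ 4 / ex R).
exists (K + n1 + n2).+1 => T kap nT kc kn; set n := #|T| in nT kc kn *.
have [nK nn1 nn2] := sum3_le nT; have nn : (0 < n)%N by apply: leq_trans nT.
have n0 : 0 < n%:R :> R by rewrite ltr0n (leq_trans _ nT).
have k0 : (0 < kap)%N by rewrite -(ltr0n R) (lt_le_trans _ kc) // mulr_gt0.
have kk : kap = kap.-1.+1 by rewrite prednK.
have n1le : 1 / dd <= n%:R.
  apply: le_trans (ltW (archi_boundP _)) _; first by rewrite divr_ge0 // ltW.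
  by rewrite ler_nat.
have n2le : 6 / (e2 / 4) ^+ 4 / ex R <= n%:R.
  apply: le_trans (ltW (archi_boundP _)) _; first by rewrite !divr_ge0 ?exprn_ge0 ?divr_ge0 // ltW // ex_gt0.
  by rewrite ler_nat.
have e0 := ex_gt0 R.
rewrite (@card_CF R T kap n.+1 (ltnSn _)) -/n.
pose p := cegf R n.+1; pose pK := cegf R K; pose q := pK ^+ kap.-1.
have pK0 i : 0 <= pK`_i by rewrite /pK /cegf /egf coef_poly; case: ifP => // _; rewrite divr_ge0.
have p0 i : 0 <= p`_i by rewrite /p /cegf /egf coef_poly; case: ifP => // _; rewrite divr_ge0.
have pKp i : pK`_i <= p`_i.
  rewrite /p /pK /cegf /egf !coef_poly; case: ltnP => iK; last by case: ifP => // _; rewrite divr_ge0.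
  by rewrite (leq_trans iK) // (leq_trans nK).
have q0 i : 0 <= q`_i := coef_exp_ge0 _ _ pK0.
have pE : pK.[ex R] = u by rewrite /pK /cegf /egf horner_poly.
have qE : q.[ex R] = u ^+ kap.-1 by rewrite horner_exp pE.
have low : ex R / n%:R ^+ 3 * (\sum_(a < n) q`_a * ex R ^+ a) <= (p ^+ kap)`_n * ex R ^+ n.
  rewrite [X in p ^+ X]kk [p ^+ _]exprS coefM mulr_suml big_ord_recl /= -[leLHS]add0r lerD //.
    by rewrite !mulr_ge0 ?exprn_ge0 ?coef_exp_ge0 // ltW.
  rewrite [X in _ * X](reindex_inj rev_ord_inj) mulr_sumr; apply: ler_sum => i _.
  have i1 : (0 < i.+1)%N by [].
  have iN : (i.+1 <= n)%N := ltn_ord i.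
  have eN : ex R ^+ n = ex R ^+ i.+1 * ex R ^+ (n - i.+1) by rewrite -exprD subnKC.
  rewrite /= /bump /= add1n eN [leRHS]mulrACA; apply: ler_pM.
  - by rewrite divr_ge0 ?exprn_ge0 // ltW.
  - by rewrite mulr_ge0 // exprn_ge0 // ltW.
  - rewrite /p /cegf /egf coef_poly ltnS iN; apply: le_trans (cnum_lb i1).
    rewrite ler_wpM2l ?(ltW e0) // lef_pV2 ?posrE ?exprn_gt0 ?ltr0n //.
    by rewrite lerXn2r ?nnegrE // ler_nat.
  - by rewrite ler_wpM2r ?exprn_ge0 ?(ltW e0) // coef_exp_le.
(* With probability at least one half under the truncated series, kap - 1 trees have fewer than n
   vertices together. *)
have half : 1 / 2 * u ^+ kap.-1 <= \sum_(a < n) q`_a * ex R ^+ a.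
  apply: le_trans (horner_tail n (ltW e0) (ltW la0) q0).
  rewrite qE horner_exp.
  have pl : pK.[ex R * expR la] <= u * expR ((la + 2 * la ^+ 2 * K%:R) * (2 + e1 / 4)).
    apply: (@le_trans _ _ (u * (1 + (la + 2 * la ^+ 2 * K%:R) * (2 + e1 / 4)))); last first.
      by rewrite ler_wpM2l ?(ltW u0) // expR_ge1Dx.
    apply: (@le_trans _ _ (u + (la + 2 * la ^+ 2 * K%:R))); last first.
      have : 0 <= la + 2 * la ^+ 2 * K%:R by rewrite addr_ge0 ?mulr_ge0 ?sqr_ge0 // ltW.
      by move=> /(fun h => ler_wpM2l h uinv); lra.
    rewrite /pK /cegf /egf horner_poly.
    have st := @sum_tnum_le R K.
    have h0 : 0 <= la + 2 * la ^+ 2 * K%:R by rewrite addr_ge0 ?mulr_ge0 ?sqr_ge0 // ltW.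
    have st' := lerD (lexx u) (ler_wpM2l h0 st); rewrite mulr1 in st'; apply: le_trans st'.
    rewrite /u /utree mulr_sumr -big_split; apply: ler_sum => b _ /=.
    set v := (cnum b)%:R / b`!%:R; have v0 : 0 <= v * ex R ^+ b.
      by rewrite mulr_ge0 ?divr_ge0 ?exprn_ge0 // ltW.
    rewrite exprMn mulrA [leRHS](_ : _ = v * ex R ^+ b * (1 + (la + 2 * la ^+ 2 * K%:R) * b%:R)); last first.
      by rewrite /v; ring.
    rewrite ler_wpM2l // -expRM_natr.
    have bK : b%:R <= K%:R :> R by rewrite ler_nat ltnW.
    have lab : la * b%:R <= la * K%:R by rewrite ler_wpM2l // ltW.
    apply: le_trans (expR_le_quad (le_trans lab la1)) _.
    have : (la * b%:R) * (la * b%:R) <= (la * b%:R) * (la * K%:R).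
      by rewrite ler_wpM2l // mulr_ge0 // ltW.
    by rewrite !expr2; lra.
  have uk0 : 0 <= u ^+ kap.-1 by rewrite exprn_ge0 // ltW.
  have : expR (- la * n%:R) * pK.[ex R * expR la] ^+ kap.-1 <= u ^+ kap.-1 * (1 / 2).
    have pl0 : 0 <= pK.[ex R * expR la].
      by rewrite horner_poly sumr_ge0 // => i _; rewrite mulr_ge0 ?divr_ge0 // exprn_ge0 // mulr_ge0 ?expR_ge0 // ltW.
    apply: (@le_trans _ _ (expR (- la * n%:R) * (u * expR ((la + 2 * la ^+ 2 * K%:R) * (2 + e1 / 4))) ^+ kap.-1)).
      by rewrite ler_wpM2l ?expR_ge0 // lerXn2r ?nnegrE // mulr_ge0 ?expR_ge0 // ltW.
    rewrite exprMn -expRM_natr mulrCA ler_wpM2l // -expRD.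
    apply: (@le_trans _ _ (expR (- (1 : R)))); last first.
      rewrite expRN -[1 / 2]/(1 * 2^-1) mul1r lef_pV2 ?posrE ?expR_gt0 //.
      by have := expR_ge1Dx (1 : R); lra.
    rewrite ler_expR.
    have k1 : kap.-1%:R <= kap%:R :> R by rewrite ler_nat leq_pred.
    have h0 : 0 <= (la + 2 * la ^+ 2 * K%:R) * (2 + e1 / 4).
      by rewrite mulr_ge0 // ?addr_ge0 ?mulr_ge0 ?sqr_ge0 // ltW // ?addr_gt0 ?divr_gt0.
    have h1 := ler_wpM2l h0 k1.
    have h2 := ler_wpM2l (ltW la0) kn.
    have h3 : 1 <= la * e1 / 4 * kap%:R.
      apply: (@le_trans _ _ (dd * n%:R)); first by rewrite mulrC -ler_pdivrMr.
      by rewrite /dd -mulrA ler_wpM2l // ltW // !mulr_gt0 // invr_gt0.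
    have h4 : 2 * la ^+ 2 * K%:R * (2 + e1 / 4) * kap%:R <= la * e1 / 4 * kap%:R.
      rewrite ler_wpM2r //; have := ler_wpM2l (ltW la0) la2; rewrite expr2.
      have : 0 <= la * la * K%:R * e1 by rewrite !mulr_ge0 // ltW.
      have : 0 <= la * la * K%:R by rewrite !mulr_ge0 // ltW.
      by lra.
    by lra.
  by lra.
have := ler_wpM2l (_ : 0 <= ex R / n%:R ^+ 3) half => /(_ _)/le_trans/(_ low).
rewrite divr_ge0 ?exprn_ge0 ?(ltW e0) // => /(_ isT); rewrite -ler_pdivrMr ?exprn_gt0 // => fin.
have f0 m : 0 < m`!%:R :> R by rewrite ltr0n fact_gt0.
have : (cegf R n.+1 ^+ kap)`_n / kap`!%:R >= (ex R / n%:R ^+ 3 * (1 / 2 * u ^+ kap.-1)) / ex R ^+ n / kap`!%:R.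
  by rewrite ler_wpM2r ?invr_ge0.
move=> /(ler_wpM2l (ltW (f0 n))); apply: le_trans.
have t0 : 0 < 2 ^+ kap :> R by rewrite exprn_gt0.
rewrite /Xn.
have -> : n`!%:R / (ex R ^+ n * 2 ^+ kap * kap`!%:R) * expR (- e2 * n%:R) =
  n`!%:R * (2 ^+ kap)^-1 / ex R ^+ n / kap`!%:R * expR (- e2 * n%:R).
  by field; rewrite !gt_eqF ?exprn_gt0.
have -> : n`!%:R * (ex R / n%:R ^+ 3 * (1 / 2 * u ^+ kap.-1) / ex R ^+ n / kap`!%:R) =
  n`!%:R * (2 ^+ kap)^-1 / ex R ^+ n / kap`!%:R * (ex R / n%:R ^+ 3 * (2 * u) ^+ kap.-1).
  have -> : (2 * u) ^+ kap.-1 = 2 ^+ kap / 2 * u ^+ kap.-1.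
    by rewrite exprMn (_ : 2 ^+ kap = 2 ^+ kap.-1 * 2 :> R) ?mulfK ?pnatr_eq0 // -exprSr prednK.
  by field; rewrite !gt_eqF ?exprn_gt0.
rewrite ler_wpM2l ?divr_ge0 ?exprn_ge0 ?mulr_ge0 ?invr_ge0 ?(ltW e0) // ?exprn_ge0 //.
have pw : expR (- (e2 / 2) * n%:R) <= (2 * u) ^+ kap.-1.
  apply: (@le_trans _ _ (expR (- (e2 / 2)) ^+ kap.-1)).
    rewrite -expRM_natr ler_expR ler_wnM2l //; first by rewrite oppr_le0 divr_ge0 // ltW.
    have k1 : kap.-1%:R <= kap%:R :> R by rewrite ler_nat leq_pred.
    have : 0 <= e1 * kap%:R by rewrite mulr_ge0 // ltW.
    have : 0 <= kap%:R :> R by [].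
    by lra.
  by rewrite lerXn2r ?nnegrE ?expR_ge0 // mulr_ge0 // ltW.
have cb : expR (- (e2 / 2) * n%:R) <= ex R / n%:R ^+ 3.
  rewrite ler_pdivlMr ?exprn_gt0 // mulNr expRN mulrC ler_pdivrMr ?expR_gt0 //.
  pose x := e2 / 4 * n%:R; have x0 : 0 <= x by rewrite mulr_ge0 ?divr_ge0 // ltW.
  have -> : e2 / 2 * n%:R = x + x by rewrite /x; field.
  rewrite expRD; have := ler_pM _ _ (cube_le_expR x0) (expR_ge1Dx x).
  rewrite divr_ge0 ?exprn_ge0 // addr_ge0 // => /(_ isT isT) h.
  apply: (@le_trans _ _ (ex R * (x ^+ 3 / 6 * x))); last first.
    rewrite ler_wpM2l ?(ltW e0) //; apply: le_trans h; rewrite ler_wpM2l ?divr_ge0 ?exprn_ge0 //; lra.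
  have -> : ex R * (x ^+ 3 / 6 * x) = (ex R * (e2 / 4) ^+ 4 / 6 * n%:R) * n%:R ^+ 3 by rewrite /x; field.
  rewrite -[leLHS]mul1r ler_wpM2r ?exprn_ge0 //.
  have := ler_wpM2l (ltW (_ : 0 < ex R * (e2 / 4) ^+ 4 / 6)) n2le.
  rewrite !mulr_gt0 ?exprn_gt0 ?divr_gt0 ?invr_gt0 // => /(_ isT); apply: le_trans.
  by rewrite le_eqVlt; apply/orP; left; apply/eqP; field; rewrite !gt_eqF.
have := ler_pM (expR_ge0 _) (expR_ge0 _) cb pw; rewrite -expRD.
by have -> : - (e2 / 2) * n%:R + - (e2 / 2) * n%:R = - e2 * n%:R by field.
Qed.
End ForestLowerBound.

(** * Planar graphs have no K5 minor *)

Section Parity.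
Variables (a n2 : nat -> nat -> int) (n : nat -> nat -> nat -> int).
Hypothesis A : forall i j, (i < j < 5)%N -> a i j - a j i = 2 - 4 * n2 i j.
Hypothesis H : forall i j k l, (i < j < 5)%N -> (k < l < 5)%N ->
    i != k -> i != l -> j != k -> j != l ->
    (a k j - a k i + 4 * n k i j) + (a j l - a j k + 4 * n j k l) =
    (a i l - a i k + 4 * n i k l) + (a l j - a l i + 4 * n l i j).

Lemma parity_quad i j k l : (i < j)%N -> (j < k)%N -> (k < l)%N -> (l < 5)%N -> exists m : int,
  (n k i j + n j k l - n i k l - n l i j) + (n j i k + n k j l - n i j l - n l i k) +
  (n j i l + n l j k - n i j k - n k i l) = 2 * m + 1.
Proof.
move=> ij jk kl l5; have ik := ltn_trans ij jk; have jl := ltn_trans jk kl; have il := ltn_trans ij jl.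
have k5 := ltn_trans kl l5; have j5 := ltn_trans jk k5.
have B x y : (x < y)%N -> (y < 5)%N -> (x < y < 5)%N by move=> -> ->.
have A1 := A (B _ _ ij j5); have A2 := A (B _ _ ik k5); have A3 := A (B _ _ il l5).
have A4 := A (B _ _ jk k5); have A5 := A (B _ _ jl l5); have A6 := A (B _ _ kl l5).
have ne x y : (x < y)%N -> x != y by move=> xy; rewrite ltn_eqF.
have en x y : (x < y)%N -> y != x by move=> xy; rewrite gtn_eqF.
have H1 := H (B _ _ ij j5) (B _ _ kl l5) (ne _ _ ik) (ne _ _ il) (ne _ _ jk) (ne _ _ jl).
have H2 := H (B _ _ ik k5) (B _ _ jl l5) (ne _ _ ij) (ne _ _ il) (en _ _ jk) (ne _ _ kl).
have H3 := H (B _ _ il l5) (B _ _ jk k5) (ne _ _ ij) (ne _ _ ik) (en _ _ jl) (en _ _ kl).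
exists (n2 j l - n2 i l + n2 i j - 1); lia.
Qed.

(* Summing the fifteen relations of K5 modulo 2, every n-term occurs twice. *)
Lemma K5_parity : False.
Proof.
have [m1 E1] := @parity_quad 0 1 2 3 isT isT isT isT.
have [m2 E2] := @parity_quad 0 1 2 4 isT isT isT isT.
have [m3 E3] := @parity_quad 0 1 3 4 isT isT isT isT.
have [m4 E4] := @parity_quad 0 2 3 4 isT isT isT isT.
have [m5 E5] := @parity_quad 1 2 3 4 isT isT isT isT.
lia.
Qed.
End Parity.

Section Quadrants.
Variable R : realType.
Implicit Types (z w p q x y : R * R) (P Q s : seq (R * R)).

(** A discrete angle: half-open quadrants in counterclockwise order, the origin counted in the last
    one. It replaces the continuous argument in winding numbers. *)
Definition quad z : nat :=
  if (0 < z.1) && (0 <= z.2) then 0 else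
  if (z.1 <= 0) && (0 < z.2) then 1 else
  if (z.1 < 0) && (z.2 <= 0) then 2 else 3.

(** Signed turn between two quadrants. Opposite quadrants get the junk value 0; they never occur
    between close points away from the origin, by [quad_noopp]. *)
Definition qinc (a b : nat) : int :=
  if a == b then 0 else if (a.+1 %% 4 == b)%N then 1 else if (b.+1 %% 4 == a)%N then -1 else 0.

Definition near_pts (d : R) z w := (`|z.1 - w.1| < d) && (`|z.2 - w.2| < d).
Definition far_pts (d : R) z w := (d <= `|z.1 - w.1|) || (d <= `|z.2 - w.2|).

Lemma quadP z : [\/ [/\ quad z = 0%N, 0 < z.1 & 0 <= z.2], [/\ quad z = 1%N, z.1 <= 0 & 0 < z.2],
  [/\ quad z = 2%N, z.1 < 0 & z.2 <= 0] | [/\ quad z = 3%N, 0 <= z.1 & z.2 <= 0]].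
Proof.
rewrite /quad; case: (ltrgtP z.1 0) => h1; case: (ltrgtP z.2 0) => h2 /=.
all: try by [apply: Or41 | apply: Or42 | apply: Or43 | apply: Or44].
all: try (by apply: Or41; split=> //; rewrite ltW).
all: try (by apply: Or42; split=> //; rewrite ?h1 ?ltW).
all: try (by apply: Or43; split=> //; rewrite ?h2 ?ltW).
all: try (by apply: Or44; split=> //; rewrite ?h1 ?h2 ?ltW).
Qed.

Lemma near_sym d z w : near_pts d z w = near_pts d w z.
Proof. by rewrite /near_pts distrC [`|z.2 - _|]distrC. Qed.

Lemma quad_noopp d z w : 0 < d -> (d <= `|z.1|) || (d <= `|z.2|) ->
  (`|z.1 - w.1| < d) && (`|z.2 - w.2| < d) -> ((quad z + 2) %% 4 != quad w)%N.
Proof.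
move=> d0; rewrite !ler_normr !ltr_norml => far /andP [/andP [n1 n2] /andP [n3 n4]].
have {}far : [\/ d <= z.1, d <= - z.1, d <= z.2 | d <= - z.2].
  by case/orP: far => /orP []; [constructor 1|constructor 2|constructor 3|constructor 4].
case: (quadP z) => -[-> a1 a2]; case: (quadP w) => -[-> b1 b2] //=; exfalso;
  case: far; lra.
Qed.

Lemma quadN z : z != 0 -> quad (- z) = ((quad z + 2) %% 4)%N.
Proof.
rewrite /quad; case: z => x y; rewrite xpair_eqE /= !oppr_gt0 !oppr_ge0 !oppr_le0 !oppr_lt0.
by case: (ltrgtP x 0); case: (ltrgtP y 0).
Qed.

Lemma quad_lt z : (quad z < 4)%N.
Proof. by case: (quadP z) => -[->]. Qed.

Definition noopp a b := ((a + 2) %% 4 != b)%N.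

(** Quadrants of which no two are opposite lie in two adjacent ones, where turns are differences of
    integers: a grid cell has zero total turning. *)
Lemma qinc_cell a b c e : (a < 4)%N -> (b < 4)%N -> (c < 4)%N -> (e < 4)%N ->
  noopp a b -> noopp a c -> noopp a e -> noopp b c -> noopp b e -> noopp c e ->
  qinc a b + qinc b e = qinc a c + qinc c e.
Proof.
by case: a => [|[|[|[|a]]]] // _; case: b => [|[|[|[|b]]]] // _; case: c => [|[|[|[|c]]]] // _;
  case: e => [|[|[|[|e]]]].
Qed.

Lemma qinc_mod a b : (a < 4)%N -> (b < 4)%N -> noopp a b -> exists m, qinc a b = b%:Z - a%:Z + 4 * m.
Proof.
by case: a => [|[|[|[|a]]]] // _; case: b => [|[|[|[|b]]]] // _ _; [exists 0|exists 0|exists (-1)|exists 0|exists 0|exists 0|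
  exists 0|exists 0|exists 0|exists 1|exists 0|exists 0].
Qed.

Lemma qinc_shift a b : (a < 4)%N -> (b < 4)%N -> qinc ((a + 2) %% 4) ((b + 2) %% 4) = qinc a b.
Proof. by case: a => [|[|[|[|a]]]] // _; case: b => [|[|[|[|b]]]]. Qed.

Lemma quad_near d p q p' q' : 0 < d -> near_pts d p p' -> near_pts d q q' -> far_pts (2 * d) p q ->
  noopp (quad (p - q)) (quad (p' - q')).
Proof.
move=> d0 /andP [n1 n2] /andP [n3 n4] far; apply: (@quad_noopp (2 * d)) => //; first by lra.
have key (x x' y y' : R) : `|x - x'| < d -> `|y - y'| < d -> `|(x - y) - (x' - y')| < 2 * d.
  by rewrite !ltr_norml => /andP [h1 h2] /andP [h3 h4]; apply/andP; split; lra.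
by rewrite !key.
Qed.

Lemma near_refl d p : 0 < d -> near_pts d p p.
Proof. by rewrite /near_pts !subrr normr0 => ->. Qed.

Fixpoint th p x s : int :=
  if s is y :: s' then qinc (quad (x - p)) (quad (y - p)) + th p y s' else 0.

Lemma th_mod d p x s : 0 < d -> path (near_pts d) x s -> {in x :: s, forall z, far_pts (2 * d) z p} ->
  exists m, th p x s = (quad (last x s - p))%:Z - (quad (x - p))%:Z + 4 * m.
Proof.
move=> d0; elim: s x => [|y s IH] x /= => [_ _|/andP [xy ps] far]; first by exists 0; rewrite subrr mulr0.
have [m ->] := IH y ps (fun z zs => far z (mem_behead (s := x :: y :: s) zs)).
have [|m' ->] := @qinc_mod (quad (x - p)) (quad (y - p)) (quad_lt _) (quad_lt _).
  by apply: (quad_near d0 xy (near_refl p d0)); apply: far; apply: mem_head.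
by exists (m + m'); ring.
Qed.

Lemma qinc_flip d p q q' : 0 < d -> far_pts (2 * d) p q -> far_pts (2 * d) p q' ->
  qinc (quad (p - q)) (quad (p - q')) = qinc (quad (q - p)) (quad (q' - p)).
Proof.
move=> d0; have nz z : far_pts (2 * d) p z -> p - z != 0.
  apply: contraTneq => e; have e1 : p.1 - z.1 = 0 := congr1 fst e; have e2 : p.2 - z.2 = 0 := congr1 snd e.
  by rewrite /far_pts e1 e2 normr0 orbb -ltNge mulr_gt0.
by move=> /nz h1 /nz h2; rewrite -(opprB p q') -(opprB p q) !quadN ?qinc_shift ?quad_lt.
Qed.

Lemma th_strip d q q' x s : 0 < d -> near_pts d q q' -> path (near_pts d) x s ->
  {in x :: s, forall z, far_pts (2 * d) z q /\ far_pts (2 * d) z q'} ->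
  th q x s + qinc (quad (last x s - q)) (quad (last x s - q')) =
  qinc (quad (x - q)) (quad (x - q')) + th q' x s.
Proof.
move=> d0 qq; elim: s x => [|y s IH] x /= => [_ _|/andP [xy ps] far]; first by rewrite addr0 add0r.
rewrite -addrA IH ?addrA //; last by move=> z zs; apply: far; rewrite in_cons zs orbT.
congr (_ + _).
have [fx fx'] := far x (mem_head _ _).
have [fy fy'] : far_pts (2 * d) y q /\ far_pts (2 * d) y q'.
  by apply: far; rewrite in_cons mem_head orbT.
have qr := near_refl q d0; have qr' := near_refl q' d0.
have xr := near_refl x d0; have yr := near_refl y d0.
have qs : near_pts d q' q by rewrite near_sym.
have yx : near_pts d y x by rewrite near_sym.
by apply: qinc_cell; rewrite ?quad_lt //; apply: (quad_near d0).
Qed.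

(** A discrete homotopy: the direction z - w is defined on the product grid of two chains that stay
    far apart, and the turning along the boundary of the grid is the sum over its cells, that is
    zero. *)
Lemma th_square d x s y t : 0 < d -> path (near_pts d) x s -> path (near_pts d) y t ->
  {in x :: s & y :: t, forall z w, far_pts (2 * d) z w} ->
  th y x s + th (last x s) y t = th x y t + th (last y t) x s.
Proof.
move=> d0 ps; elim: t y => [|y' t IH] y /= => [_ _|/andP [yy' pt] far]; first by rewrite addr0 add0r.
have far' : {in x :: s & y' :: t, forall z w, far_pts (2 * d) z w}.
  by move=> z w zs wt; apply: far; rewrite // in_cons wt orbT.
have y'in : y' \in y :: y' :: t by rewrite in_cons mem_head orbT.
have S : {in x :: s, forall z, far_pts (2 * d) z y /\ far_pts (2 * d) z y'}.
  by move=> z zs; split; apply: far; rewrite ?mem_head.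
have := th_strip d0 yy' ps S; have := IH y' pt far'.
have ls : last x s \in x :: s by apply: mem_last.
rewrite (@qinc_flip d (last x s)) ?(S _ ls).1 ?(S _ ls).2 //.
have xs : x \in x :: s by apply: mem_head.
rewrite (@qinc_flip d x) ?(S _ xs).1 ?(S _ xs).2 // => e1 e2.
by rewrite addrA e2 -!addrA; congr (_ + _); rewrite e1.
Qed.

Local Open Scope classical_set_scope.

Lemma ball_near d z w : ball z d w -> near_pts d z w.
Proof. by move=> [h1 h2]; apply/andP; split. Qed.

(** Finite chains of close points replace parametrised curves. The points reachable by a chain form
    a set both open and closed in A. *)
Lemma chain_connected (A : set (R * R)) d x y : connected A -> 0 < d -> A x -> A y ->
  exists s, [/\ path (near_pts d) x s, last x s = y & {in x :: s, forall z, A z}].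
Proof.
move=> cA d0 Ax Ay.
pose B := [set z | A z /\ exists s, [/\ path (near_pts d) x s, last x s = z & {in x :: s, forall z, A z}]].
pose N (C : set (R * R)) := \bigcup_(z in C) (ball z d)^°.
have oN C : open (N C) by apply: bigcup_open => z _; apply: open_interior.
have self z : (ball z d)^° z by apply: nbhsx_ballx.
have step z w : B z -> A w -> near_pts d z w -> B w.
  move=> [Az [s [ps ls As]]] Aw zw; split=> //; exists (rcons s w); split.
  - by rewrite rcons_path ps ls.
  - by rewrite last_rcons.
  - by move=> u; rewrite -rcons_cons mem_rcons in_cons => /orP [/eqP ->|/As].
have Bx : B x by split=> //; exists [::]; split=> // z; rewrite inE => /eqP ->.
suff: B = A by move=> BA; have [] : B y by rewrite BA.
apply: cA; first by exists x.
  exists (N B) => //; apply/seteqP; split=> z.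
    by move=> Bz; split; [case: Bz|exists z].
  by move=> [Az [w Bw /interior_subset /ball_near zw]]; apply: step zw.
exists (~` N (A `\` B)); first by apply: open_closedC.
apply/seteqP; split=> z.
  move=> Bz; split; first by case: Bz.
  move=> [w [Aw nBw] /interior_subset /ball_near zw]; apply: nBw.
  by apply: step Bz Aw _; rewrite near_sym.
move=> [Az nz]; apply: contrapT => nB; apply: nz; exists z => //.
Qed.

Lemma compact_sep (K K' : set (R * R)) : compact K -> compact K' -> (forall z, K z -> ~ K' z) ->
  \forall d \near 0^'+, forall x y, K x -> K' y -> far_pts d x y.
Proof.
move=> /compact_near_coveringP cK /compact_near_coveringP cK' dj.
have H : \forall d \near (0 : R)^'+, K `<=` (fun x => forall y, K' y -> far_pts d x y).
  apply: cK => x Kx.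
  have := @cK' (R * R * R)%type (filter_prod (nbhs x) (0 : R)^'+) (fun xd y => far_pts xd.2 xd.1 y) _.
  move=> H; apply: (H _) => y Ky {H}.
  have [r r0 Hr] : exists2 r, 0 < r & 3 * r <= `|x.1 - y.1| \/ 3 * r <= `|x.2 - y.2|.
    have [e1|n1] := eqVneq x.1 y.1; last first.
      by exists (`|x.1 - y.1| / 3); [rewrite divr_gt0 // normr_gt0 subr_eq0|left; rewrite mulrC divfK].
    have [e2|n2] := eqVneq x.2 y.2; last first.
      by exists (`|x.2 - y.2| / 3); [rewrite divr_gt0 // normr_gt0 subr_eq0|right; rewrite mulrC divfK].
    have xy : x = y by case: x y e1 e2 {Kx Ky} => ? ? [? ?] /= -> ->.
    by case: (dj x Kx); rewrite xy.
  exists (ball y r, [set xd | ball x r xd.1 /\ xd.2 < r]).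
    split => /=; first exact: nbhsx_ballx.
    exists (ball x r, [set d | d < r]); first by split; [exact: nbhsx_ballx|exact: nbhs_right_lt].
    by move=> [u v] [].
  move=> [y' [x' d']] [/= /ball_near /andP [a1 a2] [/ball_near /andP [b1 b2] dr]].
  have key (u v u' v' : R) : `|u - u'| < r -> `|v - v'| < r -> 3 * r <= `|u - v| -> d' <= `|u' - v'|.
    rewrite !ltr_norml => /andP [h1 h2] /andP [h3 h4]; rewrite !ler_normr => /orP [h|h]; apply/orP.
      by left; lra.
    by right; lra.
  by apply/orP; case: Hr => Hr; [left; apply: key Hr|right; apply: key Hr].
by apply: filterS H => d Hd x y Kx; apply: Hd.
Qed.
End Quadrants.

Section Drawing.
Variables (R : realType) (T : finType) (g : {set {set T}}) (p : T -> R * R) (gam : {set T} -> R -> R * R).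
Hypothesis Dr : plane_drawing g p gam.
Local Open Scope classical_set_scope.

Definition curve (e : {set T}) : set (R * R) := gam e @` `[0, 1].
Definition curves (U : {set T}) : set (R * R) := [set z | exists2 e, (e \in g) && (e \subset U) & curve e z].

Lemma edge_ends e : e \in g -> exists x y, [/\ e = [set x; y]%SET, x != y, gam e 0 = p x & gam e 1 = p y].
Proof. by case: Dr => _ [h _ _ _ _]; apply: h. Qed.

Lemma curve_end e v : e \in g -> v \in e -> curve e (p v).
Proof.
move=> eg; have [x [y [-> _ g0 g1]]] := edge_ends eg; rewrite !inE => /orP [] /eqP ->.
  by exists 0; [rewrite /= in_itv /= lexx ler01|exact: g0].
by exists 1; [rewrite /= in_itv /= lexx ler01|exact: g1].
Qed.

Lemma curve_cases e s : e \in g -> 0 <= s <= 1 -> 0 < s < 1 \/ exists2 v, v \in e & gam e s = p v.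
Proof.
move=> eg /andP [s0 s1]; have [x [y [ee _ g0 g1]]] := edge_ends eg.
have [->|n0] := eqVneq s 0; first by right; exists x; rewrite // ee !inE eqxx.
have [->|n1] := eqVneq s 1; first by right; exists y; rewrite // ee !inE eqxx orbT.
by left; rewrite !lt_neqAle eq_sym n0 s0 n1 s1.
Qed.

Lemma curve_compact e : e \in g -> compact (curve e).
Proof.
move=> eg; apply: continuous_compact; last exact: segment_compact.
by case: Dr => _ [_ h _ _ _]; apply: h.
Qed.

Lemma curve_connected e : e \in g -> connected (curve e).
Proof.
move=> eg; apply: connected_continuous_connected; first exact: segment_connected.
by case: Dr => _ [_ h _ _ _]; apply: h.
Qed.

Lemma curve_disjoint e e' : e \in g -> e' \in g -> disjoint (mem e) (mem e') ->
  forall z, curve e z -> ~ curve e' z.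
Proof.
move=> eg e'g dj z [s /= sI <-] [t /= tI E].
case: Dr => ip [_ _ _ hv he].
have {sI} sI : 0 <= s <= 1 by move: sI; rewrite in_itv.
have {tI} tI : 0 <= t <= 1 by move: tI; rewrite in_itv.
case: (curve_cases eg sI) => [si|[v ve Ev]]; case: (curve_cases e'g tI) => [ti|[w we Ew]].
- apply: (he e e' s t eg e'g _ si ti); last by rewrite E.
  have [x [y [ee _ _ _]]] := edge_ends eg.
  apply: contraTneq dj => <-; rewrite -setI_eq0 finset.setIid; apply/set0Pn; exists x.
  by rewrite ee !inE eqxx.
- by apply: (hv e w s eg si); rewrite -E.
- by apply: (hv e' v t e'g ti); rewrite E.
- have : v = w by apply: ip; rewrite -Ev -Ew.
  by move=> vw; move: we; rewrite -vw (disjointFr dj ve).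
Qed.

(** Finitely many compact edges, and disjoint edges have disjoint curves, so a single distance works
    for all pairs. *)
Lemma curves_sep : exists2 d, 0 < d &
  forall U W : {set T}, disjoint (mem U) (mem W) -> forall z w, curves U z -> curves W w -> far_pts (2 * d) z w.
Proof.
have H : \forall d \near (0 : R)^'+, forall e e' : {set T}, e \in g -> e' \in g -> disjoint (mem e) (mem e') ->
    forall z w, curve e z -> curve e' w -> far_pts d z w.
  apply: filter_forall => e; apply: filter_forall => e'.
  have [eg|] := boolP (e \in g); last by move=> _; apply: nearW.
  have [e'g|] := boolP (e' \in g); last by move=> _; apply: nearW.
  have [dj|] := boolP (disjoint (mem e) (mem e')); last by move=> _; apply: nearW.
  apply: filterS (compact_sep (curve_compact eg) (curve_compact e'g) (curve_disjoint eg e'g dj)).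
  by move=> d Hd _ _ _; apply: Hd.
near (0 : R)^'+%classic => d.
have d0 : 0 < d by near: d; exact: nbhs_right_gt.
have Hd : forall e e' : {set T}, e \in g -> e' \in g -> disjoint (mem e) (mem e') ->
    forall z w, curve e z -> curve e' w -> far_pts d z w by near: d; exact: H.
exists (d / 2); first by rewrite divr_gt0.
move=> U W UW z w [e /andP [eg eU] ez] [e' /andP [e'g e'W] ew].
rewrite mulrC divfK //; apply: (Hd e e') => //.
by apply: disjointWl eU _; apply: disjointWr e'W _.
Unshelve. all: by end_near. Qed.

Lemma edge_chain d U x y : 0 < d -> rin (graph_adj g) U x y ->
  exists s, [/\ path (near_pts d) (p x) s, last (p x) s = p y & {in p x :: s, forall z, curves U z}].
Proof.
move=> d0 /and3P [eg xU yU]; set e := [set x; y]%SET in eg *.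
have xe : curve e (p x) by apply: curve_end; rewrite // !inE eqxx.
have ye : curve e (p y) by apply: curve_end; rewrite // !inE eqxx orbT.
have [s [h1 h2 h3]] := chain_connected (curve_connected eg) d0 xe ye.
exists s; split=> // z zs; exists e; last exact: h3.
apply/andP; split; first exact: eg.
by apply/subsetP => v; rewrite !inE => /orP [] /eqP ->.
Qed.

Lemma path_chain d U x y : 0 < d -> connect (rin (graph_adj g) U) x y -> x != y ->
  exists s, [/\ path (near_pts d) (p x) s, last (p x) s = p y & {in p x :: s, forall z, curves U z}].
Proof.
move=> d0 /connectP [q]; elim: q x => [|z q IH] x /= => [_ ->|/andP [xz pq] ly xy]; first by rewrite eqxx.
have [s [h1 h2 h3]] := edge_chain d0 xz.
have [zy|zy] := eqVneq z y; first by exists s; rewrite -zy.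
have [s' [h1' h2' h3']] := IH z pq ly zy.
exists (s ++ s'); split.
- by rewrite cat_path h1 h2.
- by rewrite last_cat h2.
- move=> w; rewrite -cat_cons mem_cat => /orP [/h3 //|ws]; apply: h3'.
  by rewrite in_cons ws orbT.
Qed.
End Drawing.

Lemma graph_adj_sym (T : finType) (g : {set {set T}}) : symmetric (graph_adj g).
Proof. by move=> x y; rewrite /graph_adj setUC. Qed.

(* Disjoint drawn paths have vanishing winding around each other; for the ten
   paths of a K5 these relations are contradictory modulo 2. *)
Lemma planar_noK5 (R : realType) (T : finType) (g : {set {set T}}) :
  planar R g -> ~ Kminor (graph_adj g) 5.
Proof.
move=> [p [gam Dr]] [s [ss cs ps]].
pose B i := nth set0 s i.
have cB i : (i < 5)%N -> conn (graph_adj g) (B i) by move=> i5; apply: (all_nthP set0 cs); rewrite ss.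
have [x0 _] : exists x, x \in B 0 by have /connP [] := cB 0%N isT.
pose b i := odflt x0 [pick x in B i].
have bB i : (i < 5)%N -> b i \in B i.
  move=> /cB /connP [[x xB] _]; rewrite /b; case: pickP => [//|/(_ x)].
  by rewrite xB.
have pB i j : (i < j < 5)%N -> [disjoint B i & B j] && touch (graph_adj g) (B i) (B j).
  move=> /andP [ij j5]; move/(pairwiseP set0): ps; apply; rewrite ?inE ?ss //.
  exact: ltn_trans j5.
have dB i j : (i < 5)%N -> (j < 5)%N -> i != j -> [disjoint B i & B j].
  move=> i5 j5; rewrite neq_ltn => /orP [] h.
    by have /andP [] : [disjoint B i & B j] && touch (graph_adj g) (B i) (B j) by apply: pB; rewrite h.
  rewrite disjoint_sym.
  by have /andP [] : [disjoint B j & B i] && touch (graph_adj g) (B j) (B i) by apply: pB; rewrite h.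
have [d d0 sep] := curves_sep Dr.
pose ch (ij : nat * nat) (c : seq (R * R)) := (ij.1 < ij.2 < 5)%N ->
  [/\ path (near_pts d) (p (b ij.1)) c, last (p (b ij.1)) c = p (b ij.2) &
    {in p (b ij.1) :: c, forall z, curves g gam (B ij.1 :|: B ij.2) z}].
have /choice [P HP] : forall ij, exists c, ch ij c.
  move=> [i j]; rewrite /ch /=; case: (boolP (i < j < 5)%N) => [ij|]; last by exists [::].
  have /andP [dj tj] := pB _ _ ij; have /andP [ij' j5] := ij; have i5 := ltn_trans ij' j5.
  have /connP [_ cU] := connU (graph_adj_sym g) (cB i i5) (cB j j5) tj.
  have nb : b i != b j by apply: contraTneq (bB j j5) => <-; rewrite (disjointFr dj) ?bB.
  have bi : b i \in B i :|: B j by rewrite inE bB.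
  have bj : b j \in B i :|: B j by rewrite inE [b j \in B j]bB ?orbT.
  by have [c Hc] := path_chain Dr d0 (cU _ _ bi bj) nb; exists c.
pose q i := p (b i).
pose a k i : int := (quad (q i - q k))%:Z.
have far i j k l : (i < j < 5)%N -> (k < l < 5)%N -> i != k -> i != l -> j != k -> j != l ->
   {in q i :: P (i, j) & q k :: P (k, l), forall z w, far_pts (2 * d) z w}.
  move=> ij kl ik il jk jl z w zP wP; have [_ _ H1] := HP (i, j) ij; have [_ _ H2] := HP (k, l) kl.
  move/andP: (ij) => [ij' j5]; move/andP: (kl) => [kl' l5].
  have i5 := ltn_trans ij' j5; have k5 := ltn_trans kl' l5.
  apply: (sep (B i :|: B j) (B k :|: B l)); [|exact: H1|exact: H2].
  by rewrite -setI_eq0 finset.setIUl !finset.setIUr !finset.setU_eq0 !setI_eq0 !dB.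
have far' i j k l : (i < j < 5)%N -> (k < 5)%N -> (l < 5)%N -> i != k -> i != l -> j != k -> j != l -> k != l ->
   {in q i :: P (i, j), forall z, far_pts (2 * d) z (q k)}.
  move=> ij k5 l5 ik il jk jl; rewrite neq_ltn => /orP [] kl z zP.
    by apply: (far i j k l) => //; rewrite ?kl ?mem_head.
  apply: (far i j l k) => //; rewrite ?kl //.
  have lk5 : (l < k < 5)%N by rewrite kl.
  by have [_ lP _] := HP (l, k) lk5; rewrite /q -[p (b k)]lP; apply: mem_last.
(* The index l, different from the other three, supplies a path with end [q k]; being disjoint from
   the path of i and j, it shows that the latter stays away from [q k]. The other premises only make
   the choice total. *)
pose mo (kij : nat * nat * nat) (m : int) := (exists l, [/\ (l < 5)%N, kij.1.2 != l, kij.2 != l & kij.1.1 != l]) ->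
  (kij.1.2 < kij.2 < 5)%N -> (kij.1.1 < 5)%N -> kij.1.2 != kij.1.1 -> kij.2 != kij.1.1 ->
  th (q kij.1.1) (q kij.1.2) (P (kij.1.2, kij.2)) = a kij.1.1 kij.2 - a kij.1.1 kij.1.2 + 4 * m.
have /choice [n Hn] : forall kij, exists m, mo kij m.
  move=> [[k i] j]; rewrite /mo /=.
  case: (pselect (exists l, [/\ (l < 5)%N, i != l, j != l & k != l])) => [[l [l5 il jl kl]]|nl]; last by exists 0 => /nl.
  case: (boolP [&& (i < j < 5)%N, (k < 5)%N, i != k & j != k]) => [/and4P [ij k5 ik jk]|nc]; last first.
    by exists 0 => _ h1 h2 h3 h4; rewrite h1 h2 h3 h4 in nc.
  have [h1 h2 _] := HP (i, j) ij.
  have [m Hm] := th_mod d0 h1 (far' i j k l ij k5 l5 ik il jk jl kl).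
  by exists m => _ _ _ _ _; rewrite Hm h2.
pose mo2 (ij : nat * nat) (m : int) := (ij.1 < ij.2 < 5)%N -> a ij.1 ij.2 - a ij.2 ij.1 = 2 - 4 * m.
have /choice [n2 Hn2] : forall ij, exists m, mo2 ij m.
  move=> [i j]; rewrite /mo2 /=; case: (boolP (i < j < 5)%N) => [ij|]; last by exists 0.
  have /andP [dj _] := pB _ _ ij; have /andP [ij' j5] := ij; have i5 := ltn_trans ij' j5.
  have nz : q j - q i != 0.
    rewrite subr_eq0; apply: contraTneq (bB j j5) => e.
    have /(_ _ _ e) -> : injective p by case: Dr.
    by rewrite (disjointFr dj) ?bB.
  rewrite /a -(opprB (q j)) quadN //; have := quad_lt (q j - q i).
  case: (quad _) => [|[|[|[|]]]] // _ ; [exists 1|exists 1|exists 0|exists 0]; by [].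
apply: (@K5_parity a (fun i j => n2 (i, j)) (fun k i j => n (k, i, j))).
  by move=> i j ij; apply: (Hn2 (i, j)).
move=> i j k l ij kl ik il jk jl.
have [h1 h2 _] := HP (i, j) ij; have [h3 h4 _] := HP (k, l) kl.
have := th_square d0 h1 h3 (far i j k l ij kl ik il jk jl).
rewrite h2 h4 /=; move/andP: (ij) => [ij' j5]; move/andP: (kl) => [kl' l5].
have i5 := ltn_trans ij' j5; have k5 := ltn_trans kl' l5.
have ki : k != i by rewrite eq_sym. have li : l != i by rewrite eq_sym.
have kj : k != j by rewrite eq_sym. have lj : l != j by rewrite eq_sym.
have nij : i != j by rewrite neq_ltn ij'. have nkl : k != l by rewrite neq_ltn kl'.
have nji : j != i by rewrite eq_sym. have nlk : l != k by rewrite eq_sym.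
have := Hn (k, i, j); rewrite /mo /= => -> //; last by exists l.
have := Hn (j, k, l); rewrite /mo /= => -> //; last by exists i.
have := Hn (i, k, l); rewrite /mo /= => -> //; last by exists j.
by have := Hn (l, i, j); rewrite /mo /= => -> //; exists k.
Qed.

(** * Adding a bridge to a plane drawing *)

Section LastExit.
Variable R : realType.
Implicit Types (h : R -> R) (f : R -> R * R).

Lemma within_near (V : pseudoMetricNormedZmodType R) (f : R -> V) x : 0 <= x <= 1 ->
  {within `[0, 1], continuous f}%classic -> forall e, 0 < e ->
  exists2 d, 0 < d & forall y, 0 <= y <= 1 -> `|x - y| < d -> `|f x - f y| < e.
Proof.
move=> xI /subspace_continuousP /(_ x) H e e0.
have Ix : `[(0 : R), 1]%classic x by rewrite /= in_itv.
have /cvgrPdist_lt /(_ e e0) := H Ix; rewrite near_withinE => /nbhs_normP [d /= d0 Hd].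
by exists d => // y yI xy; apply: Hd => //; rewrite /= in_itv.
Qed.

Lemma within_compr (V : topologicalType) (f : R -> V) (k : R -> R) (A B : set R) :
  (forall x, A x -> B (k x)) -> continuous k -> {within B, continuous f}%classic ->
  {within A, continuous (f \o k)}%classic.
Proof.
move=> AB ck /subspace_continuousP H; apply/subspace_continuousP => x Ax.
apply: cvg_comp (H _ (AB _ Ax)); move=> P; rewrite /within /= => HP.
change (\forall y \near x, A y -> P (k y))%classic.
have HQ := ck x _ HP; near=> y; move=> Ay.
by have : B (k y) -> P (k y) by [near: y; exact: HQ]; apply; exact: AB.
Unshelve. all: by end_near. Qed.

Lemma within_eq (V : topologicalType) (f h : R -> V) (A : set R) : (forall x, A x -> f x = h x) ->
  {within A, continuous f}%classic -> {within A, continuous h}%classic.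
Proof. by move=> fh cf; apply: (subspace_eq_continuous _ cf) => x /set_mem; exact: fh. Qed.

Lemma last_exit h (c : R) : {within `[0, 1], continuous h}%classic -> h 0 < c -> c < h 1 ->
  exists2 s, 0 < s < 1 & h s = c /\ forall t, s < t <= 1 -> c < h t.
Proof.
move=> ch h0 h1; pose S := [set s | 0 <= s <= 1 /\ h s <= c]%classic.
have S0 : S 0 by split; [rewrite lexx ler01|apply: ltW].
have Sub : has_ubound S by exists 1 => s [/andP []].
have hS : has_sup S by split; [exists 0|].
set s := sup S; have s0 : 0 <= s by apply: ub_le_sup.
have s1 : s <= 1 by apply: ge_sup; [exists 0|move=> x [/andP []]].
have sI : 0 <= s <= 1 by rewrite s0 s1.
have after t : s < t <= 1 -> c < h t.
  move=> /andP [st t1]; rewrite ltNge; apply/negP => htc.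
  have : t <= s by apply: ub_le_sup => //; split=> //; rewrite t1 (le_trans s0 (ltW st)).
  by rewrite leNgt st.
have hsc : h s = c.
  apply/eqP; rewrite eq_le; apply/andP; split; rewrite leNgt; apply/negP => hs.
    have e0 : 0 < h s - c by rewrite subr_gt0.
    have [d d0 Hd] := within_near sI ch e0.
    have [x [xI hx] sx] := sup_adherent d0 hS.
    have xs : x <= s by apply: ub_le_sup.
    have /Hd : 0 <= x <= 1 by [].
    rewrite ger0_norm ?subr_ge0 // => /(_ _); have : s - x < d by rewrite -/s in sx; lra.
    by move=> -> /(_ isT); rewrite ltr_norml => /andP [_]; lra.
  have e0 : 0 < c - h s by rewrite subr_gt0.
  have [d d0 Hd] := within_near sI ch e0.
  have s1' : s < 1 by rewrite lt_neqAle s1 andbT; apply: contraTneq hs => ->; rewrite -leNgt ltW.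
  pose t := Num.min (s + d / 2) 1.
  have st : s < t by rewrite lt_min s1' andbT ltrDl divr_gt0.
  have t1 : t <= 1 by rewrite ge_min lexx orbT.
  have tI : 0 <= t <= 1 by rewrite t1 (le_trans s0 (ltW st)).
  have td : `|s - t| < d.
    rewrite distrC ger0_norm ?subr_ge0 ?(ltW st) //.
    have : t <= s + d / 2 by rewrite ge_min lexx.
    by lra.
  have := Hd t tI td; rewrite ltr_norml => /andP [hh _].
  by have := after t; rewrite st t1 => /(_ isT); lra.
exists s; last by [].
rewrite !lt_neqAle s0 s1 !andbT; apply/andP; split.
  by apply: contraTneq h0 => e; rewrite e hsc ltxx.
by apply: contraTneq h1 => e; rewrite -e hsc ltxx.
Qed.
End LastExit.

Section Reverse.
Variables (R : realType) (T : finType) (g : {set {set T}}) (p : T -> R * R) (gam : {set T} -> R -> R * R).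

Lemma reverse_drawing (c : pred {set T}) : plane_drawing g p gam ->
  plane_drawing g p (fun e s => if c e then gam e (1 - s) else gam e s).
Proof.
have onem (s : R) : 0 <= s <= 1 -> 0 <= 1 - s <= 1 by move=> /andP [? ?]; apply/andP; split; lra.
have onel (s : R) : 0 < s < 1 -> 0 < 1 - s < 1 by move=> /andP [? ?]; apply/andP; split; lra.
move=> [ip [h1 h2 h3 h4 h5]]; split=> //; split.
- move=> e eg; have [x [y [ee xy g0 g1]]] := h1 e eg; case: (c e); last by exists x, y.
  by exists y, x; rewrite subr0 subrr eq_sym; split=> //; rewrite ee setUC.
- move=> e eg; case: (c e); last exact: h2.
  apply: (@within_compr R _ (gam e) (fun s => 1 - s) `[0, 1]%classic `[0, 1]%classic _ _ (h2 e eg)).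
    by move=> x; rewrite /= !in_itv /=; apply: onem.
  by move=> x; apply: cvgB; [exact: cvg_cst|exact: cvg_id].
- move=> e s t eg sI tI; case: (c e) => E; last exact: (h3 e).
  have := h3 e _ _ eg (onem _ sI) (onem _ tI) E; lra.
- move=> e v s eg sI; case: (c e); [exact: (h4 e v _ eg (onel _ sI))|exact: h4].
- move=> e e' s t eg e'g ee' sI tI; case: (c e); case: (c e'); apply: (h5 e e') => //; exact: onel.
Qed.
End Reverse.

Section Radialize.
Variables (R : realType) (T : finType) (g : {set {set T}}) (p : T -> R * R).

(** Within distance rho of [p a] the drawing consists of pieces of the rays from [p a] in the
    directions d e, one for each edge e at a; nothing else comes that close. *)
Definition radial_at (gam : {set T} -> R -> R * R) (a : T) (rho : R) (d : {set T} -> R * R) :=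
  [/\ 0 < rho, forall v, v != a -> rho < `|p v - p a|,
      forall e s, e \in g -> a \notin e -> 0 <= s <= 1 -> rho < `|gam e s - p a|
    & forall e s, e \in g -> a \in e -> 0 <= s <= 1 -> d e != 0 /\
        (rho < `|gam e s - p a| \/ exists2 la, 0 <= la & gam e s = p a + la *: d e)].

Lemma far_norm d (z w : R * R) : far_pts d z w = (d <= `|z - w|).
Proof. by rewrite prod_normE le_max. Qed.

(** On each edge at a, the part up to its last exit from the sphere of radius rho is replaced by the
    straight radius to the exit point. Different edges exit at different points, so these radii meet
    only in [p a]. *)
Lemma radialize gam (a : T) : plane_drawing g p gam ->
  exists gam' rho d, plane_drawing g p gam' /\ radial_at gam' a rho d.
Proof.
move=> Dr0; have := @reverse_drawing R T g p gam (fun e => gam e 0 != p a) Dr0.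
set gam0 := (X in plane_drawing _ _ X) => Dr.
have [ip [_ h2 h3 h4 h5]] := Dr.
have st0 e : e \in g -> a \in e -> gam0 e 0 = p a.
  move=> eg ae; have [x [y [ee xy g0 g1]]] := edge_ends Dr0 eg.
  rewrite /gam0; case: eqP => [->//|ne] /=; rewrite subr0.
  by move: ae; rewrite ee !inE => /orP [] /eqP ax; rewrite -ee; [case: ne; rewrite g0 ax|rewrite g1 ax].
have st1 e : e \in g -> a \in e -> exists2 v, v != a & gam0 e 1 = p v.
  move=> eg ae; have [x [y [ee xy g0 g1]]] := edge_ends Dr eg.
  exists y => //; apply: contraNneq xy => ->; apply/eqP/ip.
  by rewrite -g0 st0.
near (0 : R)^'+%classic => r.
have r0 : 0 < r by near: r; exact: nbhs_right_gt.
have rv' : forall v, v != a -> r < `|p v - p a|.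
  near: r; apply: filter_forall => v; case: (eqVneq v a) => [_|va]; first by apply: nearW.
  have pv : 0 < `|p v - p a| by rewrite normr_gt0 subr_eq0; apply: contraNneq va => /ip ->.
  by apply: filterS (nbhs_right_lt pv) => x Hx _.
have re' : forall e, e \in g -> a \notin e -> forall z, curve gam0 e z -> r <= `|z - p a|.
  near: r; apply: filter_forall => e; case: (boolP (e \in g)) => eg; last by apply: nearW.
  case: (boolP (a \in e)) => ae; first by apply: nearW.
  have cpt : compact [set p a]%classic by apply: compact_set1.
  have dj z : curve gam0 e z -> ~ [set p a]%classic z.
    move=> [s sI <-] /= E; have sI' : 0 <= s <= 1 by move: sI; rewrite /= in_itv.
    case: (curve_cases Dr eg sI') => [si|[v ve Ev]]; first exact: (h4 e a s eg si).
    by move: ae; rewrite (_ : a = v) ?ve //; apply: ip; rewrite -Ev -E.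
  apply: filterS (compact_sep (curve_compact Dr eg) cpt dj) => x Hx _ _ z ez.
  by rewrite -far_norm; apply: Hx.
pose rho := r / 2; have rho0 : 0 < rho by rewrite divr_gt0.
have rr : rho < r by rewrite /rho; lra.
have rv v : v != a -> rho < `|p v - p a| by move=> /rv'; apply: lt_trans.
have re e s : e \in g -> a \notin e -> 0 <= s <= 1 -> rho < `|gam0 e s - p a|.
  move=> eg ae sI; apply: lt_le_trans rr _; apply: (re' e eg ae); exists s => //.
have Hs e : exists s, e \in g -> a \in e -> [/\ 0 < s, s < 1, `|gam0 e s - p a| = rho &
    forall t, s < t <= 1 -> rho < `|gam0 e t - p a|].
  case: (boolP (e \in g)) => eg; last by exists 0.
  case: (boolP (a \in e)) => ae; last by exists 0.
  have ch : {within `[0, 1], continuous (fun t => `|gam0 e t - p a|)}%classic.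
    apply: (@within_continuous_comp _ _ _ `[(0 : R), 1]%classic (gam0 e) (fun z => `|z - p a|)); last exact: h2.
    by move=> z _; apply: cvg_norm; apply: cvgB; [exact: cvg_id|exact: cvg_cst].
  have [||s /andP [s0 s1] [hs hs']] := @last_exit R (fun t => `|gam0 e t - p a|) rho ch.
  - by rewrite (st0 _ eg ae) subrr normr0.
  - by have [v va ->] := st1 _ eg ae; apply: rv.
  by exists s.
have [sg {}Hs] := choice Hs.
pose d (e : {set T}) : R * R := gam0 e (sg e) - p a.
pose gam1 (e : {set T}) (s : R) : R * R := if (a \in e) && (s <= sg e) then p a + (s / sg e) *: d e else gam0 e s.
have lin (e : {set T}) (s : R) : e \in g -> a \in e -> 0 <= s <= sg e -> `|gam1 e s - p a| = s / sg e * rho.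
  move=> eg ae /andP [s0 s1]; have [sg0 _ dn _] := Hs e eg ae.
  by rewrite /gam1 ae s1 addrC addKr normrZ dn ger0_norm // divr_ge0 // ltW.
have lin_le (e : {set T}) (s : R) : e \in g -> a \in e -> 0 <= s <= sg e -> `|gam1 e s - p a| <= rho.
  move=> eg ae sI; rewrite lin //; have [sg0 _ dn _] := Hs e eg ae.
  by rewrite ler_piMl ?(ltW rho0) // ler_pdivrMr // mul1r; case/andP: sI.
have far (e : {set T}) (s : R) : e \in g -> a \in e -> sg e < s -> gam1 e s = gam0 e s.
  by move=> eg ae ss; rewrite /gam1 leNgt ss andbF.
have out (e : {set T}) : a \notin e -> gam1 e = gam0 e.
  by move=> ae; apply: funext => s; rewrite /gam1 (negPf ae).
have farn (e : {set T}) (s : R) : e \in g -> 0 <= s <= 1 -> (a \notin e) || (sg e < s) -> rho < `|gam1 e s - p a| /\ gam1 e s = gam0 e s.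
  move=> eg sI; case: (boolP (a \in e)) => ae /= H; last by rewrite out //; split=> //; apply: re.
  rewrite far //; split=> //; have [_ _ _] := Hs e eg ae; apply.
  by rewrite H; case/andP: sI.
exists gam1, rho, d; split.
  split=> //; split.
  - move=> e eg; have [x [y [ee xy g0 g1]]] := edge_ends Dr eg; exists x, y; split=> //.
      case: (boolP (a \in e)) => ae; last by rewrite out.
      have [sg0 _ _ _] := Hs e eg ae.
      by rewrite /gam1 ae (ltW sg0) /= mul0r scale0r addr0 -(st0 e eg ae).
    case: (boolP (a \in e)) => ae; last by rewrite out.
    by have [_ sg1 _ _] := Hs e eg ae; rewrite far.
  - move=> e eg; case: (boolP (a \in e)) => ae; last by rewrite out //; apply: h2.
    have [sg0 sg1 dn _] := Hs e eg ae.
    have -> : `[(0 : R), 1]%classic = (`[(0 : R), sg e] `|` `[sg e, 1])%classic.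
      apply/seteqP; split=> x; rewrite /= !in_itv /=; first by case: (leP x (sg e)) => h /andP [-> ->]; [left|right; rewrite ltW].
      by case=> /andP [u v]; rewrite ?u ?v ?(le_trans (ltW sg0) u) ?(le_trans v (ltW sg1)).
    apply: withinU_continuous.
    + exact: itv_closed.
    + exact: itv_closed.
    + apply: (@within_eq R _ (fun s => p a + (s / sg e) *: d e)).
        by move=> s; rewrite /= in_itv /= /gam1 ae => /andP [_ ->].
      apply: continuous_subspaceT => s; apply: cvgD; first exact: cvg_cst.
      by apply: cvgZl; apply: cvgMl; exact: cvg_id.
    + apply: (@within_eq R _ (gam0 e)).
        move=> s; rewrite /= in_itv /= => /andP [h _]; case: (ltrP (sg e) s) => hs; first by rewrite far.
        have -> : s = sg e by apply/le_anti; rewrite hs.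
        by rewrite /gam1 ae lexx /= divff ?gt_eqF // scale1r addrC subrK.
      apply: continuous_subspaceW (h2 e eg) => s; rewrite /= !in_itv /= => /andP [u ->].
      by rewrite (le_trans (ltW sg0) u).
  - move=> e s t eg sI tI E; case: (boolP (a \in e)) => ae; last by move: E; rewrite out //; apply: h3.
    have [sg0 sg1 dn _] := Hs e eg ae; have [s0 s1] := andP sI; have [t0 t1] := andP tI.
    case: (leP s (sg e)) => hs; case: (leP t (sg e)) => ht.
    + have := lin e s eg ae; rewrite s0 hs E lin ?t0 ?ht // => /(_ isT) /(mulIf (lt0r_neq0 rho0)).
      by move=> /(mulIf (invr_neq0 (lt0r_neq0 sg0))) ->.
    + have := lin_le e s eg ae; rewrite s0 hs E => /(_ isT).
      by have [] := farn e t eg tI; rewrite ?ht ?orbT // ltNge => /negPf ->.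
    + have := lin_le e t eg ae; rewrite t0 ht -E => /(_ isT).
      by have [] := farn e s eg sI; rewrite ?hs ?orbT // ltNge => /negPf ->.
    + by move: E; rewrite !far //; apply: h3.
  - move=> e v s eg sI; case: (boolP (a \in e)) => ae; last by rewrite out //; exact: (h4 e v s eg sI).
    have [sg0 sg1 dn _] := Hs e eg ae; have [s0 s1] := andP sI.
    case: (leP s (sg e)) => hs; last by rewrite far //; exact: (h4 e v s eg sI).
    move=> E; have := lin e s eg ae; rewrite (ltW s0) hs E => /(_ isT).
    case: (eqVneq v a) => [->|va].
      by rewrite subrr normr0 => /eqP; rewrite eq_sym mulf_eq0 (gt_eqF rho0) orbF gt_eqF // divr_gt0.
    have := lin_le e s eg ae; rewrite (ltW s0) hs E => /(_ isT).
    by rewrite leNgt rv.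
  - move=> e e' s t eg e'g ee' sI tI E; have [s0 s1] := andP sI; have [t0 t1] := andP tI.
    have sI' : 0 <= s <= 1 by rewrite !ltW.
    have tI' : 0 <= t <= 1 by rewrite !ltW.
    case: (boolP ((a \notin e) || (sg e < s))) => hs; case: (boolP ((a \notin e') || (sg e' < t))) => ht.
    + have [_ E1] := farn e s eg sI' hs; have [_ E2] := farn e' t e'g tI' ht.
      by apply: (h5 e e' s t) => //; rewrite -E1 E.
    + have [F1 _] := farn e s eg sI' hs.
      move: ht; rewrite negb_or negbK -leNgt => /andP [ae' ht].
      have := lin_le e' t e'g ae'; rewrite (ltW t0) ht -E => /(_ isT).
      by rewrite leNgt F1.
    + have [F1 _] := farn e' t e'g tI' ht.
      move: hs; rewrite negb_or negbK -leNgt => /andP [ae hs].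
      have := lin_le e s eg ae; rewrite (ltW s0) hs E => /(_ isT).
      by rewrite leNgt F1.
    + move: hs ht; rewrite !negb_or !negbK -!leNgt => /andP [ae hs] /andP [ae' ht].
      have [sg0 sg1 dn _] := Hs e eg ae; have [sg0' sg1' dn' _] := Hs e' e'g ae'.
      have := lin e s eg ae; rewrite (ltW s0) hs E lin ?(ltW t0) // => /(_ isT) /(mulIf (lt0r_neq0 rho0)) rat.
      have rp : s / sg e != 0 by rewrite gt_eqF // divr_gt0.
      move: E; rewrite /gam1 ae ae' hs ht /= rat => /addrI /(scalerI rp); rewrite /d => /addIr E.
      by apply: (h5 e e' (sg e) (sg e')) => //; rewrite ?sg0 ?sg0'.
split=> //; first by move=> e s eg ae sI; rewrite out //; apply: re.
move=> e s eg ae sI; have [sg0 sg1 dn _] := Hs e eg ae; split.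
  by rewrite -normr_gt0 dn.
case: (leP s (sg e)) => hs; last by left; have [] := farn e s eg sI; rewrite ?hs ?orbT.
right; exists (s / sg e); last by rewrite /gam1 ae hs.
by rewrite divr_ge0 ?(ltW sg0) //; case/andP: sI.
Unshelve. all: by end_near. Qed.
End Radialize.

(** * Free directions at a vertex, and inversion in the plane *)

Section FreeDirection.
Variable R : realType.
Implicit Types (z u w d : R * R).

Definition cross u d : R := u.1 * d.2 - u.2 * d.1.

Lemma coord_le z : `|z.1| <= `|z| /\ `|z.2| <= `|z|.
Proof. by rewrite prod_normE !le_max !lexx orbT. Qed.

Lemma cross_le u d : `|cross u d| <= 2 * (`|u| * `|d|).
Proof.
have [u1 u2] := coord_le u; have [d1 d2] := coord_le d.
apply: le_trans (ler_normB _ _) _; rewrite !normrM mulr_natl mulr2n.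
by apply: lerD; apply: ler_pM.
Qed.

(** A vector (1, y) with y above all finitely many slopes is parallel to none of the directions, and
    by continuity of the cross product neither is any vector in a thin cone around it. *)
Lemma free_direction (I : finType) (P : pred I) (d : I -> R * R) : (forall i, P i -> d i != 0) ->
  exists2 u, 1 <= `|u| & \forall kap \near (0 : R)^'+%classic,
    forall i, P i -> forall w t la, `|w| <= kap -> 0 < t -> t *: (u + w) = la *: d i -> False.
Proof.
move=> dn; pose y := 1 + \sum_i `|(d i).2 / (d i).1|; pose u : R * R := (1, y).
have u1 : 1 <= `|u| by have [h _] := coord_le u; apply: le_trans h; rewrite normr1.
have cu i : P i -> cross u (d i) != 0.
  move=> Pi; rewrite /cross /= mul1r subr_eq0; have [d1|d1] := eqVneq (d i).1 0.
    rewrite d1 mulr0; apply: contraNneq (dn i Pi) => d2.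
    by rewrite -pair_eqE /= /pair_eq /= d1 d2 !eqxx.
  apply/eqP => E; have : `|(d i).2 / (d i).1| < y.
    by rewrite /y (bigD1 i) //= -[ltLHS]add0r ltr_leD // lerDl sumr_ge0.
  by rewrite E mulfK // ltNge ler_norm.
exists u => //; apply: filter_forall => i; case: (boolP (P i)) => Pi; last by apply: nearW.
have e0 : 0 < `|cross u (d i)| / (2 * `|d i|) by rewrite divr_gt0 ?mulr_gt0 ?normr_gt0 ?cu ?dn.
apply: filterS (nbhs_right_lt e0) => kap kk _ w t la wk t0 E.
have : cross (u + w) (d i) = 0.
  have e1 : t * (u + w).1 = la * (d i).1 := congr1 fst E.
  have e2 : t * (u + w).2 = la * (d i).2 := congr1 snd E.
  apply: (mulfI (lt0r_neq0 t0)); rewrite mulr0 /cross mulrBr !mulrA e1 e2; ring.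
have -> : cross (u + w) (d i) = cross u (d i) + cross w (d i) by rewrite /cross /=; ring.
move=> /eqP; rewrite addr_eq0 => /eqP E2; have := cross_le w (d i).
rewrite -[`|cross w _|]normrN -E2 leNgt => /negP; apply.
apply: le_lt_trans (_ : 2 * (kap * `|d i|) < _).
  by rewrite ler_wpM2l // ler_wpM2r.
by move: kk; rewrite ltr_pdivlMr ?mulr_gt0 ?normr_gt0 ?dn //; lra.
Qed.
End FreeDirection.

Section Inversion.
Variable R : realType.
Implicit Types (z w u : R * R).

Definition sqn z : R := z.1 ^+ 2 + z.2 ^+ 2.
Definition inv2 z : R * R := (sqn z)^-1 *: z.

Lemma sqn_gt0 z : z != 0 -> 0 < sqn z.
Proof.
rewrite -pair_eqE /= /pair_eq /= negb_and /sqn => /orP [] h.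
  by rewrite ltr_pwDl ?sqr_ge0 // lt0r sqrf_eq0 h sqr_ge0.
by rewrite ltr_wpDl ?sqr_ge0 // lt0r sqrf_eq0 h sqr_ge0.
Qed.

Lemma sqnZ a z : sqn (a *: z) = a ^+ 2 * sqn z.
Proof. by rewrite /sqn (_ : (a *: z).1 = a * z.1) // (_ : (a *: z).2 = a * z.2) //; ring. Qed.

Lemma inv2Z a z : a != 0 -> inv2 (a *: z) = a^-1 *: inv2 z.
Proof.
move=> a0; rewrite /inv2 sqnZ !scalerA; congr (_ *: z).
by rewrite invfM expr2 invfM -!mulrA [_ * a]mulrC mulKf // mulrC.
Qed.

Lemma inv2K z : z != 0 -> inv2 (inv2 z) = z.
Proof.
move=> z0; have s0 := lt0r_neq0 (sqn_gt0 z0).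
rewrite /inv2 sqnZ scalerA (_ : _ * _ = 1) ?scale1r //.
by move: (sqn z) s0 => s s0; field.
Qed.

Lemma inv2_norm z : z != 0 -> `|inv2 z| <= `|z|^-1.
Proof.
move=> z0; have n0 : 0 < `|z| by rewrite normr_gt0.
have s0 := sqn_gt0 z0; rewrite /inv2 normrZ ger0_norm ?invr_ge0 ?(ltW s0) // mulrC.
rewrite ler_pdivrMr // mulrC -ler_pdivrMr ?invr_gt0 // invrK -expr2.
rewrite prod_normE; have h (x : R) : `|x| ^+ 2 = x ^+ 2 by rewrite real_normK ?num_real.
by case: (leP `|z.1| `|z.2|) => _; rewrite h /sqn ?lerDl ?lerDr sqr_ge0.
Qed.

Lemma inv2_continuous z : z != 0 -> {for z, continuous inv2}%classic.
Proof.
move=> z0; apply: cvgZ; last exact: cvg_id.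
apply: cvgV; first exact: lt0r_neq0 (sqn_gt0 z0).
by apply: cvgD; rewrite expr2; apply: cvgM; (exact: cvg_fst || exact: cvg_snd).
Qed.
End Inversion.

Section AddBridge.
Variables (R : realType) (T : finType) (g : {set {set T}}) (p : T -> R * R).

Lemma cone_free gam a rho (d : {set T} -> R * R) u kap :
  radial_at g p gam a rho d -> 1 <= `|u| -> kap < 1 ->
  (forall e, e \in g -> a \in e -> forall w t la, `|w| <= kap -> 0 < t -> t *: (u + w) = la *: d e -> False) ->
  forall t w, 0 < t -> t * (`|u| + 1) <= rho -> `|w| <= kap ->
  (forall v, p v <> p a + t *: (u + w)) /\
  (forall e s, e \in g -> 0 <= s <= 1 -> gam e s <> p a + t *: (u + w)).
Proof.
move=> [rho0 rv re ra] u1 k1 fr t w t0 tr wk.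
have nle : `|t *: (u + w)| <= rho.
  rewrite normrZ gtr0_norm //; apply: le_trans tr; rewrite ler_wpM2l ?(ltW t0) //.
  by apply: le_trans (ler_normD _ _) _; lra.
have nz : t *: (u + w) != 0.
  rewrite scaler_eq0 (gt_eqF t0) /= addr_eq0; apply: contraTneq u1 => ->.
  by rewrite normrN -ltNge; lra.
have sh z : z = p a + t *: (u + w) -> ~ rho < `|z - p a| by move=> ->; rewrite addrC addKr; lra.
split=> [v E|e s eg sI E].
  have [va|va] := eqVneq v a; last exact: sh E (rv v va).
  by move: nz; rewrite -(inj_eq (addrI (p a))) -E va addr0 eqxx.
have [ae|ae] := boolP (a \in e); last exact: sh E (re e s eg ae sI).
have [_ [/(sh _ E) //|[la _ E']]] := ra e s eg ae sI.
by apply: (fr e eg ae w t la wk t0); apply: (addrI (p a)); rewrite -E' E.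
Qed.
End AddBridge.

(* The component of [b] is moved, by an inversion centred at a free point close to [b],
   into a free cone at [a]; the new edge is then a straight segment. *)
Lemma planar_add_bridge (R : realType) (T : finType) (g : {set {set T}}) (a b : T) :
  planar R g -> ~~ connect (graph_adj g) a b -> planar R ([set a; b] |: g).
Proof.
move=> [p [gam Dr]] nab.
have [gam1 [rho1 [d1 [Dr1 rad1]]]] := radialize a Dr.
have [gam2 [rho2 [d2 [Dr2 rad2]]]] := radialize b Dr.
have I01 : 0 <= (0 : R) <= 1 by rewrite lexx ler01.
pose P (i : {set T} * bool) := (i.1 \in g) && (if i.2 then a \in i.1 else b \in i.1).
pose d (i : {set T} * bool) := if i.2 then d1 i.1 else d2 i.1.
have [|u u1 Hu] := @free_direction R ({set T} * bool)%type P d.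
  move=> [e [|]] /andP [/= eg ae].
    by have [_ _ _ /(_ e 0 eg ae I01) []] := rad1.
  by have [_ _ _ /(_ e 0 eg ae I01) []] := rad2.
near (0 : R)^'+%classic => kap.
have k0 : 0 < kap by near: kap; exact: nbhs_right_gt.
have k1 : kap < 1 by near: kap; exact: nbhs_right_lt.
have fr : forall i, P i -> forall w t la, `|w| <= kap -> 0 < t -> t *: (u + w) = la *: d i -> False.
  by near: kap.
have fr1 := cone_free rad1 u1 k1 (fun e eg ae => fr (e, true) (introT andP (conj eg ae))).
have fr2 := cone_free rad2 u1 k1 (fun e eg be => fr (e, false) (introT andP (conj eg be))).
have un0 : 0 < `|u| + 1 by rewrite ltr_pwDr.
have [rho10 _ _ _] := rad1; have [rho20 _ _ _] := rad2.
pose ra := rho1 / (`|u| + 1); have ra0 : 0 < ra by rewrite divr_gt0.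
pose rb := rho2 / (`|u| + 1); have rb0 : 0 < rb by rewrite divr_gt0.
have raE t : t <= ra -> t * (`|u| + 1) <= rho1 by rewrite ler_pdivlMr.
have rbE t : t <= rb -> t * (`|u| + 1) <= rho2 by rewrite ler_pdivlMr.
pose Pt2 z := (exists v, z = p v) \/ (exists e s, [/\ e \in g, 0 <= s <= 1 & z = gam2 e s]).
pose Pt1 z := (exists v, z = p v) \/ (exists e s, [/\ e \in g, 0 <= s <= 1 & z = gam1 e s]).
have cone1 z t w : Pt1 z -> 0 < t -> t <= ra -> `|w| <= kap -> z <> p a + t *: (u + w).
  move=> zP t0 tr wk; have [h1 h2] := fr1 t w t0 (raE _ tr) wk.
  by case: zP => [[v ->]|[e [s [eg sI ->]]]]; [apply: h1|apply: h2].
have cone2 z t w : Pt2 z -> 0 < t -> t <= rb -> `|w| <= kap -> z <> p b + t *: (u + w).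
  move=> zP t0 tr wk; have [h1 h2] := fr2 t w t0 (rbE _ tr) wk.
  by case: zP => [[v ->]|[e [s [eg sI ->]]]]; [apply: h1|apply: h2].
(* The centre of inversion lies on the axis of the free cone at b, so a disc of radius rb kap around
   it contains no point of the second drawing. *)
pose x := p b + rb *: u.
have zx z : Pt2 z -> rb * kap < `|z - x|.
  move=> zP; rewrite ltNge; apply/negP => h.
  apply: (@cone2 z rb (rb^-1 *: (z - x)) zP rb0 (lexx _)).
    by rewrite normrZ gtr0_norm ?invr_gt0 // mulrC ler_pdivrMr // mulrC.
  by rewrite scalerDr scalerA divff ?gt_eqF // scale1r addrA -/x addrC subrK.
have zx0 z : Pt2 z -> z - x != 0.
  by move=> /zx h; rewrite -normr_gt0; apply: lt_trans h; rewrite mulr_gt0.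
pose mu := kap * (rb * kap); have mu0 : 0 < mu by rewrite !mulr_gt0.
pose iv z := mu *: inv2 (z - x).
have ivk z : Pt2 z -> `|iv z| <= kap.
  move=> zP; rewrite normrZ gtr0_norm //.
  apply: (@le_trans _ _ (mu * `|z - x|^-1)); first by rewrite ler_wpM2l ?(ltW mu0) // inv2_norm // zx0.
  by rewrite ler_pdivrMr ?normr_gt0 ?zx0 // ler_wpM2l ?(ltW k0) // ltW // zx.
(* Inversion at x sends the second drawing into a disc of radius kap (the reason for the value of
   mu), and F moves that disc into the free cone at a, clear of the first drawing. *)
pose F z := p a + ra *: (u + iv z).
have Finj z z' : Pt2 z -> Pt2 z' -> F z = F z' -> z = z'.
  move=> zP zP' /addrI /(scalerI (lt0r_neq0 ra0)) /addrI /(scalerI (lt0r_neq0 mu0)) E.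
  by apply: (addIr (- x)); rewrite -(inv2K (zx0 z zP)) E inv2K // zx0.
have F1 z z' : Pt2 z -> Pt1 z' -> z' <> F z.
  by move=> zP zP'; apply: cone1 => //; apply: ivk.
have Fc z : Pt2 z -> {for z, continuous F}%classic.
  move=> zP; apply: cvgD; first exact: cvg_cst.
  apply: cvgZr; apply: cvgD; first exact: cvg_cst.
  apply: cvgZr; apply: (@cvg_comp _ _ _ (fun y => y - x) (@inv2 R)); last exact: (inv2_continuous (zx0 z zP)).
  by apply: cvgB; [exact: cvg_id|exact: cvg_cst].
have su0 : 0 < sqn u by apply: sqn_gt0; rewrite -normr_gt0; lra.
pose nu := mu / (rb * sqn u); have nu0 : 0 < nu by rewrite divr_gt0 // mulr_gt0.
have Pb : Pt2 (p b) by left; exists b.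
have ivb : iv (p b) = - nu *: u.
  rewrite /iv /x opprD addNKr -scaleNr inv2Z ?oppr_eq0 ?gt_eqF // /inv2 !scalerA; congr (_ *: u).
  by rewrite /nu; field; rewrite !gt_eqF.
have nu1 : nu < 1.
  have := ivk _ Pb; rewrite ivb normrZ normrN gtr0_norm // => h.
  have : nu * 1 <= nu * `|u| by rewrite ler_wpM2l // ltW.
  lra.
have FbE : F (p b) = p a + (ra * (1 - nu)) *: u.
  by rewrite /F ivb -{1}[u]scale1r -scalerDl scalerA.
pose seg s := p a + s *: (F (p b) - p a).
have segE s : seg s = p a + (s * (ra * (1 - nu))) *: (u + 0).
  by rewrite /seg FbE [p a + _ - _]addrC addKr scalerA addr0.
have seg1 s z : 0 < s <= 1 -> Pt1 z -> z <> seg s.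
  move=> /andP [s0 s1] zP; rewrite segE; apply: cone1 => //.
  - by rewrite !mulr_gt0 // subr_gt0.
  - rewrite mulrCA ler_piMr ?(ltW ra0) //; have h1 : 0 <= 1 - nu by rewrite subr_ge0 ltW.
    have h2 : 1 - nu <= 1 by rewrite gerBl ltW.
    exact: (mulr_ile1 (ltW s0) h1 s1 h2).
  - by rewrite normr0 ltW.
(* F maps [p b] onto the axis of the cone at a. A point z sent onto the open segment would, undoing
   the inversion, lie on the axis of the free cone at b, strictly between [p b] and x. *)
have seg2 s z : 0 < s < 1 -> Pt2 z -> F z <> seg s.
  move=> /andP [s0 s1] zP; rewrite segE addr0 mulrCA -scalerA => /addrI /(scalerI (lt0r_neq0 ra0)) E.
  pose la := 1 - s * (1 - nu).
  have snu : 0 < s * (1 - nu) by rewrite mulr_gt0 // subr_gt0.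
  have s1nu : s * (1 - nu) < 1 * (1 - nu) by rewrite ltr_pM2r // subr_gt0.
  have la0 : 0 < la by rewrite /la; lra.
  have lanu : nu < la by rewrite /la; lra.
  have ivE : iv z = - la *: u.
    by apply: (addrI u); rewrite E -{2}[u]scale1r -scalerDl /la; congr (_ *: u); ring.
  have i2 : inv2 (z - x) = - (la / mu) *: u.
    by apply: (scalerI (lt0r_neq0 mu0)); rewrite -/(iv z) ivE scalerA; congr (_ *: u); field; rewrite gt_eqF.
  have := inv2K (zx0 z zP); rewrite i2 inv2Z ?oppr_eq0 ?gt_eqF ?divr_gt0 // /inv2 scalerA => E2.
  apply: (@cone2 z (rb * (1 - nu / la)) 0 zP).
  - by rewrite mulr_gt0 // subr_gt0 ltr_pdivrMr // mul1r.
  - by rewrite ler_piMr ?(ltW rb0) // gerBl divr_ge0 // ltW.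
  - by rewrite normr0 ltW.
  rewrite addr0 -[LHS](subrK x) -E2 /x addrCA -scalerDl; congr (_ + _ *: u).
  by rewrite /nu; field; rewrite !gt_eqF.
pose C := [set v | connect (graph_adj g) b v].
have sg : connect_sym (graph_adj g) := connect_sym_of_sym (@graph_adj_sym T g).
have bC : b \in C by rewrite inE.
have aC : a \notin C by rewrite inE sg.
have edC e x0 y : e \in g -> e = [set x0; y] -> (x0 \in C) = (y \in C).
  move=> eg ee; rewrite !inE; have xy : graph_adj g x0 y by rewrite /graph_adj -ee.
  by apply/idP/idP => h; apply: connect_trans h (connect1 _); rewrite // graph_adj_sym.
have inC e : e \in g -> e \subset C \/ (forall v, v \in e -> v \notin C) /\ ~~ (e \subset C).
  move=> eg; have [x0 [y [ee xy _ _]]] := edge_ends Dr eg.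
  have := edC e x0 y eg ee; rewrite ee; case: (boolP (y \in C)) => yC xC.
    by left; apply/subsetP => v; rewrite !in_set2 => /orP [] /eqP ->; rewrite ?xC.
  right; split; first by move=> v; rewrite !in_set2 => /orP [] /eqP ->; rewrite ?xC.
  by apply/negP => /subsetP /(_ y); rewrite in_set2 eqxx orbT (negPf yC) => /(_ isT).
have abg : [set a; b] \notin g.
  by apply: contra nab => h; apply: connect1.
pose p' v := if v \in C then F (p v) else p v.
pose gam' e s := if e == [set a; b] then seg s else if e \subset C then F (gam2 e s) else gam1 e s.
have P1v v : Pt1 (p v) by left; exists v.
have P2v v : Pt2 (p v) by left; exists v.
have P1e e s : e \in g -> 0 <= s <= 1 -> Pt1 (gam1 e s) by move=> eg sI; right; exists e, s.
have P2e e s : e \in g -> 0 <= s <= 1 -> Pt2 (gam2 e s) by move=> eg sI; right; exists e, s.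
have neab e : e \in g -> (e == [set a; b]) = false by move=> eg; apply: contraNF abg => /eqP <-.
have lt_le (s : R) : 0 < s < 1 -> 0 <= s <= 1 by move=> /andP [? ?]; rewrite !ltW.
have lt_le1 (s : R) : 0 < s < 1 -> 0 < s <= 1 by move=> /andP [-> ?]; rewrite ltW.
have [ip [c1 c2 c3 c4 c5]] := Dr1; have [_ [e1 e2 e3 e4 e5]] := Dr2.
exists p', gam'; split.
  move=> v w; rewrite /p'; case: ifP => _; case: ifP => _.
  - by move=> /(Finj _ _ (P2v v) (P2v w)) /ip.
  - by move=> /esym E; case: (F1 _ _ (P2v v) (P1v w) E).
  - by move=> E; case: (F1 _ _ (P2v w) (P1v v) E).
  - exact: ip.
split.
- move=> e; rewrite in_setU1 => /orP [/eqP ->|eg].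
    exists a, b; rewrite /gam' eqxx /seg scale0r addr0 scale1r addrC subrK /p' bC (negPf aC); split=> //.
    by apply: contraNneq nab => ->.
  rewrite /gam' neab //; case: (inC e eg) => [eC|[nC eC]].
    have [x0 [y [ee xy g0 g1]]] := e1 e eg; exists x0, y; rewrite eC g0 g1 /p'.
    by rewrite !(subsetP eC) // ee !inE eqxx ?orbT.
  have [x0 [y [ee xy g0 g1]]] := c1 e eg; exists x0, y; rewrite (negPf eC) g0 g1 /p'.
  by rewrite !(negPf (nC _ _)) // ee !inE eqxx ?orbT.
- move=> e; rewrite in_setU1 => /orP [/eqP ->|eg].
    rewrite /gam' eqxx; apply: continuous_subspaceT => s; apply: cvgD; first exact: cvg_cst.
    by apply: cvgZl; exact: cvg_id.
  rewrite /gam' neab //; case: (inC e eg) => [eC|[nC eC]]; last by rewrite (negPf eC); apply: c2.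
  rewrite eC; apply: (@within_continuous_comp _ _ _ `[(0 : R), 1]%classic (gam2 e) F); last exact: e2.
  move=> z /set_mem [s]; rewrite /= in_itv /= => sI <-.
  by apply: Fc; apply: P2e.
- move=> e s t; rewrite in_setU1 => /orP [/eqP ->|eg] sI tI; rewrite /gam'.
    rewrite eqxx !segE !addr0 => /addrI E.
    have : (s * (ra * (1 - nu)) - t * (ra * (1 - nu))) *: u = 0 by rewrite scalerBl E subrr.
    have un : u != 0 by rewrite -normr_gt0; lra.
    move/eqP; rewrite scaler_eq0 (negPf un) orbF.
    by rewrite -mulrBl mulf_eq0 [_ * _ == 0]gt_eqF ?orbF ?mulr_gt0 ?subr_gt0 // subr_eq0 => /eqP.
  rewrite neab //; case: (inC e eg) => [eC|[nC eC]]; last by rewrite (negPf eC); apply: c3.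
  by rewrite eC => /(Finj _ _ (P2e e s eg sI) (P2e e t eg tI)); apply: e3.
- move=> e v s; rewrite in_setU1 => /orP [/eqP ->|eg] sI; rewrite /gam' /p'.
    rewrite eqxx; case: ifP => _ E; first exact: (seg2 s (p v) sI (P2v v) (esym E)).
    exact: (seg1 s (p v) (lt_le1 _ sI) (P1v v) (esym E)).
  rewrite neab //; case: (inC e eg) => [eC|[nC eC]]; [rewrite eC|rewrite (negPf eC)]; case: ifP => _ E.
  + by move: E => /(Finj _ _ (P2e e s eg (lt_le _ sI)) (P2v v)); apply: e4.
  + exact: (F1 _ _ (P2e e s eg (lt_le _ sI)) (P1v v) (esym E)).
  + exact: (F1 _ _ (P2v v) (P1e e s eg (lt_le _ sI)) E).
  + by move: E; apply: c4.
- have sym : forall e e' s t, e \in g -> 0 < s < 1 -> 0 < t < 1 -> e' = [set a; b] -> gam' e s <> gam' e' t.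
    move=> e e' s t eg sI tI ->; rewrite /gam' eqxx neab //; case: (inC e eg) => [eC|[nC eC]].
      by rewrite eC; apply: seg2 => //; apply: P2e => //; apply: lt_le.
    by rewrite (negPf eC); apply: seg1; [apply: lt_le1|apply: P1e => //; apply: lt_le].
  move=> e e' s t; rewrite !in_setU1 => /orP [/eqP ee|eg] /orP [/eqP ee'|e'g] ne sI tI.
  + by move: ne; rewrite ee ee' eqxx.
  + by move/esym; apply: sym.
  + exact: sym.
  rewrite /gam' !neab //; case: (inC e eg) => [eC|[nC eC]]; [rewrite eC|rewrite (negPf eC)];
    case: (inC e' e'g) => [eC'|[nC' eC']]; [rewrite eC'|rewrite (negPf eC')|rewrite eC'|rewrite (negPf eC')].
  + by move=> /(Finj _ _ (P2e e s eg (lt_le _ sI)) (P2e e' t e'g (lt_le _ tI))); apply: e5.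
  + by move/esym; apply: F1; [apply: P2e => //; apply: lt_le|apply: P1e => //; apply: lt_le].
  + by apply: F1; [apply: P2e => //; apply: lt_le|apply: P1e => //; apply: lt_le].
  + exact: c5.
Unshelve. all: by end_near. Qed.

Section PlanarBasics.
Variables (R : realType) (T : finType).
Implicit Types (g h : {set {set T}}) (f : {ffun T -> T}).

Lemma planar_sub g h : h \subset g -> planar R g -> planar R h.
Proof.
move=> /subsetP hg [p [gam [ip [h1 h2 h3 h4 h5]]]]; exists p, gam; split=> //; split.
- by move=> e /hg; apply: h1.
- by move=> e /hg; apply: h2.
- by move=> e s t /hg; apply: h3.
- by move=> e v s /hg; apply: h4.
- by move=> e e' s t /hg eg /hg; apply: h5.
Qed.

Lemma planar0 : planar R (set0 : {set {set T}}).
Proof.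
exists (fun v => ((enum_rank v)%:R, 0)), (fun _ _ => 0); split.
  by move=> v w [] /eqP; rewrite eqr_nat => /eqP /ord_inj /enum_rank_inj.
by split=> [e|e|e s t|e v s|e e' s t]; rewrite in_set0.
Qed.

Lemma graph_adj_gr f : graph_adj (gr f) =2 fadj f.
Proof. by move=> x y; rewrite /graph_adj gr_adj. Qed.

Lemma gr_cut f x : f x != x -> gr f = [set x; f x] |: gr (upd f x x).
Proof.
move=> fx; apply/setP => e; apply/imsetP/setU1P => [[z]|[->|/imsetP [z]]].
- rewrite in_set => fz ->; have [->|zx] := eqVneq z x; [by left|right].
  by apply/imsetP; exists z; rewrite ?in_set updE (negPf zx).
- by exists x; rewrite ?in_set.
- rewrite in_set updE; case: (eqVneq z x) => [->|zx]; first by rewrite eqxx.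
  by move=> fz ->; exists z; rewrite ?in_set.
Qed.

(** Cutting a vertex from its parent separates the two, so the edge can be restored by
    [planar_add_bridge]. *)
Lemma planar_forest f : acyc f -> planar R (gr f).
Proof.
have [n] := ubnP #|[set x | f x != x]|; elim: n f => // n IH f; rewrite ltnS => fn af.
have [/existsP [x fx]|/existsPn f0] := boolP [exists x, f x != x]; last first.
  suff -> : gr f = (set0 : {set {set T}}) by apply: planar0.
  apply/eqP; rewrite -finset.subset0; apply/subsetP => e /imsetP [z].
  by rewrite in_set (negPf (f0 z)).
have a0 := cut_acyc x af; rewrite (gr_cut fx); apply: planar_add_bridge.
  apply: IH a0; apply: leq_trans fn; apply: proper_card; apply/properP; split.
    by apply/subsetP => z; rewrite !in_set updE; case: (eqVneq z x) => [->|]; rewrite ?eqxx.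
  by exists x; rewrite in_set // updE !eqxx.
rewrite (eq_connect (@graph_adj_gr _)) connect_froot // froot_id ?updE ?eqxx // eq_sym.
exact: cut_froot.
Qed.
End PlanarBasics.

(** * Random planar graphs and their spanning forests *)

Section Estimates.
Variable R : realType.

Lemma pow_fact_expR (x : R) k : 0 <= x -> x ^+ k / k`!%:R <= expR x.
Proof.
move=> x0; apply: le_trans (exp_partial_le k.+1 x0).
by rewrite big_ord_recr /= lerDr sumr_ge0 // => i _; rewrite divr_ge0 // exprn_ge0.
Qed.

Lemma fact_mul_pow a k : (a`! * a ^ k <= (a + k)`!)%N.
Proof.
elim: k => [|k IH]; first by rewrite expn0 muln1 addn0.
by rewrite addnS factS expnS mulnCA; apply: leq_mul; rewrite // -addnS leq_addr.
Qed.

Lemma fact_le_expn a n : (a <= n)%N -> (a`! <= n ^ a)%N.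
Proof.
elim: a => [//|a IH] an; rewrite factS expnS; apply: leq_mul => //; exact: IH (ltnW an).
Qed.

Lemma bin_le_pow N k : 'C(N, k)%:R <= N%:R ^+ k / k`!%:R :> R.
Proof.
rewrite ler_pdivlMr ?ltr0n ?fact_gt0 // -natrM bin_ffact -natrX ler_nat.
elim: k N => [|k IH] [|N] //; rewrite ffactnS expnS; apply: leq_mul => //=.
by apply: leq_trans (IH N) _; case: k {IH} => // k; rewrite leq_exp2r.
Qed.

Lemma Xn_lb n kap : (0 < n)%N -> (kap <= n)%N -> (n ^ (n - kap))%:R <= 2 ^+ n * Xn R n kap.
Proof.
move=> n0 kn; have e0 : 0 < ex R ^+ n by rewrite exprn_gt0 // ex_gt0.
have f0 m : 0 < m`!%:R :> R by rewrite ltr0n fact_gt0.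
have h1 : (n ^ n)%:R <= n`!%:R / ex R ^+ n.
  have := @pow_fact_expR n%:R n (ler0n _ _); rewrite natrX ler_pdivrMr // => h.
  by apply: le_trans h _; rewrite mulrC /ex -expRM_natl mulrN1 expRN invrK.
have h2 : (kap`! <= n ^ kap)%N := fact_le_expn kn.
have p2 : 2 ^+ kap <= 2 ^+ n :> R by rewrite ler_eXn2l // ltr1n.
rewrite /Xn -mulrA [ex R ^+ n * _]mulrA -mulrA invfM mulrA mulrA mulrC.
have -> : (n ^ (n - kap))%:R = (n ^ n)%:R / (n ^ kap)%:R :> R.
  have en : (n ^ n = n ^ (n - kap) * n ^ kap)%N by rewrite -expnD subnK.
  by rewrite en natrM mulfK // pnatr_eq0 -lt0n expn_gt0 n0.
rewrite invfM [leRHS](_ : _ = n`!%:R / ex R ^+ n * (2 ^+ n / 2 ^+ kap / kap`!%:R)); last first.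
  by move: (ex R ^+ n)^-1 (2 ^- kap) (kap`!%:R^-1 : R) => x y z; ring.
apply: ler_pM; rewrite ?invr_ge0 //.
rewrite -[leLHS]mul1r; apply: ler_pM; rewrite ?invr_ge0 //.
  by rewrite ler_pdivlMr ?exprn_gt0 // mul1r.
by rewrite lef_pV2 ?posrE ?ltr0n ?fact_gt0 ?expn_gt0 ?n0 // ler_nat.
Qed.

(** The price of k surplus trees, repaid by choosing k extra edges among all pairs: at most (C1 n)^k
    / k!, which is e^(o(n)) when k = o(n). *)
Lemma Xn_ratio (C1 : R) n kap k : (0 < kap)%N -> n%:R <= C1 * kap%:R ->
  Xn R n (kap + k) * 'C('C(n, 2), k)%:R <= Xn R n kap * ((C1 * n%:R) ^+ k / k`!%:R).
Proof.
move=> k0 nC; have e0 : 0 < ex R ^+ n by rewrite exprn_gt0 // ex_gt0.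
have f0 m : 0 < m`!%:R :> R by rewrite ltr0n fact_gt0.
have kp : 0 < kap%:R :> R by rewrite ltr0n.
have x0 := ex_gt0 R.
have hX : Xn R n (kap + k) <= Xn R n kap / (2 * kap%:R) ^+ k.
  rewrite /Xn -[leRHS]mulrA -invfM ler_wpM2l // lef_pV2 ?posrE ?mulr_gt0 ?exprn_gt0 ?mulr_gt0 //.
  rewrite [leLHS](_ : _ = ex R ^+ n * (2 ^+ kap * 2 ^+ k) * (kap`!%:R * kap%:R ^+ k)); last by rewrite exprMn; ring.
  rewrite -exprD ler_wpM2l ?mulr_ge0 ?exprn_ge0 ?(ltW (ex_gt0 R)) //.
  by rewrite -natrX -natrM ler_nat fact_mul_pow.
have hC : 'C('C(n, 2), k)%:R <= (n%:R ^+ 2) ^+ k / k`!%:R :> R.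
  apply: le_trans (bin_le_pow _ _) _; rewrite ler_wpM2r ?invr_ge0 // lerXn2r ?nnegrE // ?exprn_ge0 //.
  rewrite -natrX ler_nat bin2 -divn2; apply: leq_trans (leq_div _ _) _.
  by rewrite expnS expn1 leq_mul2l leq_pred orbT.
apply: le_trans (ler_pM (Xn_ge0 _ _ _) (ler0n _ _) hX hC) _.
rewrite [leLHS](_ : _ = Xn R n kap * ((n%:R ^+ 2 / (2 * kap%:R)) ^+ k / k`!%:R)); last first.
  by rewrite expr_div_n; field; rewrite !gt_eqF ?exprn_gt0 ?mulr_gt0.
rewrite ler_wpM2l ?Xn_ge0 // ler_wpM2r ?invr_ge0 // lerXn2r ?nnegrE ?divr_ge0 ?exprn_ge0 ?mulr_ge0 //.
  by rewrite -(pmulr_lge0 _ kp); apply: le_trans nC.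
rewrite ler_pdivrMr ?mulr_gt0 // expr2.
have : n%:R * n%:R <= (C1 * kap%:R) * n%:R by rewrite ler_wpM2r.
have : 0 <= n%:R * n%:R :> R by rewrite mulr_ge0.
lra.
Qed.

Lemma lin_expR (y : R) : 0 < y -> exists n0, forall n, (n0 <= n)%N -> 2 * (n%:R + 1) <= expR (y * n%:R).
Proof.
move=> y0; exists (Num.bound (24 / y ^+ 3)).+1 => n nn.
have n1 : 1 <= n%:R :> R by rewrite ler1n (leq_trans _ nn).
have nb : 24 / y ^+ 3 <= n%:R.
  apply: le_trans (ltW (archi_boundP _)) _; first by rewrite divr_ge0 // exprn_ge0 // ltW.
  by rewrite ler_nat ltnW.
have yn0 : 0 <= y * n%:R by rewrite mulr_ge0 // ltW.
apply: le_trans (cube_le_expR yn0); rewrite exprMn ler_pdivlMr //.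
move: nb; rewrite ler_pdivrMr ?exprn_gt0 // => nb.
have : n%:R * 1 <= n%:R * n%:R :> R by rewrite ler_wpM2l.
have n2 : 0 <= n%:R * n%:R :> R by rewrite mulr_ge0.
have := ler_wpM2r n2 nb; rewrite !exprS expr0; lra.
Qed.
End Estimates.

Section SpanningForests.
Variables (R : realType) (n : nat).
Local Notation T := ('I_n).
Implicit Types (g : {set {set T}}) (f : {ffun T -> T}).

Definition spans g f kap := [/\ f \in CF T kap, gr f \subset g &
  forall x y, connect (graph_adj g) x y = (froot f x == froot f y)].

Lemma spans_ex g : exists f kap, spans g f kap.
Proof.
have [f ff [cf ef hf]] := canonical_spanning (@graph_adj_sym _ g).
exists f, #|roots f [set: T]|; split=> //; first by rewrite in_set ff eqxx.
by apply/subsetP => e /imsetP [x]; rewrite in_set => /ef h ->.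
Qed.

Lemma canonical_gr_inj kap kap' f f' : f \in CF T kap -> f' \in CF T kap' -> gr f = gr f' -> f = f'.
Proof.
rewrite !in_set => /and3P [/andP [af sf] _ /forall_inP cf] /and3P [/andP [af' sf'] _ /forall_inP cf'] E.
have conE x y : (froot f x == froot f y) = (froot f' x == froot f' y).
  rewrite -!connect_froot //; apply: eq_connect => u v; by rewrite -!gr_adj E.
have cellE x y : x \in cell f [set: T] (froot f y) = (x \in cell f' [set: T] (froot f' y)).
  by rewrite !in_set /= conE.
have ce x : cell f [set: T] (froot f x) = cell f' [set: T] (froot f' x).
  by apply/setP => y; rewrite cellE.
apply: (gr_inj af af') => // x.
have aux (h : {ffun T -> T}) : acyc h -> (forall r, r \in roots h [set: T] -> [pick z in cell h [set: T] r] == Some r) ->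
    (h x == x) = ([pick z in cell h [set: T] (froot h x)] == Some x).
  move=> ah hp; have rr : froot h x \in roots h [set: T] by rewrite in_set in_setT froot_fix ?eqxx.
  rewrite (eqP (hp _ rr)); apply/eqP/eqP => [hx|[<-]]; first by rewrite froot_id.
  exact: froot_fix.
by rewrite (aux f) // (aux f') // ce.
Qed.

Lemma card_gr_CF f kap : f \in CF T kap -> (#|gr f| + kap = n)%N.
Proof.
rewrite in_set => /and3P [/frsP [af _] /eqP <- _]; rewrite card_gr //.
rewrite (_ : roots f _ = ~: [set x | f x != x]) ?cardsC ?card_ord //.
by apply/setP => x; rewrite !in_set negbK.
Qed.

Lemma gr_simple f : simple_graph (gr f).
Proof.
apply/forall_inP => e /imsetP [x]; rewrite in_set => fx ->.
by rewrite cards2 [x == _]eq_sym fx.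
Qed.

Lemma planar_graphs_ge m kap : (m + kap = n)%N -> (#|CF T kap| <= #|planar_graphs R n m|)%N.
Proof.
move=> mk; rewrite -(card_in_imset (f := @gr T) (D := CF T kap)); last first.
  by move=> f f' fC f'C; apply: canonical_gr_inj fC f'C.
apply: subset_leq_card; apply/subsetP => g /imsetP [f fC ->].
rewrite in_set gr_simple /=; apply/andP; split.
  by rewrite -(eqn_add2r kap) (card_gr_CF fC) mk.
by apply/asboolP; apply: planar_forest; move: fC; rewrite in_set => /andP [/frsP []].
Qed.

Lemma spans_kap g m f kap : g \in planar_graphs R n m -> spans g f kap -> (n <= m + kap)%N /\ #|g :\: gr f| = (m + kap - n)%N.
Proof.
rewrite in_set => /and3P [_ /eqP gm _] [fC fg _]; have h1 := card_gr_CF fC.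
have h2 := subset_leq_card fg; rewrite cardsD (setIidPr fg) gm; rewrite gm in h2.
by move: h1 h2; move: #|gr f| => q h1 h2; split; clear -h1 h2; lia.
Qed.

Lemma card_supergraphs (F : {set {ffun T -> T}}) kap m (S : {set {set {set T}}}) :
  (forall g, g \in S -> g \in planar_graphs R n m /\ exists2 f, f \in F & spans g f kap) ->
  (#|S| <= #|F| * 'C('C(n, 2), m + kap - n))%N.
Proof.
move=> HS; pose k := (m + kap - n)%N; pose prs := [set e : {set T} | #|e| == 2%N].
have cp : #|prs| = 'C(n, 2) by rewrite card_draws card_ord.
rewrite -cp -cards_draws mulnC -cardsX.
pose h (c : {set {set T}} * {ffun T -> T}) := c.1 :|: gr c.2.
apply: leq_trans (leq_imset_card h _); apply: subset_leq_card; apply/subsetP => g /HS [gP [f fF sp]].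
have [fC fg _] := sp; have [_ cD] := spans_kap gP sp.
apply/imsetP; exists (g :\: gr f, f); last by rewrite /h /= -[LHS](setID g (gr f)) (setIidPr fg) setUC.
rewrite in_setX fF andbT in_set cD eqxx andbT; apply/subsetP => e; rewrite in_setD => /andP [_ eg].
by rewrite in_set; move: gP; rewrite in_set => /and3P [/forall_inP -> ].
Qed.
End SpanningForests.

(** * Transfer of rare events from forests to planar graphs *)

Section Transfer.
Variable R : realType.

Lemma planar_kap_count n m kap (S : {set {set {set 'I_n}}}) beta : (0 < beta)%N -> (0 < n)%N ->
  (forall g, g \in S -> g \in planar_graphs R n m /\ exists f, spans g f kap) ->
  (#|S| <= 2 ^ (2 * n) * n ^ (n - kap) * (n ^ 2).+1 ^ (287 * (n %/ beta)) * 2 ^ (1220 * beta ^ 2 * n))%N.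
Proof.
move=> b0 n0 HS; have := @count_noK5 'I_n S beta kap b0; rewrite card_ord => /(_ n0); apply.
move=> g /HS [gP [f [fC _ con]]]; move: gP; rewrite in_set => /and3P [/forall_inP sg _ /asboolP pl].
split.
- by move=> e eg; have /cards2P [x [y [_ ee]]] := sg e eg; exists x, y.
- exact: planar_noK5 pl.
- move: fC; rewrite in_set => /and3P [/frsP [af _] /eqP rk _]; exists (roots f [set: 'I_n]) => //.
  move=> u w; rewrite !in_set /= => /eqP fu /eqP fw h.
  have : connect (graph_adj g) u w by [].
  by rewrite con !froot_id // => /eqP.
Qed.

(** The surplus kap - kap0 >= s n gains n^(- s n), while the further pointers cost at most n^(3 A n
    / beta) <= n^(s n / 2) by the choice of beta. The remaining factors are exponential in n and
    lose against n^(- s n / 2). *)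
Lemma big_excess_small (A B : nat) (s C : R) : 0 < s -> exists beta, exists2 n0, (0 < beta)%N /\ (0 < n0)%N &
  forall n kap kap0, (n0 <= n)%N -> (kap0 <= kap)%N -> (kap <= n)%N -> s * n%:R <= (kap - kap0)%:R ->
  (2 ^ (2 * n) * n ^ (n - kap) * (n ^ 2).+1 ^ (A * (n %/ beta)) * 2 ^ (B * beta ^ 2 * n))%:R
   <= Xn R n kap0 * expR (- C * n%:R).
Proof.
move=> s0; pose beta := (Num.bound ((6 * A%:R) / s)).+1.
have b0 : 0 < beta%:R :> R by rewrite ltr0n.
have hb : (3 * A%:R) / beta%:R <= s / 2.
  have : (6 * A%:R) / s <= beta%:R.
    apply: le_trans (ltW (archi_boundP _)) _; first by rewrite divr_ge0 ?mulr_ge0 // ltW.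
    by rewrite ler_nat; exact: leqnSn.
  rewrite ler_pdivrMr // ler_pdivrMr //; lra.
pose D : R := 3 + (B * beta ^ 2)%:R; have D0 : 0 <= D by rewrite addr_ge0.
pose n0 := (Num.bound (expR ((D + `|C|) * 2 / s))).+2.
exists beta, n0; first by [].
move=> n kap kap0 nn kk kn hs; have n2 : (1 < n)%N by apply: leq_trans nn.
have np : 0 < n%:R :> R by rewrite ltr0n ltnW.
pose L := ln n%:R : R; have nE : n%:R = expR L by rewrite lnK.
have hL : D + `|C| <= s / 2 * L.
  have : (D + `|C|) * 2 / s <= L.
    rewrite -ler_expR -nE; apply: le_trans (ltW (archi_boundP (expR_ge0 _))) _.
    by rewrite ler_nat; exact: (leq_trans (leq_trans (leqnSn _) (leqnSn _)) nn).
  by rewrite ler_pdivrMr //; lra.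
have L0 : 0 <= L by rewrite ln_ge0 // ler1n ltnW.
have two : 2 <= expR 1 :> R by have := expR_ge1Dx (1 : R); lra.
have e2 q : (2 ^ q)%:R <= expR q%:R :> R.
  by rewrite natrX -[q%:R]mul1r expRM_natr lerXn2r ?nnegrE ?expR_ge0.
have h1 : (n ^ (n - kap))%:R <= 2 ^+ n * Xn R n kap0 * expR (- (s * n%:R * L)).
  apply: (@le_trans _ _ ((n ^ (n - kap0))%:R * expR (- (s * n%:R * L)))); last first.
    rewrite ler_wpM2r ?expR_ge0 // Xn_lb // ?(leq_trans kk kn) //; exact: ltnW.
  have -> : (n - kap0 = (n - kap) + (kap - kap0))%N by move: kk kn; clear; lia.
  rewrite expnD natrM -mulrA ler_peMr // natrX nE -expRM_natr -expRD -[leLHS]expR0 ler_expR.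
  by rewrite -nE; have := ler_wpM2l L0 hs; lra.
have h2 : ((n ^ 2).+1 ^ (A * (n %/ beta)))%:R <= expR (s / 2 * n%:R * L) :> R.
  apply: (@le_trans _ _ ((n%:R ^+ 3) ^+ (A * (n %/ beta)))).
    by rewrite natrX lerXn2r ?nnegrE ?exprn_ge0 // -natrX ler_nat ltn_exp2l.
  rewrite -exprM nE -expRM_natr ler_expR mulrC ler_wpM2r //.
  have h3 : (n %/ beta)%:R <= n%:R / beta%:R :> R.
    by rewrite ler_pdivlMr // -natrM ler_nat leq_trunc_div.
  rewrite -nE natrM natrM; have := ler_wpM2r (ltW np) hb.
  have A0 : 0 <= 3 * A%:R :> R by rewrite mulr_ge0.
  have := ler_wpM2l A0 h3; lra.
rewrite !natrM.
have X0 := Xn_ge0 R n kap0.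
have h4 : (2 ^ (2 * n))%:R * (n ^ (n - kap))%:R <= expR (2 * n)%:R * (expR n%:R * Xn R n kap0 * expR (- (s * n%:R * L))).
  apply: ler_pM => //; apply: le_trans h1 _; rewrite ler_wpM2r ?expR_ge0 // ler_wpM2r //.
  by rewrite -natrX.
have h5 := ler_pM (mulr_ge0 (ler0n R _) (ler0n R _)) (ler0n R _) h4 h2.
have h6 := ler_pM (mulr_ge0 (mulr_ge0 (ler0n R _) (ler0n R _)) (ler0n R _)) (ler0n R _) h5 (e2 (B * beta ^ 2 * n)%N).
apply: le_trans h6 _; set X := Xn R n kap0.
have -> : expR (2 * n)%:R * (expR n%:R * X * expR (- (s * n%:R * L))) * expR (s / 2 * n%:R * L) *
  expR (B * beta ^ 2 * n)%:R = X * expR ((2 * n)%:R + n%:R + - (s * n%:R * L) + s / 2 * n%:R * L + (B * beta ^ 2 * n)%:R).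
  by rewrite !expRD; ring.
rewrite ler_wpM2l // ler_expR; have := ler_wpM2r (ltW np) hL; have := ler_norm C => /(ler_wpM2r (ltW np)).
by rewrite /D [(2 * n)%:R]natrM [(B * beta ^ 2 * n)%:R]natrM; lra.
Qed.

(** S is split by the number of components. With more than s n surplus components [big_excess_small]
    applies; otherwise a graph is a forest of [BadF] with a few added pairs, by [card_supergraphs].
    Of the rate d, one quarter pays for the pairs, d / 16 for the lower bound on the number of
    forests and 3 d / 16 for the sum over kap, which leaves d / 2. *)
Theorem transfer (c1 e1 d : R) : 0 < c1 -> 0 < e1 -> 0 < d ->
  exists2 s0 : R, 0 < s0 & forall s : R, 0 < s -> s <= s0 -> exists n0, forall n m kap0, (n0 <= n)%N -> (m + kap0 = n)%N ->
  c1 * n%:R <= kap0%:R -> (2 + e1) * kap0%:R <= n%:R ->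
  forall BadF : nat -> {set {ffun 'I_n -> 'I_n}},
  (forall kap, (kap0 <= kap)%N -> #|BadF kap|%:R <= Xn R n kap * expR (- d * n%:R)) ->
  forall S : {set {set {set 'I_n}}},
  (forall g, g \in S -> g \in planar_graphs R n m /\
     exists f kap, spans g f kap /\ (kap%:R <= kap0%:R + s * n%:R -> f \in BadF kap)) ->
  #|S|%:R <= expR (- (d / 2) * n%:R) * #|planar_graphs R n m|%:R.
Proof.
move=> c10 e10 d0; pose C1 := c1^-1; have C10 : 0 < C1 by rewrite invr_gt0.
(* Splitting (C1 n)^k / k! as si^(-k) times (si C1 n)^k / k!, the second factor is at most e^(si C1
   n) and the first at most e^(s n ln(1 / si)); si and then s are chosen to keep each exponent below
   d n / 8. *)
pose si := Num.min 1 (d / (8 * C1)).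
have si0 : 0 < si by rewrite lt_min ltr01 divr_gt0 // mulr_gt0.
have si1 : si <= 1 by rewrite ge_min lexx.
have sd : si * C1 <= d / 8.
  have : si <= d / (8 * C1) by rewrite ge_min lexx orbT.
  by rewrite ler_pdivlMr ?mulr_gt0 //; lra.
pose La := - ln si; have La0 : 0 <= La by rewrite oppr_ge0 ln_le0.
have siE : si^-1 = expR La by rewrite expRN lnK.
exists (d / (8 * (La + 1))); first by rewrite divr_gt0 // mulr_gt0 // ltr_wpDl.
move=> s s0 ss0; have sLa : s * La <= d / 8.
  have La1 : 0 < La + 1 by lra.
  by move: ss0; rewrite ler_pdivlMr ?mulr_gt0 //; lra.
have [beta [n1 [b0 n10] Hbig]] := @big_excess_small 287 1220 s d s0.
have d16 : 0 < d / 16 by rewrite divr_gt0.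
have d316 : 0 < 3 * d / 16 by rewrite divr_gt0 // mulr_gt0.
have [n2 Hlb] := @CF_lb R e1 (d / 16) c1 e10 d16 c10.
have [n3 Hexp] := lin_expR d316.
exists (n1 + n2 + n3).+1 => n m kap0 nn mk kc kn BadF hB S HS.
have [nn1 nn2 nn3] := sum3_le nn.
have n0 : (0 < n)%N by apply: leq_trans nn.
have np : 0 < n%:R :> R by rewrite ltr0n.
have kp : 0 < kap0%:R :> R by apply: lt_le_trans kc; rewrite mulr_gt0.
have k0 : (0 < kap0)%N by rewrite -(ltr0n R).
have nC : n%:R <= C1 * kap0%:R by rewrite /C1 mulrC ler_pdivlMr // mulrC.
set X := Xn R n kap0; have X0 : 0 <= X := Xn_ge0 R n kap0.
have PGlb : X * expR (- (d / 16) * n%:R) <= #|planar_graphs R n m|%:R.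
  apply: le_trans (_ : #|CF 'I_n kap0|%:R <= _); last by rewrite ler_nat planar_graphs_ge.
  by have := Hlb 'I_n kap0; rewrite card_ord => /(_ nn2 kc kn).
pose Sk (kap : nat) := [set g in S | `[< exists f, spans g f kap /\ (kap%:R <= kap0%:R + s * n%:R -> f \in BadF kap) >]].
have sub : S \subset \bigcup_(kap < n.+1) Sk kap.
  apply/subsetP => g gS; have [gP [f [kap [sp h]]]] := HS g gS.
  have kn1 : (kap < n.+1)%N.
    have [fC _ _] := sp; move: fC; rewrite in_set => /and3P [_ /eqP <- _].
    by rewrite ltnS -[leqRHS]card_ord max_card.
  by apply/bigcupP; exists (Ordinal kn1) => //; rewrite in_set gS /=; apply/asboolP; exists f.
have each (kap : 'I_n.+1) : #|Sk kap|%:R <= X * expR (- (3 * d / 4) * n%:R).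
  have [S0|/set0Pn [g1]] := eqVneq (Sk kap) set0; first by rewrite S0 cards0 mulr_ge0 // expR_ge0.
  rewrite in_set => /andP [g1S /asboolP [f1 [sp1 _]]].
  have [g1P _] := HS g1 g1S; have [mkap _] := spans_kap g1P sp1.
  have kk : (kap0 <= kap)%N by move: mkap; rewrite -[in X in (X <= _)%N]mk leq_add2l.
  have kn1 : (kap <= n)%N by rewrite -ltnS.
  have kE : (m + kap - n = kap - kap0)%N by rewrite -[in X in (_ - X)%N]mk subnDl.
  have kapE : (kap : nat) = (kap0 + (kap - kap0))%N by rewrite subnKC.
  have kR : (kap - kap0)%:R = kap%:R - kap0%:R :> R by rewrite natrB.
  case: (lerP kap%:R (kap0%:R + s * n%:R : R)) => hk; last first.
    apply: (@le_trans _ _ (X * expR (- d * n%:R))); last first.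
      by rewrite ler_wpM2l // ler_expR ler_wpM2r //; lra.
    apply: le_trans (Hbig n kap kap0 nn1 kk kn1 _); last by rewrite kR; lra.
    rewrite ler_nat; apply: (@planar_kap_count n m kap _ beta b0 n0) => g.
    rewrite in_set => /andP [gS /asboolP [f [sp _]]]; split; first by case: (HS g gS).
    by exists f.
  have /(_ _)/card_supergraphs := _ : forall g, g \in Sk kap -> g \in planar_graphs R n m /\ exists2 f, f \in BadF kap & spans g f kap.
  move=> /(_ _) H; have {}H : (#|Sk kap| <= #|BadF kap| * 'C('C(n, 2), m + kap - n))%N.
    apply: H => g; rewrite in_set => /andP [gS /asboolP [f [sp h]]]; split; first by case: (HS g gS).
    by exists f => //; apply: h.
  set k := (kap - kap0)%N in kE kapE kR *; rewrite kE in H.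
  apply: (@le_trans _ _ (#|BadF kap|%:R * 'C('C(n, 2), k)%:R)); first by rewrite -natrM ler_nat.
  apply: (@le_trans _ _ (Xn R n kap * expR (- d * n%:R) * 'C('C(n, 2), k)%:R)).
    by rewrite ler_wpM2r // hB.
  rewrite mulrAC kapE; apply: (@le_trans _ _ (X * ((C1 * n%:R) ^+ k / k`!%:R) * expR (- d * n%:R))).
    by rewrite ler_wpM2r ?expR_ge0 // Xn_ratio.
  rewrite -mulrA ler_wpM2l //.
  have C1n : 0 <= C1 * n%:R by rewrite mulr_ge0 // ltW.
  apply: (@le_trans _ _ (expR (d / 8 * n%:R) * expR (d / 8 * n%:R) * expR (- d * n%:R))); last first.
    by rewrite -!expRD ler_expR; lra.
  rewrite ler_wpM2r ?expR_ge0 //.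
  have -> : (C1 * n%:R) ^+ k / k`!%:R = si^-1 ^+ k * ((si * (C1 * n%:R)) ^+ k / k`!%:R).
    by rewrite [(si * _) ^+ k]exprMn mulrA mulrA -exprMn mulVf ?gt_eqF // expr1n mul1r.
  apply: ler_pM; rewrite ?exprn_ge0 ?invr_ge0 ?divr_ge0 ?exprn_ge0 ?mulr_ge0 ?(ltW si0) ?(ltW C10) //.
    rewrite siE -expRM_natr ler_expR; have kn2 : k%:R <= s * n%:R by rewrite kR; lra.
    have := ler_wpM2l La0 kn2; have := ler_wpM2r (ltW np) sLa; lra.
  apply: le_trans (pow_fact_expR _ _) _; first by rewrite !mulr_ge0 // ltW.
  by rewrite ler_expR; have := ler_wpM2r (ltW np) sd; lra.
apply: (@le_trans _ _ ((n.+1)%:R * (X * expR (- (3 * d / 4) * n%:R)))).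
  apply: (@le_trans _ _ (\sum_(kap < n.+1) #|Sk kap|%:R)).
    by rewrite -natr_sum ler_nat (leq_trans (subset_leq_card sub)) // card_bigcup_le.
  rewrite -[n.+1 in leRHS]card_ord mulr_natl -sumr_const; apply: ler_sum => kap _; exact: each.
apply: le_trans (ler_wpM2l (expR_ge0 _) PGlb); rewrite mulrCA [leRHS]mulrCA ler_wpM2l // -expRD.
have h := Hexp n nn3; have : n.+1%:R <= expR (3 * d / 16 * n%:R).
  by apply: le_trans h; rewrite -natr1; lra.
move=> /(ler_wpM2r (expR_ge0 (- (3 * d / 4) * n%:R))) /le_trans; apply.
by rewrite -expRD ler_expR; lra.
Qed.
End Transfer.

Lemma mul_chain (R : realType) (d d1 c1 n k : R) : 0 <= d1 -> 0 <= n -> d <= d1 * c1 -> c1 * n <= k -> d * n <= d1 * k.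
Proof.
move=> d0 n0 dc cn; apply: le_trans (ler_wpM2r n0 dc) _.
by rewrite -mulrA ler_wpM2l.
Qed.

Lemma notin_sep (T : finType) (A : {set T}) (P : pred T) x : x \in A -> x \notin [set y in A | P y] -> ~~ P x.
Proof. by move=> xA; rewrite in_set xA. Qed.

Lemma four_le (R : realType) (x : R) : 1 <= x -> 4 <= 2 * (x + 1).
Proof. lra. Qed.

(** * Planar graphs spanned by typical forests *)

Section GoodGraphs.
Variables (R : realType) (k : nat) (E : rel 'I_k) (rH : 'I_k) (l : nat) (par : 'I_k -> 'I_k) (D : 'I_k -> nat).
Hypothesis td : tdata E rH l par D.
Local Notation QT := (qT R E rH l D).
Local Notation QS := (qS R E rH l D).

Section Statement.
Variables (n : nat) (eps : R) (K K' K1 : nat).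
Implicit Types (f : {ffun 'I_n -> 'I_n}).

Definition good_forest f kap :=
  [/\ #|smallv f K|%:R <= (2 + eps) * kap%:R,
      (2 * QT - eps) * kap%:R <= #|[set v in smallv f K | fiso E rH (fadj f) v l]|%:R,
      (QS - eps) * #|~: smallv f K|%:R - eps * n%:R <= #|Mset E rH (fadj f) l K' (~: smallv f K)|%:R &
      (1 - eps) * #|~: smallv f K|%:R - eps * n%:R <= #|smalldsc f K1 (~: smallv f K)|%:R].

Definition good_graph (s : R) kap0 (g : {set {set 'I_n}}) := exists f kap,
  [/\ spans g f kap, kap%:R <= kap0%:R + s * n%:R & good_forest f kap].
End Statement.

(** The tolerance s for extra edges is quantified after K, K' and K1, because the number of balls an
    extra edge spoils depends on these. *)
Lemma good_whp (eps c1 e1 : R) : 0 < eps -> 0 < c1 -> 0 < e1 ->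
  exists K K' K1, [/\ (0 < K)%N, (K1 <= K)%N & forall s, 0 < s -> exists n0, forall n m kap0,
  (n0 <= n)%N -> (m + kap0 = n)%N -> c1 * n%:R <= kap0%:R -> (2 + e1) * kap0%:R <= n%:R ->
  #|[set g in planar_graphs R n m | ~~ `[< good_graph eps K K' K1 s kap0 g >]]|%:R
   <= eps * #|planar_graphs R n m|%:R].
Proof.
move=> e0 c10 e10.
have [K2 HK2] := @small_balls R k E rH l par D td eps e0.
have [K' [K3 HK3]] := @big_balls R k E rH l par D td eps e0.
have [K1 [K4 HK4]] := @big_desc R eps e0.
pose K := (K2 + K3 + K4 + K1).+1.
have [l2 l3 l4 l1] : [/\ (K2 <= K)%N, (K3 <= K)%N, (K4 <= K)%N & (K1 <= K)%N].
  by rewrite /K; split; clear; lia.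
exists K, K', K1; split=> // s0 s00.
have [d1 d10 H1] := @small_mass R eps K e0 (ltn0Sn _).
have [d2 d20 H2] := HK2 K l2; have [d3 d30 H3] := HK3 K l3; have [d4 d40 H4] := HK4 K l4.
pose d := Num.min (Num.min (d1 * c1) (d2 * c1)) (Num.min d3 d4).
have d0 : 0 < d by rewrite !lt_min !mulr_gt0 ?d30 ?d40.
have d2p : 0 < d / 2 by rewrite divr_gt0.
have [s1 s10 Hs] := @transfer R c1 e1 (d / 2) c10 e10 d2p.
pose s := Num.min s0 s1; have sp : 0 < s by rewrite lt_min s00 s10.
have ss1 : s <= s1 by rewrite ge_min lexx orbT.
have [n1 Hn] := Hs s sp ss1.
have [n2 Hexp] := lin_expR d2p.
have d4p : 0 < d / 4 * eps by rewrite mulr_gt0 // divr_gt0.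
pose n3 := Num.bound (d / 4 * eps)^-1.
exists (n1 + n2 + n3 + K).+1 => n m kap0 nn mk kc kn.
have [nn1 nn2 nn3 nnK] : [/\ (n1 <= n)%N, (n2 <= n)%N, (n3 <= n)%N & (K < n)%N].
  by move: nn; clear; move: n1 n2 n3 K => a b c' e nn; split; lia.
have n0 : (0 < n)%N by apply: leq_ltn_trans nnK.
have np : 0 < n%:R :> R by rewrite ltr0n.
pose BadF kap : {set {ffun 'I_n -> 'I_n}} :=
  [set f in CF 'I_n kap | (2 + eps) * kap%:R < #|smallv f K|%:R] :|:
  [set f in CF 'I_n kap | #|[set v in smallv f K | fiso E rH (fadj f) v l]|%:R < (2 * QT - eps) * kap%:R] :|:
  [set f in CF 'I_n kap | #|Mset E rH (fadj f) l K' (~: smallv f K)|%:R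
      < (QS - eps) * #|~: smallv f K|%:R - eps * #|'I_n|%:R] :|:
  [set f in CF 'I_n kap | #|smalldsc f K1 (~: smallv f K)|%:R
      < (1 - eps) * #|~: smallv f K|%:R - eps * #|'I_n|%:R].
have hB kap : (kap0 <= kap)%N -> #|BadF kap|%:R <= Xn R n kap * expR (- (d / 2) * n%:R).
  move=> kk; have kk' : kap0%:R <= kap%:R :> R by rewrite ler_nat.
  have b1 := H1 'I_n kap; have b2 := H2 'I_n kap; have b3 := H3 'I_n kap; have b4 := H4 'I_n kap.
  rewrite card_ord in b1 b2 b3 b4; have {}b2 := b2 nnK.
  have X0 := Xn_ge0 R n kap; set X := Xn R n kap in X0 b1 b2 b3 b4 *.
  have up (x : R) : - x <= - d * n%:R -> X * expR (- x) <= X * expR (- d * n%:R).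
    by move=> h; rewrite ler_wpM2l // ler_expR.
  have dle : [/\ d <= d1 * c1, d <= d2 * c1, d <= d3 & d <= d4].
    by split; rewrite !ge_min lexx ?orbT.
  case: dle => e1' e2' e3' e4'.
  have ck : c1 * n%:R <= kap%:R by apply: le_trans kc kk'.
  have u1 : X * expR (- d1 * kap%:R) <= X * expR (- d * n%:R).
    by rewrite mulNr up // mulNr lerN2; apply: mul_chain e1' ck; apply: ltW.
  have u2 : X * expR (- d2 * kap%:R) <= X * expR (- d * n%:R).
    by rewrite mulNr up // mulNr lerN2; apply: mul_chain e2' ck; apply: ltW.
  have u3 : X * expR (- d3 * n%:R) <= X * expR (- d * n%:R).
    by rewrite mulNr up // mulNr lerN2 ler_wpM2r // ltW.
  have u4 : X * expR (- d4 * n%:R) <= X * expR (- d * n%:R).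
    by rewrite mulNr up // mulNr lerN2 ler_wpM2r // ltW.
  have cu (A B : {set {ffun 'I_n -> 'I_n}}) : #|A :|: B|%:R <= #|A|%:R + #|B|%:R :> R.
    by rewrite -natrD ler_nat leq_card_setU.
  apply: le_trans (cu _ _) _; apply: le_trans (lerD (cu _ _) (lexx _)) _.
  apply: le_trans (lerD (lerD (cu _ _) (lexx _)) (lexx _)) _.
  apply: (@le_trans _ _ (4 * (X * expR (- d * n%:R)))).
    rewrite card_ord; move: b1 b2 b3 b4 u1 u2 u3 u4; clear; lra.
  have -> : expR (- d * n%:R) = expR (- (d / 2) * n%:R) * expR (- (d / 2) * n%:R).
    by rewrite -expRD; congr expR; field.
  set e := expR _; rewrite (_ : 4 * (X * (e * e)) = X * e * (4 * e)); last by clear; ring.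
  rewrite ler_piMr ?(mulr_ge0 X0 (expR_ge0 _)) // /e.
  rewrite mulNr expRN ler_pdivrMr ?expR_gt0 // mul1r; apply: le_trans (Hexp n nn2).
  have : 1 <= n%:R :> R by rewrite ler1n.
  exact: four_le.
set S := [set g in _ | _].
have HS g : g \in S -> g \in planar_graphs R n m /\
   exists f kap, spans g f kap /\ (kap%:R <= kap0%:R + s * n%:R -> f \in BadF kap).
  rewrite in_set => /andP [gP /asboolPn ng]; split=> //.
  have [f [kap sp']] := spans_ex g; exists f, kap; split=> // hk.
  have [fC _ _] := sp'; apply/negPn/negP => nB; apply: ng; exists f, kap; split=> //.
    apply: le_trans hk _; rewrite lerD2l ler_wpM2r // ge_min lexx //.
  move: nB; rewrite /BadF !in_setU !negb_or => /andP [/andP [/andP [b1 b2] b3] b4].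
  have := (notin_sep fC b4); have := (notin_sep fC b3); have := notin_sep fC b2; have := notin_sep fC b1.
  by rewrite -!leNgt card_ord => *; split.
apply: le_trans (Hn n m kap0 nn1 mk kc kn BadF hB S HS) _.
rewrite ler_wpM2r // mulNr expRN -[leRHS]invrK lef_pV2 ?posrE ?expR_gt0 ?invr_gt0 //.
apply: le_trans (_ : 1 + d / 2 / 2 * n%:R <= _); last exact: expR_ge1Dx.
have h : (d / 4 * eps)^-1 <= n%:R.
  apply: le_trans (ltW (archi_boundP _)) _; first by rewrite invr_ge0 ltW.
  by rewrite ler_nat.
move: h; rewrite invfM ler_pdivrMl ?divr_gt0 //; lra.
Qed.

Section Deterministic.
Variables (n : nat) (g : {set {set 'I_n}}) (f : {ffun 'I_n -> 'I_n}) (kap : nat).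
Hypothesis sp : spans g f kap.
Local Notation a := (graph_adj g).

Definition ends : {set 'I_n} := \bigcup_(e in g :\: gr f) e.

Lemma card_ends : simple_graph g -> (#|ends| <= 2 * #|g :\: gr f|)%N.
Proof.
move=> /forall_inP sg; apply: leq_trans (card_bigcup_le _ _) _.
rewrite mulnC -sum_nat_const; apply: leq_sum => e; rewrite in_setD => /andP [_ eg].
by rewrite (eqP (sg e eg)).
Qed.

Lemma adj_ends x y : x \notin ends -> a x y = fadj f x y.
Proof.
move=> xe; have [_ /subsetP fg _] := sp; rewrite -gr_adj /graph_adj; apply/idP/idP => [xy|/fg //].
apply/negPn/negP => nf; case/negP: xe; apply/bigcupP; exists [set x; y]; last by rewrite !inE eqxx.
by rewrite in_setD nf.
Qed.

Lemma spans_acyc : acyc f.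
Proof. by have [fC _ _] := sp; move: fC; rewrite in_set => /andP [/frsP []]. Qed.

Lemma cc_comp v : cc f v = Defs.comp a v.
Proof.
have [_ _ con] := sp; apply/setP => w; rewrite in_cc [RHS]in_set con.
by rewrite eq_sym.
Qed.

(** A ball inside a small tree can be spoiled only if this tree contains an end of an extra edge,
    and each end lies in one tree with at most K vertices. *)
Lemma small_ball_count K :
  (#|[set v in smallv f K | fiso E rH (fadj f) v l]| <= #|[set v in smallv f K | fiso E rH a v l]| + K * #|ends|)%N.
Proof.
have af := spans_acyc.
pose B := [set v in smallv f K | cc f v :&: ends != set0].
have cB : (#|B| <= K * #|ends|)%N.
  apply: (@leq_trans #|\bigcup_(x in ends) [set v in smallv f K | x \in cc f v]|).
    apply: subset_leq_card; apply/subsetP => v; rewrite in_set => /andP [vs /set0Pn [x /setIP [xc xe]]].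
    by apply/bigcupP; exists x; rewrite // in_set vs.
  apply: leq_trans (card_bigcup_le _ _) _; rewrite mulnC -sum_nat_const; apply: leq_sum => x _.
  have [->|/set0Pn [v0]] := eqVneq [set v in smallv f K | x \in cc f v] set0; first by rewrite cards0.
  rewrite in_set => /andP [v0s xv0]; apply: (@leq_trans #|cc f v0|); last by move: v0s; rewrite in_set.
  apply: subset_leq_card; apply/subsetP => v; rewrite in_set => /andP [_].
  by move: xv0; rewrite !in_cc => /eqP -> /eqP ->.
apply: leq_trans (leq_add (leqnn _) cB); apply: leq_trans (leq_card_setU _ _).
apply: subset_leq_card; apply/subsetP => v; rewrite in_set => /andP [vs fi].
rewrite in_setU ![v \in [set _ in _ | _]]in_set vs /=; case: (eqVneq (cc f v :&: ends) set0) => [e0|_]; last by rewrite orbT.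
rewrite orbF; case/existsP: fi => phi H; apply/existsP; exists phi.
apply: (isom_local (X := ends) _ _ H); first by move=> x y xe; rewrite adj_ends.
have vv : v \in cc f v by rewrite in_cc.
have cs := fball_closed l (cc_closed af) vv.
rewrite -setI_eq0 -subset0; apply: (subset_trans (setSI _ cs)); by rewrite e0.
Qed.

Lemma big_ball_count K K' :
  (#|Mset E rH (fadj f) l K' (~: smallv f K)| <= #|[set v in ~: smallv f K | fiso E rH a v l]| + #|ends| * K'.+1 ^ l)%N.
Proof.
apply: leq_trans (@Mset_lip _ k E rH (fadj f) a l K' ends (~: smallv f K) (@fadj_sym _ f) _) _.
  by move=> x y xe; rewrite adj_ends.
rewrite leq_add2r; apply: subset_leq_card; apply/subsetP => v => /setIdP [vs /andP [fi _]].
by rewrite [v \in [set _ in _ | _]]in_set vs fi.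
Qed.
End Deterministic.
End GoodGraphs.

(** * Uniqueness of the giant component *)

Lemma bin2_le n : ('C(n, 2) * 2 <= n * n)%N.
Proof. by rewrite bin2 -divn2; apply: leq_trans (leq_trunc_div _ _) _; rewrite leq_mul2l leq_pred orbT. Qed.

Section Pairs.
Variables (R : realType) (n K : nat).
Local Notation T := 'I_n.
Implicit Types (g : {set {set T}}) (f : {ffun T -> T}) (p : T * T).

Definition bigcomp g : {set T} := [set v | (K < #|Defs.comp (graph_adj g) v|)%N].
(* A pair in [splitpairs g] can be joined by a bridge; [badbridges] is the set of bridges so created. *)
Definition splitpairs g : {set T * T} :=
  [set p | [&& p.1 \in bigcomp g, p.2 \in bigcomp g & ~~ connect (graph_adj g) p.1 p.2]].
Definition badbridges g : {set T * T} :=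
  [set p | ([set p.1; p.2] \in g) && (p \in splitpairs (g :\ [set p.1; p.2]))].

Lemma splitpairs_edge g p : p \in splitpairs g -> [set p.1; p.2] \notin g.
Proof. by rewrite in_set => /and3P [_ _]; apply: contra; apply: connect1. Qed.

Lemma add_bridge_PG m g p : g \in planar_graphs R n m -> p \in splitpairs g ->
  [set p.1; p.2] |: g \in planar_graphs R n m.+1.
Proof.
move=> gP ps; have eg := splitpairs_edge ps; move: gP ps.
rewrite in_set => /and3P [/forall_inP sg /eqP gm /asboolP pg]; rewrite in_set => /and3P [_ _ nc].
rewrite in_set cardsU1 eg gm eqxx /=; apply/andP; split.
  apply/forall_inP => e /setU1P [->|/sg //]; rewrite cards2.
  by case: (eqVneq p.1 p.2) nc => // ->; rewrite connect0.
by apply/asboolP; apply: planar_add_bridge pg nc.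
Qed.

(** For a fixed pair p, adding the edge p is injective on graphs without it, keeps them planar and
    turns p into a bridge with two large sides. *)
Lemma sum_splitpairs m :
  (\sum_(g in planar_graphs R n m) #|splitpairs g| <= \sum_(g in planar_graphs R n m.+1) #|badbridges g|)%N.
Proof.
have ex (A : {set {set {set T}}}) (F : {set {set T}} -> {set T * T}) :
    (\sum_(g in A) #|F g| = \sum_p #|[set g in A | p \in F g]|)%N.
  under eq_bigr => g _ do rewrite -sum1_card big_mkcond /=.
  rewrite exchange_big /=; apply: eq_bigr => p _.
  rewrite -sum1_card -big_mkcondr /=; apply: eq_bigl => g; by rewrite in_set.
rewrite !ex; apply: leq_sum => p _.
rewrite -(@card_in_imset _ _ (fun g => [set p.1; p.2] |: g)); last first.
  move=> g h /setIdP [_ pg] /setIdP [_ ph] E.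
  have eg := splitpairs_edge pg; have eh := splitpairs_edge ph.
  by rewrite -(setU1K eg) E setU1K.
apply: subset_leq_card; apply/subsetP => g' /imsetP [g] /setIdP [gP ps] ->.
apply/setIdP; split; first exact: add_bridge_PG.
by apply/setIdP; rewrite setU11 setU1K // splitpairs_edge.
Qed.

Lemma edge_count m : (#|planar_graphs R n m.+1| * m.+1 <= #|planar_graphs R n m| * 'C(n, 2))%N.
Proof.
have -> : (#|planar_graphs R n m.+1| * m.+1 = \sum_(g in planar_graphs R n m.+1) #|g|)%N.
  rewrite -sum_nat_const; apply: eq_bigr => g; by rewrite in_set => /and3P [_ /eqP].
under eq_bigr => g _ do rewrite -sum1_card big_mkcond /=.
rewrite exchange_big /= (bigID (fun e : {set T} => #|e| == 2%N)) /= [X in (_ + X)%N]big1 ?addn0.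
  have -> : 'C(n, 2) = #|[set e : {set T} | #|e| == 2%N]| by rewrite card_draws card_ord.
  rewrite -sum1_card mulnC big_distrl /= big_set /=; apply: leq_sum => e _.
  rewrite mul1n -big_mkcondr /= -big_set /= sum1_card.
  rewrite -(@card_in_imset _ _ (fun g => g :\ e)); last first.
    move=> g h; rewrite !in_set => /andP [_ eg] /andP [_ eh] E.
    by rewrite -(setD1K eg) E setD1K.
  apply: subset_leq_card; apply/subsetP => g' /imsetP [g]; rewrite in_set => /andP [gP eg] ->.
  move: gP; rewrite in_set => /and3P [/forall_inP sg /eqP gm /asboolP pg].
  rewrite [_ \in planar_graphs _ _ _]in_set; apply/and3P; split.
  - by apply/forall_inP => e' /setD1P [_ /sg].
  - by move: gm; rewrite (cardsD1 e) eg add1n => -[->].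
  - by apply/asboolP; apply: planar_sub pg; apply: subD1set.
move=> e ne; apply: big1 => g; rewrite in_set => /and3P [/forall_inP sg _ _].
by case: ifP => // /sg; rewrite (negPf ne).
Qed.

(** A bridge belongs to every spanning forest. The side of its lower end consists of descendants of
    that end, so two large sides force many descendants. *)
Lemma bridge_dsc g f kap p : spans g f kap -> p \in badbridges g ->
  (f p.1 == p.2) && (K < #|dsc f p.1|)%N || (f p.2 == p.1) && (K < #|dsc f p.2|)%N.
Proof.
move=> sp; have af := spans_acyc sp; have [_ fg con] := sp.
have key x y g' : g' = g :\ [set x; y] -> ~~ connect (graph_adj g') x y -> f x = y -> x != y ->
    (#|Defs.comp (graph_adj g') x| <= #|dsc f x|)%N.
  move=> -> nc fx xy; apply: subset_leq_card; apply/subsetP => z; rewrite in_set => xz.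
  rewrite in_set; apply/negPn/negP => /fconnectP nz; case/negP: nc; apply: connect_trans (xz) _.
  have fxx : f x != x by rewrite fx eq_sym.
  have ac := cut_acyc x af; have nzx i : iter i f z != x by apply/eqP => E; apply: nz; exists i.
  have nyx i : iter i f y != x by rewrite -fx -iterSr; apply: acyc_iter_neq.
  have fz w : (forall i, iter i f w != x) -> froot (upd f x x) w = froot f w.
    by move=> nw; rewrite /froot upd_iter // => j _.
  have : connect (fadj (upd f x x)) z y.
    rewrite connect_froot // fz // fz // -con; apply: connect_trans (connect1 _ : connect _ x y).
      rewrite (connect_sym_of_sym (@graph_adj_sym _ g)); apply: (connect_sub _ xz) => u v.
      move=> uv; apply: connect1; by move: uv; rewrite /graph_adj in_setD1 => /andP [].
    by rewrite /graph_adj (subsetP fg) // gr_adj /fadj xy fx eqxx.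
  apply: connect_sub => u v uv; apply: connect1; rewrite /graph_adj in_setD1; apply/andP; split.
    apply/eqP => E; have : fadj (upd f x x) x y by rewrite -gr_adj -E gr_adj.
    rewrite /fadj xy /= !updE eqxx [y == x]eq_sym (negPf xy) /=.
    by have /= := nyx 1%N; move/negPf ->.
  by apply: (subsetP fg); rewrite (gr_cut fxx) in_setU1 gr_adj uv orbT.
rewrite in_set => /andP [pg]; rewrite in_set => /and3P []; rewrite ![_ \in bigcomp _]in_set => b1 b2 nc.
have : fadj f p.1 p.2.
  rewrite -gr_adj; apply/negPn/negP => nf; case/negP: nc.
  have : connect (fadj f) p.1 p.2 by rewrite connect_froot // -con connect1.
  apply: connect_sub => u v; rewrite -gr_adj => uv; apply: connect1.
  rewrite /graph_adj in_setD1 (subsetP fg) // andbT; apply: contraNneq nf => <- //.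
move=> /andP [ne /orP [] /eqP E]; apply/orP.
  by left; rewrite E eqxx; apply: leq_trans b1 (key _ _ _ _ nc E ne).
right; rewrite E eqxx; apply: leq_trans b2 (key _ _ _ (congr1 _ _) _ E _); rewrite 1?eq_sym //.
  by rewrite setUC.
by rewrite (connect_sym_of_sym (@graph_adj_sym _ _)).
Qed.

Lemma card_badbridges g f kap : spans g f kap ->
  (#|badbridges g| <= 2 * #|[set u | (K < #|dsc f u|)%N]|)%N.
Proof.
move=> sp; set U := [set u | _].
pose A1 : {set T * T} := [set (u, f u) | u in U]; pose A2 : {set T * T} := [set (f u, u) | u in U].
apply: (@leq_trans #|A1 :|: A2|); last first.
  apply: leq_trans (leq_card_setU _ _) _; rewrite mul2n -addnn.
  by apply: leq_add; apply: leq_imset_card.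
apply: subset_leq_card; apply/subsetP => -[x y] /(bridge_dsc sp) /= /orP [] /andP [/eqP <- h];
  apply/setUP; [left|right]; apply/imsetP; [exists x|exists y] => //; by rewrite in_set.
Qed.

Lemma badbridges_crude g f kap : spans g f kap -> (#|badbridges g| <= 2 * n)%N.
Proof.
move=> sp; apply: leq_trans (card_badbridges sp) _; rewrite leq_mul2l /=.
by apply: leq_trans (max_card _) _; rewrite card_ord.
Qed.

End Pairs.

Section Uniqueness.
Variables (R : realType) (k : nat) (E : rel 'I_k) (rH : 'I_k) (l : nat) (par : 'I_k -> 'I_k) (D : 'I_k -> nat).
Hypothesis td : tdata E rH l par D.

Lemma badbridges_good n (eps : R) K K' K1 s kap0 (g : {set {set 'I_n}}) : (K1 <= K)%N -> 0 < eps ->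
  good_graph E rH l D eps K K' K1 s kap0 g -> #|badbridges K g|%:R <= 4 * eps * n%:R.
Proof.
move=> KK e0 [f [kap [sp _ [_ _ _ h]]]]; have af := spans_acyc sp.
have := card_badbridges K sp; set U := [set u | _] => hU.
have UB : U \subset (~: smallv f K) :\: smalldsc f K1 (~: smallv f K).
  apply/subsetP => u; rewrite in_set => uU; apply/setDP; split.
    rewrite in_setC in_set -ltnNge; apply: leq_trans uU _; apply: subset_leq_card.
    by apply/subsetP => x; rewrite in_set in_cc => /fconnectP [i ->]; rewrite froot_iterK.
  by apply/negP => /setIdP [_]; rewrite leqNgt (leq_ltn_trans KK uU).
have := subset_leq_card UB; rewrite cardsD (setIidPr _); last by apply/subsetP => u; rewrite in_set => /andP [].
set B := ~: smallv f K in h * => cU.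
have Bn : #|B|%:R <= n%:R :> R by rewrite ler_nat; apply: leq_trans (max_card _) _; rewrite card_ord.
have sB : (#|smalldsc f K1 B| <= #|B|)%N by apply: subset_leq_card; apply/subsetP => u; rewrite in_set => /andP [].
have h1 : #|U|%:R <= #|B|%:R - #|smalldsc f K1 B|%:R :> R by rewrite -natrB // ler_nat.
have h2 : #|badbridges K g|%:R <= 2 * #|U|%:R :> R by rewrite -natrM ler_nat.
have := ler_wpM2l (ltW e0) Bn; move: h h1 h2; clear; lra.
Qed.

Definition nice n (eps eta : R) K K' K1 s kap0 (g : {set {set 'I_n}}) :=
  good_graph E rH l D eps K K' K1 s kap0 g /\ #|splitpairs K g|%:R <= eta ^+ 2 * n%:R ^+ 2.

(** [good_whp] is used for m and for m + 1 edges, the latter with one tree less, which is why it is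
    called with c1 / 2. Few bridges with two large sides among graphs with m + 1 edges mean few
    splittable pairs among graphs with m edges, since [edge_count] bounds the ratio of the two
    numbers of graphs by n. *)
Lemma nice_whp (eta c1 e1 : R) : 0 < eta -> eta <= 1 -> 0 < c1 -> 0 < e1 -> exists eps K K' K1, [/\ 0 < eps, eps <= eta, (0 < K)%N &
  forall s, 0 < s -> exists n0, forall n m kap0,
  (n0 <= n)%N -> (m + kap0 = n)%N -> c1 * n%:R <= kap0%:R -> (2 + e1) * kap0%:R <= n%:R ->
  #|[set g in planar_graphs R n m | ~~ `[< nice eps eta K K' K1 s kap0 g >]]|%:R
   <= 2 * eta * #|planar_graphs R n m|%:R].
Proof.
(* A graph has at most 6 eps n^2 = eta (eta^2 n^2) splittable pairs on average, so by Markov the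
   bound eta^2 n^2 fails with probability at most eta. *)
move=> t0 t1 c10 e10; pose eps := eta ^+ 3 / 6.
have e0 : 0 < eps by rewrite divr_gt0 // exprn_gt0.
have et : eps <= eta.
  rewrite /eps ler_pdivrMr // exprS ler_wpM2l ?(ltW t0) //.
  by apply: (@le_trans _ _ 1); [rewrite exprn_ile1 // ltW | rewrite ler1n].
have c2 : 0 < c1 / 2 by rewrite divr_gt0.
have [K [K' [K1 [K0 KK Hg]]]] := @good_whp R k E rH l par D td eps (c1 / 2) e1 e0 c2 e10.
exists eps, K, K', K1; split=> // s s0; have [n0 Hn] := Hg s s0.
exists (n0 + (Num.bound (2 / c1)).+2)%N => n m kap0 nn mk kc kn.
have [nn0 nn1] : (n0 <= n)%N /\ ((Num.bound (2 / c1)).+1 <= n)%N.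
  by move: nn; set b := Num.bound _; clear; lia.
have np : 0 < n%:R :> R by rewrite ltr0n (leq_trans _ nn1).
have cn2 : 2 <= c1 * n%:R.
  rewrite mulrC -ler_pdivrMr //; apply: le_trans (ltW (archi_boundP _)) _; first by rewrite divr_ge0 // ltW.
  by rewrite ler_nat ltnW.
have k2 : (1 < kap0)%N by rewrite -(ltr_nat R); lra.
have h1 : (m.+1 + kap0.-1 = n)%N by move: mk k2; clear; lia.
have kE : kap0%:R = kap0.-1%:R + 1 :> R by rewrite natr1 prednK // ltnW.
have g0 := Hn n m kap0 nn0 mk (le_trans _ kc) kn.
have g1 := Hn n m.+1 kap0.-1 nn0 h1 _ _.
have {}g0 : #|[set g in planar_graphs R n m | ~~ `[< good_graph E rH l D eps K K' K1 s kap0 g >]]|%:R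
    <= eps * #|planar_graphs R n m|%:R.
  by apply: g0; rewrite ler_wpM2r ?ltW // ltr_pdivrMr //; lra.
have {}g1 : #|[set g in planar_graphs R n m.+1 | ~~ `[< good_graph E rH l D eps K K' K1 s kap0.-1 g >]]|%:R
    <= eps * #|planar_graphs R n m.+1|%:R.
  apply: g1; first lra.
  by move: kn; rewrite kE; lra.
set PG := planar_graphs R n m in g0 *; set PG1 := planar_graphs R n m.+1 in g1 *.
have S1 : (\sum_(g in PG1) #|badbridges K g|)%:R <= 6 * eps * n%:R * #|PG1|%:R.
  pose Bad := [set g in PG1 | ~~ `[< good_graph E rH l D eps K K' K1 s kap0.-1 g >]].
  rewrite natr_sum (bigID (mem Bad)) /=.
  apply: (@le_trans _ _ (2 * n%:R * #|Bad|%:R + 4 * eps * n%:R * #|PG1|%:R)); last first.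
    have : 2 * n%:R * #|Bad|%:R <= 2 * n%:R * (eps * #|PG1|%:R) :> R by rewrite ler_wpM2l // mulr_ge0 // ltW.
    by clear; lra.
  apply: lerD.
    apply: (@le_trans _ _ (\sum_(g in Bad) (2 * n%:R))); last by rewrite sumr_const -[leLHS]mulr_natr.
    rewrite [leLHS](eq_bigl (mem Bad)) => [|g]; last by rewrite andbC /Bad /= in_set andbAC andbb.
    apply: ler_sum => g _; rewrite -natrM ler_nat.
    by have [f [kap sp]] := spans_ex g; apply: badbridges_crude sp.
  apply: (@le_trans _ _ (\sum_(g in PG1) (4 * eps * n%:R))); last by rewrite sumr_const -[leLHS]mulr_natr.
  rewrite big_mkcondr /=; apply: ler_sum => g gP; case: ifP => [|_]; last by rewrite !mulr_ge0 // ltW.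
  by rewrite in_set gP /= negbK => /asboolP; apply: badbridges_good KK e0.
have S2 : (\sum_(g in PG) #|splitpairs K g|)%:R <= 6 * eps * n%:R ^+ 2 * #|PG|%:R.
  apply: (@le_trans _ _ (\sum_(g in PG1) #|badbridges K g|)%:R); first by rewrite ler_nat sum_splitpairs.
  have q0 : 0 <= 6 * eps * n%:R by rewrite !mulr_ge0 // ltW.
  apply: le_trans S1 _; rewrite [n%:R ^+ 2]expr2 [6 * eps * (_ * _)]mulrA -[leRHS]mulrA.
  apply: (ler_wpM2l q0).
  have := edge_count R n m; rewrite -/PG -/PG1 => hE.
  (* At most n / 2 trees, hence at least n / 2 edges: this turns n^2 / (2 (m + 1)) into at most
     n. *)
  have m4 : (n <= 2 * m.+1)%N.
    have : kap0%:R *+ 2 <= n%:R :> R by have := ler0n R kap0; nra.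
    rewrite -mulr_natl -natrM ler_nat; move: mk; clear; lia.
  have hE' : (#|PG1| * m.+1 * 2 <= #|PG| * (n * n))%N.
    by rewrite (leq_trans (leq_mul hE (leqnn 2))) // -mulnA leq_mul2l bin2_le orbT.
  rewrite -natrM ler_nat -(@leq_pmul2l n); last by rewrite -(ltr0n R).
  apply: leq_trans (_ : #|PG1| * m.+1 * 2 <= _)%N.
    by rewrite -mulnA [(m.+1 * 2)%N]mulnC mulnC leq_mul2l m4 orbT.
  by apply: leq_trans hE' _; rewrite mulnA mulnC leq_mul2l mulnC leqnn orbT.
pose Bad0 := [set g in PG | ~~ `[< good_graph E rH l D eps K K' K1 s kap0 g >]].
pose Bad2 := [set g in PG | eta ^+ 2 * n%:R ^+ 2 < #|splitpairs K g|%:R].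
have S3 : #|Bad2|%:R <= eta * #|PG|%:R.
  have z0 : 0 < eta ^+ 2 * n%:R ^+ 2 by rewrite mulr_gt0 ?exprn_gt0.
  rewrite -(ler_pM2l z0); apply: (@le_trans _ _ (\sum_(g in PG) #|splitpairs K g|)%:R); last first.
    by apply: le_trans S2 _; rewrite le_eqVlt; apply/orP; left; apply/eqP; rewrite /eps; field.
  rewrite natr_sum mulr_natr -sumr_const big_mkcond [leRHS]big_mkcond /=; apply: ler_sum => g _.
  by rewrite in_set; case: (g \in PG) => //=; case: ltP => // /ltW.
apply: (@le_trans _ _ #|Bad0 :|: Bad2|%:R).
  rewrite ler_nat; apply: subset_leq_card; apply/subsetP => g /setIdP [gP /asboolPn nn2].
  apply/setUP; have [gg|ng] := asboolP (good_graph E rH l D eps K K' K1 s kap0 g); last first.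
    by left; apply/setIdP; split=> //; apply/asboolPn.
  right; apply/setIdP; split=> //; rewrite ltNge; apply/negP => h; apply: nn2; split=> //.
apply: (@le_trans _ _ (#|Bad0| + #|Bad2|)%:R); first by rewrite ler_nat leq_card_setU.
rewrite natrD (_ : 2 * eta = eta + eta); last by clear; ring.
rewrite mulrDl; apply: lerD S3; apply: le_trans g0 _; by rewrite ler_wpM2r.
Qed.
End Uniqueness.

(** * Numerical estimates for the component sizes and frequencies *)

Section Numerics.
Variable R : realType.
Implicit Types (h c n k w : R).

(** If A = 0, then also N = 0, so y <= 0 and the convention x / 0 = 0 gives the claim; this covers
    an empty S. *)
Lemma ratio_ge (y N A Bd : R) : 0 <= N -> N <= A -> A <= Bd -> 0 < Bd -> y * Bd <= N -> y <= N / A.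
Proof.
move=> N0 NA AB B0 yN; have yB : y <= N / Bd by rewrite ler_pdivlMr.
apply: le_trans yB _; have [A0|A0] := eqVneq A 0.
  have -> : N = 0 by apply/eqP; rewrite eq_le N0 andbT -A0.
  by rewrite !mul0r.
rewrite ler_wpM2l // lef_pV2 ?posrE // lt0r A0 (le_trans N0) //.
Qed.

(** Notation of these lemmas: k0 = n - m, k the number of components, sm and w the numbers of
    vertices in small and large ones, M the size of the largest, Ns and Nb the numbers of suitable
    centres in small and large ones, u and v bounds for n / w and n / k, h the error parameter. *)
Lemma num_w h c n k0 k sm w : 0 < h -> h <= (c - 1) / 12 -> c < 2 -> 0 < n ->
  k0 <= (1 - c / 2 + h) * n -> k <= k0 + h * n -> sm <= (2 + h) * k -> sm + w = n ->
  (c - 1 - 6 * h) * n <= w.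
Proof.
move=> h0 hc c2 n0 k0n kk smk wn.
have k1 : k <= (1 - c / 2 + 2 * h) * n by lra.
have : (2 + h) * k <= (2 + h) * ((1 - c / 2 + 2 * h) * n) by rewrite ler_wpM2l //; lra.
rewrite mulrA; have : (2 + h) * (1 - c / 2 + 2 * h) * n <= (2 - c + 6 * h) * n; last by lra.
rewrite ler_pM2r //; nra.
Qed.

Lemma num_whole h c n k0 k w QT QS Ns Nb : 0 < h -> 0 < n -> 0 <= QT -> 0 <= QS ->
  (1 - c / 2 - h) * n <= k0 -> k0 <= k -> k <= n -> w <= n -> (c - 1 - 6 * h) * n <= w ->
  (2 * QT - h) * k - h * n <= Ns -> (QS - h) * w - 2 * h * n <= Nb ->
  ((c - 1) * QS + (2 - c) * QT - h * (6 * QS + 2 * QT + 5)) * n <= Ns + Nb.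
Proof.
move=> h0 n0 q0 q1 a1 a2 a3 a4 a5 a6 a7.
have b1 : 2 * QT * ((1 - c / 2 - h) * n) <= 2 * QT * k by rewrite ler_wpM2l ?mulr_ge0 //; lra.
have b2 : QS * ((c - 1 - 6 * h) * n) <= QS * w by rewrite ler_wpM2l.
have b3 : h * k <= h * n by rewrite ler_wpM2l // ltW.
have b4 : h * w <= h * n by rewrite ler_wpM2l // ltW.
lra.
Qed.

(** The product w (w - M) is a lower bound for the number of splittable pairs; as w is of order n,
    almost all vertices of large components lie in the largest one. *)
Lemma num_gap h n w M u : 0 < h -> h <= 1 -> 0 < w -> 0 < n -> 0 < u -> n <= u * w -> w * (w - M) <= h ^+ 2 * n ^+ 2 ->
  w - M <= h * u * n.
Proof.
move=> h0 h1 w0 n0 u0 nw; rewrite mulrC -ler_pdivlMr // => H; apply: le_trans H _.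
rewrite ler_pdivrMr // (_ : h ^+ 2 * n ^+ 2 = (h * n) * (h * n)); last by ring.
rewrite (_ : h * u * n * w = (h * n) * (u * w)); last by ring.
rewrite ler_wpM2l ?mulr_ge0 ?(ltW h0) ?(ltW n0) //; apply: le_trans nw.
by rewrite ler_piMl // ltW.
Qed.

Lemma num_L h n w M QS Nb u : 0 < h -> 0 < w -> 0 < u -> n <= u * w -> w - M <= h * u * n ->
  (QS - h) * w - 2 * h * n <= Nb -> (QS - h * (1 + 2 * u + u * u)) * w <= Nb - (w - M).
Proof.
move=> h0 w0 u0 nw g H.
have h1 : h * n <= h * (u * w) by rewrite ler_wpM2l // ltW.
have : u * (h * n) <= u * (h * (u * w)) by rewrite ler_wpM2l // ltW.
lra.
Qed.

Lemma num_S h n k QT Ns u v : 0 < h -> 0 < n -> 0 <= k -> 0 <= QT -> 0 < u -> 0 < v -> n <= v * k ->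
  (2 * QT - h) * k - h * n <= Ns ->
  (QT - h * ((QT + 1 + (QT * u + 1) * v) / 2)) * ((2 + h) * k + h * u * n) <= Ns.
Proof.
move=> h0 n0 k0 q0 u0 v0 nk H; apply: le_trans H; set C := _ / 2.
have qu : 0 <= QT * u + 1 by rewrite addr_ge0 // mulr_ge0 // ltW.
have C0 : 0 <= C by rewrite divr_ge0 // addr_ge0 ?mulr_ge0 ?(ltW v0) // addr_ge0.
have a2 : h * ((QT * u + 1) * n) <= h * ((QT * u + 1) * (v * k)) by rewrite ler_wpM2l ?(ltW h0) // ler_wpM2l.
have e : 2 * C = QT + 1 + (QT * u + 1) * v by rewrite /C mulrC divfK // pnatr_eq0.
clearbody C; have a1 : 0 <= h * C * (h * k + h * u * n).
  have [hh uu nn] : [/\ 0 <= h, 0 <= u & 0 <= n] by split; apply: ltW.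
  by rewrite !(mulr_ge0, addr_ge0).
have : h * (2 * C) * k = h * (QT + 1 + (QT * u + 1) * v) * k by rewrite e.
move: a1 a2; clear; lra.
Qed.

Lemma pos_sum (a b d e q r : R) : 0 <= a -> 0 <= b -> 0 <= d -> 0 <= e -> 0 <= q -> 0 <= r ->
  0 < 3 * (1 + a + b + d + e + q + r).
Proof. lra. Qed.

Lemma pos_sum_ge (a b d e q r : R) : 0 <= a -> 0 <= b -> 0 <= d -> 0 <= e -> 0 <= q -> 0 <= r ->
  [/\ 3 * (e + a) <= 3 * (1 + a + b + d + e + q + r), 3 * (q + b) <= 3 * (1 + a + b + d + e + q + r) &
      3 * (r + d) <= 3 * (1 + a + b + d + e + q + r)].
Proof. by move=> *; split; lra. Qed.

Lemma num_trees h c x n k0 : 0 < h -> h <= (c - 1) / 12 -> h <= (2 - c) / 8 -> 1 < c -> c < 2 -> 0 < n ->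
  - h < c - x -> c - x < h -> k0 = (1 - x / 2) * n ->
  [/\ (1 - c / 2 - h) * n <= k0, k0 <= (1 - c / 2 + h) * n, (2 - c) / 8 * n <= k0 &
      (2 + (c - 1)) * k0 <= n].
Proof.
move=> h0 h1 h2 c1 c2 n0 x1 x2 ->; have n00 := ltW n0.
split; try by rewrite ler_wpM2r //; lra.
rewrite mulrA -[leRHS]mul1r ler_wpM2r //; apply: (@le_trans _ _ ((1 + c) * (1 - c / 2 + h / 2))); last by nra.
by rewrite (_ : 2 + (c - 1) = 1 + c) ?ler_wpM2l //; lra.
Qed.
End Numerics.

Lemma ball_fball (V : finType) (b : rel V) v l : Defs.ball (fun x y => b x y) v l = [set` fball b v l]%classic.
Proof.
elim: l => [|l IH]; first by apply/seteqP; split=> x /=; rewrite fball0 inE => /eqP.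
rewrite [LHS]/= IH; apply/seteqP; split => y /=.
  by move=> [yb|[x xb bxy]]; apply/fballSP; [left|right; exists x].
by move=> /fballSP [yb|[x xb bxy]]; [left|right; exists x].
Qed.

Lemma ball_iso_fiso (V : finType) (b : rel V) v l k (E : rel 'I_k) rH :
  ball_iso (fun x y => b x y) v l E rH <-> fiso E rH b v l.
Proof.
split=> [[phi [ip pr im ae]]|/existsP [phi /isomP [ip pr im ae]]].
  apply/existsP; exists (finfun phi); apply/isomP; split.
  - by move=> x y; rewrite !ffunE => /ip.
  - by rewrite ffunE.
  - have xE0 x : range phi x <-> Defs.ball (fun x y => b x y) v l x by rewrite im.
    have xE x : range phi x <-> x \in fball b v l by rewrite xE0 ball_fball.
    apply/setP => x; apply/imsetP/idP => [[i _ ->]|/xE [i _ <-]].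
      by rewrite ffunE; apply/xE; exists i.
    by exists i; rewrite ?ffunE ?in_setT.
  - by move=> i j; rewrite !ffunE; apply/idP/idP => /ae.
exists phi; split=> //; last by move=> i j; rewrite ae.
rewrite ball_fball; apply/seteqP; split => x /=.
  by move=> [i _ <-]; rewrite -im imset_f.
by rewrite -im => /imsetP [i _ ->]; exists i.
Qed.

Lemma rooted_prob_closed (R : realType) (V : finType) (b : rel V) (A : {set V}) l k (E : rel 'I_k) rH :
  {in A, forall x y, b x y -> y \in A} ->
  rooted_prob R b A l E rH = #|[set v in A | fiso E rH b v l]|%:R / #|A|%:R.
Proof.
move=> cl; rewrite /rooted_prob; congr (_%:R / _); apply: eq_card => v; rewrite !in_set.
apply: andb_id2l => vA; pose b' : rel V := fun x y => [&& b x y, x \in A & y \in A].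
have -> : `[< ball_iso (fun x y => [&& b x y, x \in A & y \in A]) v l E rH >] = fiso E rH b' v l.
  by apply/asboolP/idP => /(@ball_iso_fiso _ b').
have H1 : {in A, forall x y, b' x y -> y \in A} by move=> x xA y /and3P [].
have H2 x y : x \in A -> b' x y = b x y.
  by move=> xA; rewrite /b' xA /=; case bxy: (b x y); rewrite // (cl _ xA).
by have [-> _] := @closed_fball _ k E rH l b' b A v H1 H2 vA.
Qed.

(** * The largest component and lower bounds for ball frequencies *)

Section Largest.
Variables (n K : nat) (g : {set {set 'I_n}}).
Local Notation a := (graph_adj g).
Local Notation L := (largest_comp a).

Lemma comp_sym : connect_sym a.
Proof. exact: connect_sym_of_sym (@graph_adj_sym _ g). Qed.

Lemma largest_spec : (0 < n)%N -> exists2 v, L = Defs.comp a v & forall x, (#|Defs.comp a x| <= #|L|)%N.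
Proof.
move=> n0; rewrite /largest_comp; case: pickP => [v /forallP H|H]; first by exists v.
have [v _ mv] := @arg_maxnP _ (Ordinal n0) xpredT (fun v => #|Defs.comp a v|) isT.
by have /forallP [] := negbT (H v) => x; apply: mv.
Qed.

Lemma comp_eq u v : connect a u v -> Defs.comp a u = Defs.comp a v.
Proof. by move=> uv; apply/setP => x; rewrite [LHS]in_set [RHS]in_set (same_connect comp_sym uv). Qed.

Lemma largest_closed : {in L, forall x y, a x y -> y \in L} /\ {in ~: L, forall x y, a x y -> y \in ~: L}.
Proof.
have cl x y : a x y -> (x \in L) = (y \in L).
  rewrite /largest_comp; case: pickP => [v _|_] xy; last by rewrite !in_set0.
  rewrite [LHS]in_set [RHS]in_set; by rewrite !(comp_sym v) (same_connect comp_sym (connect1 xy)).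
by split=> x xL y xy; rewrite ?in_setC -(cl x y xy) // -in_setC.
Qed.

Lemma largest_sub_big : (0 < #|bigcomp K g|)%N -> L \subset bigcomp K g.
Proof.
move=> /card_gt0P [b bb]; have n0 : (0 < n)%N := leq_ltn_trans (leq0n _) (ltn_ord b).
have [v Lv mx] := largest_spec n0; apply/subsetP => x; rewrite Lv in_set => /comp_eq E.
by rewrite in_set -E -Lv; apply: leq_trans (mx b); move: bb; rewrite in_set.
Qed.

(** Each vertex of a large component forms a splittable pair with every such vertex outside its own
    component, and the latter has at most [#|L|] vertices. *)
Lemma split_gap : (0 < n)%N -> (#|bigcomp K g| * (#|bigcomp K g| - #|L|) <= #|splitpairs K g|)%N.
Proof.
move=> n0; have [v Lv mx] := largest_spec n0; set B := bigcomp K g.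
rewrite -sum_nat_const; apply: (@leq_trans (\sum_(x in B) #|B :\: Defs.comp a x|)%N).
  apply: leq_sum => x _; rewrite cardsD leq_sub2l //; apply: leq_trans (mx x).
  by apply: subset_leq_card; apply: subsetIr.
under eq_bigr => x _ do rewrite -sum1_card.
rewrite pair_big_dep /= sum1_card; apply: subset_leq_card; apply/subsetP => -[x y] /=.
rewrite -topredE /= => /andP [xB /setDP [yB nc]]; rewrite in_set xB yB /=.
by move: nc; rewrite in_set.
Qed.
End Largest.

Section Lower.
Variables (R : realType) (k : nat) (E : rel 'I_k) (rH : 'I_k) (l : nat) (par : 'I_k -> 'I_k) (D : 'I_k -> nat).
Hypothesis td : tdata E rH l par D.
Local Notation QT := (qT R E rH l D).
Local Notation QS := (qS R E rH l D).

Lemma nice_lower n m kap0 (eps h c s u v : R) K K' K1 (g : {set {set 'I_n}}) :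
  g \in planar_graphs R n m -> (m + kap0 = n)%N -> (0 < n)%N -> nice E rH l D eps h K K' K1 s kap0 g ->
  0 < h -> h <= (c - 1) / 12 -> h <= (2 - c) / 8 -> 1 < c < 2 -> eps <= h -> 0 < s -> s <= h ->
  2 * s * (K + K'.+1 ^ l)%:R <= h -> (1 - c / 2 - h) * n%:R <= kap0%:R -> kap0%:R <= (1 - c / 2 + h) * n%:R ->
  u = 2 / (c - 1) -> v = 8 / (2 - c) ->
  [/\ (c - 1) * QS + (2 - c) * QT - h * (6 * QS + 2 * QT + 5) <= rooted_prob R (graph_adj g) (whole_sel g) l E rH,
      QS - h * (1 + 2 * u + u * u) <= rooted_prob R (graph_adj g) (L_sel g) l E rH &
      QT - h * ((QT + 1 + (QT * u + 1) * v) / 2) <= rooted_prob R (graph_adj g) (S_sel g) l E rH].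
Proof.
move=> gP mk n0 [[f [kap [sp kaps [F1' F2' F3' _]]]] Dg] h0 h1 h2 /andP [c1 c2] eh s0 sh sK k0l k0u ue ve.
set a := graph_adj g; have [kapm eg] := spans_kap gP sp.
have np : 0 < n%:R :> R by rewrite ltr0n.
have sg : simple_graph g by move: gP; rewrite in_set => /and3P [].
have big : bigcomp K g = ~: smallv f K.
  by apply/setP => x; rewrite in_set in_setC in_set (cc_comp sp) ltnNge.
have kk : kap0%:R <= kap%:R :> R by rewrite ler_nat; move: kapm mk; clear; lia.
have kap_n : (kap <= n)%N.
  have [fC _ _] := sp; move: (card_gr_CF fC); by clear; lia.
have kn : kap%:R <= n%:R :> R by rewrite ler_nat.
have ee : #|ends g f|%:R <= 2 * s * n%:R.
  apply: (@le_trans _ _ (2 * (kap%:R - kap0%:R))).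
    rewrite -natrB; last by rewrite -(ler_nat R).
    rewrite -natrM ler_nat; apply: leq_trans (card_ends f sg) _; rewrite eg -mk.
    by rewrite leq_mul2l /=; clear; lia.
  by rewrite -mulrA ler_wpM2l //; lra.
have ka : kap%:R <= kap0%:R + h * n%:R.
  by apply: le_trans kaps _; rewrite lerD2l ler_wpM2r // ltW.
have sm : #|smallv f K|%:R <= (2 + h) * kap%:R.
  by apply: le_trans F1' _; rewrite ler_wpM2r // lerD2l.
have kee : (K + K'.+1 ^ l)%:R * #|ends g f|%:R <= h * n%:R.
  apply: (@le_trans _ _ ((K + K'.+1 ^ l)%:R * (2 * s * n%:R))); first by rewrite ler_wpM2l.
  by rewrite mulrA ler_wpM2r ?(ltW np) // mulrC.
set w := #|bigcomp K g|; set M := #|largest_comp a|.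
set Ns := #|[set x in smallv f K | fiso E rH a x l]|.
set Nb := #|[set x in ~: smallv f K | fiso E rH a x l]|.
have hs := small_ball_count E rH l sp K.
have hb := big_ball_count E rH l sp K K'.
have kee1 : (K * #|ends g f|)%:R + (#|ends g f| * K'.+1 ^ l)%:R <= h * n%:R.
  by rewrite -natrD [(#|_| * _)%N]mulnC -mulnDl natrM.
have Ns_lb : (2 * QT - h) * kap%:R - h * n%:R <= Ns%:R.
  have t1 : (2 * QT - h) * kap%:R <= (2 * QT - eps) * kap%:R by rewrite ler_wpM2r // lerD2l lerN2.
  have t2 : #|[set x in smallv f K | fiso E rH (fadj f) x l]|%:R <= Ns%:R + (K * #|ends g f|)%:R :> R.
    by rewrite -natrD ler_nat.
  have := ler0n R (#|ends g f| * K'.+1 ^ l); move: t1 t2 F2' kee1; clear.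
  set x1 := _%:R; set x2 := _%:R; set x3 := _%:R; lra.
have wE : w = #|~: smallv f K| by rewrite /w big.
have Nb_lb : (QS - h) * w%:R - 2 * h * n%:R <= Nb%:R.
  have t1 : (QS - h) * w%:R <= (QS - eps) * #|~: smallv f K|%:R by rewrite wE ler_wpM2r // lerD2l lerN2.
  have t2 : #|Mset E rH (fadj f) l K' (~: smallv f K)|%:R <= Nb%:R + (#|ends g f| * K'.+1 ^ l)%:R :> R.
    by rewrite -natrD ler_nat.
  have t3 : eps * n%:R <= h * n%:R by rewrite ler_wpM2r // ltW.
  have := ler0n R (K * #|ends g f|); move: t1 t2 t3 F3' kee1; clear; lra.
have swn : #|smallv f K|%:R + w%:R = n%:R :> R by rewrite wE -natrD cardsC card_ord.
have w_lb := num_w h0 h1 c2 np k0u ka sm swn.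
have c10 : 0 < c - 1 by rewrite subr_gt0.
have c20 : 0 < 2 - c by rewrite subr_gt0.
have u0 : 0 < u by rewrite ue divr_gt0.
have v0 : 0 < v by rewrite ve divr_gt0.
have nw : n%:R <= u * w%:R.
  rewrite ue mulrAC ler_pdivlMr // [2 * _]mulrC -ler_pdivrMr // -mulrA mulrC.
  by apply: le_trans w_lb; rewrite ler_wpM2r ?(ltW np) //; lra.
have wp : 0 < w%:R :> R by move: (lt_le_trans np nw); rewrite pmulr_rgt0.
have w0 : (0 < w)%N by rewrite -(ltr0n R).
have wn : w%:R <= n%:R :> R by rewrite -swn lerDr.
have nv : n%:R <= v * kap%:R.
  rewrite ve mulrAC ler_pdivlMr // [8 * _]mulrC -ler_pdivrMr // -mulrA mulrC.
  apply: le_trans kk; apply: le_trans k0l; rewrite ler_wpM2r ?(ltW np) //; lra.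
have Lb := largest_sub_big w0; have Mw : (M <= w)%N := subset_leq_card Lb.
have gap : w%:R - M%:R <= h * u * n%:R.
  apply: num_gap nw _ => //; first lra.
  rewrite -natrB // -natrM; apply: le_trans Dg; rewrite ler_nat; exact: split_gap.
have [clL clS] := largest_closed g.
split.
- rewrite rooted_prob_closed; last by move=> x _ y _; rewrite in_setT.
  rewrite cardsT card_ord ler_pdivlMr //.
  apply: le_trans (num_whole h0 np (qT_ge0 _ _ _ _ _) (qS_ge0 _ _ _ _ _) k0l kk kn wn w_lb Ns_lb Nb_lb) _.
  rewrite -natrD ler_nat -(cardsID (smallv f K) [set _ in _ | _]); apply: leq_add; apply: subset_leq_card.
    by apply/subsetP => x /setIdP [xs xf]; apply/setIP; split=> //; apply/setIdP; rewrite in_setT.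
  by apply/subsetP => x /setIdP [xs xf]; apply/setDP; rewrite -in_setC; split=> //; apply/setIdP; rewrite in_setT.
- rewrite rooted_prob_closed //.
  apply: (@ratio_ge _ _ _ _ w%:R); rewrite ?ler_nat //.
    by apply: subset_leq_card; apply/subsetP => x /setIdP [].
  apply: le_trans (num_L h0 wp u0 nw gap Nb_lb) _; rewrite lerBlDr -natrB // -natrD ler_nat.
  have -> : (w - M = #|bigcomp K g :\: largest_comp a|)%N by rewrite cardsD (setIidPr Lb).
  apply: leq_trans (leq_card_setU _ _).1; apply: subset_leq_card; apply/subsetP => x /setIdP [xb xf].
  apply/setUP; case xL: (x \in largest_comp a); first by left; apply/setIdP.
  by right; apply/setDP; rewrite big xL.
- rewrite rooted_prob_closed //.
  apply: (@ratio_ge _ _ _ _ ((2 + h) * kap%:R + h * u * n%:R)).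
  + by [].
  + by rewrite ler_nat; apply: subset_leq_card; apply/subsetP => x /setIdP [].
  + have -> : #|S_sel g|%:R = n%:R - M%:R :> R.
      by apply/eqP; rewrite eq_sym subr_eq -natrD addnC cardsC card_ord.
    by move: gap sm swn; clear; lra.
  + rewrite ltr_wpDl ?mulr_gt0 // mulr_ge0 // addr_ge0 // ltW //.
  + have k00 : 0 <= kap%:R :> R by [].
    apply: le_trans (num_S h0 np k00 (qT_ge0 _ _ _ _ _) u0 v0 nv Ns_lb) _.
    rewrite ler_nat; apply: subset_leq_card; apply/subsetP => x /setIdP [xs xf].
    apply/setIdP; split=> //; rewrite in_setC; apply: contraL xs => /(subsetP Lb).
    by rewrite big in_setC.
Qed.

Lemma rooted_prob_ge0 (T : finType) (a : rel T) A : 0 <= rooted_prob R a A l E rH.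
Proof. by rewrite divr_ge0. Qed.

Lemma average_ge n m sel (y h : R) (Q : pred {set {set 'I_n}}) : (0 < #|planar_graphs R n m|)%N -> 0 < h ->
  #|[set g in planar_graphs R n m | ~~ Q g]|%:R <= 2 * h * #|planar_graphs R n m|%:R ->
  (forall g, g \in planar_graphs R n m -> Q g -> y <= rooted_prob R (graph_adj g) (sel g) l E rH) ->
  y - 2 * h * `|y| <= planar_ball_prob R m sel l E rH.
Proof.
set PG := planar_graphs R n m => P0 h0 hQ hy; have Pp : 0 < #|PG|%:R :> R by rewrite ltr0n.
rewrite ler_pdivlMr //.
apply: (@le_trans _ _ (\sum_(g in PG) (y - `|y| * (~~ Q g)%:R))).
  rewrite sumrB sumr_const -mulr_sumr -[y *+ _]mulr_natr mulrBl lerD2l lerN2.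
  have -> : \sum_(g in PG) (~~ Q g)%:R = #|[set g in PG | ~~ Q g]|%:R :> R.
    rewrite -natr_sum; congr _%:R; rewrite -sum1_card [RHS](eq_bigl (fun g => (g \in PG) && ~~ Q g)).
      by rewrite big_mkcondr /=; apply: eq_bigr => g _; case: (Q g).
    by move=> g; rewrite in_set.
  by have := ler_wpM2l (normr_ge0 y) hQ; rewrite (_ : `|y| * (_ * _) = 2 * h * `|y| * #|PG|%:R) //; ring.
apply: ler_sum => g gP; case Qg: (Q g); first by rewrite mulr0 subr0; apply: hy.
rewrite mulr1; apply: le_trans (rooted_prob_ge0 _ _); by rewrite subr_le0 ler_norm.
Qed.

Lemma planar_lower (c : R) (m : nat -> nat) (e : R) : 1 < c < 2 ->
  ((fun n : nat => (2 * m n)%:R / n%:R : R) @ \oo --> c)%classic -> 0 < e ->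
  exists n0, forall n, (n0 <= n)%N ->
  [/\ (0 < #|planar_graphs R n (m n)|)%N,
      (c - 1) * QS + (2 - c) * QT - e <= planar_ball_prob R (m n) (@whole_sel n) l E rH,
      QS - e <= planar_ball_prob R (m n) (@L_sel n) l E rH &
      QT - e <= planar_ball_prob R (m n) (@S_sel n) l E rH].
Proof.
move=> c12 cm e0; have /andP [c1 c2] := c12.
have [u ue] : exists u : R, u = 2 / (c - 1) by eexists.
have [v ve] : exists v : R, v = 8 / (2 - c) by eexists.
have c10 : 0 < c - 1 by rewrite subr_gt0.
have c20 : 0 < 2 - c by rewrite subr_gt0.
have u0 : 0 < u by rewrite ue divr_gt0.
have v0 : 0 < v by rewrite ve divr_gt0.
have q0 := qT_ge0 R E rH l D; have q1 := qS_ge0 R E rH l D.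
pose C1 := 6 * QS + 2 * QT + 5; pose C2 := 1 + 2 * u + u * u; pose C3 := (QT + 1 + (QT * u + 1) * v) / 2.
pose y0 := (c - 1) * QS + (2 - c) * QT.
have C10 : 0 <= C1 by rewrite !(addr_ge0, mulr_ge0).
have u00 := ltW u0; have v00 := ltW v0.
have C20 : 0 <= C2 by rewrite !(addr_ge0, mulr_ge0) // ltW.
have C30 : 0 <= C3 by rewrite divr_ge0 // !(addr_ge0, mulr_ge0) // ltW.
have y00 : 0 <= y0 by rewrite addr_ge0 // mulr_ge0 // ltW.
(* The factor 3 covers the loss h Cy of [nice_lower] together with the loss 2 h (y + Cy) that bad
   graphs cause in the average. *)
pose C := 3 * (1 + C1 + C2 + C3 + y0 + QS + QT).
have Cp : 0 < C by apply: pos_sum.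
have [CE1 CE2 CE3] := pos_sum_ge C10 C20 C30 y00 q1 q0.
pose h := Num.min (Num.min ((c - 1) / 12) ((2 - c) / 8)) (e / C).
have h0 : 0 < h by rewrite !lt_min !divr_gt0.
have [h1 h2 h3] : [/\ h <= (c - 1) / 12, h <= (2 - c) / 8 & h <= e / C].
  by split; rewrite !ge_min lexx ?orbT.
have hC : h * C <= e by rewrite -ler_pdivlMr.
have hle1 : h <= 1 by move: h1 c2; clear; lra.
have cc1 : 0 < (2 - c) / 8 by rewrite divr_gt0.
have [eps [K [K' [K1 [ep ephi K0 Hn]]]]] := nice_whp td h0 hle1 cc1 c10.
pose KK := (K + K'.+1 ^ l)%:R : R.
have KKp : 0 < KK by rewrite ltr0n addn_gt0 K0.
pose s := h / (2 * KK + 1).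
have dp : 0 < 2 * KK + 1 by rewrite ltr_wpDl // mulr_ge0 // ltW.
have s0 : 0 < s by rewrite divr_gt0.
have sK : s * (2 * KK + 1) = h by rewrite divfK // gt_eqF.
have sh : s <= h by rewrite ler_pdivrMr // ler_peMr ?(ltW h0) // lerDr mulr_ge0 // ltW.
have [n1 {}Hn] := Hn s s0.
have [n2 HCF] := @CF_lb R (c - 1) 1 ((2 - c) / 8) c10 ltr01 cc1.
have [n3 Hc] : exists n3, forall n, (n3 <= n)%N -> `|c - (2 * m n)%:R / n%:R| < h.
  move/cvgrPdist_lt: cm => /(_ h h0) [n3 _ H]; by exists n3 => n nn; apply: H.
exists (n1 + n2 + n3).+1 => n nn.
have [nn1 nn2 nn3 n0] : [/\ (n1 <= n)%N, (n2 <= n)%N, (n3 <= n)%N & (0 < n)%N].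
  by move: nn; clear; move=> nn; split; lia.
have np : 0 < n%:R :> R by rewrite ltr0n.
have := Hc n nn3; rewrite ltr_norml => /andP [].
set x := (2 * m n)%:R / n%:R => x1 x2.
have xE : 2 * (m n)%:R = x * n%:R by rewrite /x divfK ?gt_eqF // natrM.
have mn : (m n <= n)%N.
  rewrite -(ler_nat R) -(@ler_pM2l _ 2) // xE ler_wpM2r ?(ltW np) //; lra.
pose kap0 := (n - m n)%N; have mk : (m n + kap0 = n)%N by rewrite subnKC.
have kE : kap0%:R = (1 - x / 2) * n%:R.
  by rewrite natrB //; lra.
have [kl ku kc kn] := num_trees h0 h1 h2 c1 c2 np x1 x2 kE.
have PG0 : (0 < #|planar_graphs R n (m n)|)%N.
  apply: leq_trans (planar_graphs_ge R mk); rewrite -(ltr0n R).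
  have := HCF 'I_n kap0; rewrite card_ord => /(_ nn2 kc kn); apply: lt_le_trans.
  by rewrite mulr_gt0 ?expR_gt0 // divr_gt0 ?ltr0n ?fact_gt0 // !mulr_gt0 ?exprn_gt0 ?ex_gt0 ?ltr0n ?fact_gt0.
have bad := Hn n (m n) kap0 nn1 mk kc kn.
have ok g : g \in planar_graphs R n (m n) -> `[< nice E rH l D eps h K K' K1 s kap0 g >] -> _ :=
  fun gP H => @nice_lower n (m n) kap0 eps h c s u v K K' K1 g gP mk n0 (elimT (asboolP _) H) h0 h1 h2 c12 ephi s0 sh _ kl ku ue ve.
have sK2 : 2 * s * (K + K'.+1 ^ l)%:R <= h.
  by rewrite -/KK -[leRHS]sK mulrDr mulr1 [2 * s]mulrC -mulrA lerDl ltW.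
have fin (y Cy : R) : 0 <= y -> 0 <= Cy -> 3 * (y + Cy) <= C -> y - e <= (y - h * Cy) - 2 * h * `|y - h * Cy|.
  move=> y0' Cy0 yC; have : `|y - h * Cy| <= y + Cy.
    apply: le_trans (ler_normB _ _) _; rewrite !ger0_norm ?mulr_ge0 ?(ltW h0) // lerD2l.
    by rewrite ler_piMl.
  move=> hn; have := ler_wpM2l (ltW h0) hn; have := ler_wpM2l (ltW h0) yC; have := mulr_ge0 (ltW h0) y0'.
  by move: hC; clear; lra.
split=> //.
- apply: le_trans (fin y0 C1 y00 C10 CE1) _.
  by apply: average_ge bad _ => // g gP Q; have [] := ok sK2 g gP Q.
- apply: le_trans (fin QS C2 q1 C20 CE2) _.
  by apply: average_ge bad _ => // g gP Q; have [] := ok sK2 g gP Q.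
- apply: le_trans (fin QT C3 q0 C30 CE3) _.
  by apply: average_ge bad _ => // g gP Q; have [] := ok sK2 g gP Q.
Qed.
End Lower.

(** * The limiting trees *)

Notation vert := (nat * seq nat)%type.

Section NatTrees.
Local Open Scope nat_scope.

Definition vroot : vert := (0, [::]).
(** A vertex (t, u) is the word u in the t-th bush. Its parent drops the last letter ([belast a u]
    is the word [a :: u] without it), and the root of a bush has the preceding bush root as parent,
    [vroot] being its own. *)
Definition vpar (v : vert) : vert :=
  if v.2 is a :: u then (v.1, belast a u) else (v.1.-1, [::]).
Definition vdep (v : vert) := v.1 + size v.2.
(* The flag [sk] tells the skeleton tree ([true]) from its first bush alone, the Galton-Watson tree ([false]). *)
Definition alive (sk : bool) (xs : nat -> seq nat -> nat) (v : vert) :=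
  (sk || (v.1 == 0)) && in_tree (xs v.1) [::] v.2.
Definition vadj sk xs : rel vert := fun p q =>
  [&& alive sk xs p, alive sk xs q & ((q != vroot) && (vpar q == p)) || ((p != vroot) && (vpar p == q))].

Lemma in_tree_rcons x pre u a : in_tree x pre (rcons u a) = in_tree x pre u && (a < x (pre ++ u)).
Proof.
elim: u pre => [|b u IH] pre /=; first by rewrite cats0 andbT.
by rewrite IH cat_rcons andbA.
Qed.

Lemma vpar_rcons t u a : vpar (t, rcons u a) = (t, u).
Proof. by case: u => [|b u] //=; rewrite /vpar /= belast_rcons. Qed.

Lemma vdep_par v : v != vroot -> vdep v = (vdep (vpar v)).+1.
Proof.
case: v => t u; case/lastP: u => [|u a]; last by rewrite vpar_rcons /vdep /= size_rcons addnS.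
by case: t => [|t]; rewrite /vdep ?eqxx //= !addn0.
Qed.

Lemma vdep0 v : (vdep v == 0) = (v == vroot).
Proof. by case: v => -[|t] [|a u]. Qed.

Section Tree.
Variables (sk : bool) (xs : nat -> seq nat -> nat).
Local Notation alive := (alive sk xs).
Local Notation adj := (vadj sk xs).

Lemma alive_root : alive vroot. Proof. by rewrite /alive /= orbT. Qed.

Lemma alive_par v : alive v -> alive (vpar v).
Proof.
case: v => t u; case/lastP: u => [|u a].
  by rewrite /alive /= !andbT => /orP [->|/eqP ->]; rewrite ?orbT.
by rewrite vpar_rcons /alive /= in_tree_rcons => /andP [-> /andP [-> _]].
Qed.

Lemma vballE l v : Defs.ball (fun p q => adj p q) vroot l v <-> alive v && (vdep v <= l).
Proof.
elim: l v => [|l IH] v /=.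
  rewrite leqn0 vdep0; split=> [->|/andP [_ /eqP //]]; by rewrite alive_root eqxx.
split=> [[/IH /andP [-> h]|[x /IH /andP [ax dx] /and3P [_ -> /orP [] /andP [nr /eqP e]]]]|/andP [av]].
- by rewrite ltnW.
- by rewrite (vdep_par nr) e.
- by move: dx; rewrite (vdep_par nr) e => /ltnW /leqW.
rewrite leq_eqVlt => /orP [/eqP dv|dv]; last by left; apply/IH; rewrite av.
have nr : v != vroot by rewrite -vdep0 dv.
right; exists (vpar v).
  by apply/IH; rewrite alive_par //= -ltnS -(vdep_par nr) dv.
by rewrite /vadj av alive_par //= nr eqxx.
Qed.

(** Pulling parents and depths back along the isomorphism: only trees occur as balls of the
    limits. *)
Lemma tdata_of_iso k (E : rel 'I_k) rH l : ball_iso (fun p q => adj p q) vroot l E rH ->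
  exists par D, tdata E rH l par D.
Proof.
move=> [f [fi fr im ae]].
have inb i : alive (f i) && (vdep (f i) <= l) by apply/vballE; rewrite -im; exists i.
have hp i : exists j, f j = vpar (f i).
  suff : range f (vpar (f i)) by move=> [j _ e]; exists j.
  rewrite im; apply/vballE; have /andP [a d] := inb i; rewrite alive_par //=; apply: leq_trans d.
  by have [->|/vdep_par ->] := eqVneq (f i) vroot.
have [par parE] := choice hp; exists par, (fun i => vdep (f i)).
have rE i : (f i != vroot) = (i != rH) by rewrite -fr (inj_eq fi).
split.
- by rewrite fr.
- by apply: fi; rewrite parE fr.
- by move=> i ni; rewrite parE; apply: vdep_par; rewrite rE.
- by move=> i; have /andP [] := inb i.
- move=> i j; have -> : E i j = adj (f i) (f j) by apply/idP/idP => /ae.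
  have /andP [ai _] := inb i; have /andP [aj _] := inb j.
  by rewrite /vadj ai aj !rE -!parE !(inj_eq fi) orbC.
Qed.

Section Iso.
Variables (k : nat) (E : rel 'I_k) (rH : 'I_k) (l : nat) (par : 'I_k -> 'I_k) (D : 'I_k -> nat).
Hypothesis td : tdata E rH l par D.
Variable f : 'I_k -> vert.
Hypotheses (fi : injective f) (fr : f rH = vroot) (im : range f = Defs.ball (fun p q => adj p q) vroot l)
  (ae : forall i j, E i j <-> adj (f i) (f j)).

Lemma iso_ball i : alive (f i) /\ vdep (f i) <= l.
Proof. by apply/andP/vballE; rewrite -im; exists i. Qed.

Lemma iso_onto v : alive v -> vdep v <= l -> exists i, f i = v.
Proof.
move=> av dv; suff : range f v by move=> [i _ <-]; exists i.
by rewrite im; apply/vballE; rewrite av.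
Qed.

Lemma iso_root i : (f i == vroot) = (i == rH). Proof. by rewrite -fr (inj_eq fi). Qed.

Lemma iso_par i : f (par i) = vpar (f i).
Proof.
have [D0 pr Dp _ EE] := td; have [n] := ubnP (D i); elim: n i => // n IH i; rewrite ltnS => Di.
have [->|ni] := eqVneq i rH; first by rewrite pr fr.
have : E i (par i) by rewrite EE ni eqxx.
move=> /ae /and3P [_ _ /orP [] /andP [nr /eqP e] //].
rewrite iso_root in nr; have Dj : D (par i) < n by rewrite -(Dp i ni).
move: e; rewrite -IH // => /fi e; have := Dp _ nr; rewrite e.
by have := Dp i ni => -> /eqP; rewrite -[X in X == _]addn0 -addn2 eqn_add2l.
Qed.

Lemma iso_dep i : vdep (f i) = D i.
Proof.
have [D0 pr Dp _ _] := td; have [n] := ubnP (D i); elim: n i => // n IH i; rewrite ltnS => Di.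
have [->|ni] := eqVneq i rH; first by rewrite fr D0.
have e := iso_par i; rewrite vdep_par; last by rewrite iso_root.
by rewrite -e IH -?(Dp i ni).
Qed.
End Iso.
End Tree.

Lemma skel_adjE xs : skel_adj xs = (fun p q => vadj true xs p q).
Proof.
apply/funext => -[t u]; apply/funext => -[t' u']; apply/propext.
rewrite /skel_adj /vadj /Defs.tree_adj /alive /=; split.
  case=> [[<- [-> -> [a [] ->]]]|[-> -> [] ->]] /=.
  - rewrite vpar_rcons eqxx andbT; case: u => [|b u] //=; by rewrite -pair_eqE /= /pair_eq andbF.
  - rewrite vpar_rcons eqxx andbT orbC; case: u' => [|b u'] //=; by rewrite -pair_eqE /= /pair_eq andbF.
  - by rewrite /vpar /= eqxx.
  - by rewrite /vpar /= eqxx orbT.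
move=> /and3P [iu iu' /orP [] /andP [nr /eqP]].
  case/lastP: u' nr iu' => [|u' a] nr iu'; last by rewrite vpar_rcons => -[e1 e2]; left; subst; split=> //; split=> //; exists a; left.
  by move=> [<- <-]; right; split=> //; left; case: t' nr iu'.
case/lastP: u nr iu => [|u a] nr iu; last by rewrite vpar_rcons => -[e1 e2]; left; subst; split=> //; split=> //; exists a; right.
by move=> [<- <-]; right; split=> //; right; case: t nr iu.
Qed.

Lemma tree_adjE xs u v : tree_adj (xs 0) u v <-> vadj false xs (0, u) (0, v).
Proof.
rewrite /vadj /tree_adj /alive /=; split.
  move=> [-> -> [a [] ->]]; rewrite vpar_rcons eqxx ?andbT.
    by case: u.
  by rewrite orbC; case: v.
move=> /and3P [iu iv /orP [] /andP [nr /eqP]].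
  case/lastP: v nr iv => [|v a] nr iv; first by rewrite eqxx in nr.
  rewrite vpar_rcons => /(congr1 snd) /= <-.
  move: iv; rewrite in_tree_rcons => /andP [iv h]; apply: And3; rewrite ?in_tree_rcons ?iv //.
  by exists a; left.
case/lastP: u nr iu => [|u a] nr iu; first by rewrite eqxx in nr.
rewrite vpar_rcons => /(congr1 snd) /= <-.
move: iu; rewrite in_tree_rcons => /andP [iu h]; apply: And3; rewrite ?in_tree_rcons ?iu //.
by exists a; right.
Qed.

Lemma tree_ball_iso xs k (E : rel 'I_k) rH l :
  ball_iso (tree_adj (xs 0)) [::] l E rH <-> ball_iso (fun p q => vadj false xs p q) vroot l E rH.
Proof.
have first v : alive false xs v -> v = (0, v.2) by case: v => t u /andP [/eqP /= -> _].
have B i u : Defs.ball (tree_adj (xs 0)) [::] i u <-> Defs.ball (fun p q => vadj false xs p q) vroot i (0, u).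
  elim: i u => [|i IH] u /=; first by split=> [->|[]].
  split=> [[/IH ?|[x /IH xB /tree_adjE a]]|[/IH ?|[[t x] xB a]]]; try by left.
    by right; exists (0, x).
  right; exists x; move: xB a; first by move=> xB /and3P [/first [t0] _ _]; apply/IH; rewrite -t0.
  by move=> _ a; have /and3P [/first [t0] _ _] := a; apply/tree_adjE; subst t.
split=> [[f [fi fr im ae]]|[f [fi fr im ae]]].
  exists (fun i => (0, f i)); split.
  - by move=> i j [] /fi.
  - by rewrite fr.
  - apply/seteqP; split=> [_ [i _ <-]|v vB]; first by apply/B; rewrite -im; exists i.
    have /andP [/first e _] := (vballE _ _ _ _).1 vB; rewrite e in vB *.
    by move/B: vB; rewrite -im => -[i _ <-]; exists i.
  - by move=> i j; rewrite ae tree_adjE.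
have f0 i : f i = (0, (f i).2) by have [/first] := iso_ball im i.
exists (fun i => (f i).2); split.
- by move=> i j e; apply: fi; rewrite f0 e -f0.
- by rewrite fr.
- apply/seteqP; split=> [_ [i _ <-]|u /B]; first by apply/B; rewrite -f0 -im; exists i.
  by rewrite -im => -[i _ e]; exists i; rewrite // e.
- by move=> i j; rewrite ae tree_adjE -!f0.
Qed.

(** * Finite balls and their isomorphism types *)

Section Codes.

Definition code_iso k (E : rel 'I_k) rH k' (E' : rel 'I_k') rH' :=
  exists h h', [/\ cancel h h', cancel h' h, h rH = rH' & forall i j, E i j = E' (h i) (h j)].

Lemma ball_iso_trans (V : Type) (adj : V -> V -> Prop) r l k (E : rel 'I_k) rH k' (E' : rel 'I_k') rH' :
  code_iso E rH E' rH' -> ball_iso adj r l E rH -> ball_iso adj r l E' rH'.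
Proof.
move=> [h [h' [hK hK' hr hE]]] [f [fi fr im ae]]; exists (f \o h'); split=> /=.
- exact: inj_comp fi (can_inj hK').
- by rewrite -hr /= hK.
- rewrite -im; apply/seteqP; split=> [_ [i _ <-]|_ [i _ <-]]; first by exists (h' i).
  by exists (h i); rewrite //= hK.
- by move=> i j; rewrite -ae hE !hK'.
Qed.

Lemma ball_iso_unique (V : Type) (adj : V -> V -> Prop) r l k (E : rel 'I_k) rH k' (E' : rel 'I_k') rH' :
  ball_iso adj r l E rH -> ball_iso adj r l E' rH' -> code_iso E rH E' rH'.
Proof.
move=> [f [fi fr im ae]] [f' [fi' fr' im' ae']].
have H i : exists j, f' j = f i.
  by have : range f' (f i) by [rewrite im' -im; exists i]; move=> [j _ e]; exists j.
have H' i : exists j, f j = f' i.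
  by have : range f (f' i) by [rewrite im -im'; exists i]; move=> [j _ e]; exists j.
have [h hE] := choice H; have [h' hE'] := choice H'.
exists h, h'; split.
- by move=> i; apply: fi; rewrite hE' hE.
- by move=> i; apply: fi'; rewrite hE hE'.
- by apply: fi'; rewrite hE fr fr'.
- move=> i j; apply/idP/idP => [/ae|/ae']; first by rewrite -!hE => /ae'.
  by rewrite !hE => /ae.
Qed.

Lemma ball_iso_finite (V : eqType) (adj : V -> V -> Prop) r l (s : seq V) :
  (forall v, Defs.ball adj r l v -> v \in s) ->
  exists k (E : rel 'I_k) rH, ball_iso adj r l E rH.
Proof.
move=> sB; pose s0 := undup [seq v <- s | `[< Defs.ball adj r l v >]].
have s0E v : v \in s0 <-> Defs.ball adj r l v.
  rewrite mem_undup mem_filter; split=> [/andP [/asboolP]|vB] //.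
  by rewrite sB // andbT; apply/asboolP.
have us : uniq s0 := undup_uniq _.
have rB : r \in s0.
  by apply/s0E; elim: l {sB s0 s0E us} => [//|l IH]; left.
have rs : index r s0 < size s0 by rewrite index_mem.
exists (size s0), (fun i j => `[< adj (nth r s0 i) (nth r s0 j) >]), (Ordinal rs).
exists (fun i => nth r s0 i); split.
- by move=> i j /eqP; rewrite nth_uniq // => /eqP /val_inj.
- by rewrite /= nth_index.
- apply/seteqP; split=> [_ [i _ <-]|v /s0E vs]; first by apply/s0E; rewrite mem_nth.
  have vi : index v s0 < size s0 by rewrite index_mem.
  by exists (Ordinal vi); rewrite //= nth_index.
- by move=> i j; split=> /asboolP.
Qed.

Lemma vball_finite sk xs l : exists s : seq vert, forall v, Defs.ball (fun p q => vadj sk xs p q) vroot l v -> v \in s.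
Proof.
elim: l => [|l [s IH]]; first by exists [:: vroot] => v ->; rewrite inE.
pose nb (v : vert) := vpar v :: (v.1.+1, [::]) :: [seq (v.1, rcons v.2 a) | a <- iota 0 (xs v.1 v.2)].
exists (s ++ flatten [seq nb v | v <- s]) => v /= [/IH vs|[x /IH xs' xv]]; rewrite mem_cat; first by rewrite vs.
apply/orP; right; apply/flattenP; exists (nb x); first exact: map_f.
rewrite /nb !in_cons; move: xv => /and3P [_ av /orP [] /andP [nr /eqP <-]]; last by rewrite eqxx.
case: v nr av => t u; case/lastP: u => [|u a] nr av.
  by rewrite /vpar /= prednK ?eqxx ?orbT //; case: t nr av.
rewrite vpar_rcons /=; apply/orP; right; apply/orP; right; apply/mapP; exists a => //.
by rewrite mem_iota /=; move: av => /andP [_ /=]; rewrite in_tree_rcons => /andP [].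
Qed.
End Codes.
End NatTrees.

(** * Placing a finite tree into the limiting tree *)

Section NatLabels.
Local Open Scope nat_scope.
Section Labels.
Variables (k : nat) (E : rel 'I_k) (rH : 'I_k) (l : nat) (par : 'I_k -> 'I_k) (D : 'I_k -> nat).
Hypothesis td : tdata E rH l par D.
Variable sk : bool.

Definition spine y i := sk && (iter (l - D i) par y == i).
(* Children off the spine; in [T(1)] there is no spine, and in the skeleton tree the spine is the path from the root to a chosen vertex [y] at depth [l]. *)
Definition kids y i : {set 'I_k} := [set j | [&& j != rH, par j == i & ~~ spine y j]].
Definition labs (C : {set 'I_k}) (h : {ffun 'I_k -> 'I_k}) := [seq val (h j) | j <- enum C].
(** Here ['I_k] serves as a range of numbers: [h j] is the birth rank of j among the children off
    the spine of its parent. The value [rH] at the root and on the spine is a default that keeps h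
    unique. *)
Definition labelings y : {set {ffun 'I_k -> 'I_k}} :=
  [set h : {ffun 'I_k -> 'I_k} | [forall i, perm_eq (labs (kids y i) h) (iota 0 #|kids y i|)] &&
             [forall j, ((j == rH) || spine y j) ==> (h j == rH)]].
Fixpoint place y (h : {ffun 'I_k -> 'I_k}) n j : vert :=
  if n is n'.+1 then
    if spine y j then (n, [::]) else
    let p := place y h n' (par j) in (p.1, rcons p.2 (h j))
  else vroot.

Lemma kids_leaf y i : l <= D i -> kids y i = finset.set0.
Proof.
have [_ _ Dp Dl _] := td => li; apply/setP => j; rewrite in_set0; apply/negP; rewrite in_set.
move=> /and3P [nj /eqP pj _]; have := Dp _ nj; rewrite pj => Dj.
by have := Dl j; rewrite Dj ltnNge li.
Qed.

Lemma card_labelings y : #|labelings y| <= \prod_(i | D i < l) (#|kids y i|)`!.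
Proof.
have -> : \prod_(i | D i < l) (#|kids y i|)`! = \prod_i (#|kids y i|)`!.
  rewrite [RHS](bigID (fun i => D i < l)) /= [X in _ * X]big1 ?muln1 // => i.
  by rewrite -leqNgt => /kids_leaf ->; rewrite cards0.
pose F i := [set h : {ffun 'I_k -> 'I_k} | perm_eq (labs (kids y i) h) (iota 0 #|kids y i|) &
   [forall j, (j \notin kids y i) ==> (h j == rH)]].
have cF i : #|F i| <= (#|kids y i|)`!.
  rewrite -[X in _ <= X`!](size_iota 0) -size_permutations ?iota_uniq // cardE.
  rewrite -(size_map (labs (kids y i))); apply: uniq_leq_size.
    rewrite map_inj_in_uniq ?enum_uniq // => h h'; rewrite !mem_enum => /setIdP [_ /forallP h1] /setIdP [_ /forallP h2].
    move=> /eq_in_map e; apply/ffunP => j; case jC: (j \in kids y i).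
      by apply: val_inj; apply: e; rewrite mem_enum.
    by have := h1 j; have := h2 j; rewrite jC /= => /eqP -> /eqP ->.
  by move=> s /mapP [h]; rewrite mem_enum => /setIdP [hp _] ->; rewrite mem_permutations.
apply: (@leq_trans (\prod_i #|F i|)); last by apply: leq_prod.
rewrite -card_family_set.
pose g (h : {ffun 'I_k -> 'I_k}) : {ffun 'I_k -> {ffun 'I_k -> 'I_k}} := [ffun i => [ffun j => if j \in kids y i then h j else rH]].
rewrite -(@card_in_imset _ _ g); last first.
  move=> h h' /setIdP [_ /forallP h1] /setIdP [_ /forallP h2] e; apply/ffunP => j.
  case c: ((j == rH) || spine y j).
    by have := h1 j; have := h2 j; rewrite c /= => /eqP -> /eqP ->.
  have := congr1 (fun F : {ffun 'I_k -> {ffun 'I_k -> 'I_k}} => F (par j) j) e.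
  by move: c => /norP [c1 c2]; rewrite !ffunE !in_set c1 c2 eqxx.
apply: subset_leq_card; apply/subsetP => F' /imsetP [h /setIdP [/forallP hp _] ->].
rewrite in_set; apply/forallP => i; apply/setIdP; split.
  rewrite ffunE; have := hp i; congr (perm_eq _ _); apply/eq_in_map => j; rewrite mem_enum => jC.
  by rewrite ffunE jC.
by apply/forallP => j; apply/implyP => /negPf jC; rewrite !ffunE jC.
Qed.

Section OfIso.
Variables (xs : nat -> seq nat -> nat) (f : 'I_k -> vert).
Hypotheses (fi : injective f) (fr : f rH = vroot) (im : range f = Defs.ball (fun p q => vadj sk xs p q) vroot l)
  (ae : forall i j, E i j <-> vadj sk xs (f i) (f j)).

(** Every isomorphism onto the ball is the placement given by a spine end y and a labelling h, and
    then the offspring number of each inner vertex is forced. So the event is covered by finitely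
    many cylinder events. *)
Lemma label_of_iso : exists y h, [/\ if sk then D y == l else y == rH, h \in labelings y,
  forall j, f j = place y h (D j) j & forall i, D i < l -> xs (f i).1 (f i).2 = #|kids y i|].
Proof.
have [D0 pr Dp Dl _] := td.
have dep := iso_dep td fi fr ae; have parE := iso_par td fi fr ae; have onto := iso_onto im.
have inb := iso_ball im; have rt := iso_root fi fr.
have [y [yok spE]] : exists y, (if sk then D y == l else y == rH) /\ forall j, spine y j = sk && ((f j).2 == [::]).
  case skE: sk; last by exists rH; rewrite eqxx; split=> // j; rewrite /spine skE.
  have [|//|y fy] := onto (l, [::]); first by rewrite /alive skE.
    by rewrite /vdep /= addn0.
  exists y; split; first by rewrite -dep fy /vdep /= addn0.
  have it m : f (iter m par y) = (l - m, [::]).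
    elim: m => [|m IH]; first by rewrite subn0.
    by rewrite iterS parE IH /vpar /= subnS.
  move=> j; rewrite /spine skE /=; apply/eqP/eqP => [<-|e]; first by rewrite it.
  apply: fi; rewrite it; case fj: (f j) e => [t u] /= e; subst u.
  have [_] := inb j; rewrite -dep fj /vdep /= addn0 => tl; by rewrite subKn.
have child j : j != rH -> ~~ spine y j ->
    f j = ((f (par j)).1, rcons (f (par j)).2 (last 0 (f j).2)) /\ last 0 (f j).2 < xs (f (par j)).1 (f (par j)).2.
  move=> nj nsp; rewrite parE; have [al _] := inb j; move: nsp al; rewrite spE -rt in nj *.
  case: (f j) nj => t u; case/lastP: u => [|u a] nj /=.
    rewrite andbT => nsk; rewrite /alive (negPf nsk) /= => /andP [/eqP t0 _].
    by rewrite t0 eqxx in nj.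
  by move=> _ /andP [_]; rewrite vpar_rcons last_rcons /= in_tree_rcons => /andP [_ h].
have cnt i : D i < l -> perm_eq [seq last 0 (f j).2 | j <- enum (kids y i)] (iota 0 (xs (f i).1 (f i).2)).
  move=> Di; apply: uniq_perm; rewrite ?iota_uniq //.
    rewrite map_inj_in_uniq ?enum_uniq // => j j'; rewrite !mem_enum !in_set.
    move=> /and3P [nj /eqP pj sj] /and3P [nj' /eqP pj' sj'] e; apply: fi.
    have [-> _] := child j nj sj; have [-> _] := child j' nj' sj'; by rewrite pj pj' e.
  move=> a; rewrite mem_iota /=; apply/mapP/idP => [[j]|ax].
    rewrite mem_enum in_set => /and3P [nj /eqP pj sj] ->; rewrite -pj; by have [] := child j nj sj.
  pose v : vert := ((f i).1, rcons (f i).2 a).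
  have [||j fj] := onto v.
  - have [] := inb i; rewrite /alive /v /= in_tree_rcons => /andP [-> ->] _; by rewrite ax.
  - by rewrite /vdep /v /= size_rcons addnS -/(vdep (f i)) dep.
  have nj : j != rH by rewrite -rt fj; apply/eqP => -[_]; case: ((f i).2).
  exists j; last by rewrite fj last_rcons.
  rewrite mem_enum in_set nj spE fj /=; apply/andP; split.
    by apply/eqP; apply: fi; rewrite parE fj vpar_rcons; case: (f i).
  by rewrite negb_and orbC; case: ((f i).2).
have cardK i : D i < l -> xs (f i).1 (f i).2 = #|kids y i|.
  by move=> Di; have := perm_size (cnt i Di); rewrite size_map size_iota cardE.
pose h : {ffun 'I_k -> 'I_k} := [ffun j => if (j == rH) || spine y j then rH else insubd rH (last 0 (f j).2)].
have hE j : j != rH -> ~~ spine y j -> h j = last 0 (f j).2 :> nat.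
  move=> nj sj; rewrite ffunE (negPf nj) (negPf sj) /= val_insubd.
  have Dj : D (par j) < l by rewrite -(Dp j nj).
  have [_] := child j nj sj; rewrite (cardK _ Dj) => lt.
  by rewrite (leq_trans lt) // -[X in _ <= X]card_ord max_card.
exists y, h; split=> //.
  apply/setIdP; split; apply/forallP => i; last by apply/implyP => c; rewrite ffunE c.
  have [Di|Di] := ltnP (D i) l; last by rewrite kids_leaf // /labs enum_set0 cards0.
  rewrite -(cardK i Di); have := cnt i Di; congr (perm_eq _ _); apply/eq_in_map => j.
  by rewrite mem_enum in_set => /and3P [nj _ sj]; rewrite -hE.
move=> j; have [n] := ubnP (D j); elim: n j => // n IH j; rewrite ltnS => Dn.
have [->|nj] := eqVneq j rH; first by rewrite D0.
rewrite (Dp j nj) /=; case sj: (spine y j).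
  move: sj; rewrite spE => /andP [_ /eqP e]; case fj: (f j) e => [t u] /= e.
  by rewrite -(Dp j nj) -dep fj e /vdep /= addn0.
have [e _] := child j nj (negbT sj); rewrite -IH; last by rewrite -(Dp j nj).
by rewrite hE // sj.
Qed.
End OfIso.
End Labels.

End NatLabels.

(** * Counting and measurability of events *)

Section CountEvents.
Local Open Scope ring_scope.
Local Open Scope ereal_scope.

(** On A the indicators of the events add up to at least N; integrate. *)
Lemma count_events (R : realType) d (Om : measurableType d) (P : probability Om R) (I : finType)
  (A : set Om) (Ev : I -> set Om) (N : nat) : measurable A -> (forall i, measurable (Ev i)) ->
  (forall w, A w -> (N <= #|[set i | `[< Ev i w >]]|)%N) ->
  N%:R%:E * P A <= \sum_i P (Ev i).
Proof.
move=> mA mE H; rewrite -integral_cst //.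
apply: (@le_trans _ _ (\int[P]_(x in A) \sum_(i <- enum I) (\1_(Ev i) x)%:E)); last first.
  rewrite ge0_integral_sum //; last first.
    by move=> i; apply/measurable_realfun.measurable_EFinP; apply: measurable_realfun.measurable_indic.
  rewrite big_enum /=; apply: lee_sum => i _; rewrite integral_indic //.
  by apply: le_measure; [apply/mem_set; apply: measurableI|apply/mem_set|apply: subIsetl].
apply: ge0_le_integral => //.
- by move=> w _; rewrite lee_fin ler0n.
- by apply: emeasurable_sum => i; apply/measurable_realfun.measurable_EFinP; apply: measurable_realfun.measurable_indic.
- move=> w Aw; rewrite sumEFin lee_fin -natr_sum ler_nat; apply: leq_trans (H w Aw) _.
  rewrite big_enum /= -sum1_card big_mkcond /=; apply: leq_sum => i _.
  by case: ifP => //; rewrite in_set => /asboolP h; rewrite mem_set.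
Qed.
End CountEvents.

Section MeasurableBool.
Variables (d : measure_display) (Om : measurableType d).
Implicit Types b : Om -> bool.

Definition mbool b := measurable [set w | b w]%classic.

Lemma mbool_ext b b' : b =1 b' -> mbool b -> mbool b'.
Proof. by move=> e; rewrite /mbool (_ : [set w | b w]%classic = [set w | b' w]%classic) //; apply/seteqP; split=> w /=; rewrite e. Qed.

Lemma mbool_cst c : mbool (fun=> c).
Proof.
case: c; rewrite /mbool.
  by rewrite (_ : [set _ | _]%classic = classical_sets.setT); [exact: measurableT|apply/seteqP; split].
by rewrite (_ : [set _ | _]%classic = classical_sets.set0); [exact: measurable0|apply/seteqP; split].
Qed.

Lemma mboolN b : mbool b -> mbool (fun w => ~~ b w).
Proof.
move=> mb; rewrite /mbool (_ : [set _ | _]%classic = (~` [set w | b w])%classic); first exact: measurableC.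
by apply/seteqP; split=> w /= /negP.
Qed.

Lemma mboolI b b' : mbool b -> mbool b' -> mbool (fun w => b w && b' w).
Proof.
move=> mb mb'; rewrite /mbool (_ : [set _ | _]%classic = ([set w | b w] `&` [set w | b' w])%classic); first exact: measurableI.
by apply/seteqP; split=> w /= /andP.
Qed.

Lemma mboolU b b' : mbool b -> mbool b' -> mbool (fun w => b w || b' w).
Proof.
move=> mb mb'; apply: (@mbool_ext (fun w => ~~ (~~ b w && ~~ b' w))).
  by move=> w; rewrite negb_and !negbK.
by apply/mboolN/mboolI; apply: mboolN.
Qed.

Lemma mbool_eq b b' : mbool b -> mbool b' -> mbool (fun w => b w == b' w).
Proof.
move=> mb mb'; apply: (@mbool_ext (fun w => (b w && b' w) || (~~ b w && ~~ b' w))).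
  by move=> w; case: (b w); case: (b' w).
by apply: mboolU; apply: mboolI => //; apply: mboolN.
Qed.

Lemma mbool_all (I : Type) (s : seq I) (b : I -> Om -> bool) : (forall i, mbool (b i)) ->
  mbool (fun w => all (fun i => b i w) s).
Proof. by move=> mb; elim: s => [|i s IH] /=; [exact: mbool_cst|exact: mboolI]. Qed.

Lemma measurable_forall (V : countType) (b : V -> Om -> bool) : (forall v, mbool (b v)) ->
  measurable [set w | forall v, b v w]%classic.
Proof.
move=> mb; rewrite (_ : [set _ | _]%classic = (\bigcap_n [set w | if unpickle n is Some v then b v w else true])%classic).
  by apply: bigcapT_measurable => n; case: (unpickle n) => [v|]; [exact: mb|exact: mbool_cst].
apply/seteqP; split=> w /= H; first by move=> n _; case: (unpickle n).
by move=> v; have := H (pickle v) I; rewrite /= pickleK.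
Qed.

Lemma measurable_exists (V : countType) (b : V -> Om -> Prop) : (forall v, measurable [set w | b v w]%classic) ->
  measurable [set w | exists v, b v w]%classic.
Proof.
move=> mb; rewrite (_ : [set _ | _]%classic = (\bigcup_n [set w | if unpickle n is Some v then b v w else False])%classic).
  apply: bigcupT_measurable => n; case: (unpickle n) => [v|]; first exact: mb.
  by rewrite (_ : [set _ | _]%classic = classical_sets.set0); [exact: measurable0|apply/seteqP; split].
apply/seteqP; split=> w /=; first by move=> [v bv]; exists (pickle v); rewrite //= pickleK.
by move=> [n _] /=; case: (unpickle n) => // v bv; exists v.
Qed.
End MeasurableBool.

(** * Upper bounds for the ball probabilities of the limiting trees *)

Section Bush.
Variables (R : realType) (d : measure_display) (Omega : measurableType d) (P : probability Omega R)
  (xi : nat -> seq nat -> Omega -> nat).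
Hypothesis mxi : forall i u k, measurable [set w | xi i u w = k]%classic.
Hypothesis pxi : forall (s : seq (nat * seq nat)) (kk : nat * seq nat -> nat), uniq s ->
     P [set w | forall j, j \in s -> xi j.1 j.2 w = kk j]%classic
     = (\prod_(j <- s) poisson_pmf 1 (kk j))%:E.
Local Notation xs := (fun w i u => xi i u w).

Lemma mxi_lt i u a : mbool (fun w => (a < xi i u w)%N).
Proof.
apply: (@mbool_ext _ _ (fun w => ~~ ~~ (a < xi i u w)%N)) => [w|]; first by rewrite negbK.
apply: mboolN; rewrite /mbool.
rewrite (_ : [set _ | _]%classic = (\bigcup_(m in [set m | (m <= a)%N]) [set w | xi i u w = m])%classic).
  by apply: bigcup_measurable => m _; apply: mxi.
by apply/seteqP; split=> w /=; [rewrite -leqNgt => h; exists (xi i u w)|move=> [m /= ma xm]; rewrite -leqNgt xm].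
Qed.

Lemma mbool_alive sk v : mbool (fun w => alive sk (xs w) v).
Proof.
rewrite /alive; apply: mboolI; first exact: mbool_cst.
case: v => t u /=; elim: u [::] => [|a u IH] pre /=; first exact: mbool_cst.
by apply: mboolI; [exact: mxi_lt|exact: IH].
Qed.

Lemma mbool_vadj sk p q : mbool (fun w => vadj sk (xs w) p q).
Proof. by rewrite /vadj; do 2?[apply: mboolI; first exact: mbool_alive]; exact: mbool_cst. Qed.

Definition isoev sk l k (E : rel 'I_k) rH :=
  [set w | ball_iso (fun p q => vadj sk (xs w) p q) vroot l E rH]%classic.

Lemma measurable_isoev sk l k (E : rel 'I_k) rH : measurable (isoev sk l E rH).
Proof.
pose ev (phi : {ffun 'I_k -> vert}) w := (injectiveb phi && (phi rH == vroot) &&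
  all (fun p => E p.1 p.2 == vadj sk (xs w) (phi p.1) (phi p.2)) (enum [set: 'I_k * 'I_k])) /\
  forall v, [exists i, phi i == v] == (alive sk (xs w) v && (vdep v <= l)%N).
rewrite (_ : isoev _ _ _ _ = [set w | exists phi, ev phi w]%classic).
  apply: measurable_exists => phi; apply: measurableI.
    apply: mboolI; first exact: mbool_cst.
    by apply: mbool_all => p; apply: mbool_eq; [exact: mbool_cst|exact: mbool_vadj].
  apply: measurable_forall => v; apply: mbool_eq; first exact: mbool_cst.
  by apply: mboolI; [exact: mbool_alive|exact: mbool_cst].
apply/seteqP; split=> w /=.
  move=> [f [fi fr im ae]]; exists (finfun f); split.
    apply/andP; split; first by rewrite ffunE fr eqxx andbT; apply/injectiveP => i j; rewrite !ffunE => /fi.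
    by apply/allP => -[i j] _ /=; rewrite !ffunE; apply/eqP; apply/idP/idP => /ae.
  move=> v; apply/eqP; apply/idP/idP => [/existsP [i /eqP]|/vballE].
    by rewrite ffunE => <-; apply/vballE; rewrite -im; exists i.
  by rewrite -im => -[i _ e]; apply/existsP; exists i; rewrite ffunE e.
move=> [phi [/andP [/andP [/injectiveP fi /eqP fr] /allP ae] im]]; exists phi; split=> //.
  apply/seteqP; split=> [_ [i _ <-]|v /vballE].
    by apply/vballE; rewrite -(eqP (im (phi i))); apply/existsP; exists i.
  by rewrite -(eqP (im v)) => /existsP [i /eqP e]; exists i.
move=> i j; have := ae (i, j); rewrite mem_enum in_setT => /(_ isT) /eqP /= ->; by [].
Qed.

Lemma measurable_cyl (s : seq vert) (kk : vert -> nat) :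
  measurable [set w | forall j, j \in s -> xi j.1 j.2 w = kk j]%classic.
Proof.
elim: s => [|j s IH].
  by rewrite (_ : [set _ | _]%classic = classical_sets.setT); [exact: measurableT|apply/seteqP; split].
rewrite (_ : [set _ | _]%classic = ([set w | xi j.1 j.2 w = kk j] `&` [set w | forall j, j \in s -> xi j.1 j.2 w = kk j])%classic).
  by apply: measurableI => //; apply: mxi.
apply/seteqP; split=> w /= H; first by split=> [|i si]; apply: H; rewrite in_cons ?eqxx ?si ?orbT.
by move=> i; rewrite in_cons => /orP [/eqP ->|]; [exact: H.1|exact: H.2].
Qed.

Section Upper.
Variables (k : nat) (E : rel 'I_k) (rH : 'I_k) (l : nat) (par : 'I_k -> 'I_k) (D : 'I_k -> nat).
Hypothesis td : tdata E rH l par D.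
Variable sk : bool.

Definition starts : {set 'I_k} := [set y | if sk then D y == l else y == rH].
Definition inner : {set 'I_k} := [set i | (D i < l)%N].
Local Notation code := ('I_k * {ffun 'I_k -> 'I_k})%type.
Definition plc (p : code) i := place l par D sk p.1 p.2 (D i) i.
Definition offspring (p : code) v := if [pick i | plc p i == v] is Some i then #|kids rH l par D sk p.1 i| else 0%N.
(** Injectivity puts the inner vertices at distinct places, so that the product formula for
    independent offspring numbers applies; an invalid code gets the empty cylinder. *)
Definition valid (p : code) := [&& p.1 \in starts, p.2 \in labelings rH l par D sk p.1 & injectiveb (finfun (plc p))].
Definition cyl (p : code) := [set w | valid p /\
  forall j, j \in [seq plc p i | i <- enum inner] -> xi j.1 j.2 w = offspring p j]%classic.

Lemma offspring_plc p i : valid p -> offspring p (plc p i) = #|kids rH l par D sk p.1 i|.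
Proof.
move=> /and3P [_ _ /injectiveP ip]; rewrite /offspring; case: pickP => [j /eqP e|/(_ i)]; last by rewrite eqxx.
by have -> : j = i by apply: ip; rewrite !ffunE.
Qed.

Lemma P_cyl p : valid p -> P (cyl p) = (\prod_(i | (D i < l)%N) (expR (-1) / (#|kids rH l par D sk p.1 i|)`!%:R))%:E.
Proof.
move=> vp; rewrite (_ : cyl p = [set w | forall j, j \in [seq plc p i | i <- enum inner] -> xi j.1 j.2 w = offspring p j]%classic); last first.
  by apply/seteqP; split=> w /=; [case|split].
rewrite pxi; last first.
  rewrite map_inj_uniq ?enum_uniq // => i j e; have /and3P [_ _ /injectiveP ip] := vp.
  by apply: ip; rewrite !ffunE.
congr _%:E; rewrite big_map big_enum /=; apply: eq_big => [i|i _]; first by rewrite in_set.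
by rewrite offspring_plc // /poisson_pmf ltr01 expr1n mul1r mulrC.
Qed.

Lemma measurable_cyl_code p : measurable (cyl p).
Proof.
case vp: (valid p); last first.
  by rewrite (_ : cyl p = classical_sets.set0); [exact: measurable0|apply/seteqP; split=> w //=; case; rewrite vp].
rewrite (_ : cyl p = [set w | forall j, j \in [seq plc p i | i <- enum inner] -> xi j.1 j.2 w = offspring p j]%classic); last first.
  by apply/seteqP; split=> w /=; [case|split].
exact: measurable_cyl.
Qed.

(** The j! orders of j children cancel the factorial in the Poisson probability e^-1 / j!. Each
    inner vertex leaves a factor e^-1, and each spine end contributes once. *)
Lemma sum_cyl : (\sum_(p : code) P (cyl p) <= (#|starts|%:R * expR (- #|inner|%:R))%:E)%E.
Proof.
pose q y := \prod_(i | (D i < l)%N) (expR (-1) / (#|kids rH l par D sk y i|)`!%:R) : R.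
have q0 y : 0 <= q y by apply: prodr_ge0 => i _; rewrite divr_ge0 ?expR_ge0.
pose F y h := if (y \in starts) && (h \in labelings rH l par D sk y) then q y else 0.
apply: (@le_trans _ _ (\sum_(p : code) (F p.1 p.2)%:E)%E).
  apply: lee_sum => p _; case vp: (valid p).
    by rewrite P_cyl // /F; move: vp => /and3P [-> -> _].
  rewrite (_ : cyl p = classical_sets.set0); last by apply/seteqP; split=> w //=; case; rewrite vp.
  by rewrite measure0 lee_fin /F; case: ifP.
rewrite sumEFin lee_fin -(pair_bigA _ (fun y h => F y h)) /=.
apply: (@le_trans _ _ (\sum_(y in starts) expR (- #|inner|%:R))); last first.
  by rewrite sumr_const mulr_natl.
rewrite [leRHS]big_mkcond; apply: ler_sum => y _; rewrite /F.
case: (y \in starts) => /=; last by rewrite big1.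
rewrite -big_mkcond sumr_const -[leLHS]mulr_natl.
apply: (@le_trans _ _ ((\prod_(i | (D i < l)%N) (#|kids rH l par D sk y i|)`!)%:R * q y)).
  by rewrite ler_wpM2r // ler_nat; apply: card_labelings td _ _.
rewrite natr_prod -big_split /= (eq_bigr (fun=> expR (-1))); last first.
  by move=> i _; rewrite mulrC divfK // pnatr_eq0 -lt0n fact_gt0.
rewrite prodr_const -expRM_natl mulrN1.
by rewrite (_ : #|[pred i | (D i < l)%N]| = #|inner|) //; apply: eq_card => i; rewrite in_set.
Qed.

(** Composing an isomorphism with the automorphisms of (E, rH) gives [Aut] different isomorphisms,
    and the code of each determines it. Hence the division by [Aut] in [qT]. *)
Lemma Aut_le w : isoev sk l E rH w -> (Aut E rH <= #|[set p | `[< cyl p w >]]|)%N.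
Proof.
move=> [f [fi fr im ae]]; rewrite /Aut; set A := [set s | _].
pose s0 (p : code) := [ffun i => odflt rH [pick j | f j == plc p i]].
apply: (@leq_trans #|s0 @: [set p | `[< cyl p w >]]|); last exact: leq_imset_card.
apply: subset_leq_card; apply/subsetP => s; rewrite in_set => /and3P [/injectiveP si /eqP sr /forallP sE].
have gi : injective (f \o s) by apply: inj_comp.
have bij : bijective s := injF_bij si.
have gim : range (f \o s) = Defs.ball (fun p q => vadj sk (xs w) p q) vroot l.
  rewrite -im; apply/seteqP; split=> [_ [i _ <-]|_ [i _ <-]]; first by exists (s i).
  by have [s' sK s'K] := bij; exists (s' i); rewrite //= s'K.
have gE i j : E i j <-> vadj sk (xs w) ((f \o s) i) ((f \o s) j).
  by have /forallP /(_ j) /eqP <- := sE i; apply: ae.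
have gr : (f \o s) rH = vroot by rewrite /= sr.
have [y [h [hy hl hp hx]]] := label_of_iso td gi gr gim gE.
have vp : valid (y, h).
  apply/and3P; split=> //; first by rewrite in_set.
  by apply/injectiveP => i j; rewrite !ffunE /plc /= -!hp; apply: gi.
apply/imsetP; exists (y, h).
  rewrite in_set; apply/asboolP; split=> // j /mapP [i]; rewrite mem_enum in_set => Di ->.
  by rewrite offspring_plc //= -hx // hp.
apply/ffunP => i; rewrite ffunE /plc /= -hp; case: pickP => [j /eqP /fi -> //|/(_ (s i))].
by rewrite /= eqxx.
Qed.

Lemma P_iso_le : fine (P (isoev sk l E rH)) <= #|starts|%:R * qT R E rH l D.
Proof.
have mI := measurable_isoev sk l E rH.
have := count_events P mI measurable_cyl_code Aut_le.
have A0 : 0 < (Aut E rH)%:R :> R by rewrite ltr0n Aut_gt0.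
have fP : P (isoev sk l E rH) \is a fin_num by apply: fin_num_measure.
move=> /le_trans /(_ sum_cyl); rewrite -[X in (_ * X <= _)%E](fineK fP) -EFinM lee_fin.
by rewrite /qT mulrA ler_pdivlMr // mulrC.
Qed.
End Upper.
End Bush.

(** * Convergence *)

(** Finite rooted graphs as a countable type, with the relation stored as a finite function so that
    [pickle] enumerates them; isomorphic graphs have several codes. *)
Definition gcode := {k : nat & ({ffun 'I_k * 'I_k -> bool} * 'I_k)%type}.
Definition gE (c : gcode) : rel 'I_(tag c) := fun i j => (tagged c).1 (i, j).
Definition gR (c : gcode) : 'I_(tag c) := (tagged c).2.
Arguments gE : clear implicits.
Definition giso (c c' : gcode) := code_iso (gE c) (gR c) (gE c') (gR c').
Definition gcode_of k (E : rel 'I_k) (rH : 'I_k) : gcode :=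
  Tagged (fun k => ({ffun 'I_k * 'I_k -> bool} * 'I_k)%type) ([ffun p => E p.1 p.2], rH).

Lemma gE_gcode_of k (E : rel 'I_k) rH : gE (gcode_of E rH) = E.
Proof. by apply/funext => i; apply/funext => j; rewrite /gE /= ffunE. Qed.

Lemma giso_refl c : giso c c.
Proof. by exists id, id. Qed.

Lemma giso_sym c c' : giso c c' -> giso c' c.
Proof.
move=> [h [h' [hK hK' hr hE]]]; exists h', h; split=> //; first by rewrite -hr hK.
by move=> i j; rewrite hE !hK'.
Qed.

Definition irredundant (s : seq gcode) := uniq s /\ forall c c', c \in s -> c' \in s -> giso c c' -> c = c'.

Lemma representatives (N : nat) c0 : exists s, irredundant (c0 :: s) /\
  forall n c, (n < N)%N -> (unpickle n : option gcode) = Some c -> exists2 r, r \in c0 :: s & giso c r.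
Proof.
elim: N => [|N [s [[us irr] H]]].
  by exists [::]; split=> //; split=> // c c'; rewrite !inE => /eqP -> /eqP ->.
case uN: (unpickle N : option gcode) => [c|]; last first.
  exists s; split=> // n c; rewrite ltnS leq_eqVlt => /orP [/eqP ->|]; [by rewrite uN|exact: H].
have [[r rs cr]|nr] := pselect (exists2 r, r \in c0 :: s & giso c r).
  exists s; split=> // n c'; rewrite ltnS leq_eqVlt => /orP [/eqP ->|]; last exact: H.
  by rewrite uN => -[<-]; exists r.
have nc : c \notin c0 :: s by apply/negP => cs; apply: nr; exists c => //; apply: giso_refl.
have mE x : (x \in [:: c0, c & s]) = (x == c) || (x \in c0 :: s) by rewrite !in_cons orbCA.
exists (c :: s); split; last first.
  move=> n c'; rewrite ltnS leq_eqVlt => /orP [/eqP ->|nN un].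
    by rewrite uN => -[<-]; exists c; [rewrite mE eqxx|exact: giso_refl].
  by have [r rs cr] := H n c' nN un; exists r; rewrite // mE rs orbT.
split.
  by move: us nc; rewrite /= !in_cons !negb_or => /andP [-> ->] /andP [n1 ->]; rewrite eq_sym n1.
move=> x y; rewrite !mE => /orP [/eqP ->|xs] /orP [/eqP ->|ys] // e.
- by case: nr; exists y.
- by case: nr; exists x => //; apply: giso_sym.
- exact: irr.
Qed.

Lemma sum_bool_le1 (T : eqType) (s : seq T) (Q : pred T) : uniq s ->
  (forall x y, x \in s -> y \in s -> Q x -> Q y -> x = y) -> (\sum_(x <- s) Q x <= 1)%N.
Proof.
move=> us H; rewrite (_ : (\sum_(x <- s) Q x = count Q s)%N); last first.
  by rewrite -sum1_count [RHS]big_mkcond; apply: eq_bigr => x _; case: (Q x).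
rewrite -size_filter; have := filter_uniq Q us; case Ef: (filter Q s) => [|x [|y t]] //= /andP [].
have mQ z : z \in [:: x, y & t] -> z \in s /\ Q z by rewrite -Ef mem_filter => /andP [].
have [xs qx] : x \in s /\ Q x by apply: mQ; rewrite in_cons eqxx.
have [ys qy] : y \in s /\ Q y by apply: mQ; rewrite !in_cons eqxx orbT.
by rewrite (H x y) // in_cons eqxx.
Qed.

Section PlanarSide.
Variables (R : realType).

Lemma rooted_prob_sum (T : finType) (a : rel T) (A : {set T}) l (s : seq gcode) : irredundant s ->
  \sum_(c <- s) rooted_prob R a A l (gE c) (gR c) <= 1.
Proof.
move=> [us irr]; rewrite /rooted_prob -mulr_suml.
set S := \sum_(c <- s) _; suff h : S <= #|A|%:R.
  have [A0|A0] := eqVneq #|A| 0%N; first by rewrite A0 invr0 mulr0.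
  by rewrite ler_pdivrMr ?mul1r // ltr0n lt0n.
rewrite /S -natr_sum ler_nat; pose Q (c : gcode) v := `[< ball_iso (fun x y => [&& a x y, x \in A & y \in A]) v l (gE c) (gR c) >].
rewrite -sum1_card; have -> : (\sum_(c <- s) #|[set v in A | Q c v]| = \sum_(c <- s) \sum_(v in A) Q c v)%N.
  apply: eq_bigr => c _; rewrite -sum1_card [LHS](eq_bigl (fun v => (v \in A) && Q c v)) => [|v]; last by rewrite in_set.
  by rewrite big_mkcondr; apply: eq_bigr => v _; case: (Q c v).
rewrite exchange_big /=; apply: leq_sum => v _; apply: sum_bool_le1 => // c c' cs c's /asboolP qc /asboolP qc'.
by apply: irr => //; apply: ball_iso_unique qc qc'.
Qed.

Lemma planar_prob_sum n m (sel : {set {set 'I_n}} -> {set 'I_n}) l (s : seq gcode) : irredundant s ->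
  \sum_(c <- s) planar_ball_prob R m sel l (gE c) (gR c) <= 1.
Proof.
move=> irr; rewrite /planar_ball_prob -mulr_suml exchange_big /=.
have [P0|P0] := eqVneq #|planar_graphs R n m| 0%N; first by rewrite P0 invr0 mulr0.
rewrite ler_pdivrMr ?mul1r ?ltr0n ?lt0n //.
apply: (@le_trans _ _ (\sum_(g in planar_graphs R n m) 1)); last by rewrite sumr_const.
by apply: ler_sum => g _; apply: rooted_prob_sum.
Qed.

(** An excess at c0 would have to be compensated by a deficit at finitely many other types, which
    their lower bounds forbid; the types outside the finite list carry at most e / 2 of the limiting
    mass. *)
Lemma squeeze (prob : gcode -> nat -> R) (p : gcode -> R) c0 :
  (forall c e, 0 < e -> exists n0, forall n, (n0 <= n)%N -> p c - e <= prob c n) ->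
  (forall s n, irredundant s -> \sum_(c <- s) prob c n <= 1) ->
  (forall e, 0 < e -> exists2 s, irredundant (c0 :: s) & 1 - e <= \sum_(c <- c0 :: s) p c) ->
  (prob c0 @ \oo --> p c0)%classic.
Proof.
move=> lo up ti; apply/cvgrPdist_le => e e0; have e2 : 0 < e / 2 by rewrite divr_gt0.
have [s irr hs] := ti _ e2; pose e' := e / 2 / (size s).+1%:R.
have e'0 : 0 < e' by rewrite divr_gt0.
have [n0 H0] : exists n0, forall n, (n0 <= n)%N -> \sum_(c <- s) p c - (size s)%:R * e' <= \sum_(c <- s) prob c n.
  elim: s {irr hs} e' e'0 => [|c s IH] e' e'0; first by exists 0%N => n _; rewrite !big_nil mul0r subr0.
  have [n1 H1] := IH e' e'0; have [n2 H2] := lo c e' e'0; exists (maxn n1 n2) => n; rewrite geq_max => /andP [a1 a2].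
  by rewrite !big_cons /= -natr1; have := H1 n a1; have := H2 n a2; lra.
have [n1 H1] := lo c0 e e0.
exists (maxn n0 n1) => // n /=; rewrite geq_max => /andP [a0 a1].
have := H0 n a0; have := H1 n a1; have := up _ n irr; move: hs; rewrite !big_cons => h1 h2 h3 h4.
have h5 : (size s)%:R * e' <= e / 2.
  by rewrite /e' mulrA ler_pdivrMr ?ltr0n // [leLHS]mulrC ler_wpM2l ?(ltW e2) // ler_nat.
rewrite ler_norml; apply/andP; split; lra.
Qed.
End PlanarSide.

(** * Tightness of the limiting balls *)

Section Tightness.
Variables (R : realType) (d : measure_display) (Omega : measurableType d) (P : probability Omega R)
  (xi : nat -> seq nat -> Omega -> nat).
Hypothesis mxi : forall i u k, measurable [set w | xi i u w = k]%classic.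
Definition limprob sk l (c : gcode) : R := fine (P (isoev xi sk l (gE c) (gR c))).

Definition covered sk l N := [set w | exists2 n, (n < N)%N & if (unpickle n : option gcode) is Some c then isoev xi sk l (gE c) (gR c) w else False]%classic.

Lemma measurable_covered sk l N : measurable (covered sk l N).
Proof.
rewrite (_ : covered sk l N = (\bigcup_(n in [set n | (n < N)%N]) [set w | if (unpickle n : option gcode) is Some c then isoev xi sk l (gE c) (gR c) w else False])%classic).
  apply: bigcup_measurable => n _; case: (unpickle n) => [c|]; first exact: measurable_isoev.
  by rewrite (_ : [set _ | _]%classic = classical_sets.set0); [exact: measurable0|apply/seteqP; split].
by apply/seteqP; split=> w [n nN h]; exists n.
Qed.

(** The limiting trees are locally finite for every outcome, so the events [covered] increase to the
    whole space and continuity from below applies. *)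
Lemma covered_prob sk l e : 0 < e -> exists N, forall N', (N <= N')%N -> 1 - e <= fine (P (covered sk l N')).
Proof.
move=> e0; have cov : (\bigcup_N covered sk l N)%classic = classical_sets.setT.
  apply/seteqP; split=> // w _; have [s hs] := vball_finite sk (fun i u => xi i u w) l.
  have [k [E [rH H]]] := ball_iso_finite hs; exists (pickle (gcode_of E rH)).+1 => //.
  by exists (pickle (gcode_of E rH)); rewrite // pickleK /isoev /= gE_gcode_of.
have H : (P \o covered sk l @ \oo --> P (\bigcup_N covered sk l N)%classic)%classic.
  apply: nondecreasing_cvg_mu.
  - by move=> N; apply: measurable_covered.
  - by rewrite cov; apply: measurableT.
  - by move=> N N' NN; apply/subsetPset => w [n nN h]; exists n => //; apply: leq_trans NN.
rewrite cov probability_setT in H; have {}H : (fine \o (P \o covered sk l) @ \oo --> (1 : R))%classic by apply: fine_cvg.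
move/cvgrPdist_le: H => /(_ e e0) [N _ H]; exists N => N' NN; have := H N' NN.
by rewrite ler_norml => /andP [_] /=; rewrite lerBlDr -lerBlDl.
Qed.

Lemma covered_le sk l N s : (forall n c, (n < N)%N -> (unpickle n : option gcode) = Some c -> exists2 r, r \in s & giso c r) ->
  fine (P (covered sk l N)) <= \sum_(c <- s) limprob sk l c.
Proof.
case: s => [|c0 s'] H.
  rewrite big_nil (_ : covered sk l N = classical_sets.set0) ?measure0 //.
  apply/seteqP; split=> // w [n nN]; case un: (unpickle n : option gcode) => [c|] //.
  by have [] := H n c nN un.
set s := c0 :: s' in H *; pose Ev (i : 'I_(size s)) := isoev xi sk l (gE (nth c0 s i)) (gR (nth c0 s i)).
have mEv i : measurable (Ev i) by apply: measurable_isoev.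
have key w : covered sk l N w -> (1 <= #|[set i | `[< Ev i w >]]|)%N.
  move=> [n nN]; case un: (unpickle n : option gcode) => [c|] // cw; have [r rs cr] := H n c nN un.
  have ri : (index r s < size s)%N by rewrite index_mem.
  apply/card_gt0P; exists (Ordinal ri); rewrite in_set; apply/asboolP; rewrite /Ev /= nth_index //.
  exact: ball_iso_trans cr cw.
have := count_events P (measurable_covered sk l N) mEv key.
have fin A : measurable A -> P A = (fine (P A))%:E by move=> mA; rewrite fineK // fin_num_measure.
rewrite mul1e fin; last exact: measurable_covered.
under eq_bigr => i _ do rewrite fin //.
by rewrite sumEFin lee_fin (big_nth c0) big_mkord.
Qed.

Lemma limprob_tight l e c0 : 0 < e -> exists2 s, irredundant (c0 :: s) &
  1 - e <= \sum_(c <- c0 :: s) limprob true l c /\ 1 - e <= \sum_(c <- c0 :: s) limprob false l c.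
Proof.
move=> e0; have [N1 H1] := covered_prob true l e0; have [N2 H2] := covered_prob false l e0.
have [s [irr H]] := representatives (maxn N1 N2) c0; exists s => //; split.
  by apply: le_trans (covered_le true l H); apply: H1; apply: leq_maxl.
by apply: le_trans (covered_le false l H); apply: H2; apply: leq_maxr.
Qed.

Hypothesis pxi : forall (s : seq (nat * seq nat)) (kk : nat * seq nat -> nat), uniq s ->
     P [set w | forall j, j \in s -> xi j.1 j.2 w = kk j]%classic
     = (\prod_(j <- s) poisson_pmf 1 (kk j))%:E.

Lemma limprob_lower (c : R) (m : nat -> nat) (l : nat) (h : gcode) (e : R) : 1 < c < 2 ->
  ((fun n : nat => (2 * m n)%:R / n%:R : R) @ \oo --> c)%classic -> 0 < e ->
  exists n0, forall n, (n0 <= n)%N ->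
  [/\ (c - 1) * limprob true l h + (2 - c) * limprob false l h - e <= planar_ball_prob R (m n) (@whole_sel n) l (gE h) (gR h),
      limprob true l h - e <= planar_ball_prob R (m n) (@L_sel n) l (gE h) (gR h) &
      limprob false l h - e <= planar_ball_prob R (m n) (@S_sel n) l (gE h) (gR h)].
Proof.
move=> c12 cm e0; have /andP [c1 c2] := c12.
have [[par [D td]]|ntd] := pselect (exists par D, tdata (gE h) (gR h) l par D).
  have [n0 H] := planar_lower td c12 cm e0; exists n0 => n nn; have [_ h1 h2 h3] := H n nn.
  have pT : limprob false l h <= qT R (gE h) (gR h) l D.
    apply: le_trans (P_iso_le mxi pxi td false) _; rewrite (_ : starts _ _ _ _ = [set gR h]%SET) ?cards1 ?mul1r //.
    by apply/setP => y; rewrite in_set in_set1.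
  have pS : limprob true l h <= qS R (gE h) (gR h) l D := P_iso_le mxi pxi td true.
  split; [|exact: le_trans (lerB pS _) h2|exact: le_trans (lerB pT _) h3].
  apply: le_trans h1; rewrite lerD2r; apply: lerD; rewrite ler_wpM2l //; lra.
(* When (E, rH) is not a tree of height at most l it is never a ball of a limiting tree, and
   nonnegativity of the frequencies suffices. *)
have z sk : limprob sk l h = 0.
  rewrite /limprob (_ : isoev _ _ _ _ _ = classical_sets.set0) ?measure0 //.
  by apply/seteqP; split=> // w /tdata_of_iso.
have pr0 n (sel : {set {set 'I_n}} -> {set 'I_n}) : 0 <= planar_ball_prob R (m n) sel l (gE h) (gR h).
  by rewrite divr_ge0 // sumr_ge0 // => g _; apply: rooted_prob_ge0.
exists 0%N => n _; rewrite !z !mulr0 addr0 sub0r.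
by split; apply: le_trans (pr0 _ _); rewrite oppr_le0 ltW.
Qed.
End Tightness.

Local Open Scope classical_set_scope.
Local Open Scope ring_scope.

Theorem theorem1p5 (R : realType) (c : R) (m : nat -> nat)
  (d : measure_display) (Omega : measurableType d) (P : probability Omega R)
  (xi : nat -> seq nat -> Omega -> nat) :
  1 < c < 2 ->
  (fun n : nat => (2 * m n)%:R / n%:R : R) @ \oo --> c ->
  (forall i u k, measurable [set w | xi i u w = k]) ->
  (forall (s : seq (nat * seq nat)) (kk : nat * seq nat -> nat), uniq s ->
     P [set w | forall j, j \in s -> xi j.1 j.2 w = kk j]
     = (\prod_(j <- s) poisson_pmf 1 (kk j))%:E) ->
  forall (k : nat) (E : rel 'I_k) (rH : 'I_k) (l : nat),
    symmetric E -> irreflexive E ->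
    let pSkel := fine (P [set w | ball_iso (skel_adj (fun i u => xi i u w))
                                    (0%N, [::]) l E rH]) in
    let pT1 := fine (P [set w | ball_iso (tree_adj (fun u => xi 0%N u w))
                                  [::] l E rH]) in
    [/\ (fun n => @planar_ball_prob R n (m n) (@L_sel n) l k E rH) @ \oo --> pSkel,
        (fun n => @planar_ball_prob R n (m n) (@S_sel n) l k E rH) @ \oo --> pT1 &
        (fun n => @planar_ball_prob R n (m n) (@whole_sel n) l k E rH) @ \oo -->
          (c - 1) * pSkel + (2 - c) * pT1].
Proof.
move=> c12 cm mxi pxi k E rH l _ _; have /andP [c1 c2] := c12.
have -> : fine (P [set w | ball_iso (skel_adj (fun i u => xi i u w)) (0%N, [::]) l E rH])
    = limprob P xi true l (gcode_of E rH).
  rewrite /limprob /isoev gE_gcode_of; congr (fine (P _)); apply/seteqP.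
  by split=> w /=; rewrite skel_adjE.
have -> : fine (P [set w | ball_iso (tree_adj (fun u => xi 0%N u w)) [::] l E rH])
    = limprob P xi false l (gcode_of E rH).
  rewrite /limprob /isoev gE_gcode_of; congr (fine (P _)); apply/seteqP.
  by split=> w /= h; apply/(tree_ball_iso (fun i u => xi i u w)).
have lower h e e0 := limprob_lower mxi pxi l h c12 cm e0 (e := e).
move=> /=; set h := gcode_of E rH.
have key (sel : forall n, {set {set 'I_n}} -> {set 'I_n}) :
    (fun n => planar_ball_prob R (m n) (sel n) l E rH) = (fun n => planar_ball_prob R (m n) (sel n) l (gE h) (gR h)).
  by rewrite gE_gcode_of.
rewrite (key (@L_sel)) (key (@S_sel)) (key (@whole_sel)); split.
- apply: (squeeze (prob := fun h n => planar_ball_prob R (m n) (@L_sel n) l (gE h) (gR h))).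
  + by move=> h' e e0; have [n0 H] := lower h' e e0; exists n0 => n /H [].
  + by move=> s n; apply: planar_prob_sum.
  + by move=> e e0; have [s irr [h1 h2]] := limprob_tight P mxi l h e0; exists s.
- apply: (squeeze (prob := fun h n => planar_ball_prob R (m n) (@S_sel n) l (gE h) (gR h))).
  + by move=> h' e e0; have [n0 H] := lower h' e e0; exists n0 => n /H [].
  + by move=> s n; apply: planar_prob_sum.
  + by move=> e e0; have [s irr [h1 h2]] := limprob_tight P mxi l h e0; exists s.
- apply: (squeeze (prob := fun h n => planar_ball_prob R (m n) (@whole_sel n) l (gE h) (gR h))
    (p := fun h => (c - 1) * limprob P xi true l h + (2 - c) * limprob P xi false l h)).
  + by move=> h' e e0; have [n0 H] := lower h' e e0; exists n0 => n /H [].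
  + by move=> s n; apply: planar_prob_sum.
  + move=> e e0; have [s irr [h1 h2]] := limprob_tight P mxi l h e0; exists s => //.
    rewrite big_split /= -!mulr_sumr; have a1 : 0 <= c - 1 by lra.
    have a2 : 0 <= 2 - c by lra.
    by have := ler_wpM2l a1 h1; have := ler_wpM2l a2 h2; lra.
Qed.
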